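(* There is a $2.41$-approximation algorithm for the Prize-collecting Multi-Path Traveling Salesman Problem (PC-Multi-Path-TSP).
   Context: In PC-Multi-Path-TSP one is given a complete graph $G=(V,E)$ with metric edge costs $c\colon E\to\mathbb{R}_{+}$, vertex penalties $\pi\colon V\to\mathbb{R}_{+}$, and $k$ terminal pairs $\mathcal{T}=\{(s_1,t_1),\dots,(s_k,t_k)\}$. A feasible solution consists of $k$ paths $P_1,\dots,P_k$, where $P_i$ has endpoints $s_i$ and $t_i$; its value is $\sum_{i=1}^k c(P_i)+\sum_{v\notin\bigcup_i V(P_i)}\pi(v)$, which is to be minimized. An $\alpha$-approximation algorithm is a polynomial-time algorithm that outputs a feasible solution whose value (in expectation, if the algorithm is randomized) is at most $\alpha$ times the optimum value. *)

(* Defs.v *)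
From HB Require Import structures.
From mathcomp Require Import all_boot all_order all_algebra.

Set Implicit Arguments.
Unset Strict Implicit.
Unset Printing Implicit Defensive.

Import Order.TTheory GRing.Theory Num.Theory.

(** * Polynomial time

    The machine model is the random access machine of Aho, Hopcroft and Ullman
    under the logarithmic cost criterion, which is polynomially equivalent to
    the Turing machine, with an additional instruction [Flip] that stores a fair
    coin.  The machine has a read-only input tape and a write-only output tape
    of natural numbers. *)

Local Open Scope nat_scope.

Definition bitlen (n : nat) : nat := (trunc_log 2 n).+1.

Inductive operand := Imm of nat | Dir of nat | Ind of nat.

Inductive dest := DDir of nat | DInd of nat.

Inductive binop := Add | Sub | Mul | Div.

Inductive instr :=
| Op of binop & dest & operand & operand
| Read of dest
| Write of operand
| Flip of dest
| Jz of operand & nat.  (* jump to the given address if the operand is 0 *)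

Definition program := seq instr.

Record config := Config {
  pc : nat;
  mem : nat -> nat;
  inp : seq nat;
  coins : seq bool;
  out : seq nat;
  time : nat
}.

Definition eval_binop (o : binop) : nat -> nat -> nat :=
  match o with Add => addn | Sub => subn | Mul => muln | Div => divn end.

Definition oval (m : nat -> nat) (a : operand) : nat :=
  match a with Imm i => i | Dir i => m i | Ind i => m (m i) end.

Definition ocost (m : nat -> nat) (a : operand) : nat :=
  match a with
  | Imm i => bitlen i
  | Dir i => bitlen i + bitlen (m i)
  | Ind i => bitlen i + bitlen (m i) + bitlen (m (m i))
  end.

Definition daddr (m : nat -> nat) (d : dest) : nat :=
  match d with DDir i => i | DInd i => m i end.

Definition dcost (m : nat -> nat) (d : dest) : nat :=
  match d with DDir i => bitlen i | DInd i => bitlen i + bitlen (m i) end.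

Definition exec (i : instr) (c : config) : config :=
  let: Config p m x r o t := c in
  match i with
  | Op f d a b =>
      let v := eval_binop f (oval m a) (oval m b) in
      Config p.+1 [eta m with daddr m d |-> v] x r o
        (t + (ocost m a + ocost m b + dcost m d + bitlen v))
  | Read d =>
      let v := head 0 x in
      Config p.+1 [eta m with daddr m d |-> v] (behead x) r o
        (t + (dcost m d + bitlen v))
  | Write a =>
      Config p.+1 m x r (rcons o (oval m a)) (t + ocost m a)
  | Flip d =>
      let v := nat_of_bool (head false r) in
      Config p.+1 [eta m with daddr m d |-> v] x (behead r) o
        (t + (dcost m d + bitlen v))
  | Jz a l =>
      Config (if oval m a == 0 then l else p.+1) m x r o (t + ocost m a)
  end.

(* The machine halts when the program counter leaves the program. *)
Definition halted (P : program) (c : config) : bool := size P <= pc c.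

Definition step (P : program) (c : config) : config :=
  if onth P (pc c) is Some i then exec i c else c.

Definition init (x : seq nat) (r : seq bool) : config :=
  Config 0 (fun=> 0) x r [::] 0.

(* The output of [P] if it halts within time [T].  Every instruction costs at
   least 1, so [T] steps suffice to detect this; likewise, at most [T] coins are
   consumed within time [T]. *)
Definition run (P : program) (T : nat) (x : seq nat) (r : seq bool) :
    option (seq nat) :=
  let c := iter T (step P) (init x r) in
  if halted P c && (time c <= T) then Some (out c) else None.

Definition input_size (x : seq nat) : nat := \sum_(i <- x) bitlen i.

(** * The prize-collecting multi-path TSP *)

Local Open Scope ring_scope.

(* The diagonal of [cost] carries no information: the edges of a complete graph
   join distinct vertices. *)
Record instance := Instance {
  nV : nat;
  nT : nat;
  cost : 'I_nV -> 'I_nV -> rat;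
  penalty : 'I_nV -> rat;
  terminal : 'I_nT -> 'I_nV * 'I_nV;
  cost_ge0 : forall u v, 0 <= cost u v;
  cost_diag : forall u, cost u u = 0;
  cost_sym : forall u v, cost u v = cost v u;
  cost_triangle : forall u v w, cost u w <= cost u v + cost v w;
  penalty_ge0 : forall v, 0 <= penalty v
}.

Definition is_path (V : eqType) (s t : V) (P : seq V) : bool :=
  [&& ohead P == Some s, last s P == t & uniq P].

Definition path_cost (I : instance) (P : seq 'I_(nV I)) : rat :=
  \sum_(e <- zip P (behead P)) cost e.1 e.2.

Definition solution (I : instance) := {ffun 'I_(nT I) -> seq 'I_(nV I)}.

Definition feasible (I : instance) (S : solution I) : bool :=
  [forall i, is_path (terminal i).1 (terminal i).2 (S i)].

Definition value (I : instance) (S : solution I) : rat :=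
  \sum_i path_cost (S i) + \sum_(v | [forall i, v \notin S i]) penalty v.

Definition is_optimum (I : instance) (opt : rat) : Prop :=
  (exists2 S : solution I, feasible S & value S = opt) /\
  (forall S : solution I, feasible S -> opt <= value S).

Lemma optimum_exists (I : instance) : exists opt : rat, is_optimum I opt.
Proof.
pose emb (F : {ffun 'I_(nT I) -> (nV I).-bseq 'I_(nV I)}) : solution I :=
  [ffun i => F i : seq _].
have embP (S : solution I) : feasible S -> exists F, emb F = S.
  move=> /forallP fS; exists [ffun i => insub_bseq _ (S i)].
  apply/ffunP => i; rewrite !ffunE /insub_bseq insubdK //.
  have /and3P[_ _ /card_uniqP uS] := fS i.
  by rewrite -topredE /= -uS (leq_trans (max_card _)) ?card_ord.
pose S0 : solution I := [ffun i => let: (s, t) := terminal i in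
                                   if s == t then [:: s] else [:: s; t]].
have fS0 : feasible S0.
  apply/forallP => i; rewrite ffunE; case: (terminal i) => s t /=.
  by case: eqVneq => [->|st]; rewrite /is_path /= !eqxx //= inE st.
have [F0 eF0] := embP _ fS0.
have fF0 : feasible (emb F0) by rewrite eF0.
have [F fF minF] := @arg_minP _ _ _ F0 (fun F => feasible (emb F))
  (fun F => value (emb F)) fF0.
exists (value (emb F)); split; first by exists (emb F).
by move=> S fS; have [G eG] := embP _ fS; rewrite -eG; apply: minF; rewrite eG.
Qed.

(* Faithful for nonnegative rationals only, which are all that is encoded. *)
Definition encode_rat (q : rat) : seq nat := [:: `|numq q|%N; `|denq q|%N].

Definition encode_instance (I : instance) : seq nat :=
  [:: nV I; nT I]
  ++ flatten [seq encode_rat (cost u v) | u <- enum 'I_(nV I), v <- enum 'I_(nV I)]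
  ++ flatten [seq encode_rat (penalty v) | v <- enum 'I_(nV I)]
  ++ flatten [seq [:: val (terminal i).1; val (terminal i).2]
                  | i <- enum 'I_(nT I)].

Definition encode_solution (I : instance) (S : solution I) : seq nat :=
  flatten [seq size (S i) :: map val (S i) | i <- enum 'I_(nT I)].

(* Randomized polynomial-time [alpha]-approximation; deterministic algorithms
   are the programs that do not use [Flip].  [p] bounds the running time on
   every coin sequence, and [sol r] is the solution printed on the coins [r],
   which are uniform on the sequences of length [T]. *)
Definition approximation_algorithm (alpha : rat) (P : program) : Prop :=
  exists p : {poly nat}, forall I : instance,
    let T : nat := p.[input_size (encode_instance I)] in
    exists sol : T.-tuple bool -> solution I,
      [/\ forall r : T.-tuple bool,
            run P T (encode_instance I) r = Some (encode_solution (sol r)),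
          forall r, feasible (sol r)
        & forall opt, is_optimum I opt ->
            (\sum_(r : T.-tuple bool) value (sol r)) / 2 ^+ T <= alpha * opt].

(* Main.v *)
Require Import Defs.
From mathcomp Require Import all_boot all_order all_algebra zify lra.

(** The algorithm is combinatorial and deterministic.  After scaling the input to
    integers, a moat growing (Goemans-Williamson) run with the terminals as roots
    turns the penalties into charges [chi] such that the charges met by any
    feasible paths are at most twice their cost, and such that every tree packing
    that covers a set [K] of vertices extends to one whose additional double
    tree cost plus penalties is at most [chi] outside [K].  Starting from this, four rounds
    of moat growing between [s_i] and [t_i], in which the charge of a vertex is
    discounted by the probability that it is covered by a uniformly random choice
    among the trees found so far, produce four trees for each pair.  Choosing one
    tree per pair by the method of conditional expectations gives a solution of
    cost at most [2 C + (256/625) chi + (369/625) chi'], with [C] the cost of the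
    optimal paths and [chi'] the charge they miss.  The better of this
    solution and of the edges [s_i t_i] is extended by the pruned root forest;
    doubling the edges off the [s_i]-[t_i] paths saves [c(s_i, t_i)], and averaging
    the two candidates gives the ratio [1506/625 = 2.4096].

    Polynomial time is obtained once and for all from a language of bounded loops
    over arrays, in which one factor of every product is an input number or a
    small constant: numbers then grow by polynomially many bits. *)

Set Implicit Arguments.
Unset Strict Implicit.
Unset Printing Implicit Defensive.

Local Open Scope nat_scope.

(** With [r] trees per pair the same argument gives the ratio [2 + (r / (r + 1)) ^ r]; four is the
    least [r] for which this is at most 2.41. In one round a new tree removes one of at most [r]
    equally likely ways in which a pair misses a vertex, so following an optimal path would gain a
    fraction [1 / r] of what remains uncovered on it, and that part shrinks by [r / (r + 1)]. The
    root run has to be made before the trees are known, because its charges are what the trees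
    collect. Its history is therefore stored, and the pruning takes the contracted set [K] as a
    parameter that is filled in only after the selection. Budgets are charged at twice the speed at
    which a moat consumes an edge. This 2 serves on both sides: a path that visits an unlabelled
    moat crosses it twice, and the average degree in a pruned forest is at most two. The bound for
    the edges [s_i t_i] contains twice their cost; in the average of the two bounds it appears once
    and cancels against the saving. *)

Lemma bitlen_gt0 m : 0 < bitlen m. Proof. by []. Qed.

Lemma bitlen_le m B : 0 < B -> m < 2 ^ B -> bitlen m <= B.
Proof.
move=> B0 mB; rewrite /bitlen; case: (posnP m) => [->|m0]; first by rewrite trunc_log0.
rewrite -(@ltn_exp2l 2) //; apply: leq_ltn_trans mB.
exact: trunc_logP.
Qed.

Lemma ltn_bitlen m : m < 2 ^ bitlen m.
Proof. by rewrite /bitlen trunc_log_ltn. Qed.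

(** * Structured programs over the memory of the machine *)

Inductive scmd :=
| SOp of binop & dest & operand & operand
| SRead of dest
| SWrite of operand
| SSeq of scmd & scmd
| SIf of operand & scmd & scmd
| SWhile of operand & scmd.

Record mstate := MState { mmem : nat -> nat; minp : seq nat; mout : seq nat }.

Definition upd (T : Type) (f : nat -> T) (x : nat) (v : T) : nat -> T :=
  fun y => if y == x then v else f y.

(* The last index counts the executed instructions.  As right factors and read
   values have at most [X] bits, every instruction adds at most [X] bits to the
   largest number in memory: see [compile_correct]. *)
Inductive sexec (X : nat) : scmd -> mstate -> mstate -> nat -> Prop :=
| sexec_op f d a b m i o :
    (f = Mul -> oval m b < 2 ^ X) ->
    sexec X (SOp f d a b) (MState m i o)
      (MState (upd m (daddr m d) (eval_binop f (oval m a) (oval m b))) i o) 1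
| sexec_read d m i o :
    head 0 i < 2 ^ X ->
    sexec X (SRead d) (MState m i o)
      (MState (upd m (daddr m d) (head 0 i)) (behead i) o) 1
| sexec_write a m i o :
    sexec X (SWrite a) (MState m i o) (MState m i (rcons o (oval m a))) 1
| sexec_seq s1 s2 c c1 c2 N1 N2 :
    sexec X s1 c c1 N1 -> sexec X s2 c1 c2 N2 ->
    sexec X (SSeq s1 s2) c c2 (N1 + N2)
| sexec_if a s1 s2 c c' N :
    sexec X (if oval (mmem c) a == 0 then s2 else s1) c c' N ->
    sexec X (SIf a s1 s2) c c' N.+2
| sexec_stop a s c :
    oval (mmem c) a = 0 -> sexec X (SWhile a s) c c 1
| sexec_loop a s c c1 c2 N1 N2 :
    oval (mmem c) a != 0 -> sexec X s c c1 N1 ->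
    sexec X (SWhile a s) c1 c2 N2 ->
    sexec X (SWhile a s) c c2 (N1 + N2).+2.

Fixpoint ssize (s : scmd) : nat :=
  match s with
  | SOp _ _ _ _ | SRead _ | SWrite _ => 1
  | SSeq s1 s2 => ssize s1 + ssize s2
  | SIf _ s1 s2 => (ssize s1 + ssize s2).+2
  | SWhile _ s => (ssize s).+2
  end.

Fixpoint compile (p : nat) (s : scmd) : seq instr :=
  match s with
  | SOp f d a b => [:: Op f d a b]
  | SRead d => [:: Read d]
  | SWrite a => [:: Write a]
  | SSeq s1 s2 => compile p s1 ++ compile (p + ssize s1) s2
  | SIf a s1 s2 =>
      Jz a (p + (ssize s1).+2) :: compile p.+1 s1
      ++ Jz (Imm 0) (p + (ssize s1 + ssize s2).+2)
         :: compile (p + (ssize s1).+2) s2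
  | SWhile a s =>
      Jz a (p + (ssize s).+2) :: compile p.+1 s ++ [:: Jz (Imm 0) p]
  end.

Lemma size_compile p s : size (compile p s) = ssize s.
Proof.
elim: s p => //= [s1 I1 s2 I2|a s1 I1 s2 I2|a s I] p;
by rewrite ?size_cat ?I1 ?I2 ?I //= ?I1 ?I2 ?I; lia.
Qed.

Definition const_ok_o (X : nat) (a : operand) : bool :=
  match a with Imm i | Dir i | Ind i => i < 2 ^ X end.

Definition const_ok_d (X : nat) (d : dest) : bool :=
  match d with DDir i | DInd i => i < 2 ^ X end.

Fixpoint const_ok (X : nat) (s : scmd) : bool :=
  match s with
  | SOp _ d a b => [&& const_ok_d X d, const_ok_o X a & const_ok_o X b]
  | SRead d => const_ok_d X d
  | SWrite a => const_ok_o X a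
  | SSeq s1 s2 => const_ok X s1 && const_ok X s2
  | SIf a s1 s2 => [&& const_ok_o X a, const_ok X s1 & const_ok X s2]
  | SWhile a s => const_ok_o X a && const_ok X s
  end.

Definition code_at (P : program) (p : nat) (c : seq instr) : Prop :=
  forall i x, onth c i = Some x -> onth P (p + i) = Some x.

Lemma code_at_cat P p c1 c2 :
  code_at P p (c1 ++ c2) -> code_at P p c1 /\ code_at P (p + size c1) c2.
Proof.
move=> H; split=> i x Hi.
  by apply: H; rewrite onth_cat; case: ltnP => // h; move: Hi; rewrite onth_default.
by rewrite -addnA; apply: H; rewrite onth_cat ltnNge leq_addr /= addKn.
Qed.

Lemma code_at_cons P p x c :
  code_at P p (x :: c) -> onth P p = Some x /\ code_at P p.+1 c.
Proof.
move=> H; split; first by rewrite -[p]addn0; apply: H.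
by move=> i y Hi; rewrite addSnnS; apply: H.
Qed.

Definition bounded (B : nat) (m : nat -> nat) : Prop := forall p, m p < 2 ^ B.

Lemma ltn_pow_le B B' m : B <= B' -> m < 2 ^ B -> m < 2 ^ B'.
Proof. by move=> h; move/leq_trans; apply; rewrite leq_exp2l. Qed.

Lemma bounded_le B B' m : B <= B' -> bounded B m -> bounded B' m.
Proof. by move=> h H p; apply: ltn_pow_le (H p). Qed.

Lemma bounded_upd B m p v : bounded B m -> v < 2 ^ B -> bounded B (upd m p v).
Proof. by move=> H hv q; rewrite /upd; case: eqP. Qed.

Lemma oval_bound X B m a :
  X <= B -> bounded B m -> const_ok_o X a -> oval m a < 2 ^ B.
Proof. by move=> XB H; case: a => //= i; apply: ltn_pow_le. Qed.

Lemma ocost_bound X B m a : 0 < X -> X <= B -> bounded B m -> const_ok_o X a ->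
  0 < ocost m a <= 3 * B.
Proof.
move=> X0 XB H.
have hm p : bitlen (m p) <= B by apply: bitlen_le (H p); lia.
case: a => i /= /(ltn_pow_le XB) hi; have {hi} := @bitlen_le i B _ hi;
by have := (hm i, hm (m i)); have := bitlen_gt0 i; move=> h1 [h2 h3] h4; have := h4 _; lia.
Qed.

Lemma dcost_bound X B m d : 0 < X -> X <= B -> bounded B m -> const_ok_d X d ->
  0 < dcost m d <= 2 * B.
Proof.
move=> X0 XB H.
have hm p : bitlen (m p) <= B by apply: bitlen_le (H p); lia.
case: d => i /= /(ltn_pow_le XB) hi; have {hi} := @bitlen_le i B _ hi;
by have := (hm i, hm (m i)); have := bitlen_gt0 i; move=> h1 [h2 h3] h4; have := h4 _; lia.
Qed.

Lemma eval_binop_bound X B f u v : 0 < X -> u < 2 ^ B -> v < 2 ^ B ->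
  (f = Mul -> v < 2 ^ X) -> eval_binop f u v < 2 ^ (B + X).
Proof.
move=> X0 hu hv; have hB : 2 ^ B * 2 <= 2 ^ (B + X).
  by rewrite -expnSr leq_exp2l //; lia.
case: f => /= hf; [lia|lia| |].
  by rewrite expnD; apply: ltn_mul => //; apply: hf.
by apply: leq_ltn_trans (leq_div _ _) _; lia.
Qed.

Definition to_config (p t : nat) (r : seq bool) (c : mstate) : config :=
  Config p (mmem c) (minp c) r (mout c) t.

Lemma step_at P p t r c i :
  onth P p = Some i -> step P (to_config p t r c) = exec i (to_config p t r c).
Proof. by rewrite /step /= => ->. Qed.

(* [k] machine steps and the elapsed time [t' - t] are bounded together. *)
Definition reaches (P : program) (B N : nat) (r : seq bool)
    (p t : nat) (c : mstate) (p' : nat) (c' : mstate) : Prop :=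
  exists k t', [/\ iter k (step P) (to_config p t r c) = to_config p' t' r c',
                   k + t <= t' & t' <= t + N * (9 * B)].

Lemma reaches_trans P B N1 N2 r p t c p1 c1 p2 c2 :
  reaches P B N1 r p t c p1 c1 ->
  (forall t1, reaches P B N2 r p1 t1 c1 p2 c2) ->
  reaches P B (N1 + N2) r p t c p2 c2.
Proof.
move=> [k1 [t1 [e1 h1 g1]]] /(_ t1) [k2 [t2 [e2 h2 g2]]].
by exists (k2 + k1), t2; rewrite iterD e1 e2; split=> //; nia.
Qed.

Lemma reaches_le P B B' N r p t c p' c' : B <= B' ->
  reaches P B N r p t c p' c' -> reaches P B' N r p t c p' c'.
Proof. by move=> hB [k [t' [e h g]]]; exists k, t'; split=> //; nia. Qed.

Lemma reaches_jz P X B r p t c a l : 0 < X -> X <= B -> bounded B (mmem c) ->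
  const_ok_o X a -> onth P p = Some (Jz a l) ->
  reaches P B 1 r p t c (if oval (mmem c) a == 0 then l else p.+1) c.
Proof.
move=> X0 XB bm ka hp; have h := ocost_bound X0 XB bm ka.
exists 1, (t + ocost (mmem c) a); split; [|lia|lia].
by rewrite /= (step_at _ _ _ hp).
Qed.

(** The bound [B] is quantified after the run because it grows along it: the second half of a
    sequence starts with numbers of [B + N1 * X] bits. The induction is on the run, so loops and
    branches enter the time only through [N]. *)
Theorem compile_correct X P s c c' N :
  sexec X s c c' N -> 0 < X -> const_ok X s ->
  forall p, code_at P p (compile p s) ->
  forall r t B, X <= B -> bounded B (mmem c) ->
  reaches P (B + N * X) N r p t c (p + ssize s) c' /\ bounded (B + N * X) (mmem c').
Proof.
move=> E X0; elim: E => {s c c' N} /=.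
- move=> f d a b m i o hf /and3P[kd ka kb] p /code_at_cons[hp _] r t B XB bm.
  have ha := oval_bound XB bm ka; have hb := oval_bound XB bm kb.
  have hv := eval_binop_bound X0 ha hb hf.
  have hvB := bitlen_le _ hv.
  have hd := dcost_bound X0 XB bm kd; have ha' := ocost_bound X0 XB bm ka.
  have hb' := ocost_bound X0 XB bm kb.
  rewrite mul1n; split; last first.
    by apply: bounded_upd => //; apply: bounded_le bm; lia.
  exists 1; eexists; split; first by rewrite /= (step_at _ _ _ hp) addn1.
    by move=> /=; lia.
  (* Two operands cost at most three numbers each, the destination two and the value one: this is
     the 9 in [reaches]. *)
  by have := hvB _; rewrite /=; lia.
- move=> d m i o hi kd p /code_at_cons[hp _] r t B XB bm.
  have hd := dcost_bound X0 XB bm kd.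
  have hi' : head 0 i < 2 ^ (B + X) by apply: ltn_pow_le hi; lia.
  have hvB := bitlen_le _ hi'.
  rewrite mul1n; split; last first.
    by apply: bounded_upd => //; apply: bounded_le bm; lia.
  exists 1; eexists; split; first by rewrite /= (step_at _ _ _ hp) addn1.
    by move=> /=; lia.
  by have := hvB _; rewrite /=; lia.
- move=> a m i o ka p /code_at_cons[hp _] r t B XB bm.
  have ha' := ocost_bound X0 XB bm ka.
  rewrite mul1n; split; last by apply: bounded_le bm; lia.
  exists 1; eexists; split; first by rewrite /= (step_at _ _ _ hp) addn1.
    by move=> /=; lia.
  by move=> /=; lia.
- move=> s1 s2 c c1 c2 N1 N2 _ I1 _ I2 /andP[k1 k2] p /code_at_cat[].
  rewrite size_compile => h1 h2 r t B XB bm.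
  have [R1 b1] := I1 k1 _ h1 r t B XB bm.
  have XB1 : X <= B + N1 * X by lia.
  split; last first.
    by rewrite mulnDl addnA; apply: (I2 k2 _ h2 r t (B + N1 * X) XB1 b1).2.
  apply: reaches_trans; first by apply: reaches_le R1; lia.
  move=> t1; rewrite addnA mulnDl addnA.
  exact: (I2 k2 _ h2 r t1 (B + N1 * X) XB1 b1).1.
- move=> a s1 s2 c c' N _ I /and3P[ka k1 k2] p.
  move=> /code_at_cons[hp] /code_at_cat[].
  rewrite size_compile => h1 /code_at_cons[hj h2] r t B XB bm.
  have J0 := reaches_jz r t X0 XB bm ka hp.
  case: eqP J0 I => _ J0 I.
    have h2' : code_at P (p + (ssize s1).+2) (compile (p + (ssize s1).+2) s2).
      by move: h2; congr code_at; lia.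
    split; last first.
      by apply: bounded_le (I k2 _ h2' r t B XB bm).2; lia.
    have -> : N.+2 = 1 + N.+1 by lia.
    apply: reaches_trans; first by apply: reaches_le J0; lia.
    move=> t1; have [[k [t' [e h g]]] _] := I k2 _ h2' r t1 B XB bm.
    exists k, t'; split=> //; last by nia.
    by rewrite e; congr to_config; lia.
  split; last by apply: bounded_le (I k1 _ h1 r t B XB bm).2; lia.
  have -> : N.+2 = 1 + (N + 1) by lia.
  apply: reaches_trans; first by apply: reaches_le J0; lia.
  move=> t1; have [R1 b1] := I k1 _ h1 r t1 B XB bm.
  apply: reaches_trans; first by apply: reaches_le R1; lia.
  move=> t2; have XB1 : X <= B + N * X by lia.
  have := reaches_jz r t2 X0 XB1 b1 (_ : const_ok_o X (Imm 0)) hj.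
  rewrite /= => /(_ (expn_gt0 _ _)); apply: reaches_le; lia.
- move=> a s c h0 /andP[ka ks] p /code_at_cons[hp _] r t B XB bm.
  have J0 := reaches_jz r t X0 XB bm ka hp; rewrite h0 eqxx in J0.
  by split; [apply: reaches_le J0; lia | apply: bounded_le bm; lia].
- move=> a s c c1 c2 N1 N2 h0 _ I1 _ I2 /andP[ka ks] p hc r t B XB bm.
  have /code_at_cons[hp] := hc.
  move=> /code_at_cat[]; rewrite size_compile => h1 /code_at_cons[hj _].
  have J0 := reaches_jz r t X0 XB bm ka hp; rewrite (negPf h0) in J0.
  have XB1 : X <= B + N1 * X by lia.
  have [_ b1] := I1 ks _ h1 r t B XB bm.
  have ks' : const_ok_o X a && const_ok X s by rewrite ka ks.
  split; last first.
    by apply: bounded_le (I2 ks' _ hc r t (B + N1 * X) XB1 b1).2; lia.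
  have -> : (N1 + N2).+2 = 1 + (N1 + (1 + N2)) by lia.
  apply: reaches_trans; first by apply: reaches_le J0; lia.
  move=> t1; have [R1 _] := I1 ks _ h1 r t1 B XB bm.
  apply: reaches_trans; first by apply: reaches_le R1; lia.
  move=> t2; have := reaches_jz r t2 X0 XB1 b1 (_ : const_ok_o X (Imm 0)) hj.
  rewrite /= => /(_ (expn_gt0 _ _)) J1.
  apply: reaches_trans; first by apply: reaches_le J1; lia.
  by move=> t3; have [R2 _] := I2 ks' _ hc r t3 (B + N1 * X) XB1 b1; apply: reaches_le R2; lia.
Qed.

(** * A loop language of polynomial-time programs *)

(* [BN] and [BK] are the first two input numbers. *)
Inductive bnd := BC of nat | BN | BK | BAdd of bnd & bnd | BMulN of bnd.

Inductive expr :=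
| ECst of nat
| EVar of nat
| ERd of nat & expr
| EOp of binop & expr & expr
| EIf of expr & expr & expr
| ESum of nat & bnd & expr.

(* [CSet a o x b e] assigns [e] to the cell [o + x] of the array [a] for all
   [x < b] in parallel.  [CRead e] reads into the cell [e + 2] of the input
   array [0], which no other command modifies. *)
Inductive cmd :=
| CSkip
| CSet of nat & expr & nat & bnd & expr
| CSeq of cmd & cmd
| CIf of expr & cmd & cmd
| CFor of nat & bnd & cmd
| CRead of expr
| CWrite of expr.

Fixpoint bval (n k : nat) (b : bnd) : nat :=
  match b with
  | BC c => c
  | BN => n
  | BK => k
  | BAdd b1 b2 => bval n k b1 + bval n k b2
  | BMulN b => bval n k b * n
  end.

Fixpoint eval (ar : nat -> nat -> nat) (env : nat -> nat) (e : expr) : nat :=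
  match e with
  | ECst c => c
  | EVar x => env x
  | ERd a e => ar a (eval ar env e)
  | EOp f e1 e2 => eval_binop f (eval ar env e1) (eval ar env e2)
  | EIf e e1 e2 => if eval ar env e != 0 then eval ar env e1 else eval ar env e2
  | ESum x b e => \sum_(i < bval (ar 0 0) (ar 0 1) b) eval ar (upd env x i) e
  end.

Record lstate := LState { arr : nat -> nat -> nat; linp : seq nat; lout : seq nat }.

Definition bvals (s : lstate) : bnd -> nat := bval (arr s 0 0) (arr s 0 1).

Fixpoint cexec (c : cmd) (env : nat -> nat) (s : lstate) : lstate :=
  match c with
  | CSkip => s
  | CSet a o x b e =>
      let off := eval (arr s) env o in
      LState (upd (arr s) a (fun i =>
                if off <= i < off + bvals s b
                then eval (arr s) (upd env x (i - off)) e else arr s a i))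
             (linp s) (lout s)
  | CSeq c1 c2 => cexec c2 env (cexec c1 env s)
  | CIf e c1 c2 =>
      if eval (arr s) env e != 0 then cexec c1 env s else cexec c2 env s
  | CFor x b c => iteri (bvals s b) (fun i s => cexec c (upd env x i) s) s
  | CRead e =>
      LState (upd (arr s) 0 (upd (arr s 0) (eval (arr s) env e).+2 (head 0 (linp s))))
             (behead (linp s)) (lout s)
  | CWrite e => LState (arr s) (linp s) (rcons (lout s) (eval (arr s) env e))
  end.

(** The right factors that are certain to have at most [X] bits: small constants and cells of the
    input array. *)
Definition small (e : expr) : bool :=
  match e with ECst c => c < 64 | ERd 0 _ => true | _ => false end.

Fixpoint wf_expr (e : expr) : bool :=
  match e with
  | ECst _ | EVar _ => true
  | ERd a e => (a < 60) && wf_expr e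
  | EOp f e1 e2 =>
      [&& wf_expr e1, wf_expr e2 & if f is Mul then small e2 else true]
  | EIf e1 e2 e3 => [&& wf_expr e1, wf_expr e2 & wf_expr e3]
  | ESum _ _ e => wf_expr e
  end.

Fixpoint wf_cmd (c : cmd) : bool :=
  match c with
  | CSkip => true
  | CSet a o _ _ e => [&& 0 < a < 60, wf_expr o & wf_expr e]
  | CSeq c1 c2 => wf_cmd c1 && wf_cmd c2
  | CIf e c1 c2 => [&& wf_expr e, wf_cmd c1 & wf_cmd c2]
  | CFor _ _ c => wf_cmd c
  | CRead e | CWrite e => wf_expr e
  end.

(* Array [a] occupies the addresses congruent to [a] modulo 64; the arrays 60,
   61 and 62 hold a buffer, the variables and the evaluation stack. *)
Definition adr (a i : nat) : nat := i * 64 + a.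
Definition stk (d : nat) : nat := adr 62 d.
Definition var (x : nat) : nat := adr 61 x.

Lemma adr_eq a b i j : a < 64 -> b < 64 ->
  (adr a i == adr b j) = (a == b) && (i == j).
Proof. by rewrite /adr; lia. Qed.

Lemma stk_eq i j : (stk i == stk j) = (i == j).
Proof. by rewrite adr_eq. Qed.

Lemma var_eq i j : (var i == var j) = (i == j).
Proof. by rewrite adr_eq. Qed.

Lemma stk_var i j : (stk i == var j) = false.
Proof. by rewrite adr_eq. Qed.

Lemma var_stk i j : (var i == stk j) = false.
Proof. by rewrite adr_eq. Qed.

Lemma adr_stk a i j : a < 62 -> (adr a i == stk j) = false.
Proof. by move=> h; rewrite adr_eq //; lia. Qed.

Lemma adr_var a i j : a < 61 -> (adr a i == var j) = false.
Proof. by move=> h; rewrite adr_eq //; lia. Qed.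

Definition mov (d : nat) (a : operand) : scmd := SOp Add (DDir d) a (Imm 0).

(** The machine can only test for zero, so a counter runs down while the loop variable runs up. *)
Definition sfor (x cnt : nat) (body : scmd) : scmd :=
  SSeq (mov (var x) (Imm 0))
    (SWhile (Dir cnt)
       (SSeq body (SSeq (SOp Add (DDir (var x)) (Dir (var x)) (Imm 1))
                        (SOp Defs.Sub (DDir cnt) (Dir cnt) (Imm 1))))).

(* [dst := address of the cell of array a whose index is in dst] *)
Definition addr_of (a dst : nat) : scmd :=
  SSeq (SOp Mul (DDir dst) (Dir dst) (Imm 64)) (SOp Add (DDir dst) (Dir dst) (Imm a)).

Definition load_code (a d : nat) : scmd :=
  SSeq (addr_of a (stk d)) (mov (stk d) (Ind (stk d))).

Fixpoint bnd_code (d : nat) (b : bnd) : scmd :=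
  match b with
  | BC c => mov (stk d) (Imm c)
  | BN => mov (stk d) (Dir (adr 0 0))
  | BK => mov (stk d) (Dir (adr 0 1))
  | BAdd b1 b2 =>
      SSeq (bnd_code d b1) (SSeq (bnd_code d.+1 b2)
        (SOp Add (DDir (stk d)) (Dir (stk d)) (Dir (stk d.+1))))
  | BMulN b =>
      SSeq (bnd_code d b) (SOp Mul (DDir (stk d)) (Dir (stk d)) (Dir (adr 0 0)))
  end.

(** The value ends in [stk d] and only cells from [stk d] on are disturbed. A sum saves and restores
    the outer value of its variable, so that evaluation has no side effect. *)
Fixpoint expr_code (d : nat) (e : expr) : scmd :=
  match e with
  | ECst c => mov (stk d) (Imm c)
  | EVar x => mov (stk d) (Dir (var x))
  | ERd a e => SSeq (expr_code d e) (load_code a d)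
  | EOp f e1 e2 =>
      SSeq (expr_code d e1) (SSeq (expr_code d.+1 e2)
        (SOp f (DDir (stk d)) (Dir (stk d)) (Dir (stk d.+1))))
  | EIf e e1 e2 =>
      SSeq (expr_code d e) (SIf (Dir (stk d)) (expr_code d e1) (expr_code d e2))
  | ESum x b e =>
      SSeq (bnd_code d b)
      (SSeq (mov (stk d.+1) (Dir (var x)))
      (SSeq (mov (stk d.+2) (Imm 0))
      (SSeq (sfor x (stk d) (SSeq (expr_code d.+3 e)
               (SOp Add (DDir (stk d.+2)) (Dir (stk d.+2)) (Dir (stk d.+3)))))
      (SSeq (mov (var x) (Dir (stk d.+1)))
            (mov (stk d) (Dir (stk d.+2)))))))
  end.

Definition store_code (d : nat) (v : operand) : scmd :=
  SOp Add (DInd (stk d)) v (Imm 0).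

(** For [CSet] the values go to the buffer and are copied only afterwards: the assignment is
    simultaneous although [e] may read the array it assigns. The bound is evaluated again for the
    copy because the first loop has consumed its counter. *)
Fixpoint cmd_code (d : nat) (c : cmd) : scmd :=
  match c with
  | CSkip => mov (stk d) (Imm 0)
  | CSet a o x b e =>
      SSeq (expr_code d o)
      (SSeq (mov (stk d.+1) (Dir (var x)))
      (SSeq (bnd_code d.+2 b)
      (SSeq (sfor x (stk d.+2)
        (SSeq (expr_code d.+3 e)
        (SSeq (mov (stk d.+4) (Dir (var x)))
        (SSeq (addr_of 60 (stk d.+4)) (store_code d.+4 (Dir (stk d.+3)))))))
      (SSeq (bnd_code d.+2 b)
      (SSeq (sfor x (stk d.+2)
        (SSeq (mov (stk d.+3) (Dir (var x)))
        (SSeq (addr_of 60 (stk d.+3))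
        (SSeq (SOp Add (DDir (stk d.+4)) (Dir (stk d)) (Dir (var x)))
        (SSeq (addr_of a (stk d.+4)) (store_code d.+4 (Ind (stk d.+3))))))))
      (mov (var x) (Dir (stk d.+1))))))))
  | CSeq c1 c2 => SSeq (cmd_code d c1) (cmd_code d c2)
  | CIf e c1 c2 =>
      SSeq (expr_code d e) (SIf (Dir (stk d)) (cmd_code d c1) (cmd_code d c2))
  | CFor x b c =>
      SSeq (bnd_code d b)
      (SSeq (mov (stk d.+1) (Dir (var x)))
      (SSeq (sfor x (stk d) (cmd_code d.+2 c))
            (mov (var x) (Dir (stk d.+1)))))
  | CRead e =>
      SSeq (expr_code d e)
      (SSeq (SOp Add (DDir (stk d)) (Dir (stk d)) (Imm 2))
      (SSeq (addr_of 0 (stk d)) (SRead (DInd (stk d)))))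
  | CWrite e => SSeq (expr_code d e) (SWrite (Dir (stk d)))
  end.

(** * Numbers of executed instructions *)

Fixpoint bnd_steps (b : bnd) : nat :=
  match b with
  | BC _ | BN | BK => 1
  | BAdd b1 b2 => bnd_steps b1 + bnd_steps b2 + 1
  | BMulN b => bnd_steps b + 1
  end.

(** Both input numbers are replaced by the single bound [X], so that the count is a polynomial in
    one variable. A conditional is charged for both branches. *)
Fixpoint expr_steps (X : nat) (e : expr) : nat :=
  match e with
  | ECst _ | EVar _ => 1
  | ERd _ e => expr_steps X e + 3
  | EOp _ e1 e2 => expr_steps X e1 + expr_steps X e2 + 1
  | EIf e1 e2 e3 => expr_steps X e1 + expr_steps X e2 + expr_steps X e3 + 2
  | ESum x b e => bnd_steps b + bval X X b * (expr_steps X e + 5) + 6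
  end.

Fixpoint cmd_steps (X : nat) (c : cmd) : nat :=
  match c with
  | CSkip => 1
  | CSet a o x b e =>
      expr_steps X o + 2 * bnd_steps b + bval X X b * (expr_steps X e + 20) + 6
  | CSeq c1 c2 => cmd_steps X c1 + cmd_steps X c2
  | CIf e c1 c2 => expr_steps X e + cmd_steps X c1 + cmd_steps X c2 + 2
  | CFor x b c => bnd_steps b + bval X X b * (cmd_steps X c + 4) + 4
  | CRead e => expr_steps X e + 4
  | CWrite e => expr_steps X e + 1
  end.

Lemma bval_mono n k X b : n <= X -> k <= X -> bval n k b <= bval X X b.
Proof. by move=> nX kX; elim: b => //= *; [apply: leq_add | apply: leq_mul]. Qed.

Definition terminates (X : nat) (s : scmd) (c : mstate) (N : nat) (Q : mstate -> Prop) :=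
  exists c' M, [/\ sexec X s c c' M, M <= N & Q c'].

(** * Correctness of the compiler *)

Section Compiler.
Variable X : nat.
Hypothesis X7 : 7 <= X.

Lemma lt64 c : c <= 64 -> c < 2 ^ X.
Proof. by move=> hc; apply: (@leq_trans (2 ^ 7)); rewrite ?leq_exp2l //; lia. Qed.

Lemma terminates_seq s1 s2 c N1 N2 Q1 Q2 :
  terminates X s1 c N1 Q1 ->
  (forall c1, Q1 c1 -> terminates X s2 c1 N2 Q2) ->
  terminates X (SSeq s1 s2) c (N1 + N2) Q2.
Proof.
move=> [c1 [M1 [e1 h1 q1]]] /(_ _ q1) [c2 [M2 [e2 h2 q2]]].
by exists c2, (M1 + M2); split=> //; [apply: sexec_seq e1 e2 | apply: leq_add].
Qed.

Lemma terminates_le s c N N' (Q Q' : mstate -> Prop) :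
  terminates X s c N Q -> N <= N' -> (forall c', Q c' -> Q' c') ->
  terminates X s c N' Q'.
Proof.
move=> [c' [M [e h q]]] hN hQ; exists c', M; split=> //; last exact: hQ.
exact: leq_trans hN.
Qed.

Lemma terminates_op f d a b m i o (Q : mstate -> Prop) :
  (f = Mul -> oval m b < 2 ^ X) ->
  Q (MState (upd m (daddr m d) (eval_binop f (oval m a) (oval m b))) i o) ->
  terminates X (SOp f d a b) (MState m i o) 1 Q.
Proof. by move=> h q; eexists; exists 1; split; [apply: sexec_op|..]. Qed.

Lemma terminates_mov d a m i o (Q : mstate -> Prop) :
  Q (MState (upd m d (oval m a)) i o) ->
  terminates X (mov d a) (MState m i o) 1 Q.
Proof. by move=> q; apply: terminates_op => //=; rewrite addn0. Qed.

Lemma terminates_addr_of a d m i o (Q : mstate -> Prop) : a < 64 ->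
  (forall m', (forall p, p != d -> m' p = m p) -> m' d = adr a (m d) ->
     Q (MState m' i o)) ->
  terminates X (addr_of a d) (MState m i o) 2 Q.
Proof.
move=> a64 H; apply: (terminates_seq (N1 := 1) (N2 := 1) (Q1 := fun c =>
   c = MState (upd m d (m d * 64)) i o)).
  by apply: terminates_op => // _; apply: lt64.
move=> _ ->; apply: terminates_op => //=; apply: H.
  by move=> p hp; rewrite /upd (negPf hp).
by rewrite /upd !eqxx.
Qed.

Lemma terminates_store d v m i o (Q : mstate -> Prop) :
  Q (MState (upd m (m (stk d)) (oval m v)) i o) ->
  terminates X (store_code d v) (MState m i o) 1 Q.
Proof. by move=> q; apply: terminates_op => //=; rewrite addn0. Qed.

(** The invariant must not depend on the loop variable and the counter, which the bookkeeping
    overwrites; the body may use them but has to leave both as it found them. *)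
Lemma sfor_correct x cnt L M body c0 (Inv : nat -> mstate -> Prop) :
  cnt != var x ->
  (forall j c m, (forall p, p != var x -> p != cnt -> m p = mmem c p) ->
     Inv j c -> Inv j (MState m (minp c) (mout c))) ->
  (forall j c, j < L -> Inv j c -> mmem c (var x) = j ->
     terminates X body c M (fun c' =>
       [/\ mmem c' (var x) = j, mmem c' cnt = mmem c cnt & Inv j.+1 c'])) ->
  Inv 0 c0 -> mmem c0 cnt = L ->
  terminates X (sfor x cnt body) c0 (2 + L * (M + 4)) (Inv L).
Proof.
move=> cx Iext Istep I0 c0L; rewrite /sfor.
have -> : 2 + L * (M + 4) = 1 + (1 + L * (M + 4)) by lia.
apply: (terminates_seq (Q1 := fun c => [/\ Inv 0 c, mmem c (var x) = 0 & mmem c cnt = L])).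
  case: c0 I0 c0L => m i o I0 c0L; apply: terminates_mov; split=> /=.
  - by apply: (Iext 0 (MState m i o)) => //= p /negPf hp _; rewrite /upd hp.
  - by rewrite /upd eqxx.
  - by rewrite /upd (negPf cx).
(* Induction on the remaining count [j], which is what the counter holds; [i] is the current
   index. *)
suff H j i c : j + i = L -> Inv i c -> mmem c (var x) = i -> mmem c cnt = j ->
    terminates X (SWhile (Dir cnt) (SSeq body
      (SSeq (SOp Add (DDir (var x)) (Dir (var x)) (Imm 1))
            (SOp Defs.Sub (DDir cnt) (Dir cnt) (Imm 1))))) c (1 + j * (M + 4)) (Inv L).
  by move=> c [h1 h2 h3]; apply: H h1 h2 h3; rewrite addn0.
elim: j i c => [|j IH] i c ijL Ic cx0 cc.
  exists c, 1; split=> //; last by rewrite -ijL.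
  exact: sexec_stop.
have iL : i < L by lia.
have [c1 [M1 [e1 h1 [q1 q2 q3]]]] := Istep i c iL Ic cx0.
pose c2 := MState (upd (upd (mmem c1) (var x) i.+1) cnt j) (minp c1) (mout c1).
have I2 : Inv i.+1 c2.
  by apply: Iext q3 => p /negPf h1' /negPf h2'; rewrite /upd h1' h2'.
have x2 : mmem c2 (var x) = i.+1 by rewrite /= /upd eq_sym (negPf cx) eqxx.
have cc2 : mmem c2 cnt = j by rewrite /= /upd eqxx.
have ijL' : j + i.+1 = L by lia.
have [c3 [M3 [e3 h3 q4]]] := IH i.+1 c2 ijL' I2 x2 cc2.
exists c3, ((M1 + (1 + 1)) + M3).+2; split=> //; last by lia.
apply: sexec_loop e3; first by rewrite /= cc.
apply: sexec_seq e1 _; case: c1 @c2 q1 q2 {h1 q3 I2 x2 cc2} => m1 i1 o1 /= q1 q2.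
apply: sexec_seq; first by apply: sexec_op.
rewrite /=; set m2 := upd m1 _ _.
have -> : upd (upd m1 (var x) i.+1) cnt j = upd m2 cnt (m2 cnt - 1).
  have -> : m2 cnt = j.+1 by rewrite /m2 /upd (negPf cx) q2 cc.
  by rewrite subn1 /m2 q1 addn1.
exact: (@sexec_op X Defs.Sub (DDir cnt) (Dir cnt) (Imm 1) m2).
Qed.

Definition frame (d : nat) (m m' : nat -> nat) : Prop :=
  forall p, (forall j, d <= j -> p != stk j) -> m' p = m p.

Lemma frame_stk d m m' j : frame d m m' -> j < d -> m' (stk j) = m (stk j).
Proof. by move=> F jd; apply: F => i di; rewrite stk_eq; lia. Qed.

Lemma frame_adr d m m' a i : frame d m m' -> a < 62 -> m' (adr a i) = m (adr a i).
Proof. by move=> F h; apply: F => j _; rewrite adr_stk. Qed.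

Lemma frame_trans d d' m m1 m2 :
  frame d m m1 -> frame d' m1 m2 -> d <= d' -> frame d m m2.
Proof. by move=> F1 F2 dd p hp; rewrite F2 ?F1 // => j hj; apply: hp; lia. Qed.

Lemma frame_upd d d' m m' v : frame d m m' -> d <= d' -> frame d m (upd m' (stk d') v).
Proof. by move=> F dd p hp; rewrite /upd (negPf (hp _ dd)) F. Qed.

Definition represents (m : nat -> nat) (ar : nat -> nat -> nat) (env : nat -> nat) :=
  (forall a i, a < 60 -> m (adr a i) = ar a i) /\ (forall x, m (var x) = env x).

Lemma represents_frame d m m' ar env :
  frame d m m' -> represents m ar env -> represents m' ar env.
Proof.
move=> F [R1 R2]; split=> [a i ha|x]; first by rewrite (frame_adr _ F) ?R1 //; lia.
by rewrite (frame_adr _ F) ?R2.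
Qed.

Definition input_ok (ar : nat -> nat -> nat) :=
  [/\ ar 0 0 <= X, ar 0 1 <= X & forall i, ar 0 i < 2 ^ X].

Definition evaluates d m i o v (c : mstate) :=
  [/\ minp c = i, mout c = o, mmem c (stk d) = v & frame d m (mmem c)].

Lemma bnd_code_correct b d m i o ar env : represents m ar env -> input_ok ar ->
  terminates X (bnd_code d b) (MState m i o) (bnd_steps b)
    (evaluates d m i o (bval (ar 0 0) (ar 0 1) b)).
Proof.
move=> R [_ _ ok]; have F0 d' m' v : frame d' m' (upd m' (stk d') v).
  by apply: frame_upd.
elim: b d m R => [c|||b1 I1 b2 I2|b I] d m R /=.
- by apply: terminates_mov; split=> //=; rewrite /upd eqxx.
- by apply: terminates_mov; split=> //=; rewrite /upd eqxx; apply: R.1.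
- by apply: terminates_mov; split=> //=; rewrite /upd eqxx; apply: R.1.
- rewrite -addnA; apply: terminates_seq (I1 d m R) _.
  move=> [m1 i1 o1] [/= -> -> v1 F1]; have R1 := represents_frame F1 R.
  apply: terminates_seq (I2 d.+1 m1 R1) _ => -[m2 i2 o2] [/= -> -> v2 F2].
  apply: terminates_op => //; split=> //=.
    by rewrite /upd eqxx v2 (frame_stk F2) // v1.
  by apply: frame_upd => //; apply: frame_trans F1 F2 _.
- apply: terminates_seq (I d m R) _.
  move=> [m1 i1 o1] [/= -> -> v1 F1]; have R1 := represents_frame F1 R.
  apply: terminates_op => [_|]; rewrite /= (R1.1 0 0) //.
  split=> //=; first by rewrite /upd eqxx v1.
  exact: frame_upd.
Qed.

Lemma expr_code_correct e d m i o ar env :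
  wf_expr e -> represents m ar env -> input_ok ar ->
  terminates X (expr_code d e) (MState m i o) (expr_steps X e)
    (evaluates d m i o (eval ar env e)).
Proof.
move=> + + ok; have F0 d' m' v : frame d' m' (upd m' (stk d') v).
  by apply: frame_upd.
elim: e d m env => [c|x|a e I|f e1 I1 e2 I2|e I e1 I1 e2 I2|x b e I] d m env /=.
- by move=> _ _; apply: terminates_mov; split=> //=; rewrite /upd eqxx.
- by move=> _ R; apply: terminates_mov; split=> //=; rewrite /upd eqxx; apply: R.2.
- move=> /andP[a60 we] R; apply: terminates_seq (I d m env we R) _.
  move=> [m1 i1 o1] [/= -> -> v1 F1]; have R1 := represents_frame F1 R.
  rewrite /load_code; apply: (terminates_seq (N1 := 2) (N2 := 1)).
    by apply: terminates_addr_of; [lia | move=> m' h1 h2; exact: (conj h1 (conj h2 (conj (erefl i) (erefl o))) :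
      (fun c => (forall p, p != stk d -> mmem c p = m1 p) /\ mmem c (stk d) = adr a (m1 (stk d)) /\ i = minp c /\ o = mout c) (MState m' i o))].
  move=> [m2 i2 o2] /= [h1 [h2 [<- <-]]]; apply: terminates_mov; split=> //=.
    rewrite /upd eqxx h2 v1 h1 ?R1.1 //; rewrite adr_stk //; lia.
  apply: frame_upd => // p hp; rewrite h1 ?F1 //; exact: hp.
- move=> /and3P[w1 w2 wf] R; rewrite -addnA; apply: terminates_seq (I1 d m env w1 R) _.
  move=> [m1 i1 o1] [/= -> -> v1 F1]; have R1 := represents_frame F1 R.
  apply: terminates_seq (I2 d.+1 m1 env w2 R1) _ => -[m2 i2 o2] [/= -> -> v2 F2].
  apply: terminates_op => [fM|].
    (* Here the syntactic restriction on products is used: a small right factor is a constant below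
       64 or an input cell, hence below [2 ^ X]. *)
    move: wf; rewrite fM /= v2; case: (e2) => //= [c c64|[|//] e' _]; first by apply: lt64; lia.
    by case: ok.
  split=> //=; first by rewrite /upd eqxx v2 (frame_stk F2) // v1.
  by apply: frame_upd => //; apply: frame_trans F1 F2 _.
- move=> /and3P[w w1 w2] R; rewrite -!addnA; apply: terminates_seq (I d m env w R) _.
  move=> [m1 i1 o1] [/= -> -> v1 F1]; have R1 := represents_frame F1 R.
  case: eqP => /= hv.
    have [c' [M [ex h [q1 q2 q3 q4]]]] := I2 d m1 env w2 R1.
    exists c', M.+2; split; [apply: sexec_if; rewrite /= v1 hv; exact: ex | lia |].
    by split=> //; apply: frame_trans F1 q4 _.
  have [c' [M [ex h [q1 q2 q3 q4]]]] := I1 d m1 env w1 R1.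
  exists c', M.+2; split; [apply: sexec_if; rewrite /= v1; move/eqP: hv => /negPf ->; exact: ex | lia |].
  by split=> //; apply: frame_trans F1 q4 _.
- move=> we R; set L := bval (ar 0 0) (ar 0 1) b.
  have LX : L <= bval X X b by case: ok => ? ? _; apply: bval_mono.
  pose Inv j c := [/\ minp c = i, mout c = o, mmem c (stk d.+1) = env x,
    mmem c (stk d.+2) = \sum_(l < j) eval ar (upd env x l) e &
    forall p, p != var x -> (forall j, d <= j -> p != stk j) -> mmem c p = m p].
  apply: (@terminates_le _ _ (bnd_steps b + (1 + (1 + ((2 + L * (expr_steps X e + 1 + 4)) + (1 + 1)))))
           _ (evaluates d m i o (\sum_(l < L) eval ar (upd env x l) e))) => //; last first.
    by have := leq_mul LX (leqnn (expr_steps X e + 5)); lia.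
  apply: terminates_seq (bnd_code_correct b d i o R ok) _ => -[m1 i1 o1] [/= -> -> v1 F1].
  apply: (terminates_seq (Q1 := fun c => c = MState (upd m1 (stk d.+1) (m1 (var x))) i o)).
    exact: terminates_mov.
  move=> _ ->; set m2 := upd _ _ _.
  apply: (terminates_seq (Q1 := fun c => c = MState (upd m2 (stk d.+2) 0) i o)).
    exact: terminates_mov.
  move=> _ ->; set m3 := upd _ _ _.
  apply: (terminates_seq (Q1 := Inv L)).
    apply: sfor_correct; first by rewrite stk_var.
    + move=> j [mc ic oc] m' /= hm [/= h1 h2 h3 h4 h5]; split=> //=.
      * by rewrite hm ?stk_var ?stk_eq //; lia.
      * by rewrite hm ?stk_var ?stk_eq //; lia.
      * by move=> p p1 p2; rewrite hm ?h5 //; apply: p2.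
    + move=> j [mc ic oc] jL [/= -> -> h3 h4 h5] hx.
      have Rj : represents mc ar (upd env x j).
        split=> [a l a60|y]; last first.
          rewrite /upd; case: eqP => [->//|/eqP yx]; rewrite h5 ?R.2 ?var_eq //.
          by move=> j' _; rewrite var_stk.
        rewrite h5 ?R.1 ?adr_var //; first by lia.
        by move=> j' _; rewrite adr_stk //; lia.
      apply: terminates_seq (I d.+3 mc _ we Rj) _ => -[m4 i4 o4] [/= -> -> v4 F4].
      have Fd j' : j' < d.+3 -> m4 (stk j') = mc (stk j') by apply: frame_stk.
      apply: terminates_op => //; split=> /=.
      * by rewrite /upd var_stk (frame_adr _ F4).
      * by rewrite /upd stk_eq ltn_eqF ?Fd //; lia.
      split=> //=.
      * by rewrite /upd stk_eq ltn_eqF ?Fd //.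
      * by rewrite /upd eqxx big_ord_recr /= v4 Fd // h4.
      * move=> p p1 p2; rewrite /upd (negPf (p2 _ _)); last by lia.
        by rewrite F4 ?h5 // => j' hj'; apply: p2; lia.
    + split=> //=.
      * rewrite /m3 /upd stk_eq ltn_eqF // /m2 /upd eqxx.
        by rewrite (frame_adr _ F1) // R.2.
      * by rewrite /m3 /upd eqxx big_ord0.
      * move=> p p1 p2; rewrite /m3 /m2 /upd !(negPf (p2 _ _)); [|lia|lia].
        by rewrite F1.
    + rewrite /= /m3 /m2 /upd !stk_eq !ltn_eqF; [|lia|lia].
      by rewrite v1.
  move=> [m4 i4 o4] [/= -> -> h3 h4 h5].
  apply: (terminates_seq (Q1 := fun c => c = MState (upd m4 (var x) (m4 (stk d.+1))) i o)).
    exact: terminates_mov.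
  move=> _ ->; apply: terminates_mov; split=> //=.
    by rewrite {1}/upd eqxx /upd stk_var h4.
  apply: frame_upd => // p hp; rewrite /upd; case: eqP => [->|/eqP px].
    by rewrite h3 R.2.
  exact: h5.
Qed.

Definition state_ok (s : lstate) :=
  input_ok (arr s) /\ (forall v, v \in linp s -> v < 2 ^ X).

(** Array 0 remains a source of legal right factors: [CSet] cannot write to it and [CRead] stores
    only input numbers. *)
Lemma cexec_ok c env s : wf_cmd c -> state_ok s -> state_ok (cexec c env s).
Proof.
elim: c env s => //= [a o x b e|c1 I1 c2 I2|e c1 I1 c2 I2|x b c I|e] env s.
- by move=> /and3P[/andP[a0 _] _ _] [ok oki]; split=> //=; rewrite /input_ok /upd eq_sym gtn_eqF.
- by move=> /andP[w1 w2] ok; apply: I2 => //; apply: I1.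
- by move=> /and3P[_ w1 w2] ok; case: ifP => _; [apply: I1 | apply: I2].
- by move=> w ok; elim: (bvals s b) => //= j IH; apply: I.
- move=> _ [[h1 h2 h3] oki]; split=> /=.
    split=> //= i; rewrite /upd /=; case: (i == _) => //.
    by case: (linp s) oki => /= [|v l] H; [apply: lt64 | apply: H; rewrite mem_head].
  by case: (linp s) oki => //= u l H v hv; apply: H; rewrite inE hv orbT.
Qed.

Lemma cmd_code_correct c d env m s :
  wf_cmd c -> represents m (arr s) env -> state_ok s ->
  terminates X (cmd_code d c) (MState m (linp s) (lout s)) (cmd_steps X c)
    (fun c' => [/\ minp c' = linp (cexec c env s), mout c' = lout (cexec c env s),
       represents (mmem c') (arr (cexec c env s)) env &
       forall j, j < d -> mmem c' (stk j) = m (stk j)]).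
Proof.
elim: c d env m s => [|a off x b e|c1 I1 c2 I2|e c1 I1 c2 I2|x b c I|e|e] d env m s /=.
- move=> _ R ok; apply: terminates_mov; split=> //=.
    by apply: (represents_frame (d := d)) R; apply: frame_upd.
  by move=> j jd; rewrite /upd stk_eq ltn_eqF.
- move=> /and3P[/andP[a0 a60] wo we] R [ok _].
  set L := bvals s b; set ar := arr s; set o := eval ar env off.
  have LX : L <= bval X X b by case: ok => ? ? _; apply: bval_mono.
  pose Out c := forall p, p != var x -> (forall j, d <= j -> p != stk j) ->
    (forall l, p != adr 60 l) -> (forall l, p != adr a l) -> mmem c p = m p.
  pose Base c := [/\ minp c = linp s, mout c = lout s, mmem c (stk d) = o,
    mmem c (stk d.+1) = env x & Out c].
  pose V l := eval ar (upd env x l) e.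
  (* [Inv1] describes the filling of the buffer while array [a] is still intact, [Inv2] the copying,
     during which [a] changes. *)
  pose Inv1 j c := [/\ Base c, (forall l, l < j -> mmem c (adr 60 l) = V l) &
    forall l, mmem c (adr a l) = ar a l].
  pose Inv2 j c := [/\ Base c, (forall l, l < L -> mmem c (adr 60 l) = V l) &
    forall l, mmem c (adr a l) = if o <= l < o + j then V (l - o) else ar a l].
  have Bext c m' : (forall p, p != var x -> p != stk d.+2 -> m' p = mmem c p) ->
      Base c -> Base (MState m' (minp c) (mout c)).
    move=> hm [h1 h2 h3 h4 h5]; split=> //=.
    - by rewrite hm ?stk_var ?stk_eq //; lia.
    - by rewrite hm ?stk_var ?stk_eq //; lia.
    - move=> p p1 p2 p3 p4 /=; rewrite /= hm ?h5 //; apply: p2; lia.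
  have BR c j : Base c -> (forall l, mmem c (adr a l) = ar a l) -> mmem c (var x) = j ->
      represents (mmem c) ar (upd env x j).
    move=> [h1 h2 h3 h4 h5] ha hx; split=> [a' l' a'60|y].
      case: (eqVneq a' a) => [->|aa']; first exact: ha.
      rewrite h5 ?R.1 ?adr_var //; first by lia.
      + by move=> j' _; rewrite adr_stk //; lia.
      + by move=> l; rewrite adr_eq; lia.
      + by move=> l; rewrite adr_eq; lia.
    rewrite /upd; case: eqP => [->//|/eqP yx]; rewrite h5 ?R.2 ?var_eq //.
    + by move=> j' _; rewrite var_stk.
    + by move=> l; rewrite adr_eq.
    + by move=> l; rewrite adr_eq; lia.
  apply: (@terminates_le _ _ (expr_steps X off + (1 + (bnd_steps b +
     ((2 + L * ((expr_steps X e + (1 + (2 + 1))) + 4)) + (bnd_steps b +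
     ((2 + L * ((1 + (2 + (1 + (2 + 1)))) + 4)) + 1)))))) _ (fun c' =>
     [/\ Inv2 L c' & mmem c' (var x) = env x])); first last.
  + move=> c' [[[h1 h2 h3 h4 h5] h6 h7] h8]; split=> //.
      split=> [a' l' a'60|y] /=; last first.
        case: (eqVneq y x) => [->//|yx]; rewrite h5 ?R.2 ?var_eq //.
        * by move=> j' _; rewrite var_stk.
        * by move=> l; rewrite adr_eq.
        * by move=> l; rewrite adr_eq; lia.
      rewrite /upd; case: eqP => [->|/eqP aa']; first exact: h7.
      rewrite h5 ?R.1 ?adr_var //; first by lia.
      * by move=> j' _; rewrite adr_stk //; lia.
      * by move=> l; rewrite adr_eq; lia.
      * by move=> l; rewrite adr_eq; lia.
    move=> j jd; rewrite h5 ?stk_var //.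
    * by move=> j' dj; rewrite stk_eq; lia.
    * by move=> l; rewrite adr_eq.
    * by move=> l; rewrite adr_eq //; lia.
  + by have := leq_mul LX (leqnn (expr_steps X e + 18)); lia.
  apply: terminates_seq (expr_code_correct d (linp s) (lout s) wo R ok) _ => -[m1 i1 o1] [/= -> -> v1 F1].
  have R1 := represents_frame F1 R.
  apply: (terminates_seq (Q1 := fun c => c = MState (upd m1 (stk d.+1) (m1 (var x))) (linp s) (lout s))).
    exact: terminates_mov.
  move=> _ ->; set m1' := upd _ _ _.
  have F1' : frame d m m1' by apply: frame_upd.
  have R1' := represents_frame F1' R.
  apply: terminates_seq (bnd_code_correct b d.+2 (linp s) (lout s) R1' ok) _ => -[m2 i2 o2] [/= -> -> v2 F2].
  have R2 := represents_frame F2 R1'.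
  apply: (terminates_seq (Q1 := Inv1 L)).
    apply: sfor_correct; first by rewrite stk_var.
    + move=> j c m' hm [h1 h2 h3]; split; first exact: Bext.
        by move=> l lj /=; rewrite hm ?h2 ?adr_eq.
      by move=> l /=; rewrite hm ?h3 ?adr_eq //; lia.
    + move=> j [mc ic oc] jL [B h2 h3] hx; have Rj := BR _ _ B h3 hx.
      rewrite /= in hx h2 h3; case: B => /= -> -> h5 h6 h7.
      apply: terminates_seq (expr_code_correct d.+3 (linp s) (lout s) we Rj ok) _.
      move=> [m4 i4 o4] [/= -> -> v4 F4].
      have Fd j' : j' < d.+3 -> m4 (stk j') = mc (stk j') by apply: frame_stk.
      apply: (terminates_seq (Q1 := fun c => c = MState (upd m4 (stk d.+4) (m4 (var x))) (linp s) (lout s))).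
        exact: terminates_mov.
      move=> _ ->; apply: (terminates_seq (N1 := 2) (N2 := 1) (Q1 := fun c =>
         [/\ minp c = linp s, mout c = lout s, mmem c (stk d.+4) = adr 60 j &
             forall p, p != stk d.+4 -> mmem c p = m4 p])).
        apply: terminates_addr_of => // m' g1 g2; split=> //=.
          by rewrite g2 /upd eqxx (frame_adr _ F4) //= hx.
        by move=> p hp; rewrite g1 // /upd (negPf hp).
      move=> [m5 i5 o5] [/= -> -> g1 g2].
      apply: terminates_store; rewrite /= g1; split=> /=.
      * by rewrite /upd eq_sym adr_var // g2 ?var_stk // (frame_adr _ F4).
      * by rewrite /upd eq_sym adr_stk // g2 ?stk_eq ?ltn_eqF ?Fd //; lia.
      split; first split=> //=.
      * by rewrite /upd eq_sym adr_stk // g2 ?stk_eq ?ltn_eqF ?Fd //; lia.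
      * by rewrite /upd eq_sym adr_stk // g2 ?stk_eq ?ltn_eqF ?Fd //; lia.
      * move=> p p1 p2 p3 p4 /=; rewrite /upd (negPf (p3 _)) g2 ?p2 //; last by lia.
        by rewrite F4; [apply: h7 | move=> j' hj'; apply: p2; lia].
      * move=> l lj /=; rewrite /upd adr_eq //=; case: eqP => [->|/eqP nlj].
          by rewrite g2 ?stk_eq ?ltn_eqF // v4.
        by rewrite g2 ?adr_stk // (frame_adr _ F4) ?h2 //; lia.
      * move=> l /=; rewrite /upd adr_eq //=; last by lia.
        rewrite (_ : a == 60 = false) /=; last by lia.
        by rewrite g2 ?adr_stk ?(frame_adr _ F4) ?h3 //; lia.
    + split=> //=; first split=> //=.
      * by rewrite (frame_stk F2) // /m1' /upd stk_eq ltn_eqF.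
      * by rewrite (frame_stk F2) // /m1' /upd eqxx R1.2.
      * by move=> p p1 p2 p3 p4 /=; rewrite F2 ?F1' // => j' hj'; apply: p2; lia.
      * by move=> l; rewrite R2.1.
    + by [].
  move=> [m3 i3 o3] [B3 h2 h3]; rewrite /= in h2 h3.
  (* The first loop left some value in its variable; it is named to have an environment in which the
     bound is evaluated again. *)
  pose xv := m3 (var x).
  have R3 : represents m3 ar (upd env x xv) by apply: BR B3 h3 _.
  case: (B3) => /= -> -> k3 k4 k5.
  apply: terminates_seq (bnd_code_correct b d.+2 (linp s) (lout s) R3 ok) _ => -[m4 i4 o4] [/= -> -> v4 F4].
  apply: (terminates_seq (Q1 := Inv2 L)).
    apply: sfor_correct; first by rewrite stk_var.
    + move=> j c m' hm [g1 g2 g3]; split; first exact: Bext.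
        by move=> l lj /=; rewrite hm ?g2 ?adr_eq.
      by move=> l /=; rewrite hm ?g3 ?adr_eq //; lia.
    + move=> j [mc ic oc] jL [[/= -> -> h5 h6 h7] g2 g3] hx; rewrite /= in hx g2 g3.
      apply: (terminates_seq (Q1 := fun c => c = MState (upd mc (stk d.+3) (mc (var x))) (linp s) (lout s))).
        exact: terminates_mov.
      move=> _ ->; apply: (terminates_seq (N1 := 2) (N2 := 4) (Q1 := fun c =>
         [/\ minp c = linp s, mout c = lout s, mmem c (stk d.+3) = adr 60 j &
             forall p, p != stk d.+3 -> mmem c p = mc p])).
        apply: terminates_addr_of => // m' q1 q2; split=> //=.
          by rewrite q2 /upd eqxx hx.
        by move=> p hp; rewrite q1 // /upd (negPf hp).
      move=> [m5 i5 o5] [/= -> -> q1 q2].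
      apply: (terminates_seq (N1 := 1) (N2 := 3) (Q1 := fun c => c = MState (upd m5 (stk d.+4) (o + j)) (linp s) (lout s))).
        apply: terminates_op => //=; rewrite q2 ?stk_eq ?ltn_eqF // ?h5; last by lia.
        by rewrite q2 ?hx // var_stk.
      move=> _ ->; apply: (terminates_seq (N1 := 2) (N2 := 1) (Q1 := fun c =>
         [/\ minp c = linp s, mout c = lout s, mmem c (stk d.+4) = adr a (o + j) &
             forall p, p != stk d.+4 -> mmem c p = m5 p])).
        apply: terminates_addr_of; first by lia.
        move=> m' r1 r2; split=> //=; first by rewrite r2 /upd eqxx.
        by move=> p hp; rewrite r1 // /upd (negPf hp).
      move=> [m6 i6 o6] [/= -> -> r1 r2].
      have hv : m6 (m6 (stk d.+3)) = V j.
        rewrite (r2 (stk d.+3)) ?stk_eq ?ltn_eqF // q1 r2 ?adr_stk // q2 ?adr_stk //.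
        exact: g2.
      have r3 p : p != stk d.+3 -> p != stk d.+4 -> m6 p = mc p.
        by move=> p1 p2; rewrite r2 ?q2.
      apply: terminates_store; rewrite /= r1 hv; split=> /=.
      * by rewrite /upd eq_sym adr_var ?r3 ?var_stk //; lia.
      * by rewrite /upd eq_sym adr_stk ?r3 ?stk_eq //; lia.
      split; first split=> //=.
      * by rewrite /upd eq_sym adr_stk ?r3 ?stk_eq //; lia.
      * by rewrite /upd eq_sym adr_stk ?r3 ?stk_eq //; lia.
      * move=> p p1 p2 p3 p4 /=; rewrite /upd (negPf (p4 _)) r3; [by apply: h7|apply: p2; lia|apply: p2; lia].
      * move=> l lj /=; rewrite /upd adr_eq //=; last by lia.
        rewrite (_ : 60 == a = false) /=; last by lia.
        by rewrite r3 ?adr_stk // g2.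
      * move=> l /=; rewrite /upd adr_eq ?eqxx /=; [|lia|lia].
        case: (eqVneq l (o + j)) => [->|nl].
          by rewrite (_ : _ <= _ < _ = true) ?addKn //; lia.
        rewrite r3 ?adr_stk //; try lia.
        by rewrite g3 (_ : (o <= l < o + j.+1) = (o <= l < o + j)) //; lia.
    + split=> /=.
      * split=> //=; try by rewrite (frame_stk F4).
        by move=> p p1 p2 p3 p4 /=; rewrite F4; [apply: k5 | move=> j' hj'; apply: p2; lia].
      * by move=> l lL; rewrite (frame_adr _ F4) // h2.
      * move=> l; rewrite (frame_adr _ F4); last by lia.
        by rewrite h3 (_ : _ <= _ < _ = false) //; lia.
    + by [].
  move=> [m5 i5 o5] [[/= -> -> h5 h6 h7] g2 g3].
  apply: terminates_mov; split=> //=; last by rewrite /upd eqxx.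
  split=> /=.
  + split=> //=; try by rewrite /upd stk_var.
    by move=> p p1 p2 p3 p4 /=; rewrite /upd (negPf p1); apply: h7.
  + by move=> l lL; rewrite /upd adr_var // g2.
  + by move=> l; rewrite /upd adr_var ?g3 //; lia.
- move=> /andP[w1 w2] R ok.
  apply: terminates_seq (I1 d env m s w1 R ok) _ => -[m1 i1 o1] [/= -> -> R1 h1].
  have := I2 d env m1 (cexec c1 env s) w2 R1 (cexec_ok env w1 ok).
  move=> /terminates_le; apply=> // -[m2 i2 o2] [/= -> -> R2 h2]; split=> // j jd.
  by rewrite h2 ?h1.
- move=> /and3P[w w1 w2] R ok; rewrite -!addnA.
  apply: terminates_seq (expr_code_correct d (linp s) (lout s) w R ok.1) _ => -[m1 i1 o1] [/= -> -> v1 F1].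
  have R1 := represents_frame F1 R.
  case: (eqVneq (eval (arr s) env e) 0) => hv /=.
    have [c' [M [ex h [q1 q2 q3 q4]]]] := I2 d env m1 s w2 R1 ok.
    exists c', M.+2; split; [apply: sexec_if; rewrite /= v1 hv; exact: ex | lia |].
    by split=> // j jd; rewrite q4 // (frame_stk F1).
  have [c' [M [ex h [q1 q2 q3 q4]]]] := I1 d env m1 s w1 R1 ok.
  exists c', M.+2; split; [apply: sexec_if; rewrite /= v1 (negPf hv); exact: ex | lia |].
  by split=> // j jd; rewrite q4 // (frame_stk F1).
- move=> w R ok; set L := bvals s b.
  have LX : L <= bval X X b by case: ok => -[? ? _] _; apply: bval_mono.
  pose st j := iteri j (fun i s => cexec c (upd env x i) s) s.
  have okj j : state_ok (st j) by elim: j => //= j IH; apply: cexec_ok.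
  pose Inv j c := [/\ minp c = linp (st j), mout c = lout (st j), mmem c (stk d.+1) = env x,
    (forall a l, a < 60 -> mmem c (adr a l) = arr (st j) a l) &
    (forall y, y != x -> mmem c (var y) = env y) /\
    (forall l, l < d -> mmem c (stk l) = m (stk l))].
  apply: (@terminates_le _ _ (bnd_steps b + (1 + ((2 + L * (cmd_steps X c + 4)) + 1))) _
    (fun c => Inv L c /\ mmem c (var x) = env x)); first last.
  + move=> c' [[h1 h2 h3 h4 [h5 h6]] h7]; split=> //; split=> // y.
    by case: (eqVneq y x) => [->//|]; apply: h5.
  + by have := leq_mul LX (leqnn (cmd_steps X c + 4)); lia.
  apply: terminates_seq (bnd_code_correct b d (linp s) (lout s) R ok.1) _ => -[m1 i1 o1] [/= -> -> v1 F1].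
  have R1 := represents_frame F1 R.
  apply: (terminates_seq (Q1 := fun c => c = MState (upd m1 (stk d.+1) (m1 (var x))) (linp s) (lout s))).
    exact: terminates_mov.
  move=> _ ->; apply: (terminates_seq (Q1 := Inv L)).
    apply: sfor_correct; first by rewrite stk_var.
    + move=> j [mc ic oc] m' /= hm [/= h1 h2 h3 h4 [h5 h6]]; split=> //=.
      * by rewrite hm ?stk_var ?stk_eq //; lia.
      * by move=> a l a60; rewrite hm ?h4 ?adr_var ?adr_stk //; lia.
      * split=> [y yx|l ld]; first by rewrite hm ?h5 ?var_eq ?var_stk.
        by rewrite hm ?h6 ?stk_var ?stk_eq //; lia.
    + move=> j [mc ic oc] jL [/= -> -> h3 h4 [h5 h6]] hx.
      have Rj : represents mc (arr (st j)) (upd env x j).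
        by split=> // y; rewrite /upd; case: eqP => [->//|/eqP]; apply: h5.
      have := I d.+2 (upd env x j) mc (st j) w Rj (okj j).
      move=> /terminates_le; apply=> // -[m2 i2 o2] [/= -> -> R2 g2]; split=> //.
      * by rewrite R2.2 /upd eqxx.
      * by rewrite g2.
      split=> //=.
      * by rewrite g2.
      * exact: R2.1.
      * split=> [y yx|l ld]; first by rewrite R2.2 /upd (negPf yx).
        by rewrite g2 ?h6 //; lia.
    + split=> //=.
      * by rewrite /upd eqxx R1.2.
      * by move=> a l a60; rewrite /upd adr_stk ?R1.1 //; lia.
      * split=> [y yx|l ld]; first by rewrite /upd var_stk R1.2.
        by rewrite /upd stk_eq ltn_eqF ?(frame_stk F1) //; lia.
    + by rewrite /= /upd stk_eq ltn_eqF.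
  move=> [m4 i4 o4] [/= -> -> h3 h4 [h5 h6]].
  apply: terminates_mov; split=> /=; last by rewrite /upd eqxx.
  split=> //=.
  + by rewrite /upd stk_var.
  + by move=> a l a60; rewrite /upd adr_var ?h4 //; lia.
  + split=> [y yx|l ld]; last by rewrite /upd stk_var h6.
    by rewrite /upd var_eq (negPf yx) h5.
- move=> w R ok.
  apply: terminates_seq (expr_code_correct d (linp s) (lout s) w R ok.1) _ => -[m1 i1 o1] [/= -> -> v1 F1].
  have R1 := represents_frame F1 R.
  apply: (terminates_seq (N1 := 1) (N2 := 3) (Q1 := fun c => c = MState (upd m1 (stk d) (eval (arr s) env e).+2) (linp s) (lout s))).
    by apply: terminates_op => //=; rewrite v1 addn2.
  move=> _ ->; apply: (terminates_seq (N1 := 2) (N2 := 1) (Q1 := fun c =>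
     [/\ minp c = linp s, mout c = lout s, mmem c (stk d) = adr 0 (eval (arr s) env e).+2 &
         forall p, p != stk d -> mmem c p = m1 p])).
    apply: terminates_addr_of => // m' q1 q2; split=> //=; first by rewrite q2 /upd eqxx.
    by move=> p hp; rewrite q1 // /upd (negPf hp).
  move=> [m2 i2 o2] [/= -> -> q1 q2].
  eexists; exists 1; split=> //.
    apply: sexec_read; case: (linp s) ok.2 => /= [|v l] H; first exact: lt64.
    by apply: H; rewrite inE eqxx.
  rewrite /= q1; split=> //=.
    split=> [a l a60|y]; last by rewrite /upd eq_sym adr_var // q2 ?var_stk ?R1.2.
    rewrite /upd adr_eq //; last by lia.
    case: (eqVneq a 0) => [->|a0] /=; last by rewrite q2 ?adr_stk ?R1.1 //; lia.
    by case: eqP => // _; rewrite q2 ?adr_stk ?R1.1.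
  move=> j jd; rewrite /upd eq_sym adr_stk // q2 ?(frame_stk F1) //.
  by rewrite stk_eq ltn_eqF.
- move=> w R ok.
  apply: terminates_seq (expr_code_correct d (linp s) (lout s) w R ok.1) _ => -[m1 i1 o1] [/= -> -> v1 F1].
  eexists; exists 1; split=> //; first exact: sexec_write.
  rewrite /= v1; split=> //; first exact: represents_frame F1 R.
  by move=> j jd; rewrite (frame_stk F1).
Qed.
End Compiler.

(** * Polynomial running time *)

Definition is_poly (f : nat -> nat) : Prop := exists p : {poly nat}, forall x, f x = (p.[x])%R.

Lemma is_poly_cst c : is_poly (fun=> c).
Proof. by exists (c%:P)%R => x; rewrite hornerC. Qed.

Lemma is_poly_id : is_poly id.
Proof. by exists 'X%R => x; rewrite hornerX. Qed.

Lemma is_poly_add f g : is_poly f -> is_poly g -> is_poly (fun x => f x + g x).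
Proof. by move=> [p hp] [q hq]; exists (p + q)%R => x; rewrite hornerD hp hq. Qed.

Lemma is_poly_mul f g : is_poly f -> is_poly g -> is_poly (fun x => f x * g x).
Proof. by move=> [p hp] [q hq]; exists (p * q)%R => x; rewrite hornerM hp hq. Qed.

Section Steps.
Variable g : nat -> nat.
Hypothesis pg : is_poly g.

Lemma is_poly_bval b : is_poly (fun x => bval (g x) (g x) b).
Proof.
elim: b => [c|||b1 I1 b2 I2|b I] //=; first exact: is_poly_cst.
  exact: is_poly_add.
exact: is_poly_mul.
Qed.

Lemma is_poly_expr_steps e : is_poly (fun x => expr_steps (g x) e).
Proof.
elim: e => [c|x|a e I|f e1 I1 e2 I2|e I e1 I1 e2 I2|x b e I] /=;
  repeat first [apply: is_poly_cst | assumption | apply: is_poly_bval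
               | apply: is_poly_add | apply: is_poly_mul].
Qed.

Lemma is_poly_cmd_steps c : is_poly (fun x => cmd_steps (g x) c).
Proof.
elim: c => [|a o x b e|c1 I1 c2 I2|e c1 I1 c2 I2|x b c I|e|e] /=;
  repeat first [apply: is_poly_cst | assumption | apply: is_poly_bval
    | apply: is_poly_expr_steps | apply: is_poly_add | apply: is_poly_mul].
Qed.
End Steps.

(** A constant [i] fits as soon as [i <= X], so for a fixed program it is enough to add a constant
    to the input size. *)
Lemma const_ok_exists s : exists C, forall X, C <= X -> const_ok X s.
Proof.
have lt i X : i <= X -> i < 2 ^ X by move/leq_ltn_trans; apply; apply: ltn_expl.
have ho a : exists C, forall X, C <= X -> const_ok_o X a by case: a => i; exists i => X /lt.
have hd d : exists C, forall X, C <= X -> const_ok_d X d by case: d => i; exists i => X /lt.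
elim: s => [f d a b|d|a|s1 [C1 h1] s2 [C2 h2]|a s1 [C1 h1] s2 [C2 h2]|a s [C h]] /=.
- have [[C1 h1] [[C2 h2] [C3 h3]]] := (hd d, (ho a, ho b)).
  by exists (C1 + C2 + C3) => X hX; rewrite h1 ?h2 ?h3 //; lia.
- exact: hd.
- exact: ho.
- by exists (C1 + C2) => X hX; rewrite h1 ?h2 //; lia.
- by have [C3 h3] := ho a; exists (C1 + C2 + C3) => X hX; rewrite h1 ?h2 ?h3 //; lia.
- by have [C3 h3] := ho a; exists (C + C3) => X hX; rewrite h ?h3 //; lia.
Qed.

Lemma input_size_ge x v : v \in x -> v < 2 ^ input_size x.
Proof.
move=> vx; apply: leq_trans (ltn_bitlen v) _.
by rewrite leq_exp2l // /input_size (big_rem v vx) /= leq_addr.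
Qed.

(** The state after [start_code] has read the two numbers to which all loop bounds refer. *)
Definition start_state (x : seq nat) : lstate :=
  LState (fun a i => if a == 0 then if i < 2 then nth 0 x i else 0 else 0)
    (drop 2 x) [::].

Definition start_code (c : cmd) : scmd :=
  SSeq (SRead (DDir (adr 0 0))) (SSeq (SRead (DDir (adr 0 1))) (cmd_code 0 c)).

(** The loop bounds are polynomials in the first two input numbers, not in their lengths. The side
    conditions, which hold when the input lists at least that many numbers, turn them into
    polynomials in the input size. *)
Theorem loop_program_poly_time c : wf_cmd c ->
  exists P (p : {poly nat}), forall x r,
    nth 0 x 0 <= input_size x -> nth 0 x 1 <= input_size x ->
    run P p.[input_size x]%R x r = Some (lout (cexec c (fun=> 0) (start_state x))).
Proof.
move=> wc; have [C hC] := const_ok_exists (start_code c).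
pose g x := x + (C + 7).
have pg : is_poly g by apply: is_poly_add; [apply: is_poly_id | apply: is_poly_cst].
pose N x := 2 + cmd_steps (g x) c.
have pN : is_poly N by apply: is_poly_add; [apply: is_poly_cst | apply: is_poly_cmd_steps].
have [p hp] : is_poly (fun x => N x * (9 * (g x + N x * g x))).
  by apply: is_poly_mul => //; apply: is_poly_mul (is_poly_cst _) _;
     apply: is_poly_add => //; apply: is_poly_mul.
exists (compile 0 (start_code c)), p => x r h0 h1; rewrite -hp.
set X := g (input_size x); have X7 : 7 <= X by rewrite /X /g; lia.
have sX : input_size x <= X by rewrite /X /g; lia.
have hx v : v \in x -> v < 2 ^ X by move/input_size_ge; apply: ltn_pow_le.
have hnth i : nth 0 x i < 2 ^ X.
  case: (ltnP i (size x)) => hi; first by apply/hx/mem_nth.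
  by rewrite nth_default // expn_gt0.
have hxd v : v \in drop 2 x -> v < 2 ^ X by move/mem_drop; apply: hx.
pose m2 := upd (upd (fun=> 0) (adr 0 0) (nth 0 x 0)) (adr 0 1) (nth 0 x 1).
have R2 : represents m2 (arr (start_state x)) (fun=> 0).
  split=> [a i a60|y] /=; rewrite /m2 /upd !adr_eq //; try lia.
  by case: a {a60} => [|a] //=; case: i => [|[|i]].
have ok : state_ok X (start_state x).
  split=> //; split=> /=; try lia.
  by move=> i; case: ifP => _; rewrite ?expn_gt0.
have [c' [M [ex hM [_ hout _ _]]]] := @cmd_code_correct X X7 c 0 (fun=> 0) m2 (start_state x) wc R2 ok.
have E : sexec X (start_code c) (MState (fun=> 0) x [::]) c' (1 + (1 + M)).
  have hr i o m d : head 0 i < 2 ^ X -> sexec X (SRead (DDir d)) (MState m i o)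
    (MState (upd m d (head 0 i)) (behead i) o) 1 by move=> h; apply: (@sexec_read X (DDir d)).
  apply: sexec_seq (hr _ _ _ _ _) _; first by rewrite -nth0.
  apply: sexec_seq (hr _ _ _ _ _) _; first by rewrite -nth0 nth_behead.
  by move: ex; rewrite /m2 /= -!nth0 nth_behead -!drop1 drop_drop.
have X0 : 0 < X by lia.
have CX : C <= X by rewrite /X /g; lia.
have b0 : bounded X (mmem (MState (fun=> 0) x [::])) by move=> q; rewrite expn_gt0.
have hcode : code_at (compile 0 (start_code c)) 0 (compile 0 (start_code c)) by [].
have [[k [t' [e hk ht]]] _] := compile_correct E X0 (hC X CX) hcode r 0 (leqnn X) b0.
rewrite /run; set T := N _ * _.
have tT : t' <= T.
  apply: leq_trans ht _; rewrite /T add0n.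
  have hN : 1 + (1 + M) <= N (input_size x) by rewrite /N -/X; lia.
  by apply: leq_mul => //; apply: leq_mul => //; rewrite leq_add2l leq_mul.
have hh : halted (compile 0 (start_code c)) (to_config (0 + ssize (start_code c)) t' r c').
  by rewrite /halted /= size_compile add0n.
have -> : iter T (step (compile 0 (start_code c))) (init x r) =
          to_config (0 + ssize (start_code c)) t' r c'.
  (* A halted configuration is a fixed point of [step], so the surplus steps up to [T] change
     nothing. *)
  have -> : T = (T - k) + k by lia.
  rewrite iterD -[init x r]/(to_config 0 0 r (MState (fun=> 0) x [::])) e.
  elim: (T - k) => //= j ->; rewrite {1}/step onth_default //.
by rewrite hh /= tT hout.
Qed.

(** * Moat growing *)

Fixpoint path_sum (f : nat -> nat -> nat) (x : nat) (p : seq nat) : nat :=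
  if p is y :: p' then f x y + path_sum f y p' else 0.

Lemma crossing1 (S : pred nat) x p : S x != S (last x p) ->
  1 <= path_sum (fun u v => S u != S v) x p.
Proof.
elim: p x => [|y p IH] x /=; first by rewrite eqxx.
case: (eqVneq (S x) (S y)) => [->|_] h //=; exact: IH.
Qed.

Lemma crossing2 (S : pred nat) x p : ~~ S x -> ~~ S (last x p) -> has S p ->
  2 <= path_sum (fun u v => S u != S v) x p.
Proof.
elim: p x => [|y p IH] x //= Sx Sl; case Sy: (S y) => /= h.
  by rewrite (negPf Sx) add1n ltnS; apply: crossing1; rewrite Sy (negPf Sl).
by rewrite (negPf Sx) /=; apply: IH => //; rewrite Sy.
Qed.

Lemma sum_two n (F : nat -> nat) x y : x < n -> y < n -> x != y ->
  \sum_(z < n) F z = F x + F y + \sum_(z < n | (z != x :> nat) && (z != y :> nat)) F z.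
Proof.
move=> xn yn xy; rewrite (bigD1 (Ordinal xn)) //= (bigD1 (Ordinal yn)) /=; last first.
  by rewrite -val_eqE /= eq_sym.
by rewrite addnA; congr (_ + _); apply: eq_bigl => z; rewrite -!val_eqE /=.
Qed.

Lemma sum_delta n (F : nat -> nat) x : x < n -> \sum_(z < n) F z * (x == z) = F x.
Proof.
move=> xn; rewrite (bigD1 (Ordinal xn)) //= eqxx muln1 big1 ?addn0 // => z.
by rewrite -val_eqE /= eq_sym => /negPf ->; rewrite muln0.
Qed.

Lemma sum_delta1 n x : x < n -> \sum_(z < n) (x == z) = 1.
Proof.
by move=> xn; rewrite -(sum_delta (fun=> 1) xn); apply: eq_bigr => z _; rewrite mul1n.
Qed.

Lemma leq_sum_term (F : nat -> nat) j i k : j <= i < k -> F i <= \sum_(j <= l < k) F l.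
Proof.
move=> /andP[ji ik]; rewrite (big_cat_nat ji (ltnW ik)) /= [X in _ + X]big_ltn //; lia.
Qed.

(** [gc] holds the reduced costs, [gb] the remaining budgets, and [gm] sends a vertex to the
    representative of its component. *)
Record gstate := GState { gc : nat -> nat -> nat; gb : nat -> nat; gm : nat -> nat }.

Section Moats.
Variables (n : nat) (la lb : pred nat).

Definition ex (P : pred nat) : bool := has P (iota 0 n).

Lemma exP (P : pred nat) : reflect (exists2 v, v < n & P v) (ex P).
Proof.
apply: (iffP hasP) => -[v]; rewrite ?mem_iota => hv Pv.
  by exists v.
by exists v; rewrite ?mem_iota.
Qed.

Definition meets (g : gstate) (P : pred nat) (x : nat) : bool :=
  ex (fun v => (gm g v == x) && P v).

Lemma meetsP g (P : pred nat) x : reflect (exists2 v, v < n & gm g v = x /\ P v) (meets g P x).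
Proof.
apply: (iffP (exP _)) => -[v vn]; first by move=> /andP[/eqP h1 h2]; exists v.
by move=> [h1 h2]; exists v => //; rewrite h1 eqxx.
Qed.

Lemma meets_self g (P : pred nat) v : v < n -> P v -> meets g P (gm g v).
Proof. by move=> vn Pv; apply/meetsP; exists v. Qed.

Lemma meets_sub g (P Q : pred nat) x : (forall v, v < n -> P v -> Q v) ->
  meets g P x -> meets g Q x.
Proof. by move=> PQ /meetsP[v vn [h1 h2]]; apply/meetsP; exists v => //; split=> //; apply: PQ. Qed.

(* [act g x]: the component labelled [x] grows.  A component with both kinds of
   labels never grows, one with a single kind always does, and an unlabelled one
   grows as long as some vertex in it has budget left. *)
Definition act (g : gstate) (x : nat) : bool :=
  if meets g la x then ~~ meets g lb x
  else meets g lb x || meets g (fun v => 0 < gb g v) x.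

(* The unique vertex of a growing unlabelled component that is charged. *)
Definition pay (g : gstate) (v : nat) : bool :=
  [&& 0 < gb g v, ~~ meets g la (gm g v), ~~ meets g lb (gm g v) &
      ~~ ex (fun u => [&& u < v, gm g u == gm g v & 0 < gb g u])].

Definition rate (g : gstate) (u v : nat) : nat :=
  if gm g u == gm g v then 0 else act g (gm g u) + act g (gm g v).

(* All quantities are doubled in each step to keep them integral. *)
Definition gstep (g g' : gstate) (e : option (nat * nat)) (eps : nat) : Prop :=
  [/\ forall u v, u < n -> v < n -> gc g' u v + eps * rate g u v = 2 * gc g u v,
      forall v, v < n -> gb g' v + 2 * eps * pay g v = 2 * gb g v &
      match e with
      | None => forall v, v < n -> gm g' v = gm g v
      | Some (a, b) =>
          [/\ a < n, b < n, gm g a != gm g b, gc g' a b = 0 &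
              forall v, v < n -> gm g' v = if gm g v == gm g b then gm g a else gm g v]
      end].

Definition gwf (g : gstate) : Prop :=
  forall v, v < n -> gm g v < n /\ gm g (gm g v) = gm g v.

Lemma meets_merge g g' (P : pred nat) x y z : x != y ->
  (forall v, v < n -> gm g' v = if gm g v == y then x else gm g v) ->
  meets g' P z = if z == x then meets g P x || meets g P y
                 else (z != y) && meets g P z.
Proof.
move=> xy H; apply/meetsP/idP => [[v vn [<- Pv]]|].
  rewrite H //; case: (eqVneq (gm g v) y) => [e|ne].
    by rewrite eqxx -e meets_self ?orbT.
  by case: (eqVneq (gm g v) x) => [e|nx]; rewrite ?ne -?e meets_self.
case: (eqVneq z x) => [->|zx].
  move=> /orP[] /meetsP[v vn [e Pv]]; exists v => //; split=> //; rewrite H // e ?eqxx //.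
  by rewrite (negPf xy).
move=> /andP[zy] /meetsP[v vn [e Pv]]; exists v => //; split=> //.
by rewrite H // e (negPf zy).
Qed.

Lemma meets_same g g' (P : pred nat) z :
  (forall v, v < n -> gm g' v = gm g v) -> meets g' P z = meets g P z.
Proof.
by move=> H; apply/meetsP/meetsP => -[v vn [e Pv]]; exists v => //; split=> //; rewrite ?H // -H.
Qed.

Lemma inactP g x : ~~ (meets g la x && meets g lb x) -> ~~ act g x ->
  [/\ ~~ meets g la x, ~~ meets g lb x & forall v, v < n -> gm g v = x -> gb g v = 0].
Proof.
rewrite /act; case: (meets g la x) => /=; first by move=> /negPf ->.
move=> _ /norP[h1 h2]; split=> // v vn e; apply/eqP; rewrite -leqn0 leqNgt.
by apply: contra h2 => h; apply/meetsP; exists v.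
Qed.

Lemma pay_unique g u v : u < n -> v < n -> pay g u -> pay g v -> gm g u = gm g v -> u = v.
Proof.
move=> un vn /and4P[bu _ _ mu] /and4P[bv _ _ mv] e.
case: (ltngtP u v) => // h.
  by case/negP: mv; apply/exP; exists u => //; rewrite h e eqxx.
by case/negP: mu; apply/exP; exists v => //; rewrite h e eqxx.
Qed.

Lemma pay_exists g x : act g x -> ~~ meets g la x -> ~~ meets g lb x ->
  exists2 v, v < n & pay g v /\ gm g v = x.
Proof.
move=> h ha hb; move: h; rewrite /act (negPf ha) (negPf hb) /= => /meetsP[v0 v0n [e0 b0]].
have exn : exists v, [&& v < n, gm g v == x & 0 < gb g v] by exists v0; rewrite v0n e0 eqxx.
case: (ex_minnP exn) => v /and3P[vn /eqP ev bv] vmin; exists v => //; split=> //.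
rewrite /pay bv ev ha hb /=; apply/negP => /exP[u un /and3P[uv /eqP eu bu]].
by have := vmin u; rewrite un eu eqxx bu => /(_ isT); rewrite leqNgt uv.
Qed.

Lemma pay_act g v : v < n -> pay g v ->
  [/\ act g (gm g v), ~~ meets g la (gm g v) & ~~ meets g lb (gm g v)].
Proof.
move=> vn /and4P[bv h1 h2 _]; split=> //; rewrite /act (negPf h1).
by apply/orP; right; apply/meetsP; exists v.
Qed.

Definition unlab g x := [&& act g x, ~~ meets g la x & ~~ meets g lb x].

Lemma pay_count g x : \sum_(v < n) pay g v * (gm g v == x) = unlab g x.
Proof.
case: (boolP (unlab g x)) => [/and3P[h1 h2 h3]|h].
  have [v vn [pv ev]] := pay_exists h1 h2 h3.
  rewrite (bigD1 (Ordinal vn)) //= pv ev eqxx big1 // => u.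
  rewrite -val_eqE /= => uv; case pu: (pay g u) => //=; case: eqP => // eu.
  by case/eqP: uv; apply: (pay_unique (ltn_ord u) vn pu pv); rewrite eu ev.
rewrite big1 // => v _; case pv: (pay g v) => //=; case: eqP => // ev.
by have [h1 h2 h3] := pay_act (ltn_ord v) pv; move: h; rewrite /unlab -ev h1 h2 h3.
Qed.

(** Budgets are charged at vertices while costs shrink at components; since every growing unlabelled
    component has exactly one payer, the two kinds of sums can be exchanged. *)
Lemma pay_sum g (F : nat -> nat) : gwf g ->
  \sum_(v < n) pay g v * F (gm g v) = \sum_(x < n) F x * unlab g x.
Proof.
move=> W; under [RHS]eq_bigr => x _ do rewrite -pay_count big_distrr /=.
rewrite exchange_big /=; apply: eq_bigr => v _.
have [h _] := W v (ltn_ord v).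
rewrite -{1}(sum_delta F h) big_distrr /=; apply: eq_bigr => x _; lia.
Qed.

Lemma rate_sum g u v : gwf g -> u < n -> v < n ->
  rate g u v = \sum_(x < n) act g x * ((gm g u == x) != (gm g v == x)).
Proof.
move=> W un vn; rewrite /rate; case: eqP => [->|/eqP uv].
  by rewrite big1 // => x _; rewrite eqxx muln0.
have [hu _] := W u un; have [hv _] := W v vn.
rewrite -{1}(sum_delta (fun x => act g x) hu) -(sum_delta (fun x => act g x) hv) -big_split /=.
apply: eq_bigr => x _; case: (eqVneq (gm g u) x) => [e|]; case: (eqVneq (gm g v) x) => [e'|]; rewrite /= ?muln0 ?muln1 ?addn0 //.
by rewrite e e' eqxx in uv.
Qed.

Lemma path_sum_rate g x p : gwf g -> x < n -> all (fun v => v < n) p ->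
  path_sum (rate g) x p =
  \sum_(z < n) act g z * path_sum (fun u v => (gm g u == z) != (gm g v == z)) x p.
Proof.
move=> W; elim: p x => [|y p IH] x xn /=; first by rewrite big1 // => z _; rewrite muln0.
move=> /andP[yn pn]; rewrite IH // rate_sum // -big_split /=; apply: eq_bigr => z _.
by rewrite mulnDr.
Qed.

Lemma path_sum_step g g' e eps x p : gstep g g' e eps -> x < n -> all (fun v => v < n) p ->
  path_sum (gc g') x p + eps * path_sum (rate g) x p = 2 * path_sum (gc g) x p.
Proof.
move=> [H _ _]; elim: p x => [|y p IH] x xn /=; first by rewrite muln0.
by move=> /andP[yn pn]; have := H x y xn yn; have := IH y yn pn; lia.
Qed.

(** * Charges of a run against the cost of paths *)

Variables (L : nat) (g : nat -> gstate) (ev : nat -> option (nat * nat)) (eps : nat -> nat).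
Hypothesis Hstep : forall j, j < L -> gstep (g j) (g j.+1) (ev j) (eps j).
Hypothesis Hinit : forall v, v < n -> gm (g 0) v = v.
Hypothesis Hfinal : forall v, v < n -> ~~ act (g L) (gm (g L) v).

Lemma gwf_run j : j <= L -> gwf (g j).
Proof.
elim: j => [|j IH] jL v vn; first by rewrite !Hinit.
have W := IH (ltnW jL); have [_ _] := Hstep jL.
case: (ev j) => [[a b] [an bn ab _ H]|H]; last by rewrite !H //; have [] := W v vn.
have [h1 h2] := W v vn; have [h3 h4] := W a an; have [h5 h6] := W b bn.
rewrite !(H v) //; case: (eqVneq (gm (g j) v) (gm (g j) b)) => [e|ne].
  by rewrite H // h4; split=> //; case: ifP.
by rewrite H // h2 (negPf ne).
Qed.

Lemma coarse j i u v : j <= i <= L -> u < n -> v < n ->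
  gm (g j) u = gm (g j) v -> gm (g i) u = gm (g i) v.
Proof.
move=> /andP[ji iL] un vn e; elim: i ji iL => [|i IH]; first by rewrite leqn0 => /eqP <-.
rewrite leq_eqVlt => /orP[/eqP <- //|ji iL]; have {}IH := IH ji (ltnW iL).
have [_ _] := Hstep iL.
by case: (ev i) => [[a b] [_ _ _ _ H]|H]; rewrite !H // IH.
Qed.

(** A paying vertex lies in an unlabelled component, whereas the paths start and end at labelled
    vertices. A path through it crosses the component twice and its reduced cost drops by [2 * eps],
    which is the charge. The powers of 2 account for the doublings still to come. *)
Lemma root_lower (ps : seq (nat * seq nat)) (O : pred nat) j : j <= L ->
  (forall q, q \in ps -> [/\ q.1 < n, all (fun v => v < n) q.2, la q.1 && lb q.1 &
     la (last q.1 q.2) && lb (last q.1 q.2)]) ->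
  (forall v, O v = has (fun q : nat * seq nat => v \in q.1 :: q.2) ps) ->
  2 ^ (L - j) * \sum_(v < n) O v * gb (g j) v <=
  2 ^ (L - j) * \sum_(q <- ps) path_sum (gc (g j)) q.1 q.2 + \sum_(v < n) O v * gb (g L) v.
Proof.
move=> jL Hps HO; have [d] : exists d, d + j = L by exists (L - j); rewrite subnK.
elim: d j {jL} => [|d IH] j e; first by move: e; rewrite add0n => ->; rewrite subnn !mul1n leq_addl.
have jL : j < L by lia.
have ejL : d + j.+1 = L by lia.
have {}IH := IH j.+1 ejL.
have W := gwf_run (ltnW jL); have [_ Hb _] := Hstep jL.
have -> : L - j = (L - j.+1).+1 by lia.
have E1 : 2 * \sum_(v < n) O v * gb (g j) v =
    \sum_(v < n) O v * gb (g j.+1) v + 2 * eps j * \sum_(v < n) pay (g j) v * O v.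
  rewrite !big_distrr /= -big_split /=; apply: eq_bigr => v _.
  by have := Hb v (ltn_ord v); case: (O v); rewrite ?mul1n ?mul0n ?muln0 ?muln1; lia.
have E2 : 2 * \sum_(q <- ps) path_sum (gc (g j)) q.1 q.2 =
    \sum_(q <- ps) path_sum (gc (g j.+1)) q.1 q.2
    + eps j * \sum_(q <- ps) path_sum (rate (g j)) q.1 q.2.
  rewrite !big_distrr /= -big_split /= big_seq [RHS]big_seq; apply: eq_bigr => q qp.
  by have [q1 q2 _ _] := Hps q qp; rewrite (path_sum_step (Hstep jL)).
have E3 : 2 * \sum_(v < n) pay (g j) v * O v <= \sum_(q <- ps) path_sum (rate (g j)) q.1 q.2.
  pose C z := \sum_(q <- ps) path_sum (fun u v => (gm (g j) u == z) != (gm (g j) v == z)) q.1 q.2.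
  have -> : \sum_(q <- ps) path_sum (rate (g j)) q.1 q.2 = \sum_(z < n) act (g j) z * C z.
    under [RHS]eq_bigr => z _ do rewrite big_distrr /=.
    rewrite exchange_big /= big_seq [RHS]big_seq; apply: eq_bigr => q qp.
    by have [q1 q2 _ _] := Hps q qp; apply: path_sum_rate.
  apply: (@leq_trans (\sum_(z < n) C z * unlab (g j) z)); last first.
    apply: leq_sum => z _; rewrite mulnC leq_mul2r /unlab; apply/orP; right.
    by case: (act _ _) => //=; rewrite leq_b1.
  rewrite -pay_sum // big_distrr /=; apply: leq_sum => v _; have vn := ltn_ord v.
  case pv: (pay (g j) v) => //; rewrite !mul1n; case Ov: (O v) => //.
  have [_ ha hb] := pay_act vn pv.
  move: Ov; rewrite HO => /hasP[q qp vq]; have [q1 q2 /andP[l1 _] /andP[l2 _]] := Hps q qp.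
  have qn : last q.1 q.2 < n.
    have := mem_last q.1 q.2; rewrite inE => /orP[/eqP -> //|]; exact: (allP q2).
  have lab_ne u : u < n -> la u -> gm (g j) u != gm (g j) v.
    by move=> un lu; apply: contra ha => /eqP <-; apply: meets_self.
  rewrite /C (big_rem q) //=; apply: leq_trans (leq_addr _ _); rewrite muln1.
  apply: (@crossing2 (fun u => gm (g j) u == gm (g j) v)); [exact: lab_ne|exact: lab_ne|].
  apply/hasP; exists (v : nat) => //; move: vq; rewrite inE => /orP[/eqP vq|//].
  by case/eqP: (lab_ne _ q1 l1); rewrite vq.
rewrite expnS; move: IH E1 E2 E3.
set A := \sum_(v < n) O v * gb (g j) v; set A' := \sum_(v < n) O v * gb (g j.+1) v.
set B := \sum_(q <- ps) path_sum (gc (g j)) _ _; set B' := \sum_(q <- ps) path_sum (gc (g j.+1)) _ _.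
set P := \sum_(v < n) pay _ _ * _; set R := \sum_(q <- ps) path_sum (rate _) _ _.
set Z := \sum_(v < n) _ * _; set X := 2 ^ _ => IH E1 E2 E3.
have : X * (2 * A) <= X * (2 * B) + Z; last by lia.
rewrite E1 E2 !mulnDr.
have : X * (eps j * (2 * P)) <= X * (eps j * R) by rewrite !leq_mul2l E3 !orbT.
lia.
Qed.

(** * Reverse deletion and degree counting *)

Section Prune.
Variables (K : pred nat) (mk : nat -> pred nat) (keep : nat -> bool).

(** The merges are examined backwards. A side that is unmarked and inactive is dropped, and so is a
    merge without any marked side. Two sides that both meet [K] are connected already, since [K] is
    contracted. *)
Definition keep_spec j :=
  if ev j is Some (a, b) then
    let x := gm (g j) a in let y := gm (g j) b in
    let h1 := meets (g j) (mk j.+1) x in let h2 := meets (g j) (mk j.+1) y in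
    [&& h1 || h2, h1 || act (g j) x, h2 || act (g j) y &
        ~~ (meets (g j) K x && meets (g j) K y)]
  else false.

(** Endpoints of a kept edge are marked for all earlier merges, so that these hold the two
    components together at the vertices where the edge attaches. *)
Definition mark_spec j (v : nat) :=
  mk j.+1 v || (keep j && if ev j is Some (a, b) then (v == a) || (v == b) else false).

Hypothesis Hkeep : forall j, j < L -> keep j = keep_spec j.
Hypothesis Hmk : forall j v, j < L -> v < n -> mk j v = mark_spec j v.
Hypothesis HK : forall v, v < n -> K v -> mk L v.
(** In the root run the marks are [K] itself and this is void. In a pair run it concerns the
    component of [s], which grows until it meets [t]. *)
Hypothesis Hmark : forall j v, j <= L -> v < n -> mk L v ->
  ~~ meets (g j) K (gm (g j) v) -> act (g j) (gm (g j) v).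
Hypothesis Hlab : forall j x, j <= L ->
  meets (g j) la x -> meets (g j) lb x -> meets (g j) K x.

(** The default 0 is never met at a kept step, which always has an event. *)
Definition ea i := if ev i is Some (a, _) then a else 0.
Definition eb i := if ev i is Some (_, b) then b else 0.

Lemma keepP i : i < L -> keep i ->
  [/\ ev i = Some (ea i, eb i), ea i < n, eb i < n & gm (g i) (ea i) != gm (g i) (eb i)].
Proof.
move=> iL; rewrite Hkeep // /keep_spec /ea /eb; have [_ _] := Hstep iL.
by case: (ev i) => [[a b]|] // [].
Qed.

Lemma mk_mono j i v : j <= i <= L -> v < n -> mk i v -> mk j v.
Proof.
move=> /andP[ji iL] vn; elim: i ji iL => [|i IH]; first by rewrite leqn0 => /eqP <-.
rewrite leq_eqVlt => /orP[/eqP <- //|ji iL] h; apply: IH => //; first exact: ltnW.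
by rewrite Hmk // /mark_spec h.
Qed.

Lemma mk_keep j i : j <= i < L -> keep i -> mk j (ea i) /\ mk j (eb i).
Proof.
move=> /andP[ji iL] ki; have [e an bn _] := keepP iL ki.
by split; apply: (@mk_mono j i) => //; rewrite ?ji ?(ltnW iL) // Hmk // /mark_spec ki e eqxx ?orbT.
Qed.

Lemma mk_src j v : j <= L -> v < n -> mk j v ->
  mk L v \/ exists2 i, j <= i < L & keep i /\ ((v == ea i) || (v == eb i)).
Proof.
move=> jL vn; have [d] : exists d, d + j = L by exists (L - j); rewrite subnK.
elim: d j {jL} => [|d IH] j e; first by move: e; rewrite add0n => ->; left.
have jL : j < L by lia.
rewrite Hmk // /mark_spec => /orP[/IH|/andP[kj]].
  case; [by lia| by left | move=> [i /andP[i1 i2] h]; right; exists i => //; lia].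
have [-> _ _ _] := keepP jL kj => h; right; exists j => //; lia.
Qed.

Lemma K_mk j v : j <= L -> v < n -> K v -> mk j v.
Proof. by move=> jL vn Kv; apply: (@mk_mono j L); rewrite ?jL ?leqnn //; apply: HK. Qed.

Definition hit j x := meets (g j) (mk j) x.
Definition kfree j x := ~~ meets (g j) K x.

Lemma keep_diff j i : j <= i < L -> keep i -> gm (g j) (ea i) != gm (g j) (eb i).
Proof.
move=> /andP[ji iL] ki; have [_ an bn ab] := keepP iL ki.
by apply: contra ab => /eqP e; apply/eqP; apply: (@coarse j i) => //; rewrite ji ltnW.
Qed.

Lemma unhit_kfree j x : j <= L -> ~~ hit j x -> kfree j x.
Proof. by move=> jL; apply: contra; apply: meets_sub => v vn; apply: K_mk. Qed.

Lemma hit_merge j a b : j < L -> ev j = Some (a, b) ->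
  let x := gm (g j) a in let y := gm (g j) b in
  let h1 := meets (g j) (mk j.+1) x in let h2 := meets (g j) (mk j.+1) y in
  [/\ hit j x = h1 || keep j, hit j y = h2 || keep j,
      hit j.+1 x = h1 || h2, hit j.+1 y = false &
      forall z, z != x -> z != y -> hit j.+1 z = hit j z].
Proof.
move=> jL e x y h1 h2; have [_ _] := Hstep jL; rewrite e => -[an bn xy _ H].
have hj z : hit j z = meets (g j) (mk j.+1) z || (keep j && ((z == x) || (z == y))).
  apply/meetsP/orP => [[v vn [ez]]|[/meetsP[v vn [ez mv]]|/andP[kj /orP[]/eqP ->]]].
  - rewrite Hmk // /mark_spec e => /orP[mv|/andP[kj /orP[]/eqP ev']].
    + by left; apply/meetsP; exists v.
    + by right; rewrite kj -ez ev' eqxx.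
    + by right; rewrite kj -ez ev' eqxx orbT.
  - by exists v => //; split=> //; rewrite Hmk // /mark_spec mv.
  - by exists a => //; split=> //; rewrite Hmk // /mark_spec kj e eqxx orbT.
  - by exists b => //; split=> //; rewrite Hmk // /mark_spec kj e eqxx !orbT.
split; rewrite ?hj ?eqxx ?orbT ?andbT //.
- by rewrite /hit (meets_merge _ _ xy H) eqxx.
- by rewrite /hit (meets_merge _ _ xy H) eq_sym (negPf xy) eqxx.
- move=> z zx zy; rewrite hj (negPf zx) (negPf zy) andbF orbF.
  by rewrite /hit (meets_merge _ _ xy H) (negPf zx) zy.
Qed.

Lemma hit_same j x : j < L -> ev j = None -> hit j.+1 x = hit j x.
Proof.
move=> jL e; have [_ _] := Hstep jL; rewrite e => H.
rewrite /hit (meets_same _ _ H); apply/meetsP/meetsP => -[v vn [h mv]]; exists v => //; split=> //.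
  by rewrite Hmk // /mark_spec mv.
by move: mv; rewrite Hmk // /mark_spec e andbF orbF.
Qed.

Lemma kfree_merge j a b : j < L -> ev j = Some (a, b) ->
  let x := gm (g j) a in let y := gm (g j) b in
  [/\ kfree j.+1 x = kfree j x && kfree j y, kfree j.+1 y &
      forall z, z != x -> z != y -> kfree j.+1 z = kfree j z].
Proof.
move=> jL e x y; have [_ _] := Hstep jL; rewrite e => -[an bn xy _ H].
rewrite /kfree; split.
- by rewrite (meets_merge _ _ xy H) eqxx negb_or.
- by rewrite (meets_merge _ _ xy H) eq_sym (negPf xy) eqxx.
- by move=> z zx zy; rewrite (meets_merge _ _ xy H) (negPf zx) zy.
Qed.

Lemma keepE j a b : j < L -> ev j = Some (a, b) ->
  let x := gm (g j) a in let y := gm (g j) b in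
  let h1 := meets (g j) (mk j.+1) x in let h2 := meets (g j) (mk j.+1) y in
  keep j = [&& h1 || h2, h1 || act (g j) x, h2 || act (g j) y & kfree j x || kfree j y]
  /\ (~~ h1 -> kfree j x) /\ (~~ h2 -> kfree j y).
Proof.
move=> jL e x y h1 h2; rewrite Hkeep // /keep_spec e negb_and; split=> //.
by split; apply: contra; apply: meets_sub => v vn; apply: K_mk.
Qed.

Definition nkept j := \sum_(j <= i < L) keep i.

(** With [K] contracted to a root, the kept edges form a forest on the marked components, which has
    at most as many edges as nodes other than the root. In the backward induction, undoing a kept
    merge splits off exactly one more marked component free of [K]. *)
Lemma nkept_le j : j <= L -> nkept j <= \sum_(x < n) (hit j x && kfree j x).
Proof.
move=> jL; have [d] : exists d, d + j = L by exists (L - j); rewrite subnK.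
elim: d j {jL} => [|d IH] j e; first by rewrite /nkept -e add0n big_geq.
have jL : j < L by lia.
rewrite /nkept big_ltn //; have {}IH : nkept j.+1 <= _ := IH j.+1 (_ : d + j.+1 = L).
have {}IH := IH ltac:(lia).
case ej: (ev j) => [[a b]|]; last first.
  rewrite Hkeep // /keep_spec ej add0n; apply: leq_trans IH _.
  apply: leq_sum => x _; rewrite (hit_same _ jL ej) /kfree.
  by have [_ _] := Hstep jL; rewrite ej => H; rewrite (meets_same _ _ H).
have [_ _] := Hstep jL; rewrite ej => -[an bn xy _ _].
have [xn _] := gwf_run (ltnW jL) an; have [yn _] := gwf_run (ltnW jL) bn.
have [t1 t2 t3 t4 t5] := hit_merge jL ej; have [k1 k2 k3] := kfree_merge jL ej.
have [kE [kx ky]] := keepE jL ej.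
pose F i x : nat := hit i x && kfree i x.
have E1 := sum_two (F j) xn yn xy; have E2 := sum_two (F j.+1) xn yn xy.
rewrite -[X in _ <= X]/(\sum_(x < n) F j x) E1.
have {}IH : nkept j.+1 <= \sum_(x < n) F j.+1 x by [].
rewrite E2 (eq_bigr (fun z : 'I_n => F j z)) in IH; last first.
  by move=> z /andP[z1 z2]; rewrite /F t5 // k3.
move: IH; rewrite /F t1 t2 t3 t4 k1 /nkept /= addn0 => IH.
apply: leq_trans (leq_add (leqnn (keep j)) IH) _; rewrite addnA leq_add2r.
move: kx ky; rewrite kE.
move: (meets _ _ _) (meets _ _ _) (kfree j _) (kfree j _) (act _ _) (act _ _).
by do 6 case=> //=; move=> h1 h2; try (by have := h1 isT); try (by have := h2 isT).
Qed.

Definition deg j z :=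
  \sum_(j <= i < L) keep i * ((gm (g j) (ea i) == z) + (gm (g j) (eb i) == z)).

Lemma kfree_nolab j z : j <= L -> kfree j z -> ~~ (meets (g j) la z && meets (g j) lb z).
Proof. by move=> jL; apply: contra => /andP[]; apply: Hlab. Qed.

Lemma gb_zero j v : j < L -> v < n -> gb (g j) v = 0 -> gb (g j.+1) v = 0.
Proof. by move=> jL vn h; have [_ /(_ v vn) + _] := Hstep jL; rewrite h; lia. Qed.

Lemma inact_intro j z : ~~ meets (g j) la z -> ~~ meets (g j) lb z ->
  (forall v, v < n -> gm (g j) v = z -> gb (g j) v = 0) -> ~~ act (g j) z.
Proof.
move=> h1 h2 h; rewrite /act (negPf h1) (negPf h2) /=.
by apply/meetsP => -[v vn [e]]; rewrite h.
Qed.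

(** Leaves of the kept forest are active. If the current merge attaches an inactive component, this
    was marked by a later kept edge, which is the second one. If the merge is dropped, the other
    side is inactive and unmarked, so the merged component is inactive too and all its edges end in
    the marked side. *)
Lemma deg_ge2 j z : j <= L -> hit j z -> kfree j z -> ~~ act (g j) z -> 2 <= deg j z.
Proof.
move=> jL; have [d] : exists d, d + j = L by exists (L - j); rewrite subnK.
elim: d j z {jL} => [|d IH] j z e hz kz az.
  move: e; rewrite add0n => e; subst j; case/meetsP: hz => v vn [ez mv].
  by case/negP: az; rewrite -ez; apply: Hmark => //; rewrite ez.
have jL : j < L by lia.
have {}IH : forall z, hit j.+1 z -> kfree j.+1 z -> ~~ act (g j.+1) z -> 2 <= deg j.+1 z.
  by move=> z'; apply: IH; lia.
have [na nb z0] := inactP (kfree_nolab (ltnW jL) kz) az.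
case ej: (ev j) => [[a b]|]; last first.
  have [_ _] := Hstep jL; rewrite ej => H.
  have -> : deg j z = deg j.+1 z.
    rewrite /deg big_ltn // Hkeep // /keep_spec ej mul0n add0n.
    apply: eq_big_nat => i hi; case ki: (keep i) => //; have iL : i < L by lia.
  have [_ an bn _] := keepP iL ki.
    by rewrite !H.
  apply: IH.
  - by rewrite hit_same.
  - by rewrite /kfree (meets_same _ _ H).
  - apply: inact_intro; rewrite ?(meets_same _ _ H) // => v vn; rewrite H // => ?.
    by apply: gb_zero => //; apply: z0.
have [_ _] := Hstep jL; rewrite ej => -[an bn xy _ H].
have [t1 t2 t3 t4 t5] := hit_merge jL ej; have [k1 k2 k3] := kfree_merge jL ej.
have [kE [kx ky]] := keepE jL ej.
set x := gm (g j) a in xy H t1 t2 t3 t4 t5 k1 k2 k3 kE kx ky *.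
set y := gm (g j) b in xy H t1 t2 t3 t4 t5 k1 k2 k3 kE kx ky *.
have keep_ab i : j < i < L -> keep i -> [/\ ea i < n, eb i < n, mk j.+1 (ea i) & mk j.+1 (eb i)].
  move=> /andP[ji iL] ki; have [_ ? ? _] := keepP iL ki.
  by have [] := @mk_keep j.+1 i _ ki => //; rewrite ji.
(* The two sides play symmetric roles: [w] is the one examined and [w'] the other. *)
have side w w' : (w = x /\ w' = y) \/ (w = y /\ w' = x) ->
    hit j w -> kfree j w -> ~~ act (g j) w -> 2 <= deg j w.
  move=> ww hw kw aw; have [wa wb w0] := inactP (kfree_nolab (ltnW jL) kw) aw.
  case kj: (keep j).
    have mw : meets (g j) (mk j.+1) w.
      by move: kE; rewrite kj => /esym/and4P[_ e1 e2 _]; case: ww => -[? ?]; subst w;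
         move: e1 e2; rewrite (negPf aw) orbF.
    case/meetsP: mw => v vn [ew mv].
    case: (@mk_src j.+1 v jL vn mv) => [mL|[i /andP[ji iL] [ki vi]]].
      by case/negP: aw; rewrite -ew; apply: Hmark; rewrite ?ew //; apply: ltnW.
    rewrite /deg big_ltn // kj mul1n.
    have h1 : 1 <= (gm (g j) (ea j) == w) + (gm (g j) (eb j) == w).
      by rewrite /ea /eb ej -/x -/y; case: ww => -[-> _]; rewrite eqxx /= ?addn1.
    have := @leq_sum_term (fun i => keep i * ((gm (g j) (ea i) == w) + (gm (g j) (eb i) == w))) j.+1 i L.
    rewrite ki mul1n ji iL => /(_ isT) h2.
    apply: (leq_add h1); apply: leq_trans h2.
    by case/orP: vi => /eqP <-; rewrite ew eqxx /= ?addn1.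
  have mw : meets (g j) (mk j.+1) w by case: ww hw => -[-> _]; rewrite ?t1 ?t2 kj orbF.
  have [mw' aw'] : ~~ meets (g j) (mk j.+1) w' /\ ~~ act (g j) w'.
    move: kE; rewrite kj; case: ww => -[e1 e2]; subst w w'; rewrite mw kw /= ?orbT ?andbT //=.
      by move/esym/negbT; rewrite negb_or => /andP[].
    by move/esym/negbT; rewrite negb_or => /andP[].
  have kw' : kfree j w' by case: ww mw' => -[_ ->].
  have [wa' wb' w0'] := inactP (kfree_nolab (ltnW jL) kw') aw'.
  have D : 2 <= deg j.+1 x.
    apply: IH.
    - by rewrite t3; case: ww mw => -[-> _] ->; rewrite ?orbT.
    - by rewrite k1; case: ww kw kw' => -[-> ->] -> ->.
    - apply: inact_intro.
      + by rewrite (meets_merge _ _ xy H) eqxx negb_or; case: ww wa wa' => -[-> ->] -> ->.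
      + by rewrite (meets_merge _ _ xy H) eqxx negb_or; case: ww wb wb' => -[-> ->] -> ->.
      + move=> v vn; rewrite H // => hv; apply: gb_zero => //.
        have : gm (g j) v = w \/ gm (g j) v = w'.
          by move: hv; case: eqP => [-> _|_ ->]; case: ww => -[-> ->]; [right|left|left|right].
        by case; [apply: w0 | apply: w0'].
  apply: leq_trans D _; rewrite /deg [X in _ <= X]big_ltn // kj mul0n add0n.
  rewrite !big_nat; apply: leq_sum => i hi; case ki: (keep i) => //; rewrite !mul1n.
  have [ain bin ma mb] := keep_ab i hi ki.
  have G v : v < n -> mk j.+1 v -> (gm (g j.+1) v == x : nat) <= (gm (g j) v == w).
    move=> vn mv; rewrite H //; have nw : gm (g j) v != w'.
      by apply: contra mw' => /eqP <-; apply: meets_self.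
    case: (eqVneq (gm (g j) v) y) => [hy|ny].
      rewrite eqxx; case: ww => -[e1 e2]; subst w w'; first by rewrite hy eqxx in nw.
      by rewrite hy eqxx.
    by case: ww => -[e1 e2]; subst w w'; rewrite ?leqnn // (negPf nw).
  by apply: leq_add; apply: G.
case: (eqVneq z x) => [zx|zx]; first by apply: (side z y) => //; left.
case: (eqVneq z y) => [zy|zy]; first by apply: (side z x) => //; right.
have zE v : v < n -> (gm (g j.+1) v == z) = (gm (g j) v == z).
  by move=> vn; rewrite H //; case: (eqVneq (gm (g j) v) y) => [->|//]; rewrite ![_ == z]eq_sym (negPf zx) (negPf zy).
have -> : deg j z = deg j.+1 z.
  rewrite /deg big_ltn // /ea /eb ej -/x -/y ![_ == z]eq_sym (negPf zx) (negPf zy) muln0 add0n.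
  apply: eq_big_nat => i hi; case ki: (keep i) => //; have [ain bin _ _] := keep_ab i hi ki.
  by rewrite !zE.
apply: IH.
- by rewrite t5.
- by rewrite k3.
- apply: inact_intro; rewrite ?(meets_merge _ _ xy H) ?(negPf zx) ?zy // => v vn /eqP.
  by rewrite zE // => /eqP ?; apply: gb_zero => //; apply: z0.
Qed.

Lemma rate_kept j i : j <= i < L -> keep i ->
  rate (g j) (ea i) (eb i) =
  \sum_(z < n) act (g j) z * ((gm (g j) (ea i) == z) + (gm (g j) (eb i) == z)).
Proof.
move=> hi ki; have iL : i < L by lia.
have [_ an bn _] := keepP iL ki.
have W : gwf (g j) by apply: gwf_run; lia.
have [h1 _] := W _ an; have [h2 _] := W _ bn.
rewrite /rate (negPf (keep_diff hi ki)).
rewrite -(sum_delta (fun x => act (g j) x) h1) -(sum_delta (fun x => act (g j) x) h2) -big_split /=.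
by apply: eq_bigr => z _; rewrite mulnDr.
Qed.

(** The degrees sum to twice the number of kept edges, and inactive marked components already take
    up two each. A growing component that meets [K] has its degree counted on the left without
    appearing on the right: contracting [K] leaves at most one edge per node other than the root. *)
Lemma degree_bound j : j <= L ->
  \sum_(j <= i < L) keep i * rate (g j) (ea i) (eb i) <=
  2 * \sum_(z < n) [&& hit j z, kfree j z & act (g j) z].
Proof.
move=> jL; have W := gwf_run jL.
have E1 : \sum_(j <= i < L) keep i * rate (g j) (ea i) (eb i) = \sum_(z < n) act (g j) z * deg j z.
  under [RHS]eq_bigr => z _ do rewrite big_distrr /=.
  rewrite exchange_big /=; apply: eq_big_nat => i hi; case ki: (keep i); last first.
    by rewrite big1 // => z _; rewrite muln0.
  by rewrite mul1n rate_kept //; apply: eq_bigr => z _; rewrite mul1n.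
have E2 : \sum_(z < n) deg j z = 2 * nkept j.
  rewrite exchange_big big_distrr /=; apply: eq_big_nat => i hi; case ki: (keep i); last first.
    by rewrite big1.
  have iL : i < L by lia.
  have [_ an bn _] := keepP iL ki; have [h1 _] := W _ an; have [h2 _] := W _ bn.
  under eq_bigr => z _ do rewrite mul1n.
  by rewrite big_split /= !sum_delta1.
have := nkept_le jL; rewrite E1 -(leq_pmul2l (isT : 0 < 2)) -E2 => h.
have E3 : \sum_(z < n) act (g j) z * deg j z + 2 * \sum_(z < n) [&& hit j z, kfree j z & ~~ act (g j) z] <= \sum_(z < n) deg j z.
  rewrite big_distrr /= -big_split /=; apply: leq_sum => z _.
  case az: (act (g j) z); rewrite /= ?mul1n ?mul0n ?andbF ?andbT ?muln0 ?addn0 ?add0n //.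
  by case: andP => // -[hz kz]; rewrite muln1; apply: deg_ge2 => //; rewrite az.
have E4 : \sum_(z < n) (hit j z && kfree j z) = \sum_(z < n) [&& hit j z, kfree j z & act (g j) z] + \sum_(z < n) [&& hit j z, kfree j z & ~~ act (g j) z].
  by rewrite -big_split /=; apply: eq_bigr => z _; case: (hit j z); case: (kfree j z); case: (act _ _).
by move: h E3; rewrite E4; lia.
Qed.

(** The potential of the analysis: it vanishes at the end of the run and equals the cost of the kept
    edges plus the missed budgets at its start. *)
Definition lhs j :=
  \sum_(j <= i < L) keep i * gc (g j) (ea i) (eb i)
  + \sum_(v < n) ~~ hit j (gm (g j) v) * gb (g j) v.

Definition npay j := \sum_(v < n) (pay (g j) v && kfree j (gm (g j) v)).
(** Growing labelled components carry one kind of label and are paid by no budget. The root run has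
    none, and in a pair run at most that of [s] is free of [K]. *)
Definition nhalf j := \sum_(x < n) [&& kfree j x, act (g j) x & meets (g j) la x || meets (g j) lb x].

(** A growing component free of [K] accounts for [2 * eps]: through the degree bound if it is
    marked, through the drop of a budget if it is unlabelled and not marked. Charging budgets at
    double speed makes the two cases equal. *)
Lemma lhs_step j : j < L -> 2 * lhs j <= lhs j.+1 + 2 * eps j * (npay j + nhalf j).
Proof.
move=> jL; have W := gwf_run (ltnW jL); have [Hc Hb He] := Hstep jL.
have E1 : 2 * (\sum_(j <= i < L) keep i * gc (g j) (ea i) (eb i)) =
   \sum_(j.+1 <= i < L) keep i * gc (g j.+1) (ea i) (eb i)
   + eps j * \sum_(j <= i < L) keep i * rate (g j) (ea i) (eb i).
  have -> : \sum_(j.+1 <= i < L) keep i * gc (g j.+1) (ea i) (eb i)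
          = \sum_(j <= i < L) keep i * gc (g j.+1) (ea i) (eb i).
    rewrite [RHS]big_ltn //; case kj: (keep j) => //.
    by move: He; have [-> _ _ _] := keepP jL kj => -[_ _ _ -> _].
  rewrite !big_distrr /= -big_split /=; apply: eq_big_nat => i hi; case ki: (keep i); last by lia.
  have iL : i < L by lia.
  by have [_ an bn _] := keepP iL ki; have := Hc _ _ an bn; lia.
have E2 : 2 * (\sum_(v < n) ~~ hit j (gm (g j) v) * gb (g j) v) =
   \sum_(v < n) ~~ hit j (gm (g j) v) * gb (g j.+1) v
   + 2 * eps j * \sum_(v < n) (pay (g j) v * ~~ hit j (gm (g j) v)).
  rewrite !big_distrr /= -big_split /=; apply: eq_bigr => v _.
  have := Hb v (ltn_ord v); case: (hit _ _); rewrite /= ?mul1n ?mul0n ?muln0 ?muln1; lia.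
(* A component that is unmarked now but becomes part of a marked one was left out by the pruning. It
   is inactive, so its budget is exhausted and nothing is lost when the next sum omits it. *)
have E3 : \sum_(v < n) ~~ hit j (gm (g j) v) * gb (g j.+1) v <=
          \sum_(v < n) ~~ hit j.+1 (gm (g j.+1) v) * gb (g j.+1) v.
  apply: leq_sum => v _; have vn := ltn_ord v.
  case h1: (hit j.+1 (gm (g j.+1) v)); last by rewrite /= mul1n; case: (hit j _); rewrite /= ?mul0n ?mul1n.
  case h0: (hit j (gm (g j) v)) => //; rewrite /= mul1n mul0n leqn0; apply/eqP.
  have kv := unhit_kfree (ltnW jL) (negbT h0).
  suff av : ~~ act (g j) (gm (g j) v).
    have [_ _ z0] := inactP (kfree_nolab (ltnW jL) kv) av.
    by apply: gb_zero => //; apply: z0.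
  case ej: (ev j) He => [[a b]|] He; last first.
    by move: h1; rewrite He // (hit_same _ jL ej) h0.
  have [t1 t2 t3 t4 t5] := hit_merge jL ej; have [kE [kx ky]] := keepE jL ej.
  have [_ _ xy _ H] := He.
  move: h1; rewrite H //; case: (eqVneq (gm (g j) v) (gm (g j) b)) => [e|ny].
    rewrite t3; move: h0 kv; rewrite e t2 => /norP[hb kj] kv; rewrite (negPf hb) orbF => ha.
    by move: kE; rewrite (negPf kj) ha (negPf hb) kv orbT /= andbT => <-.
  case: (eqVneq (gm (g j) v) (gm (g j) a)) => [e|nx]; last by rewrite t5 // h0.
  rewrite e t3; move: h0 kv; rewrite e t1 => /norP[ha kj] kv; rewrite (negPf ha) /= => hb.
  by move: kE; rewrite (negPf kj) hb (negPf ha) kv /= andbT => <-.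
have E4 : \sum_(z < n) [&& hit j z, kfree j z & act (g j) z]
   + \sum_(v < n) (pay (g j) v * ~~ hit j (gm (g j) v)) <= npay j + nhalf j.
  have -> : npay j = \sum_(v < n) pay (g j) v * kfree j (gm (g j) v).
    by apply: eq_bigr => v _; case: (pay _ _); rewrite /= ?mul1n.
  rewrite (pay_sum (fun x => kfree j x)) // (pay_sum (fun x => ~~ hit j x)) // -!big_split /=.
  apply: leq_sum => z _; rewrite /unlab.
  have := @unhit_kfree j z (ltnW jL).
  by case: (hit j z); case: (kfree j z); case: (act _ _); case: (meets _ _ _); case: (meets _ _ _) => //= /(_ isT).
have := degree_bound (ltnW jL); rewrite /lhs => E5.
rewrite mulnDr E1 E2; move: E3 E4 E5; set A := \sum_(z < n) [&& hit j z, kfree j z & act (g j) z].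
set B := \sum_(v < n) (pay _ _ * _).
set C := \sum_(j <= i < L) _ * rate _ _ _; set Q := npay j + nhalf j.
move=> E3 E4 E5.
have : eps j * C <= eps j * (2 * A) by rewrite leq_mul2l E5 orbT.
have : 2 * eps j * (A + B) <= 2 * eps j * Q by rewrite leq_mul2l E4 orbT.
lia.
Qed.

Lemma lhs_final : lhs L = 0.
Proof.
rewrite /lhs big_geq // add0n big1 // => v _; case: (boolP (hit L _)) => //= h.
have [_ _ z0] := inactP (kfree_nolab (leqnn L) (unhit_kfree (leqnn L) h)) (Hfinal (ltn_ord v)).
by rewrite z0.
Qed.

Lemma lhs_init : lhs 0 = \sum_(0 <= i < L) keep i * gc (g 0) (ea i) (eb i)
  + \sum_(v < n) ~~ mk 0 v * gb (g 0) v.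
Proof.
congr (_ + _); apply: eq_bigr => v _; congr (_ * _); congr (nat_of_bool (~~ _)).
rewrite Hinit //; apply/meetsP/idP => [[u un [<-]]|h]; first by rewrite Hinit.
by exists v => //; rewrite Hinit.
Qed.

(* A set that contains [K] and respects the components and the kept edges
   contains every marked component; dropped components can be added or removed
   freely since no kept edge touches them. *)
Lemma kept_connected j (A : pred nat) : j <= L ->
  (forall v, v < n -> K v -> A v) ->
  (forall u v, u < n -> v < n -> gm (g j) u = gm (g j) v -> A u = A v) ->
  (forall i, j <= i < L -> keep i -> A (ea i) = A (eb i)) ->
  forall v, v < n -> hit j (gm (g j) v) -> A v.
Proof.
move=> jL; have [d] : exists d, d + j = L by exists (L - j); rewrite subnK.
elim: d j A {jL} => [|d IH] j A e AK Am Ae v vn hv.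
  move: e; rewrite add0n => e; subst j; case/meetsP: hv => u un [eu mu].
  rewrite -(Am u v) //; case: (boolP (meets (g L) K (gm (g L) u))) => [/meetsP[w wn [ew Kw]]|kf].
    by rewrite -(Am w u) //; apply: AK.
  by have := Hmark (leqnn L) un mu kf; rewrite (negPf (Hfinal un)).
have jL : j < L by lia.
have ejL : d + j.+1 = L by lia.
have [_ _] := Hstep jL; case ej: (ev j) => [[a b]|] He; last first.
  apply: (IH j.+1) => //; last by rewrite He // hit_same.
    by move=> u w un wn; rewrite !He //; apply: Am.
  by move=> i /andP[h1 h2]; apply: Ae; rewrite (ltnW h1).
have [an bn xy _ H] := He.
have [t1 t2 t3 t4 t5] := hit_merge jL ej; have [kE [kx ky]] := keepE jL ej.
set x := gm (g j) a in xy H t1 t2 t3 t4 t5 kE kx ky *.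
set y := gm (g j) b in xy H t1 t2 t3 t4 t5 kE kx ky *.
have Hm u w : u < n -> w < n -> gm (g j.+1) u = gm (g j.+1) w ->
    gm (g j) u = gm (g j) w \/ (gm (g j) u \in [:: x; y]) && (gm (g j) w \in [:: x; y]).
  move=> un wn; rewrite !H // !inE; case: eqP => eu; case: eqP => ew h.
  - by left; rewrite eu ew.
  - by right; rewrite eu -h !eqxx orbT.
  - by right; rewrite ew h !eqxx orbT.
  - by left.
have hit_next u : u < n -> hit j (gm (g j) u) -> hit j.+1 (gm (g j.+1) u) || (keep j && (gm (g j) u \in [:: x; y])).
  move=> un hu; rewrite H // !inE; case: eqP => [e1|/eqP ny].
    by rewrite orbT andbT t3; move: hu; rewrite e1 t2; case: (keep j); rewrite ?orbT // orbF => ->; rewrite orbT.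
  case: (eqVneq (gm (g j) u) x) => [e1|nx] /=; last by rewrite t5 // hu.
  by rewrite andbT e1 t3; move: hu; rewrite e1 t1; case: (keep j); rewrite ?orbT // orbF => ->.
have mkab i : j < i < L -> keep i -> [/\ ea i < n, eb i < n, mk j.+1 (ea i) & mk j.+1 (eb i)].
  move=> /andP[ji iL] ki; have [_ ? ? _] := keepP iL ki.
  by have [] := @mk_keep j.+1 i _ ki => //; rewrite ji.
case kj: (keep j).
  have Aab : A a = A b by have := Ae j; rewrite /ea /eb ej leqnn jL => /(_ isT kj).
  have Axy u : u < n -> gm (g j) u \in [:: x; y] -> A u = A a.
    by move=> un; rewrite !inE => /orP[]/eqP h; [|rewrite Aab]; apply: Am.
  have A1 u w : u < n -> w < n -> gm (g j.+1) u = gm (g j.+1) w -> A u = A w.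
    move=> un wn /(Hm _ _ un wn)[h|/andP[h1 h2]]; first exact: Am.
    by rewrite !Axy.
  have A2 i : j.+1 <= i < L -> keep i -> A (ea i) = A (eb i) by move=> /andP[h1 h2]; apply: Ae; rewrite (ltnW h1).
  case/orP: (hit_next v vn hv) => [h|/andP[_ h]]; first exact: (IH j.+1 A).
  have ha : hit j.+1 (gm (g j.+1) a).
    rewrite H // -/x (negPf xy) t3; move: kE; rewrite kj => /esym/and4P[] //.
  by rewrite Axy //; apply: (IH j.+1 A).
have hv1 : hit j.+1 (gm (g j.+1) v) by case/orP: (hit_next v vn hv); rewrite ?kj.
(* [w] is a component of the merge that no later mark meets *)
have drop w w' c : (w = x /\ w' = y) \/ (w = y /\ w' = x) ->
    ~~ meets (g j) (mk j.+1) w ->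
    A v = (if gm (g j) v == w then c else A v) ->
    (forall u, u < n -> gm (g j) u = w' -> A u = c) -> A v.
  move=> ww nw -> Ac.
  have wE u : u \in [:: x; y] -> u = w \/ u = w'.
    by rewrite !inE; case: ww => -[-> ->] /orP[]/eqP ->; [left|right|right|left].
  have wnw : w != w' by case: ww => -[-> ->] //; rewrite eq_sym.
  have mkw u : u < n -> mk j.+1 u -> gm (g j) u != w.
    by move=> un mu; apply: contra nw => /eqP <-; apply: meets_self.
  apply: (IH j.+1 (fun u => if gm (g j) u == w then c else A u)) => //.
  - move=> u un Ku; rewrite (negPf (mkw u un _)); first exact: AK.
    exact: K_mk.
  - move=> u t un tn /(Hm _ _ un tn)[h|/andP[/wE h1 /wE h2]]; first by rewrite h (Am u t).
    case: h1 => h1; case: h2 => h2; rewrite h1 h2 ?eqxx //.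
    + by rewrite eq_sym (negPf wnw) (Ac t).
    + by rewrite eq_sym (negPf wnw) (Ac u).
    + by rewrite eq_sym (negPf wnw) (Ac u) // (Ac t).
  - move=> i hi ki; have [ain bin ma mb] := mkab i hi ki.
    rewrite !(negPf (mkw _ _ _)) //; case/andP: hi => h1 h2; apply: Ae => //.
    by rewrite (ltnW h1).
case hx: (meets (g j) (mk j.+1) x); case hy: (meets (g j) (mk j.+1) y).
- have : meets (g j) K x && meets (g j) K y.
    by move: kE; rewrite kj hx hy /kfree /= => /esym/negbT; rewrite negb_or !negbK.
  move=> /andP[/meetsP[u un [eu Ku]] /meetsP[t tn [et Kt]]].
  have Axy w : w < n -> gm (g j) w \in [:: x; y] -> A w.
    move=> wn; rewrite !inE => /orP[]/eqP h.
      by rewrite (Am w u) ?h //; apply: AK.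
    by rewrite (Am w t) ?h //; apply: AK.
  apply: (IH j.+1) => //.
    move=> w w' wn wn' /(Hm _ _ wn wn')[h|/andP[h1 h2]]; first exact: Am.
    by rewrite !Axy.
  by move=> i /andP[h1 h2]; apply: Ae; rewrite (ltnW h1).
- apply: (drop y x (A a)); rewrite ?hy //; first by right.
    by case: eqP => // h; move: hv; rewrite h t2 hy kj.
  by move=> u un h; apply: Am.
- apply: (drop x y (A b)); rewrite ?hx //; first by left.
    by case: eqP => // h; move: hv; rewrite h t1 hx kj.
  by move=> u un h; apply: Am.
- apply: (drop x y (A b)); rewrite ?hx //; first by left.
    by case: eqP => // h; move: hv; rewrite h t1 hx kj.
  by move=> u un h; apply: Am.
Qed.
(** When the labels agree no component is half labelled, so only paying vertices contribute, and one
    in a component free of [K] lies outside [K]. The run itself does not depend on [K], so it can be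
    pruned for a set found later. *)
Lemma root_upper j : j <= L -> (forall v, v < n -> la v = lb v) ->
  2 ^ (L - j) * lhs j + \sum_(v < n) ~~ K v * gb (g L) v <=
  2 ^ (L - j) * \sum_(v < n) ~~ K v * gb (g j) v.
Proof.
move=> jL lab; have [d] : exists d, d + j = L by exists (L - j); rewrite subnK.
elim: d j {jL} => [|d IH] j e.
  by move: e; rewrite add0n => ->; rewrite subnn !mul1n lhs_final.
have jL : j < L by lia.
have ejL : d + j.+1 = L by lia.
have {}IH := IH j.+1 ejL.
have [_ Hb _] := Hstep jL.
have -> : L - j = (L - j.+1).+1 by lia.
have E1 : 2 * \sum_(v < n) ~~ K v * gb (g j) v =
    \sum_(v < n) ~~ K v * gb (g j.+1) v + 2 * eps j * \sum_(v < n) pay (g j) v * ~~ K v.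
  rewrite !big_distrr /= -big_split /=; apply: eq_bigr => v _.
  by have := Hb v (ltn_ord v); case: (K v); rewrite /= ?mul1n ?mul0n ?muln0 ?muln1; lia.
have E2 : npay j <= \sum_(v < n) pay (g j) v * ~~ K v.
  apply: leq_sum => v _; case: (pay _ _) => //=; rewrite mul1n /kfree.
  case Kv: (K v); last by case: (meets _ _ _).
  by rewrite meets_self.
have E3 : nhalf j = 0.
  rewrite /nhalf big1 // => x _.
  have h : meets (g j) la x = meets (g j) lb x.
    by apply/idP/idP; apply: meets_sub => v vn; rewrite lab.
  by rewrite /act h orbb; case: (meets _ lb _); rewrite /= ?andbF.
have := lhs_step jL; rewrite E3 addn0 expnS; move: IH E1 E2.
set A := \sum_(v < n) ~~ K v * gb (g j) v; set A' := \sum_(v < n) ~~ K v * gb (g j.+1) v.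
set P := \sum_(v < n) pay _ _ * _; set Z := \sum_(v < n) _ * _; set X := 2 ^ _ => IH E1 E2 E3'.
have h1 : X * (2 * lhs j) <= X * (lhs j.+1 + 2 * eps j * npay j) by rewrite leq_mul2l E3' orbT.
have h2 : X * (2 * eps j * npay j) <= X * (2 * eps j * P) by rewrite !leq_mul2l E2 !orbT.
have : X * (2 * lhs j) + Z <= X * (2 * A); last by lia.
rewrite E1; move: IH h1 h2; move: (lhs j) (lhs j.+1) => l l1; rewrite !mulnDr; lia.
Qed.

(** The path crosses the components of [s] and of [t] once each, and twice any unlabelled component
    whose payer is on it; a payer off the path is covered by its own budget. Of the two labelled
    components only that of [s] is free of [K], and its [2 * eps] is matched by the two single
    crossings. *)
Lemma pair_bound s t p j : j <= L -> s < n -> t < n ->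
  (forall v, v < n -> la v = (v == s)) -> (forall v, v < n -> lb v = (v == t)) ->
  (forall v, v < n -> K v = (v == t)) ->
  all (fun v => v < n) p -> last s p = t ->
  lhs j <= path_sum (gc (g j)) s p + \sum_(v < n) ((v : nat) \notin s :: p) * gb (g j) v.
Proof.
move=> jL sn tn laE lbE KE pn lp; have [d] : exists d, d + j = L by exists (L - j); rewrite subnK.
elim: d j {jL} => [|d IH] j e; first by move: e; rewrite add0n => ->; rewrite lhs_final.
have jL : j < L by lia.
have ejL : d + j.+1 = L by lia.
have {}IH := IH j.+1 ejL.
have W := gwf_run (ltnW jL); have [_ Hb _] := Hstep jL.
pose P v := v \in s :: p.
have E1 : 2 * \sum_(v < n) ~~ P v * gb (g j) v =
    \sum_(v < n) ~~ P v * gb (g j.+1) v + 2 * eps j * \sum_(v < n) pay (g j) v * ~~ P v.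
  rewrite !big_distrr /= -big_split /=; apply: eq_bigr => v _.
  by have := Hb v (ltn_ord v); case: (P v); rewrite /= ?mul1n ?mul0n ?muln0 ?muln1; lia.
have E2 := path_sum_step (Hstep jL) sn pn.
pose C z := path_sum (fun u v => (gm (g j) u == z) != (gm (g j) v == z)) s p.
have msa z : meets (g j) la z = (gm (g j) s == z).
  apply/meetsP/eqP => [[v vn [<-]]|<-]; first by rewrite laE // => /eqP ->.
  by exists s => //; rewrite laE // eqxx.
have mtb (Q : pred nat) z : (forall v, v < n -> Q v = (v == t)) -> meets (g j) Q z = (gm (g j) t == z).
  move=> QE; apply/meetsP/eqP => [[v vn [<-]]|<-]; first by rewrite QE // => /eqP ->.
  by exists t => //; rewrite QE // eqxx.
have E3 : 2 * (npay j + nhalf j) <= path_sum (rate (g j)) s p + 2 * \sum_(v < n) pay (g j) v * ~~ P v.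
  rewrite path_sum_rate // -/(C _).
  have -> : \sum_(z < n) act (g j) z * C z = \sum_(z < n) C z * unlab (g j) z
     + \sum_(z < n) C z * (act (g j) z && (meets (g j) la z || meets (g j) lb z)).
    rewrite -big_split /=; apply: eq_bigr => z _; rewrite /unlab.
    by case: (act _ _); case: (meets _ _ _); case: (meets _ _ _); rewrite /= ?muln0 ?muln1 ?mul1n ?addn0.
  rewrite -pay_sum //.
  have F1 : npay j <= \sum_(v < n) pay (g j) v * P v + \sum_(v < n) pay (g j) v * ~~ P v.
    by rewrite -big_split /=; apply: leq_sum => v _; case: (pay _ _); case: (P v) => //=; case: (kfree _ _).
  have F2 : 2 * \sum_(v < n) pay (g j) v * P v <= \sum_(v < n) pay (g j) v * C (gm (g j) v).
    rewrite big_distrr /=; apply: leq_sum => v _; have vn := ltn_ord v.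
    case pv: (pay (g j) v) => //; rewrite !mul1n; case Pv: (P v) => //.
    have [_] := pay_act vn pv; rewrite msa (mtb _ _ lbE) => hs ht.
    rewrite muln1; apply: (@crossing2 (fun u => gm (g j) u == gm (g j) v)) => //; first by rewrite lp.
    apply/hasP; exists (v : nat) => //; move: Pv; rewrite /P inE => /orP[/eqP vs|//].
    by rewrite vs eqxx in hs.
  have F3 : 2 * nhalf j <= \sum_(z < n) C z * (act (g j) z && (meets (g j) la z || meets (g j) lb z)).
    case: (eqVneq (gm (g j) s) (gm (g j) t)) => [st|st].
      rewrite /nhalf big1 // => x _; rewrite /kfree /act msa (mtb _ _ KE) (mtb _ _ lbE) st.
      by case: (gm (g j) t == _); rewrite /= ?andbF.
    have [sn' _] := W s sn; have [tn' _] := W t tn.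
    pose G z := C z * (act (g j) z && (meets (g j) la z || meets (g j) lb z)).
    have -> : \sum_(z < n) C z * (act (g j) z && (meets (g j) la z || meets (g j) lb z)) = \sum_(z < n) G z by [].
    rewrite (sum_two G sn' tn' st).
    have hG : G (gm (g j) s) >= 1 /\ G (gm (g j) t) >= 1.
      rewrite /G /act !msa !(mtb _ _ lbE) !eqxx /= (negPf st) eq_sym (negPf st) /= !muln1.
      split; apply: crossing1; rewrite ?lp ?eqxx ?(negPf st) //.
      by rewrite [gm (g j) t == _]eq_sym (negPf st).
    suff : nhalf j <= 1 by lia.
    rewrite /nhalf -(sum_delta1 sn'); apply: leq_sum => z _.
    by rewrite /kfree (mtb _ _ KE) msa (mtb _ _ lbE); case: (gm (g j) t == z); rewrite //= orbF; case: (act _ _) => //=; case: (_ == _).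
  lia.
have E4 := lhs_step jL.
rewrite -[X in _ <= _ + X]/(\sum_(v < n) ~~ P v * gb (g j) v).
have {}IH : lhs j.+1 <= path_sum (gc (g j.+1)) s p + \sum_(v < n) ~~ P v * gb (g j.+1) v by [].
have : eps j * (2 * (npay j + nhalf j)) <= eps j * (path_sum (rate (g j)) s p + 2 * \sum_(v < n) pay (g j) v * ~~ P v) by rewrite leq_mul2l E3 orbT.
move: IH E1 E2 E4.
set A := \sum_(v < n) ~~ P v * gb (g j) v; set A' := \sum_(v < n) ~~ P v * gb (g j.+1) v.
set B := \sum_(v < n) pay _ _ * _; move: (lhs j) (lhs j.+1) => l l1; rewrite !mulnDr; lia.
Qed.
End Prune.
End Moats.

(** * Growing rooted trees and turning them into paths *)

Section Growth.
Variables (n : nat) (c : nat -> nat -> nat) (base : pred nat).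
Variables (L : nat) (keep : pred nat) (ea eb : nat -> nat).
Hypothesis c_sym : forall u v, u < n -> v < n -> c u v = c v u.
Hypothesis e_lt : forall i, i < L -> keep i -> ea i < n /\ eb i < n.

(* [P] maps every grown vertex outside the base to its parent. *)
Definition grown (G : pred nat) (P : nat -> nat) : Prop :=
  [/\ forall v, v < n -> base v -> G v,
      exists2 r : nat -> nat, (forall v, base v -> r v = 0) &
        forall v, v < n -> G v -> ~~ base v ->
        [/\ P v < n, G (P v), r (P v) < r v & r v <= \sum_(u < n) (G u && ~~ base u)] &
      \sum_(v < n) (G v && ~~ base v) * c v (P v) <=
      \sum_(0 <= i < L) [&& keep i, G (ea i) & G (eb i)] * c (ea i) (eb i)].

Definition edges_closed (G : pred nat) : Prop :=
  forall i, i < L -> keep i -> G (ea i) = G (eb i).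

Definition ncount (G : pred nat) := \sum_(u < n) G u.

Lemma ncount_le G : ncount G <= n.
Proof.
rewrite /ncount -[X in _ <= X](card_ord n) -sum1_card; apply: leq_sum => u _.
exact: leq_b1.
Qed.

Lemma grown_init G P : (forall v, v < n -> G v = base v) -> grown G P.
Proof.
move=> H; split; first by move=> v vn; rewrite H.
  by exists (fun=> 0) => // v vn; rewrite H // => ->.
by rewrite big1 // => v _; rewrite H // andbN.
Qed.

Lemma grown_add G P G' P' i u v : grown G P -> i < L -> keep i ->
  (u = ea i /\ v = eb i) \/ (u = eb i /\ v = ea i) -> u < n -> v < n ->
  G u -> ~~ G v -> (forall w, w < n -> G' w = G w || (w == v)) ->
  (forall w, w < n -> P' w = if w == v then u else P w) ->
  [/\ grown G' P', ncount G' = (ncount G).+1 & forall w, w < n -> G w -> G' w].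
Proof.
move=> [h1 [r h0 h2] h3] iL ki uv un vn Gu Gv HG HP.
have GG w : w < n -> G w -> G' w by move=> wn h; rewrite HG // h.
have bv : ~~ base v by apply: contra Gv => /h1; apply.
have split_sum (F : nat -> nat) :
    \sum_(w < n) F w = F v + \sum_(w < n | (w : nat) != v) F w.
  by rewrite (bigD1 (Ordinal vn)) //=; congr (_ + _); apply: eq_bigl => w; rewrite -val_eqE.
have cnt (Q : pred nat) : Q v -> \sum_(w < n) (G' w && Q w) = (\sum_(w < n) (G w && Q w)).+1.
  move=> Qv; rewrite (split_sum (fun w => G' w && Q w)) (split_sum (fun w => G w && Q w)).
  rewrite HG // eqxx orbT Qv (negPf Gv) /= add1n add0n; congr S; apply: eq_bigr => w wv.
  by rewrite HG // (negPf wv) orbF.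
split=> //; last first.
  by rewrite /ncount; have := cnt predT isT; under eq_bigr => w _ do rewrite andbT;
     under [X in _ = X.+1 -> _]eq_bigr => w _ do rewrite andbT.
split; first by move=> w wn bw; apply: GG => //; apply: h1.
  (* The new vertex is ranked by its time of entry, which exceeds all earlier ranks and keeps the
     ranks bounded by the number of grown vertices. *)
  exists (fun w => if w == v then (\sum_(w < n) (G w && ~~ base w)).+1 else r w).
    move=> w bw; rewrite ifN ?h0 //; by apply: contraNneq bv => <-.
  have cb := cnt (fun w => ~~ base w) bv.
  move=> w wn; rewrite HG // HP //; case: (eqVneq w v) => [-> _ _|wv].
    have uv' : u != v by apply: contraNneq Gv => <-.
    split=> //; [exact: GG | | by rewrite cb].
    rewrite (negPf uv') ltnS; case: (boolP (base u)) => bu; first by rewrite h0.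
    by have [] := h2 u un Gu bu.
  rewrite orbF => Gw bw; have [q1 q2 q3 q4] := h2 w wn Gw bw.
  have Pv : P w != v by apply: contraNneq Gv => <-.
  by split; rewrite ?(negPf Pv) //; [apply: GG | rewrite cb; apply: leqW].
rewrite (split_sum (fun w => (G' w && ~~ base w) * c w (P' w))).
rewrite (split_sum (fun w => (G w && ~~ base w) * c w (P w))) (negPf Gv) mul0n add0n in h3.
rewrite HG // HP // eqxx orbT bv /= mul1n.
have -> : \sum_(w < n | (w : nat) != v) (G' w && ~~ base w) * c w (P' w) =
          \sum_(w < n | (w : nat) != v) (G w && ~~ base w) * c w (P w).
  by apply: eq_bigr => w wv; rewrite HG // HP // (negPf wv) orbF.
have cuv : c v u = c (ea i) (eb i) by case: uv => -[<- <-]; rewrite // c_sym.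
have [eain ebin] : ea i < n /\ eb i < n by case: uv => -[<- <-].
apply: leq_trans (leq_add (leqnn _) h3) _; rewrite addnC.
have hi : c v u <= \sum_(0 <= l < L) (l == i) * c (ea l) (eb l).
  have := @leq_sum_term (fun l => (l == i) * c (ea l) (eb l)) 0 i L.
  by rewrite iL eqxx mul1n cuv; apply.
apply: leq_trans (leq_add (leqnn _) hi) _; rewrite -big_split /= !big_nat.
apply: leq_sum => l lL; case: (eqVneq l i) => [->|_]; last first.
  rewrite mul0n addn0 leq_mul2r; apply/orP; right.
  case kl: (keep l) => //=; case Ga: (G (ea l)) => //; case Gb: (G (eb l)) => //=.
  by have [al bl] := e_lt lL kl; rewrite !GG.
rewrite mul1n ki /= (_ : G (ea i) && G (eb i) = false); last first.
  by case: uv => -[<- <-]; rewrite (negPf Gv) ?andbF.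
by rewrite !HG // ; case: uv => -[<- <-]; rewrite Gu eqxx ?orbT mul1n.
Qed.
End Growth.

Definition seq_cost (c : nat -> nat -> nat) (q : seq nat) : nat :=
  if q is x :: p then path_sum c x p else 0.

Definition insert_at (k v : nat) (q : seq nat) : seq nat := take k q ++ v :: drop k q.

Lemma mem_insert_at k v q w : (w \in insert_at k v q) = (w == v) || (w \in q).
Proof. by rewrite mem_cat inE orbCA -mem_cat cat_take_drop. Qed.

Lemma uniq_insert_at k v q : uniq q -> v \notin q -> uniq (insert_at k v q).
Proof.
by move=> uq vq; rewrite -(perm_uniq (_ : perm_eq (v :: q) _)) /= ?vq // /insert_at
  -[in X in perm_eq (_ :: X)](cat_take_drop k q) -cat_rcons -cats1 -catA -cat1s
  perm_catCA.
Qed.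

Lemma path_sum_cat c x p1 p2 :
  path_sum c x (p1 ++ p2) = path_sum c x p1 + path_sum c (last x p1) p2.
Proof. by elim: p1 x => //= y p1 IH x; rewrite IH addnA. Qed.

(** * From a rooted tree to a path *)

Section TreePath.
Variables (n : nat) (c : nat -> nat -> nat).
Hypothesis c_sym : forall u v, u < n -> v < n -> c u v = c v u.
Hypothesis c_tri : forall u v w, u < n -> v < n -> w < n -> c u w <= c u v + c v w.
Hypothesis c_diag : forall u, u < n -> c u u = 0.

Lemma path_sum_ge x p : x < n -> all (fun v => v < n) p -> c x (last x p) <= path_sum c x p.
Proof.
elim: p x => [|y p IH] x xn /=; first by rewrite c_diag.
move=> /andP[yn pn]; have ln : last y p < n.
  by have := mem_last y p; rewrite inE => /orP[/eqP -> //|]; apply: (allP pn).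
by have := IH y yn pn; have := c_tri xn yn ln; lia.
Qed.

(** The neighbour across the gap is reached from [v] through [u], so the detour costs at most
    [c v u] twice. *)
Lemma insert_cost q k u v : all (fun v => v < n) q -> v < n -> 0 < k < size q ->
  nth 0 q k.-1 = u \/ nth 0 q k = u ->
  seq_cost c (insert_at k v q) <= seq_cost c q + 2 * c v u.
Proof.
move=> qn vn /andP[k0 kq] hu.
have km : k.-1 < size q by lia.
pose x := nth 0 q k.-1; pose y := nth 0 q k.
have xn : x < n by apply: (allP qn); apply: mem_nth.
have yn : y < n by apply: (allP qn); apply: mem_nth.
have dq : drop k q = y :: drop k.+1 q by rewrite (drop_nth 0).
have tq : take k q = rcons (take k.-1 q) x by rewrite -take_nth // prednK.
have E1 : seq_cost c q = seq_cost c (take k q) + c x y + path_sum c y (drop k.+1 q).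
  rewrite -{1}(cat_take_drop k q) dq; case et: (take k q) tq => [|z p] tq.
    by move: tq => /esym; case: (take k.-1 q).
  rewrite /= path_sum_cat /= addnA; congr (_ + c _ _ + _).
  by rewrite -(last_rcons z (take k.-1 q) x) -tq.
have E2 : seq_cost c (insert_at k v q) = seq_cost c (take k q) + (c x v + (c v y + path_sum c y (drop k.+1 q))).
  rewrite /insert_at dq; case et: (take k q) tq => [|z p] tq.
    by move: tq => /esym; case: (take k.-1 q).
  rewrite /= path_sum_cat /=; congr (_ + (c _ _ + _)).
  by rewrite -(last_rcons z (take k.-1 q) x) -tq.
rewrite E1 E2; case: hu => hu; rewrite -hu -/x -/y.
  by have := c_tri vn xn yn; rewrite (c_sym vn xn); lia.
by have := c_tri xn yn vn; rewrite (c_sym yn vn); lia.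
Qed.

Variables (T : pred nat) (P : nat -> nat) (s t R : nat) (r : nat -> nat).

Definition rooted_tree : Prop := [/\ t < n, T t &
  forall v, v < n -> T v -> v != t ->
    [/\ P v < n, T (P v), r (P v) < r v & r v <= R]].

Hypothesis HT : rooted_tree.
Hypothesis sn : s < n.
Hypothesis Ts : T s.
Hypothesis st : s != t.

Definition tree_sum (q : seq nat) := \sum_(v < n) (((v : nat) \in q) && (v != t :> nat)) * c v (P v).

Lemma tree_sum_add q q' x : x < n -> x \notin q -> (forall v, (v \in q') = (v == x) || (v \in q)) ->
  tree_sum q' = tree_sum q + (x != t) * c x (P x).
Proof.
move=> xn xq H; rewrite /tree_sum (bigD1 (Ordinal xn)) //= [X in _ = X + _](bigD1 (Ordinal xn)) //=.
rewrite H eqxx (negPf xq) /= add0n addnC; congr (_ + _).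
by apply: eq_bigr => v; rewrite -val_eqE /= => vx; rewrite H (negPf vx).
Qed.

(** A walk from [s] towards the root along parents. Its last vertex has the least rank, so the next
    vertex is new; the edge to that vertex is already counted in [tree_sum]. As the rank drops in
    every step, [R.+1] steps must reach [t]. *)
Definition good_chain (j : nat) (q : seq nat) : Prop :=
  [/\ ohead q = Some s, uniq q, all (fun v => (v < n) && T v) q &
      if last s q == t then seq_cost c q = tree_sum q
      else [/\ t \notin q, forall v, v \in q -> r (last s q) <= r v,
               seq_cost c q + c (last s q) (P (last s q)) = tree_sum q & r (last s q) + j <= R]].

Lemma good_chain_init : good_chain 0 [:: s].
Proof.
split=> //=; first by rewrite sn Ts.
rewrite (negPf st); have [_ _ H] := HT; have [h1 h2 h3 h4] := H s sn Ts st.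
split; rewrite ?inE ?[t == s]eq_sym ?(negPf st) ?addn0 //; first by move=> v; rewrite inE => /eqP ->.
have := @tree_sum_add [::] [:: s] s sn; rewrite st mul1n => -> //.
by rewrite /tree_sum big1.
Qed.

Lemma good_chain_stop j q : good_chain j q -> last s q = t -> good_chain j.+1 q.
Proof. by move=> [h1 h2 h3 h5] e; split=> //; move: h5; rewrite e eqxx. Qed.

Lemma uniq_bound (q : seq nat) : uniq q -> all (fun v => v < n) q -> size q <= n.
Proof.
move=> uq qn; rewrite -[n](size_iota 0); apply: uniq_leq_size => // v vq.
by rewrite mem_iota /=; apply: (allP qn).
Qed.

Lemma good_chain_next j q : good_chain j q -> last s q != t ->
  good_chain j.+1 (rcons q (P (last s q))).
Proof.
move=> [h1 h2 h3]; case: eqP => // _ [tq rq e1 e2] _.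
have [_ _ H] := HT; case: q h1 h2 h3 tq rq e1 e2 => [//|s' p] /= [->] {s'}.
set l := last s p => h2 h3 tq rq e1 e2.
have lq : l \in s :: p by apply: mem_last.
have /andP[ln Tl] : (l < n) && T l by apply: (@allP _ _ (s :: p) h3).
have lt : l != t by apply: contraNneq tq => <-.
have [q1 q2 q3 q4] := H l ln Tl lt; set x := P l in q1 q2 q3 *.
have xq : x \notin s :: p.
  by apply/negP => /rq; rewrite leqNgt q3.
have hs : tree_sum (s :: rcons p x) = tree_sum (s :: p) + (x != t) * c x (P x).
  by apply: tree_sum_add => // v; rewrite !inE mem_rcons inE orbCA.
have uq : uniq (s :: rcons p x).
  by rewrite -rcons_cons rcons_uniq xq.
have aq : all (fun v => (v < n) && T v) (s :: rcons p x).
  by rewrite /= all_rcons q1 q2 /=; move: h3.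
have pq : path_sum c s (rcons p x) = path_sum c s p + c l x.
  by rewrite -cats1 path_sum_cat /= addn0.
split=> //=.
rewrite last_rcons; case: (eqVneq x t) => [xt|xt].
  rewrite pq hs -e1; have -> : (x != t) = false by rewrite xt eqxx.
  by rewrite mul0n addn0.
split; rewrite ?hs ?pq ?xt ?mul1n.
  + by rewrite inE mem_rcons inE orbCA -in_cons negb_or eq_sym xt.
  + move=> v; rewrite inE mem_rcons inE orbCA -in_cons => /orP[/eqP -> //|/rq].
    by apply: leq_trans; apply: ltnW.
  + by rewrite -e1 ?mul1n.
  + by rewrite addnS -addSn; apply: leq_trans (leq_add q3 (leqnn j)) e2.
Qed.

(** The inequality survives insertions: a new vertex adds at most twice its parent edge on the left
    and exactly that on the right. *)
Definition good_path (q : seq nat) : Prop :=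
  [/\ ohead q = Some s, last s q = t, uniq q, all (fun v => (v < n) && T v) q &
      seq_cost c q + c s t <= 2 * tree_sum q].

(** The chain uses its tree edges once and costs at least [c s t]; here the saving of the direct
    edge arises. *)
Lemma good_chain_path q : good_chain R.+1 q -> good_path q.
Proof.
move=> [h1 h2 h3]; case: eqP => [e h5|_ [_ _ _ h]]; last by move: h; lia.
split=> //; rewrite -h5; case: q h1 e h3 {h2 h5} => [//|s' p] /= [->] e /andP[_ h3].
have pn : all (fun v => v < n) p by apply: sub_all h3 => v /andP[].
by have := path_sum_ge sn pn; rewrite e; lia.
Qed.

(** The vertex goes right after its parent, except when the parent is the last vertex: then it goes
    before, so that the path still ends in [t]. *)
Lemma good_path_insert q v k : good_path q -> v < n -> T v -> v != t -> v \notin q ->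
  P v \in q ->
  k = (if index (P v) q == (size q).-1 then index (P v) q else (index (P v) q).+1) ->
  good_path (insert_at k v q).
Proof.
move=> [h1 h2 h3 h4 h5] vn Tv vt vq Pq ->; have iq := Pq; rewrite -index_mem in iq.
have qn : all (fun v => v < n) q by apply: sub_all h4 => w /andP[].
have sq : 1 < size q.
  case: (q) h1 h2 => [|s' [|z p]] //= [->] e; by case/eqP: st.
set i := index _ _ in iq *; set k' := if _ then _ else _.
have k'q : 0 < k' < size q.
  rewrite /k'; case: ifP => [/eqP ->|/negbT h].
    by case: (size q) sq => [|[|m]] //= _; rewrite ltnSn.
  by rewrite /= ltn_neqAle iq andbT; apply: contraNneq h => <-.
have hk : nth 0 q k'.-1 = P v \/ nth 0 q k' = P v.
  rewrite /k'; case: eqP => h; [right|left]; exact: nth_index.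
have C := insert_cost qn vn k'q hk.
case/andP: k'q => k'0 k'q.
split.
- by case: (q) h1 k'0 => [//|s' p] /= [->]; case: (k').
- have dk : drop k' q != [::] by rewrite -size_eq0 size_drop -lt0n subn_gt0.
  rewrite -h2 /insert_at last_cat /= -{2}(cat_take_drop k' q) last_cat.
  by case: (drop k' q) dk.
- exact: uniq_insert_at.
- by apply/allP => w; rewrite mem_insert_at => /orP[/eqP ->|/(allP h4)//]; rewrite vn Tv.
- rewrite (@tree_sum_add q _ v vn vq); last by move=> w; rewrite mem_insert_at.
  by rewrite vt mul1n; lia.
Qed.

Lemma good_path_all q : good_path q -> (forall v, v < n -> T v -> v \in q) ->
  seq_cost c q + c s t <= 2 * \sum_(v < n) (T v && (v != t :> nat)) * c v (P v).
Proof.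
move=> [_ _ _ h4 h5] H; apply: leq_trans h5 _; rewrite leq_mul2l /=.
apply: leq_sum => v _; rewrite leq_mul2r; apply/orP; right.
case vq: ((v : nat) \in q) => //=.
by have /andP[_ ->] := allP h4 _ vq.
Qed.
End TreePath.

(** * Four rounds of tree selection and their rounding *)

Section Rounds.
Variables (n k X : nat) (chi : nat -> nat).
Variables (T : nat -> nat -> pred nat) (cT : nat -> nat -> nat).

(** Trees are found round by round and, within a round, pair by pair: tree [t'] of pair [j] precedes
    step [(t, i)]. *)
Definition done (t i t' j : nat) : bool := (t' < t) || ((t' == t) && (j < i)).

(** Four times the probability that a uniformly chosen tree of pair [j] misses [v], where trees not
    found yet count as empty. *)
Definition avail (t i j v : nat) : nat := \sum_(t' < 4) ~~ (done t i t' j && T t' j v).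

Definition others (t i v : nat) : nat := \prod_(j < k | (j : nat) != i) avail t i j v.

(** [4 ^ k] times the probability that independent choices for all pairs leave [v] uncovered; [upot]
    is the expected uncovered charge on the same scale. *)
Definition uncov (t i v : nat) : nat := \prod_(j < k) avail t i j v.

Definition upot (t i : nat) : nat := \sum_(v < n) chi v * uncov t i v.

(** The identity [5 * gam t = 4 * gam t.+1] makes the rounds telescope. The extremes [4 ^ 4] and
    [5 ^ 4] are the 256 and 625 of the ratio. *)
Definition gam (t : nat) : nat := 4 ^ (4 - t) * 5 ^ t.

Lemma avail_le t i j v : avail t i j v <= 4.
Proof.
apply: (@leq_trans (\sum_(t' < 4) 1)); last by rewrite sum_nat_const card_ord.
by apply: leq_sum => t' _; apply: leq_b1.
Qed.

Lemma avail_step t i j v : t < 4 -> j != i -> avail t i.+1 j v = avail t i j v.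
Proof.
move=> t4 ji; apply: eq_bigr => t' _; rewrite /done; congr (nat_of_bool (~~ ((_ || (_ && _)) && _))).
by rewrite ltnS [j <= i]leq_eqVlt (negPf ji).
Qed.

Lemma avail_step_eq t i v : t < 4 -> avail t i i v = avail t i.+1 i v + T t i v.
Proof.
move=> t4; rewrite /avail (bigD1 (Ordinal t4)) //= [X in _ = X + _](bigD1 (Ordinal t4)) //=.
rewrite /done ltnn eqxx ltnn ltnS leqnn /= addnAC; congr (_ + _); first by case: (T t i v).
by apply: eq_bigr => t' h; rewrite -val_eqE /= in h; rewrite (negPf h).
Qed.

Lemma uncov_split t i i' v : i < k -> t < 4 -> i' = i \/ i' = i.+1 ->
  uncov t i' v = avail t i' i v * others t i v.
Proof.
move=> ik t4 ii; rewrite /uncov (bigD1 (Ordinal ik)) //=; congr (_ * _).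
apply: eq_big => [j|j h]; first by rewrite -val_eqE.
by case: ii => -> //; rewrite avail_step.
Qed.

Lemma uncov_step t i v : i < k -> t < 4 ->
  uncov t i v = uncov t i.+1 v + T t i v * others t i v.
Proof.
move=> ik t4; rewrite (@uncov_split t i i) ?(@uncov_split t i i.+1) //; [|by right|by left].
by rewrite -mulnDl -avail_step_eq.
Qed.

Lemma uncov_others t i v : i < k -> t < 4 -> uncov t i v <= 4 * others t i v.
Proof.
by move=> ik t4; rewrite (@uncov_split t i i) //; [rewrite leq_mul2r avail_le orbT | left].
Qed.

Lemma uncov_mono t i i' v : t < 4 -> i <= i' <= k -> uncov t i' v <= uncov t i v.
Proof.
move=> t4 /andP[ii]; elim: i' ii => [|i' IH]; first by rewrite leqn0 => /eqP ->.
rewrite leq_eqVlt => /orP[/eqP -> //|ii ik].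
by apply: leq_trans (IH ii (ltnW ik)); rewrite [X in _ <= X]uncov_step // leq_addr.
Qed.

Lemma uncov_next t v : uncov t k v = uncov t.+1 0 v.
Proof.
apply: eq_bigr => j _; apply: eq_bigr => t' _; rewrite /done ltn_ord andbT ltn0 andbF orbF.
by rewrite ltnS (leq_eqVlt t' t) orbC.
Qed.

Lemma uncov_start v : uncov 0 0 v = 4 ^ k.
Proof.
rewrite /uncov -[X in _ ^ X]card_ord -prod_nat_const; apply: eq_bigr => j _.
by rewrite /avail (eq_bigr (fun=> 1)) ?sum_nat_const ?card_ord // => t' _; rewrite /done ltn0 andbF.
Qed.

Lemma uncov_le t v : t <= 4 -> uncov t 0 v <= 4 ^ k.
Proof.
elim: t => [|t IH] t4; first by rewrite uncov_start.
by rewrite -uncov_next; apply: leq_trans (IH (ltnW t4)); apply: uncov_mono => //=.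
Qed.

Variables (cP : nat -> nat) (inP : nat -> pred nat) (O : pred nat).
Hypothesis O_def : forall v, v < n -> O v = has (fun i => inP i v) (iota 0 k).
(** The tree does at least as well as the path when a missed charge is discounted by
    [(4/5) ^ (4 - t)] and by the probability that no other pair covers it. The factors 625 and
    [4 ^ k.-1] clear these denominators; 2 is for doubling the tree and [X] is the scale of the
    charges. *)
Hypothesis oracle : forall t i, t < 4 -> i < k ->
  (2 * 625) * 4 ^ k.-1 * X * cT t i + \sum_(v < n) ~~ T t i v * (gam t * chi v * others t i v) <=
  (2 * 625) * 4 ^ k.-1 * X * cP i + \sum_(v < n) ~~ inP i v * (gam t * chi v * others t i v).

Lemma oracle_step t i : t < 4 -> i < k ->
  (2 * 625) * 4 ^ k.-1 * X * cT t i + gam t * upot t i.+1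
  + gam t * \sum_(v < n) inP i v * (chi v * others t i v) <=
  (2 * 625) * 4 ^ k.-1 * X * cP i + gam t * upot t i.
Proof.
move=> t4 ik; have := oracle t4 ik.
have E1 : upot t i = upot t i.+1 + \sum_(v < n) T t i v * (chi v * others t i v).
  by rewrite -big_split /=; apply: eq_bigr => v _; rewrite uncov_step // mulnDr; lia.
have E2 (Q : pred nat) : \sum_(v < n) ~~ Q v * (gam t * chi v * others t i v)
    + gam t * \sum_(v < n) Q v * (chi v * others t i v) = gam t * \sum_(v < n) chi v * others t i v.
  rewrite !big_distrr /= -big_split /=; apply: eq_bigr => v _.
  by case: (Q v); rewrite /= ?mul0n ?mul1n ?muln0 ?addn0 ?add0n ?mulnA.
have := E2 (T t i); have := E2 (inP i); rewrite E1 mulnDr.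
move: (\sum_(v < n) ~~ T t i v * _) (\sum_(v < n) ~~ inP i v * _).
move: (gam t * \sum_(v < n) T t i v * _) (gam t * \sum_(v < n) inP i v * _).
move: (gam t * upot _ _) (gam t * \sum_(v < n) _) => *; lia.
Qed.

Definition chiM := \sum_(v < n) ~~ O v * chi v.

(** At most four trees of pair [i] miss [v], so [others] is at least a quarter of [uncov]. Covering
    the vertices of the compared paths would thus gain a quarter of the potential left on them after
    the round, whence 5 on the left against 4 on the right; the other vertices enter through
    [chiM]. *)
Lemma round_bound t : t < 4 ->
  (2 * 625) * 4 ^ k * X * (\sum_(i < k) cT t i) + 5 * gam t * upot t.+1 0 <=
  (2 * 625) * 4 ^ k * X * (\sum_(i < k) cP i) + 4 * gam t * upot t 0 + gam t * (4 ^ k * chiM).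
Proof.
move=> t4.
have kk i : i < k -> 4 ^ k = 4 * 4 ^ k.-1 by case: (k) => // k' _; rewrite expnS.
have H m : m <= k ->
    (2 * 625) * 4 ^ k * X * (\sum_(i < m) cT t i) + 4 * gam t * upot t m
    + 4 * gam t * \sum_(i < m) \sum_(v < n) inP i v * (chi v * others t i v) <=
    (2 * 625) * 4 ^ k * X * (\sum_(i < m) cP i) + 4 * gam t * upot t 0.
  elim: m => [|m IH] mk; first by rewrite !big_ord0; lia.
  have := IH (ltnW mk); have := oracle_step t4 mk; rewrite !big_ord_recr /= (kk m mk) !mulnDr.
  move: (\sum_(i < m) _) (\sum_(i < m) _) (\sum_(i < m) _) (\sum_(v < n) _).
  by move: (upot t m) (upot t m.+1) (upot t 0) (gam t) (4 ^ k.-1) => *; lia.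
have := H k (leqnn k).
have E1 : upot t k = upot t.+1 0 by apply: eq_bigr => v _; rewrite uncov_next.
have E2 : upot t.+1 0 <= 4 * (\sum_(i < k) \sum_(v < n) inP i v * (chi v * others t i v)) + 4 ^ k * chiM.
  rewrite exchange_big /chiM !big_distrr /= -big_split /=; apply: leq_sum => v _.
  case Ov: (O v); last first.
    rewrite mul1n mulnC; apply: leq_trans (leq_addl _ _); rewrite leq_mul2r uncov_le ?orbT //.
  move: Ov; rewrite O_def // => /hasP[i]; rewrite mem_iota /= add0n => ik iv.
  rewrite mul0n muln0 addn0 (bigD1 (Ordinal ik)) //= iv mul1n mulnDr.
  apply: leq_trans (leq_addr _ _); rewrite mulnCA leq_mul2l; apply/orP; right.
  rewrite -uncov_next; apply: leq_trans (uncov_others v ik t4).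
  by apply: uncov_mono => //; rewrite (ltnW ik) leqnn.
have : gam t * upot t.+1 0 <= gam t * (4 * (\sum_(i < k) \sum_(v < n) inP i v * (chi v * others t i v)) + 4 ^ k * chiM).
  by rewrite leq_mul2l E2 orbT.
rewrite E1 mulnDr; move: (\sum_(i < k) \sum_(v < n) inP i v * (chi v * others t i v)).
move: (\sum_(i < k) _) (\sum_(i < k) _) (4 ^ k * chiM).
move: (upot _ _) (upot _ _) (gam t) (4 ^ k) => *; lia.
Qed.

(** After telescoping, the missed charge has been collected with the weights
    [256 + 320 + 400 + 500 = 4 * 369]. *)
Lemma rounds_bound :
  (2 * 625) * 4 ^ k * X * (\sum_(t < 4) \sum_(i < k) cT t i) + (4 * 625) * upot 4 0 <=
  (8 * 625) * 4 ^ k * X * (\sum_(i < k) cP i) + (4 * 256) * (4 ^ k * \sum_(v < n) chi v)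
  + (4 * 369) * (4 ^ k * chiM).
Proof.
have U0 : upot 0 0 = 4 ^ k * \sum_(v < n) chi v.
  by rewrite /upot big_distrr /=; apply: eq_bigr => v _; rewrite uncov_start mulnC.
rewrite -U0 !big_ord_recr big_ord0 /= add0n.
have := round_bound (isT : 0 < 4); have := round_bound (isT : 1 < 4).
have := round_bound (isT : 2 < 4); have := round_bound (isT : 3 < 4).
rewrite (_ : gam 0 = 256) // (_ : gam 1 = 320) // (_ : gam 2 = 400) // (_ : gam 3 = 500) //.
have e8 a b p : 8 * 625 * a * b * p = 4 * (2 * 625 * a * b * p) by rewrite -[8]/(4 * 2) -!mulnA.
rewrite e8; move: (4 ^ k * chiM) (2 * 625 * 4 ^ k * X) => M Q; rewrite !(mulnDr Q).
move: (Q * \sum_(i < k) cP i) (Q * \sum_(i < k) cT 0 i) (Q * \sum_(i < k) cT 1 i).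
move: (Q * \sum_(i < k) cT 2 i) (Q * \sum_(i < k) cT 3 i).
move: (upot 0 0) (upot 1 0) (upot 2 0) (upot 3 0) (upot 4 0).
clear; move=> *; lia.
Qed.

(* Conditional expectations: [sel i] minimizes over the four trees of pair [i]. *)
Variable sel : nat -> nat.

Definition covered (i v : nat) : bool := has (fun j => T (sel j) j v) (iota 0 i).

Definition rest (i v : nat) : nat := \prod_(j < k | i <= j) avail 4 0 j v.

(** [4 ^ (k - i.+1)] times the conditional expectation of doubled cost plus uncovered charge when
    pair [i] takes tree [t], up to the costs of the other pairs, which do not depend on [t]. *)
Definition sel_value (i t : nat) : nat :=
  2 * X * 4 ^ (k - i.+1) * cT t i
  + \sum_(v < n) (~~ covered i v && ~~ T t i v) * (chi v * rest i.+1 v).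

Hypothesis sel_lt : forall i, i < k -> sel i < 4.
Hypothesis sel_min : forall i t, i < k -> t < 4 -> sel_value i (sel i) <= sel_value i t.

(** [2 * 4 ^ (k - i)] times the conditional expectation after [i] selections; the extra 2 turns the
    mean of the four values [2 * X * cT t j] into an integral sum. *)
Definition rpot (i : nat) : nat :=
  4 ^ (k - i) * (4 * X * (\sum_(j < i) cT (sel j) j) + X * (\sum_(j < k | i <= j) \sum_(t < 4) cT t j))
  + 2 * \sum_(v < n) ~~ covered i v * (chi v * rest i v).

(** The least of the four conditional expectations is at most their mean. *)
Lemma rpot_step i : i < k -> 4 * rpot i.+1 <= rpot i.
Proof.
move=> ik.
have split_ge (R : Type) (idx : R) (op : Monoid.com_law idx) (F : nat -> R) :
    \big[op/idx]_(j < k | i <= j) F j = op (F i) (\big[op/idx]_(j < k | i.+1 <= j) F j).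
  rewrite (bigD1 (Ordinal ik)) //=; congr (op _ _); apply: eq_bigl => j.
  by rewrite -val_eqE /= [i < j]ltn_neqAle eq_sym andbC.
have E1 : \sum_(t < 4) sel_value i t = 2 * X * 4 ^ (k - i.+1) * (\sum_(t < 4) cT t i)
    + \sum_(v < n) ~~ covered i v * (chi v * rest i v).
  rewrite big_split /= -big_distrr /=; congr (_ + _); rewrite exchange_big /=; apply: eq_bigr => v _.
  rewrite /rest (@split_ge nat 1 muln (fun j => avail 4 0 j v)) /= [avail 4 0 i v]/avail.
  rewrite -/(rest i.+1 v) big_distrl /= !big_distrr /=; apply: eq_bigr => t _.
  rewrite /done ltn_ord /=; case: (covered i v); case: (T t i v); rewrite /= ?mul0n ?mul1n ?muln0 //.
have E2 : 4 * sel_value i (sel i) <= \sum_(t < 4) sel_value i t.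
  by rewrite -[4 in X in X <= _]card_ord -sum_nat_const; apply: leq_sum => t _; apply: sel_min.
have E3 : rpot i.+1 = 4 ^ (k - i.+1) * (4 * X * (\sum_(j < i) cT (sel j) j)
     + X * (\sum_(j < k | i.+1 <= j) \sum_(t < 4) cT t j)) + 2 * sel_value i (sel i).
  rewrite /rpot /sel_value big_ord_recr /=.
  have -> : \sum_(v < n) ~~ covered i.+1 v * (chi v * rest i.+1 v) =
            \sum_(v < n) (~~ covered i v && ~~ T (sel i) i v) * (chi v * rest i.+1 v).
    apply: eq_bigr => v _; congr (nat_of_bool _ * _).
    by rewrite /covered -addn1 iotaD has_cat /= orbF negb_or.
  rewrite !mulnDr; move: (\sum_(v < n) _) (4 ^ _) (\sum_(j < i) _) (\sum_(j < k | _) _) => *; lia.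
have kE : 4 ^ (k - i) = 4 * 4 ^ (k - i.+1) by rewrite -expnS; congr (4 ^ _); lia.
rewrite E3 /rpot (@split_ge nat 0 addn (fun j => \sum_(t < 4) cT t j)) /= kE.
move: E1 E2; move: (\sum_(v < n) _) (\sum_(t < 4) sel_value _ _) (\sum_(t < 4) cT _ _) (4 ^ _).
move: (\sum_(j < i) _) (\sum_(j < k | _) _) (sel_value i (sel i)) => *; rewrite !mulnDr; lia.
Qed.

Lemma rounding_bound :
  4 ^ k * (4 * X * (\sum_(j < k) cT (sel j) j) + 2 * \sum_(v < n) ~~ covered k v * chi v) <=
  4 ^ k * X * (\sum_(t < 4) \sum_(i < k) cT t i) + 2 * upot 4 0.
Proof.
have H i : i <= k -> 4 ^ i * rpot i <= rpot 0.
  elim: i => [|i IH] ik; first by rewrite mul1n.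
  by apply: leq_trans (IH (ltnW ik)); rewrite expnSr -mulnA leq_mul2l rpot_step ?orbT.
have := H k (leqnn k); rewrite {1}/rpot subnn mul1n.
have -> : \sum_(j < k | k <= j) \sum_(t < 4) cT t j = 0.
  by rewrite big1 // => j; rewrite leqNgt ltn_ord.
rewrite muln0 addn0.
have -> : \sum_(v < n) ~~ covered k v * (chi v * rest k v) = \sum_(v < n) ~~ covered k v * chi v.
  apply: eq_bigr => v _; rewrite /rest big1 ?muln1 // => j; rewrite leqNgt ltn_ord //.
suff -> : rpot 0 = 4 ^ k * X * (\sum_(t < 4) \sum_(i < k) cT t i) + 2 * upot 4 0 by [].
rewrite /rpot subn0 big_ord0 muln0 add0n exchange_big /= mulnA; congr (_ + 2 * _).
by apply: eq_bigr => v _; rewrite /covered /= mul1n.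
Qed.

Theorem selection_bound :
  (4 * 625) * (2 * X * (\sum_(j < k) cT (sel j) j) + \sum_(v < n) ~~ covered k v * chi v) <=
  (8 * 625) * X * (\sum_(i < k) cP i) + (4 * 256) * (\sum_(v < n) chi v) + (4 * 369) * chiM.
Proof.
have h0 : 0 < 4 ^ k by rewrite expn_gt0.
rewrite -(leq_pmul2l h0); have := rounds_bound.
have := leq_mul (leqnn (2 * 625)) rounding_bound.
move: (\sum_(j < k) _) (\sum_(v < n) _) (\sum_(t < 4) _) (\sum_(i < k) _) (\sum_(v < n) _) chiM (upot _ _).
move: (4 ^ k) 625 256 369; clear; move=> *; lia.
Qed.
End Rounds.

(** * Programming idioms *)

Notation "a +e b" := (EOp Add a b) (at level 50, left associativity).
Notation "a -e b" := (EOp Defs.Sub a b) (at level 50, left associativity).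
Notation "a *e b" := (EOp Mul a b) (at level 40, left associativity).
Notation "a /e b" := (EOp Div a b) (at level 40, left associativity).

(** Truth means being nonzero, and truncated subtraction is nonzero exactly when the strict
    inequality holds. *)
Definition Elt (a b : expr) := b -e a.
Definition Enot (a : expr) := EIf a (ECst 0) (ECst 1).
Definition Eand (a b : expr) := EIf a b (ECst 0).
Definition Eor (a b : expr) := EIf a (ECst 1) b.
Definition Ebool (a : expr) := EIf a (ECst 1) (ECst 0).
Definition Eeq (a b : expr) := Enot (Eor (Elt a b) (Elt b a)).
Definition Eex (x : nat) (b : bnd) (e : expr) := ESum x b (Ebool e).
Definition EN := ERd 0 (ECst 0).
Definition Esq := EN *e EN.

(* The least [x < b] with [e], or [b] if there is none; [y] must be fresh. *)
Definition Efind (x y : nat) (b : bnd) (e : expr) :=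
  ESum y b (Enot (Eex x b (Eand (Enot (Elt (EVar y) (EVar x))) e))).

(** A block of length one, with variable 59 as its dummy index. *)
Definition CPut (a : nat) (i e : expr) : cmd := CSet a i 59 (BC 1) e.

(** * Values of the idioms *)

Section Eval.
Variables (ar : nat -> nat -> nat) (env : nat -> nat).
Local Notation ev := (eval ar env).

Lemma ev_cst c : ev (ECst c) = c. Proof. by []. Qed.
Lemma ev_var x : ev (EVar x) = env x. Proof. by []. Qed.
Lemma ev_rd a e : ev (ERd a e) = ar a (ev e). Proof. by []. Qed.
Lemma ev_add a b : ev (a +e b) = ev a + ev b. Proof. by []. Qed.
Lemma ev_sub a b : ev (a -e b) = ev a - ev b. Proof. by []. Qed.
Lemma ev_mul a b : ev (a *e b) = ev a * ev b. Proof. by []. Qed.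
Lemma ev_div a b : ev (a /e b) = ev a %/ ev b. Proof. by []. Qed.
Lemma ev_if a b c : ev (EIf a b c) = if ev a != 0 then ev b else ev c. Proof. by []. Qed.
Lemma ev_sum x b e :
  ev (ESum x b e) = \sum_(i < bval (ar 0 0) (ar 0 1) b) eval ar (upd env x i) e.
Proof. by []. Qed.
Lemma ev_bool a : ev (Ebool a) = (ev a != 0). Proof. by rewrite /Ebool ev_if; case: ifP. Qed.
Lemma ev_not a : ev (Enot a) = (ev a == 0). Proof. by rewrite /Enot ev_if; case: eqP. Qed.
Lemma ev_EN : ev EN = ar 0 0. Proof. by []. Qed.
Lemma ev_Esq : ev Esq = ar 0 0 * ar 0 0. Proof. by []. Qed.

Lemma tr_lt a b : (ev (Elt a b) != 0) = (ev a < ev b).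
Proof. by rewrite /Elt ev_sub subn_eq0 -ltnNge. Qed.
Lemma tr_not a : (ev (Enot a) != 0) = ~~ (ev a != 0).
Proof. by rewrite ev_not eqb0. Qed.
Lemma tr_bool a : (ev (Ebool a) != 0) = (ev a != 0).
Proof. by rewrite ev_bool eqb0 negbK. Qed.
Lemma tr_and a b : (ev (Eand a b) != 0) = (ev a != 0) && (ev b != 0).
Proof. by rewrite /Eand ev_if; case: ifP. Qed.
Lemma tr_or a b : (ev (Eor a b) != 0) = (ev a != 0) || (ev b != 0).
Proof. by rewrite /Eor ev_if; case: ifP. Qed.
Lemma tr_eq a b : (ev (Eeq a b) != 0) = (ev a == ev b).
Proof. by rewrite /Eeq tr_not tr_or !tr_lt; case: ltngtP. Qed.

Lemma tr_ex x b e : (ev (Eex x b e) != 0) =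
  has (fun i => eval ar (upd env x i) e != 0) (iota 0 (bval (ar 0 0) (ar 0 1) b)).
Proof.
rewrite /Eex ev_sum sum_nat_eq0 negb_forall; apply/existsP/hasP => [[i h]|[i]].
  exists (i : nat); first by rewrite mem_iota /=.
  by move: h => /=; case: (eval _ _ e != 0).
by rewrite mem_iota /= => hi h; exists (Ordinal hi); rewrite /= h.
Qed.
Lemma tr_ite a b c : (ev (EIf a b c) != 0) = if ev a != 0 then ev b != 0 else ev c != 0.
Proof. by rewrite ev_if; case: ifP. Qed.
End Eval.

Definition evE := (ev_cst, ev_var, ev_rd, ev_add, ev_sub, ev_mul, ev_div, ev_EN, ev_Esq, ev_if).

(** The [y] with no witness up to [y] are those below the first witness, so counting them replaces a
    search. *)
Lemma count_find (P : pred nat) N :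
  \sum_(y < N) ~~ has (fun x => (x <= y) && P x) (iota 0 N) = find P (iota 0 N).
Proof.
set f := find _ _; have fN : f <= N by rewrite /f -[X in _ <= X](size_iota 0) find_size.
transitivity (\sum_(y < N) (y < f)); last first.
  rewrite -(big_mkord xpredT (fun y => nat_of_bool (y < f))) (big_cat_nat (leq0n f) fN) /=.
  rewrite (eq_big_nat _ _ (F2 := fun=> 1)); last by move=> i /= ->.
  rewrite sum_nat_const_nat subn0 muln1 [X in _ + X]big_nat_cond big1 ?addn0 // => i.
  by rewrite andbT => /andP[h _]; rewrite ltnNge h.
apply: eq_bigr => y _; congr nat_of_bool; apply/negP/idP => [h|yf /hasP[x]].
  rewrite ltnNge; apply/negP => fy; apply: h.
  have hf : f < N by apply: leq_ltn_trans (ltn_ord y).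
  apply/hasP; exists f; first by rewrite mem_iota.
  rewrite fy /=; have := nth_find 0 (_ : has P (iota 0 N)); rewrite nth_iota // add0n; apply.
  by rewrite has_find size_iota.
rewrite mem_iota /= add0n => xN /andP[xy Px].
have xf : x < f by apply: leq_ltn_trans yf.
by have := before_find 0 xf; rewrite nth_iota // add0n Px.
Qed.

Lemma ev_find ar env x y b e (P : pred nat) : x != y ->
  let N := bval (ar 0 0) (ar 0 1) b in
  (forall i j, i < N -> (eval ar (upd (upd env y j) x i) e != 0) = P i) ->
  eval ar env (Efind x y b e) = find P (iota 0 N).
Proof.
move=> xy N H; rewrite -count_find /Efind ev_sum; apply: eq_bigr => j _.
rewrite ev_not -[_ == 0]negbK tr_ex; congr (nat_of_bool (~~ _)).
apply: eq_in_has => i; rewrite mem_iota andTb add0n => iN; cbv beta; rewrite tr_and tr_not tr_lt H // !ev_var.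
by rewrite /upd eqxx eq_sym (negPf xy) eqxx -leqNgt.
Qed.

Fixpoint writes (c : cmd) : seq nat :=
  match c with
  | CSkip | CWrite _ => [::]
  | CSet a _ _ _ _ => [:: a]
  | CSeq c1 c2 | CIf _ c1 c2 => writes c1 ++ writes c2
  | CFor _ _ c => writes c
  | CRead _ => [:: 0]
  end.

Lemma cexec_frame c env s a : a \notin writes c -> arr (cexec c env s) a = arr s a.
Proof.
elim: c env s => //= [b o x bd e|c1 I1 c2 I2|e c1 I1 c2 I2|x bd c I|e] env s.
- by rewrite inE /upd => /negPf ->.
- by rewrite mem_cat => /norP[h1 h2]; rewrite I2 ?I1.
- by rewrite mem_cat => /norP[h1 h2]; case: ifP => _; rewrite ?I1 ?I2.
- by move=> h; elim: (bvals s bd) => //= j IH; rewrite I.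
- by rewrite inE /upd => /negPf ->.
Qed.

Fixpoint noio (c : cmd) : bool :=
  match c with
  | CSkip | CSet _ _ _ _ _ => true
  | CSeq c1 c2 | CIf _ c1 c2 => noio c1 && noio c2
  | CFor _ _ c => noio c
  | CRead _ | CWrite _ => false
  end.

Lemma cexec_noio c env s : noio c -> lout (cexec c env s) = lout s.
Proof.
elim: c env s => //= [c1 I1 c2 I2|e c1 I1 c2 I2|x bd c I] env s.
- by move=> /andP[h1 h2]; rewrite I2 ?I1.
- by move=> /andP[h1 h2]; case: ifP => _; rewrite ?I1 ?I2.
- by move=> h; elim: (bvals s bd) => //= j IH; rewrite I.
Qed.

Lemma cset_val env s a o x b e i : arr (cexec (CSet a o x b e) env s) a i =
  if eval (arr s) env o <= i < eval (arr s) env o + bvals s b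
  then eval (arr s) (upd env x (i - eval (arr s) env o)) e else arr s a i.
Proof. by rewrite /= /upd eqxx. Qed.

Lemma cset0_val env s a x b e i : i < bvals s b ->
  arr (cexec (CSet a (ECst 0) x b e) env s) a i = eval (arr s) (upd env x i) e.
Proof. by move=> h; rewrite cset_val /= add0n h subn0. Qed.

Lemma cput_val env s a i e j : arr (cexec (CPut a i e) env s) a j =
  if j == eval (arr s) env i then eval (arr s) (upd env 59 0) e else arr s a j.
Proof.
rewrite cset_val /bvals /= addn1 ltnS -eqn_leq eq_sym.
by case: eqP => // ->; rewrite subnn.
Qed.

Lemma for_ind x b c env s (I : nat -> lstate -> Prop) :
  I 0 s ->
  (forall j s', j < bvals s b -> I j s' -> I j.+1 (cexec c (upd env x j) s')) ->
  I (bvals s b) (cexec (CFor x b c) env s).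
Proof.
move=> I0 IS /=; set N := bvals s b; have: N <= N by [].
elim: {1 3 4}N => //= j IH jN; apply: IS => //; apply: IH; exact: ltnW.
Qed.

Definition dims (n k : nat) (s : lstate) : Prop := arr s 0 0 = n /\ arr s 0 1 = k.

Lemma dims_bval n k s b : dims n k s -> bvals s b = bval n k b.
Proof. by move=> [h1 h2]; rewrite /bvals h1 h2. Qed.

Lemma cexec_seq c1 c2 env s : cexec (CSeq c1 c2) env s = cexec c2 env (cexec c1 env s).
Proof. by []. Qed.

Lemma cexec_if e c1 c2 env s : cexec (CIf e c1 c2) env s =
  if eval (arr s) env e != 0 then cexec c1 env s else cexec c2 env s.
Proof. by []. Qed.

Lemma cexec_for x b c env s :
  cexec (CFor x b c) env s = iteri (bvals s b) (fun i s => cexec c (upd env x i) s) s.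
Proof. by []. Qed.

Lemma cexec_skip env s : cexec CSkip env s = s.
Proof. by []. Qed.

(** * The moat growing program *)

(* Arrays: 3 reduced costs, 4 budgets, 5 and 6 labels, 7 history of the
   component maps, 8 history of the activity, 11 chosen event, 12 growth,
   13-15 history of the merges and their endpoints. *)

Definition Ecmp (v : expr) := ERd 7 (EVar 0 *e EN +e v).
Definition Emeets (a : nat) (v : expr) :=
  Eex 1 BN (Eand (Eeq (Ecmp (EVar 1)) (Ecmp v)) (ERd a (EVar 1))).
Definition Eact (v : expr) :=
  Ebool (EIf (Emeets 5 v) (Enot (Emeets 6 v)) (Eor (Emeets 6 v) (Emeets 4 v))).
Definition Epay (v : expr) :=
  Eand (ERd 4 v) (Eand (Enot (Emeets 5 v)) (Eand (Enot (Emeets 6 v))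
    (Enot (Eex 1 BN (Eand (Elt (EVar 1) v)
       (Eand (Eeq (Ecmp (EVar 1)) (Ecmp v)) (ERd 4 (EVar 1)))))))).
Definition Erate (u v : expr) :=
  EIf (Eeq (Ecmp u) (Ecmp v)) (ECst 0) (Eact u +e Eact v).
Definition Ediv (x : expr) := x /e EN.
Definition Emod (x : expr) := x -e (x /e EN) *e EN.
(** All possible events share one range: a number below [n * n] stands for the edge between its
    quotient and its remainder by [n], and the next [n] numbers for vertices. The value 0 says that
    the event cannot occur. *)
Definition Ecval (x : expr) :=
  EIf (Elt x Esq) (Erate (Ediv x) (Emod x)) (Ebool (Epay (x -e Esq))).
(** The [eps] at which the event occurs: an edge consumed at rate 1 is exhausted at twice its cost,
    one at rate 2 at its cost, and a budget at its own value. Doubling in each step is what makes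
    all three integral. *)
Definition Eckey (x : expr) :=
  EIf (Elt x Esq) (EIf (Eeq (Ecval x) (ECst 1)) (ERd 3 x +e ERd 3 x) (ERd 3 x))
      (ERd 4 (x -e Esq)).

Definition Bsq := BMulN BN.
Definition Bcand := BAdd Bsq BN.
Definition B2n := BAdd BN BN.
Definition Ebest := ERd 11 (ECst 0).
Definition Eeps := ERd 12 (ECst 0).

Definition best_code := CPut 11 (ECst 0) (Efind 3 8 Bcand
  (Eand (Ecval (EVar 3))
        (Enot (Eex 4 Bcand (Eand (Ecval (EVar 4)) (Elt (Eckey (EVar 4)) (Eckey (EVar 3)))))))).
(** Without a possible event [eps] is 0 and nothing is merged: the step only doubles all quantities,
    so that every run has exactly [2 n] steps. *)
Definition eps_code := CPut 12 (ECst 0) (EIf (Elt Ebest (Esq +e EN)) (Eckey Ebest) (ECst 0)).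
Definition mg_code := CPut 13 (EVar 0) (Ebool (Elt Ebest Esq)).
Definition eu_code := CPut 14 (EVar 0) (Ediv Ebest).
Definition ev_code := CPut 15 (EVar 0) (Emod Ebest).
Definition act_code := CSet 8 (EVar 0 *e EN) 2 BN (Eact (EVar 2)).
Definition cost_code := CSet 3 (ECst 0) 3 Bsq
  (EIf (Eeq (Erate (Ediv (EVar 3)) (Emod (EVar 3))) (ECst 0)) (ERd 3 (EVar 3) +e ERd 3 (EVar 3))
  (EIf (Eeq (Erate (Ediv (EVar 3)) (Emod (EVar 3))) (ECst 1)) (ERd 3 (EVar 3) +e ERd 3 (EVar 3) -e Eeps)
       (ERd 3 (EVar 3) +e ERd 3 (EVar 3) -e (Eeps +e Eeps)))).
Definition budget_code := CSet 4 (ECst 0) 2 BN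
  (EIf (Epay (EVar 2)) (ERd 4 (EVar 2) +e ERd 4 (EVar 2) -e (Eeps +e Eeps))
       (ERd 4 (EVar 2) +e ERd 4 (EVar 2))).
(** Row [j] of array 7 is the component map before step [j]; a merge writes the next row, so no map
    is lost. *)
Definition merge_code := CSet 7 ((EVar 0 +e ECst 1) *e EN) 2 BN
  (EIf (Eand (ERd 13 (EVar 0)) (Eeq (Ecmp (EVar 2)) (Ecmp (ERd 15 (EVar 0)))))
       (Ecmp (ERd 14 (EVar 0))) (Ecmp (EVar 2))).

Definition moat_step := CSeq best_code (CSeq eps_code (CSeq mg_code (CSeq eu_code
  (CSeq ev_code (CSeq act_code (CSeq cost_code (CSeq budget_code merge_code))))))).
Definition moat_code := CSeq (CSet 7 (ECst 0) 2 BN (EVar 2)) (CFor 0 B2n moat_step).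

Lemma bvalN n k : bval n k BN = n. Proof. by []. Qed.

Definition gview (n j : nat) (ar : nat -> nat -> nat) : gstate :=
  GState (fun u v => ar 3 (u * n + v)) (ar 4) (fun v => ar 7 (j * n + v)).

Definition tr (f : nat -> nat) : pred nat := fun v => f v != 0.

Section Sem.
Variables (ar : nat -> nat -> nat) (env : nat -> nat) (n j : nat).
Hypothesis hn : ar 0 0 = n.
Hypothesis hj : env 0 = j.
Let g := gview n j ar.
Let la := tr (ar 5).
Let lb := tr (ar 6).

(** Variable 1 is bound inside [Emeets] and [Epay], and must not occur in what is substituted
    there. *)
Definition free1 (e : expr) := forall i, eval ar (upd env 1 i) e = eval ar env e.

Lemma ev_cmp i e : free1 e -> eval ar (upd env 1 i) (Ecmp e) = gm g (eval ar env e).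
Proof. by move=> f; rewrite /Ecmp !evE f /= hn -hj. Qed.

Lemma ev_cmp1 i : eval ar (upd env 1 i) (Ecmp (EVar 1)) = gm g i.
Proof. by rewrite /Ecmp !evE /= hn -hj. Qed.

Lemma tr_meets a e : free1 e ->
  (eval ar env (Emeets a e) != 0) = meets n g (tr (ar a)) (gm g (eval ar env e)).
Proof.
move=> f; rewrite /Emeets tr_ex bvalN hn; apply: eq_has => i; cbv beta.
by rewrite tr_and tr_eq ev_cmp1 ev_cmp.
Qed.

Lemma tr_budget (x : nat) : meets n g (tr (ar 4)) x = meets n g (fun v => 0 < gb g v) x.
Proof. by apply: eq_has => v; rewrite /tr lt0n. Qed.

Lemma ev_act e : free1 e -> eval ar env (Eact e) = act n la lb g (gm g (eval ar env e)).
Proof. by move=> f; rewrite /Eact ev_bool tr_ite tr_not tr_or !tr_meets // tr_budget. Qed.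

Lemma tr_pay e : free1 e -> (eval ar env (Epay e) != 0) = pay n la lb g (eval ar env e).
Proof.
move=> f; rewrite /Epay !tr_and !tr_not !tr_meets // tr_ex bvalN hn /pay lt0n -/la -/lb.
do 3 congr (_ && _); congr (~~ _); apply: eq_has => i; cbv beta.
by rewrite tr_and tr_lt tr_and tr_eq ev_cmp1 ev_cmp // f lt0n.
Qed.

Lemma ev_rate e1 e2 : free1 e1 -> free1 e2 ->
  eval ar env (Erate e1 e2) = rate n la lb g (eval ar env e1) (eval ar env e2).
Proof.
move=> f1 f2; rewrite /Erate ev_if tr_eq ev_add !ev_act // /rate.
have E e : free1 e -> eval ar env (Ecmp e) = gm g (eval ar env e).
  by move=> f; rewrite /Ecmp !evE hn hj.
by rewrite !E.
Qed.

Definition cval (x : nat) : nat :=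
  if x < n * n then rate n la lb g (x %/ n) (x %% n) else pay n la lb g (x - n * n).
Definition ckey (x : nat) : nat :=
  if x < n * n then if cval x == 1 then 2 * ar 3 x else ar 3 x else ar 4 (x - n * n).

Lemma ev_mod e : eval ar env (Emod e) = eval ar env e %% n.
Proof. by rewrite /Emod !evE hn {1}(divn_eq (eval ar env e) n) addKn. Qed.

Lemma ev_cval e : free1 e -> eval ar env (Ecval e) = cval (eval ar env e).
Proof.
move=> f; have f1 : free1 (Ediv e) by move=> i; rewrite /Ediv !evE f.
have f2 : free1 (Emod e) by move=> i; rewrite /Emod !evE f.
have f3 : free1 (e -e Esq) by move=> i; rewrite !evE f.
rewrite /Ecval ev_if tr_lt ev_rate // ev_bool tr_pay // ev_mod /cval.
by rewrite /Ediv !evE hn.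
Qed.

Lemma ev_ckey e : free1 e -> eval ar env (Eckey e) = ckey (eval ar env e).
Proof.
move=> f; rewrite /Eckey ev_if tr_lt ev_if tr_eq ev_cval // /ckey !evE hn.
by rewrite mul2n addnn.
Qed.
End Sem.

Definition best_pred (n : nat) (cv ck : nat -> nat) : pred nat :=
  fun x => (cv x != 0) &&
    ~~ has (fun y => (cv y != 0) && (ck y < ck x)) (iota 0 (n * n + n)).

Lemma best_spec n cv ck : let N := n * n + n in
  let b := find (best_pred n cv ck) (iota 0 N) in
  (b < N -> cv b != 0 /\ forall y, y < N -> cv y != 0 -> ck b <= ck y) /\
  (forall y, y < N -> cv y != 0 -> b < N).
Proof.
move=> N b; split=> [bN|y yN cy].
  have hb : has (best_pred n cv ck) (iota 0 N) by rewrite has_find size_iota.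
  have := nth_find 0 hb; rewrite nth_iota // add0n => /andP[h1 h2]; split=> // y yN cy.
  rewrite leqNgt; apply: contra h2 => h; apply/hasP; exists y; rewrite ?mem_iota //.
  by rewrite cy h.
have ex0 : exists m, has (fun y => (cv y != 0) && (ck y == m)) (iota 0 N).
  by exists (ck y); apply/hasP; exists y; rewrite ?mem_iota // cy eqxx.
case: (ex_minnP ex0) => m /hasP[z zN /andP[cz /eqP ez]] mmin.
suff : has (best_pred n cv ck) (iota 0 N) by rewrite has_find size_iota.
apply/hasP; exists z => //; rewrite /best_pred cz /=; apply/hasP => -[w wN /andP[cw h]].
have := mmin (ck w); rewrite -ez leqNgt h => /(_ _)/negP; apply=> //.
by apply/hasP; exists w => //; rewrite cw eqxx.
Qed.

Opaque cexec eval.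

Definition event (ar : nat -> nat -> nat) (j : nat) : option (nat * nat) :=
  if ar 13 j != 0 then Some (ar 14 j, ar 15 j) else None.

Lemma divmod_lt n x : x < n * n -> x %/ n < n /\ x %% n < n.
Proof.
case: n => // n h; split; last by rewrite ltn_pmod.
by rewrite ltn_divLR.
Qed.

Lemma divmod_idx n u v : v < n -> (u * n + v) %/ n = u /\ (u * n + v) %% n = v.
Proof.
move=> vn; have n0 : 0 < n by apply: leq_ltn_trans vn.
by rewrite divnMDl // divn_small // addn0 modnMDl modn_small.
Qed.

Lemma idx_lt n u v m : u < m -> v < n -> u * n + v < m * n.
Proof.
move=> um vn; apply: (@leq_trans (u * n + n)); first by rewrite ltn_add2l.
by rewrite addnC -mulSn leq_mul2r um orbT.
Qed.

(** The order of the assignments matters: rates and payers read the budgets but not the costs, so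
    costs are updated first and budgets after them, and merging touches only the next row of array
    7. Everything can then be expressed in the state before the step. *)
Lemma moat_step_raw n k env j s : dims n k s ->
  let e := upd env 0 j in
  let s' := cexec moat_step e s in
  let g := gview n j (arr s) in
  let la := tr (arr s 5) in let lb := tr (arr s 6) in
  let cv := cval (arr s) n j in let ck := ckey (arr s) n j in
  let b := find (best_pred n cv ck) (iota 0 (n * n + n)) in
  let eps := if b < n * n + n then ck b else 0 in
  [/\ forall i, i < n * n -> arr s' 3 i =
        if cv i == 0 then 2 * arr s 3 i else if cv i == 1 then 2 * arr s 3 i - eps
        else 2 * arr s 3 i - 2 * eps,
      forall v, v < n -> arr s' 4 v =
        if pay n la lb g v then 2 * arr s 4 v - 2 * eps else 2 * arr s 4 v,
      (forall i, arr s' 13 i = if i == j then nat_of_bool (b < n * n) else arr s 13 i) /\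
      (forall i, arr s' 14 i = if i == j then b %/ n else arr s 14 i) /\
      (forall i, arr s' 15 i = if i == j then b %% n else arr s 15 i),
      forall i, arr s' 8 i = if j * n <= i < j * n + n then nat_of_bool (act n la lb g (gm g (i - j * n))) else arr s 8 i &
      forall i, arr s' 7 i = if j.+1 * n <= i < j.+1 * n + n
        then let v := i - j.+1 * n in
          if (b < n * n) && (gm g v == gm g (b %% n)) then gm g (b %/ n) else gm g v
        else arr s 7 i].
Proof.
move=> D e s' g la lb cv ck b eps; have [h0 h1] := D.
have [s1 q1] : exists x, x = cexec best_code e s by eexists.
have [s2 q2] : exists x, x = cexec eps_code e s1 by eexists.
have [s3 q3] : exists x, x = cexec mg_code e s2 by eexists.
have [s4 q4] : exists x, x = cexec eu_code e s3 by eexists.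
have [s5 q5] : exists x, x = cexec ev_code e s4 by eexists.
have [s6 q6] : exists x, x = cexec act_code e s5 by eexists.
have [s7 q7] : exists x, x = cexec cost_code e s6 by eexists.
have [s8 q8] : exists x, x = cexec budget_code e s7 by eexists.
have es' : s' = cexec merge_code e s8.
  by rewrite /s' /moat_step !cexec_seq -q1 -q2 -q3 -q4 -q5 -q6 -q7 -q8.
have a1 a : a != 11 -> arr s1 a = arr s a by move=> h; rewrite q1 cexec_frame // inE.
have a2 a : a != 12 -> arr s2 a = arr s1 a by move=> h; rewrite q2 cexec_frame // inE.
have a3 a : a != 13 -> arr s3 a = arr s2 a by move=> h; rewrite q3 cexec_frame // inE.
have a4 a : a != 14 -> arr s4 a = arr s3 a by move=> h; rewrite q4 cexec_frame // inE.
have a5 a : a != 15 -> arr s5 a = arr s4 a by move=> h; rewrite q5 cexec_frame // inE.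
have a6 a : a != 8 -> arr s6 a = arr s5 a by move=> h; rewrite q6 cexec_frame // inE.
have a7 a : a != 3 -> arr s7 a = arr s6 a by move=> h; rewrite q7 cexec_frame // inE.
have a8 a : a != 4 -> arr s8 a = arr s7 a by move=> h; rewrite q8 cexec_frame // inE.
have a9 a : a != 7 -> arr s' a = arr s8 a by move=> h; rewrite es' cexec_frame // inE.
have b1 : arr s1 11 0 = b.
  rewrite q1 /best_code cput_val evE eqxx.
  rewrite (@ev_find _ _ _ _ _ _ (best_pred n cv ck)) //.
    by rewrite /= h0.
  move=> i i' iN; set e' := upd _ _ _.
  have je : e' 0 = j by [].
  rewrite tr_and tr_not tr_ex /best_pred; congr (_ && _).
    by rewrite (ev_cval h0 je) // /cv.
  rewrite /= h0; congr (~~ _); apply: eq_has => y; cbv beta.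
  set e2 := upd _ _ _; have je2 : e2 0 = j by [].
  by rewrite tr_and tr_lt (ev_cval h0 je2) // !(ev_ckey h0 je2).
have g1 : gview n j (arr s1) = g by rewrite /gview !a1.
have eps2 : arr s2 12 0 = eps.
  rewrite q2 /eps_code cput_val evE eqxx ev_if tr_lt.
  have h0' : arr s1 0 0 = n by rewrite a1.
  have je2 : (upd e 59 0) 0 = j by [].
  rewrite (ev_ckey h0' je2) // /Ebest !evE h0' b1 /eps /ck /ckey /cval g1.
  by rewrite !a1.
have b2 : arr s2 11 0 = b by rewrite a2.
have b3 : arr s3 11 0 = b by rewrite a3.
have b4 : arr s4 11 0 = b by rewrite a4.
have n2 : arr s2 0 0 = n by rewrite a2 // a1.
have n3 : arr s3 0 0 = n by rewrite a3.
have n4 : arr s4 0 0 = n by rewrite a4.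
have n5 : arr s5 0 0 = n by rewrite a5.
have n6 : arr s6 0 0 = n by rewrite a6.
have n7 : arr s7 0 0 = n by rewrite a7.
have n8 : arr s8 0 0 = n by rewrite a8.
have p6 : arr s6 12 0 = eps by rewrite a6 // a5 // a4 // a3.
have p7 : arr s7 12 0 = eps by rewrite a7.
have o5 a : a \notin [:: 11; 12; 13; 14; 15] -> arr s5 a = arr s a.
  by rewrite !inE !negb_or => /and5P[? ? ? ? ?]; rewrite a5 // a4 // a3 // a2 // a1.
have G5 : gview n j (arr s5) = g by rewrite /gview !o5.
have G6 : gview n j (arr s6) = g by rewrite -G5 /gview !a6.
have m13 i : arr s3 13 i = if i == j then nat_of_bool (b < n * n) else arr s 13 i.
  rewrite q3 /mg_code cput_val ev_bool tr_lt /Ebest !evE -[e 0]/(j) b2 n2.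
  by rewrite a2 // a1.
have m14 i : arr s4 14 i = if i == j then b %/ n else arr s 14 i.
  rewrite q4 /eu_code cput_val /Ediv /Ebest !evE -[e 0]/(j) b3 n3.
  by rewrite a3 // a2 // a1.
have m15 i : arr s5 15 i = if i == j then b %% n else arr s 15 i.
  rewrite q5 /ev_code cput_val (ev_mod _ n4) /Ebest !evE -[e 0]/(j) b4.
  by rewrite a4 // a3 // a2 // a1.
have r13 : arr s8 13 = arr s3 13 by rewrite a8 // a7 // a6 // a5 // a4.
have r14 : arr s8 14 = arr s4 14 by rewrite a8 // a7 // a6 // a5.
have r15 : arr s8 15 = arr s5 15 by rewrite a8 // a7 // a6.
split.
- move=> i iN; rewrite a9 // a8 // q7 /cost_code cset0_val; last by rewrite /bvals /= n6.
  set e' := upd _ _ _; have je : e' 0 = j by [].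
  have f1 : free1 (arr s6) e' (Ediv (EVar 3)) by [].
  have f1' : free1 (arr s6) e' (Emod (EVar 3)) by [].
  rewrite ev_if tr_eq ev_if tr_eq (ev_rate n6 je f1 f1') (ev_mod _ n6) G6.
  rewrite [arr s6 5]a6 // [arr s6 6]a6 // !o5 // -/la -/lb.
  rewrite /Ediv /Eeps !evE n6 p6 a6 // o5 // -[e' 3]/(i) /cv /cval iN -/g -/la -/lb.
  by rewrite !addnn !mul2n.
- move=> v vn; rewrite a9 // q8 /budget_code cset0_val; last by rewrite /bvals /= n7.
  set e' := upd _ _ _; have je : e' 0 = j by [].
  have f1 : free1 (arr s7) e' (EVar 2) by [].
  have PE x : pay n (tr (arr s7 5)) (tr (arr s7 6)) (gview n j (arr s7)) x = pay n la lb g x.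
    rewrite [arr s7 5]a7 // [arr s7 6]a7 // [arr s6 5]a6 // [arr s6 6]a6 // !o5 //.
    by rewrite /gview [arr s7 4]a7 // [arr s7 7]a7 // !a6 // !o5.
  rewrite ev_if (tr_pay n7 je f1) PE /Eeps !evE p7 a7 // a6 // o5 // -[e' 2]/(v).
  by rewrite !addnn !mul2n.
- by split; [|split]=> i; rewrite a9 // ?r13 ?r14 ?r15.
- move=> i; rewrite a9 // a8 // a7 // q6 /act_code cset_val.
  rewrite ev_mul ev_var ev_EN -[e 0]/(j) n5 (_ : bvals s5 BN = n) // o5 //.
  case: ifP => // _; set e' := upd _ _ _; have je : e' 0 = j by [].
  by rewrite (ev_act n5 je) // G5 !o5.
- move=> i; rewrite es' /merge_code cset_val.
  rewrite ev_mul ev_add ev_var ev_cst ev_EN -[e 0]/(j) n8 addn1 (_ : bvals s8 BN = n) //.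
  have w7 : arr s8 7 = arr s 7 by rewrite a8 // a7 // a6 // o5.
  case: ifP => // _; last by rewrite w7.
  rewrite ev_if tr_and tr_eq.
  rewrite /Ecmp !evE -[upd _ _ _ 0]/(j) -[upd _ _ _ 2]/(i - j.+1 * n) n8 r13 r14 r15 m13 m14 m15 !eqxx w7.
  by rewrite eqb0 negbK.
Qed.

(** * Termination within [2 n] steps *)

Lemma ltn_sum_one n (F G : nat -> nat) y : y < n -> F y < G y ->
  (forall x, x < n -> F x <= G x) -> \sum_(x < n) F x < \sum_(x < n) G x.
Proof.
move=> yn h H; rewrite (bigD1 (Ordinal yn)) //= [X in _ < X](bigD1 (Ordinal yn)) //=.
by rewrite -addSn; apply: leq_add => //; apply: leq_sum => x _; apply: H.
Qed.

(** A merge removes one representative and the other kind of event exhausts one budget, so every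
    event lowers this number, which is at most [2 n]. *)
Definition gpot (n : nat) (g : gstate) : nat :=
  \sum_(x < n) (gm g x == x) + \sum_(v < n) (0 < gb g v).

(** Otherwise a last component with a single kind of label could grow forever without an event. *)
Definition balanced (n : nat) (la lb : pred nat) : Prop := ex n la = ex n lb.

Definition step_eps (ar : nat -> nat -> nat) (n j : nat) : nat :=
  let b := find (best_pred n (cval ar n j) (ckey ar n j)) (iota 0 (n * n + n)) in
  if b < n * n + n then ckey ar n j b else 0.

Lemma moat_step_spec n k env j s : dims n k s ->
  let s' := cexec moat_step (upd env 0 j) s in
  let g := gview n j (arr s) in let g' := gview n j.+1 (arr s') in
  let la := tr (arr s 5) in let lb := tr (arr s 6) in
  gwf n g -> balanced n la lb ->
  gstep n la lb g g' (event (arr s') j) (step_eps (arr s) n j) /\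
    ((forall v, v < n -> ~~ act n la lb g (gm g v)) /\
     (forall v, v < n -> ~~ act n la lb g' (gm g' v)) \/
     (exists2 v, v < n & act n la lb g (gm g v)) /\ gpot n g' < gpot n g).
Proof.
move=> D s' g g' la lb W B.
have [rc rb [r13 [r14 r15]] _ r7] := moat_step_raw env j D.
set cv := cval (arr s) n j in rc rb r13 r14 r15 r7.
set ck := ckey (arr s) n j in rc rb r13 r14 r15 r7.
set b := find _ _ in rc rb r13 r14 r15 r7.
set eps := (if b < n * n + n then _ else _) in rc rb.
rewrite -/s' -/g -/la -/lb in rc rb r13 r14 r15 r7.
have [bs1 bs2] := best_spec n cv ck; rewrite -/b in bs1 bs2.
have eps_le y : y < n * n + n -> cv y != 0 -> eps <= ck y.
  by move=> yN cy; rewrite /eps; have bN := bs2 y yN cy; rewrite bN; have [_] := bs1 bN; apply.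
have cvE u v : u < n -> v < n -> cv (u * n + v) = rate n la lb g u v.
  by move=> un vn; rewrite /cv /cval idx_lt //; have [-> ->] := divmod_idx u vn.
have cvP v : v < n -> cv (n * n + v) = pay n la lb g v.
  by move=> vn; rewrite /cv /cval ltnNge leq_addr /= addKn.
have rate2 u v : rate n la lb g u v <= 2.
  by rewrite /rate; case: ifP => // _; case: (act _ _ _ _ _); case: (act _ _ _ _ _).
have S1 u v : u < n -> v < n -> gc g' u v + eps * rate n la lb g u v = 2 * gc g u v.
  move=> un vn; have iN := idx_lt un vn; rewrite /= rc // cvE //.
  have iN' : u * n + v < n * n + n by apply: leq_trans iN (leq_addr _ _).
  have := eps_le _ iN'; rewrite cvE // /ck /ckey iN -/cv cvE //.
  move: (rate2 u v); case: (rate _ _ _ _ _ _) => [|[|[|r]]] //= _ h.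
  - by rewrite muln0 addn0.
  - by rewrite muln1 subnK //; apply: h.
  - by have := h isT; lia.
have S2 v : v < n -> gb g' v + 2 * eps * pay n la lb g v = 2 * gb g v.
  move=> vn; rewrite /= rb //; case pv: (pay _ _ _ _ _); last by rewrite muln0 addn0.
  have iN' : n * n + v < n * n + n by rewrite ltn_add2l.
  have := eps_le _ iN'; rewrite cvP // pv /ck /ckey ltnNge leq_addr /= addKn => /(_ isT) h.
  by rewrite muln1; lia.
have gm' v : v < n -> gm g' v =
    if (b < n * n) && (gm g v == gm g (b %% n)) then gm g (b %/ n) else gm g v.
  by move=> vn; rewrite /= r7 leq_addr ltn_add2l vn /= addKn.
have evE' : event (arr s') j = if b < n * n then Some (b %/ n, b %% n) else None.
  by rewrite /event r13 r14 r15 !eqxx; case: (b < n * n).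
have bdone : n * n + n <= b -> forall y, y < n * n + n -> cv y = 0.
  by move=> hb y yN; apply/eqP; apply: contraTT hb => cy; rewrite -ltnNge; apply: bs2 yN cy.
rewrite -[step_eps _ _ _]/eps; split.
  split=> //; rewrite evE'; case: ifP => bn2; last by move=> v vn; rewrite gm' // bn2.
  have [dn mn] := divmod_lt bn2; have bN : b < n * n + n by apply: leq_trans bn2 (leq_addr _ _).
  have [cb _] := bs1 bN.
  have bE : b = (b %/ n) * n + b %% n by apply: divn_eq.
  have rE : cv b = rate n la lb g (b %/ n) (b %% n) by rewrite {1}bE cvE.
  have dm : gm g (b %/ n) != gm g (b %% n).
    by apply: contraNneq cb => h; rewrite rE /rate h eqxx.
  split=> //; last by move=> v vn; rewrite gm' // bn2.
  rewrite /= -bE rc // (negPf cb); have eE : eps = ck b by rewrite /eps bN.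
  by rewrite eE /ck /ckey bn2 -/cv; case: (cv b == 1); rewrite subnn.
case: (ltnP b (n * n)) => [bn2|bn2].
  right; have [dn mn] := divmod_lt bn2; have bN : b < n * n + n by apply: leq_trans bn2 (leq_addr _ _).
  have [cb _] := bs1 bN.
  have bE : b = (b %/ n) * n + b %% n by apply: divn_eq.
  have rE : cv b = rate n la lb g (b %/ n) (b %% n) by rewrite {1}bE cvE.
  have dm : gm g (b %/ n) != gm g (b %% n).
    by apply: contraNneq cb => h; rewrite rE /rate h eqxx.
  have [yn ym] := W _ mn; have [xn xm] := W _ dn.
  split.
    case ad: (act n la lb g (gm g (b %/ n))); first by exists (b %/ n).
    exists (b %% n) => //; move: cb; rewrite rE /rate (negPf dm) ad.
    by case: (act _ _ _ _ _).
  rewrite /gpot -addSn; apply: leq_add.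
    apply: (@ltn_sum_one n (fun x => gm g' x == x) (fun x => gm g x == x) (gm g (b %% n))) => //.
      by rewrite gm' // bn2 ym eqxx /= (negPf dm).
    move=> x xn'; rewrite gm' // bn2 /=; case: (eqVneq (gm g x) (gm g (b %% n))) => // h.
    case: (eqVneq (gm g (b %/ n)) x) => // hx.
    by case/eqP: dm; rewrite -h -hx xm.
  apply: leq_sum => v _; have := S2 v (ltn_ord v).
  by case: (gb g v) => [|m] h //; rewrite ?leq_b1 //; move: h; rewrite muln0; case: (gb g' v).
case: (ltnP b (n * n + n)) => [bN|bN].
  right; have [cb _] := bs1 bN; have vn : b - n * n < n by lia.
  have pv : pay n la lb g (b - n * n) by rewrite -[pay _ _ _ _ _]lt0b -cvP // subnKC // lt0n.
  have eE : eps = gb g (b - n * n) by rewrite /eps bN /ck /ckey ltnNge bn2.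
  split; first by exists (b - n * n) => //; have [] := pay_act vn pv.
  rewrite /gpot -addnS; apply: leq_add.
    by apply: leq_sum => x _; rewrite gm' // ltnNge bn2.
  apply: (@ltn_sum_one n (fun v => 0 < gb g' v) (fun v => 0 < gb g v) (b - n * n)) => //.
    have := S2 _ vn; rewrite pv eE; case/and4P: pv => -> _ _ _ h.
    by have -> : gb g' (b - n * n) = 0 by lia.
  move=> v vn'; have := S2 v vn'.
  by case: (gb g v) => [|m] h //; rewrite ?leq_b1 //; move: h; rewrite muln0; case: (gb g' v).
left; have cv0 := bdone bN.
have A0 v : v < n -> ~~ act n la lb g (gm g v).
  move=> vn; apply/negP => av.
  (* Without possible events an active component must be the only one, as an edge leaving it would
     have a positive rate. By balance it then has both kinds of labels or none, and in either case
     it is not active. *)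
  have nohalf u : u < n -> gm g u != gm g v -> False.
    move=> un uv; have iN' : v * n + u < n * n + n by apply: leq_trans (idx_lt vn un) (leq_addr _ _).
    by have := cv0 _ iN'; rewrite cvE // /rate eq_sym (negPf uv) av.
  have other (P Q : pred nat) : ex n P = ex n Q -> meets n g P (gm g v) -> ~~ meets n g Q (gm g v) -> False.
    move=> PQ /meetsP[u un [_ Pu]] mQ.
    have /exP[w wn Qw] : ex n Q by rewrite -PQ; apply/exP; exists u.
    apply: (nohalf w) => //; apply: contra mQ => /eqP <-; exact: meets_self.
  case ma: (meets n g la (gm g v)).
    case mb: (meets n g lb (gm g v)); last by apply: (other la lb) => //; rewrite ?mb.
    by move: av; rewrite /act ma mb.
  case mb: (meets n g lb (gm g v)); first by apply: (other lb la) => //; rewrite ?ma.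
  have [w wn [pw _]] := pay_exists av (negbT ma) (negbT mb).
  have iN' : n * n + w < n * n + n by rewrite ltn_add2l.
  by have := cv0 _ iN'; rewrite cvP // pw.
split=> // v vn.
have mE (P P' : pred nat) x : (forall u, u < n -> P' u = P u) -> meets n g' P' x = meets n g P x.
  move=> PP; apply: eq_in_has => u; rewrite mem_iota /= => un.
  by rewrite -[arr s' 7 _]/(gm g' u) gm' // ltnNge bn2 /= PP.
have e0 : eps = 0 by rewrite /eps ltnNge bN.
rewrite /act !(mE la la) // !(mE lb lb) // (mE (fun v => 0 < gb g v)); last first.
  by move=> u un; have := S2 u un; rewrite e0 muln0 mul0n addn0 => ->; rewrite muln_gt0.
by rewrite gm' // ltnNge bn2 /=; have := A0 v vn.
Qed.

(** What later programs need of a run: component maps, activities and merges as arrays, and the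
    amounts at both ends. The states in between are quantified away. *)
Definition hist n (la lb : pred nat) (c0 : nat -> nat -> nat) (b0 bL : nat -> nat)
    (cm ac mg eu ev : nat -> nat) : Prop :=
  exists (g : nat -> gstate) (eps : nat -> nat),
  let L := n + n in
  let evt j := if mg j != 0 then Some (eu j, ev j) else None in
  [/\ forall j, j < L -> gstep n la lb (g j) (g j.+1) (evt j) (eps j),
      [/\ forall v, v < n -> gm (g 0) v = v,
          forall u v, u < n -> v < n -> gc (g 0) u v = c0 u v,
          forall v, v < n -> gb (g 0) v = b0 v &
          forall v, v < n -> gb (g L) v = bL v],
      forall v, v < n -> ~~ act n la lb (g L) (gm (g L) v),
      forall j v, j <= L -> v < n -> cm (j * n + v) = gm (g j) v &
      forall j v, j < L -> v < n ->
        (ac (j * n + v) != 0) = act n la lb (g j) (gm (g j) v)].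

Lemma row_disjoint n i j v : v < n -> i != j -> (j * n <= i * n + v < j * n + n) = false.
Proof. by move=> vn ij; apply/negP => /andP[h1 h2]; case: (ltngtP i j) ij => // h _; nia. Qed.

Theorem moat_code_spec n k env s : dims n k s ->
  balanced n (tr (arr s 5)) (tr (arr s 6)) ->
  let s' := cexec moat_code env s in
  hist n (tr (arr s 5)) (tr (arr s 6)) (fun u v => arr s 3 (u * n + v)) (arr s 4)
    (arr s' 4) (arr s' 7) (arr s' 8) (arr s' 13) (arr s' 14) (arr s' 15).
Proof.
move=> D B s'; rewrite /s' /moat_code cexec_seq.
have [s1 q1] : exists x, x = cexec (CSet 7 (ECst 0) 2 BN (EVar 2)) env s by eexists.
have a1 a : a != 7 -> arr s1 a = arr s a by move=> h; rewrite q1 cexec_frame // inE.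
have D1 : dims n k s1 by case: D => h1 h2; split; rewrite a1.
rewrite -q1 cexec_for (dims_bval _ D1) -[bval n k B2n]/(n + n).
pose st j := iteri j (fun i s => cexec moat_step (upd env 0 i) s) s1.
rewrite -/(st (n + n)).
have stS j : st j.+1 = cexec moat_step (upd env 0 j) (st j) by [].
have fr j a : a \notin writes moat_step -> arr (st j) a = arr s1 a.
  by move=> h; elim: j => // j IH; rewrite stS cexec_frame.
have Dj j : dims n k (st j) by case: D1 => h1 h2; split; rewrite fr.
pose la := tr (arr s 5); pose lb := tr (arr s 6).
have l5 j : arr (st j) 5 = arr s 5 by rewrite fr // a1.
have l6 j : arr (st j) 6 = arr s 6 by rewrite fr // a1.
pose g j := gview n j (arr (st j)).
have g0 v : v < n -> gm (g 0) v = v.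
  move=> vn; rewrite /= q1 mul0n add0n cset0_val // (dims_bval _ D) //.
(* Entries of earlier steps are never rewritten, so the final arrays contain the whole history. *)
have stab m j : j < m -> (arr (st m) 13 j = arr (st j.+1) 13 j) /\
    (arr (st m) 14 j = arr (st j.+1) 14 j) /\ (arr (st m) 15 j = arr (st j.+1) 15 j).
  elim: m => // m IH; rewrite ltnS leq_eqVlt => /orP[/eqP -> //|jm].
  have [_ _ [r13 [r14 r15]] _ _] := moat_step_raw env m (Dj m).
  have [<- [<- <-]] := IH jm.
  by rewrite stS r13 r14 r15 (ltn_eqF jm).
have stab7 m j v : j <= m -> v < n -> arr (st m) 7 (j * n + v) = gm (g j) v.
  move=> + vn; elim: m => [|m IH]; first by rewrite leqn0 => /eqP ->.
  rewrite leq_eqVlt => /orP[/eqP -> //|jm].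
  have [_ _ _ _ r7] := moat_step_raw env m (Dj m).
  by rewrite stS r7 row_disjoint ?IH // ltn_eqF.
have stab8 m j v : j < m -> v < n -> (arr (st m) 8 (j * n + v) != 0) = act n la lb (g j) (gm (g j) v).
  move=> + vn; elim: m => // m IH; rewrite ltnS leq_eqVlt => /orP[/eqP ->|jm].
    have [_ _ _ r8 _] := moat_step_raw env m (Dj m).
    by rewrite stS r8 leq_addr ltn_add2l vn /= addKn eqb0 negbK l5 l6.
  have [_ _ _ r8 _] := moat_step_raw env m (Dj m).
  by rewrite stS r8 row_disjoint ?IH // ltn_eqF.
have evE j : j < n + n -> (if arr (st (n + n)) 13 j != 0 then Some (arr (st (n + n)) 14 j, arr (st (n + n)) 15 j) else None) = event (arr (st j.+1)) j.
  by move=> jL; have [-> [-> ->]] := stab _ _ jL.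
pose eps j := step_eps (arr (st j)) n j.
pose evt j := event (arr (st j.+1)) j.
have spec j : gwf n (g j) -> gstep n la lb (g j) (g j.+1) (evt j) (eps j) /\
    ((forall v, v < n -> ~~ act n la lb (g j) (gm (g j) v)) /\
     (forall v, v < n -> ~~ act n la lb (g j.+1) (gm (g j.+1) v)) \/
     (exists2 v, v < n & act n la lb (g j) (gm (g j) v)) /\ gpot n (g j.+1) < gpot n (g j)).
  by move=> W; have := moat_step_spec env (Dj j) W; rewrite l5 l6 => /(_ B).
have Hs j i : i < j -> gstep n la lb (g i) (g i.+1) (evt i) (eps i).
  elim: j i => // j IH i; rewrite ltnS leq_eqVlt => /orP[/eqP ->|]; last exact: IH.
  by have [] := spec j (gwf_run (fun i h => IH i h) g0 (leqnn j)).
have Wj j : gwf n (g j) by apply: (gwf_run (fun i h => Hs j i h) g0 (leqnn j)).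
have pot j : (forall v, v < n -> ~~ act n la lb (g j) (gm (g j) v)) \/ gpot n (g j) + j <= n + n.
  elim: j => [|j IH].
    right; rewrite addn0; apply: leq_add.
      exact: (ncount_le n (fun x => gm (g 0) x == x)).
    exact: (ncount_le n (fun v => 0 < gb (g 0) v)).
  have [_ [[_ h]|[[v vn av] h]]] := spec j (Wj j); first by left.
  case: IH => IH; first by rewrite (negPf (IH v vn)) in av.
  by right; lia.
exists g, eps; split.
- by move=> j jL; rewrite evE //; apply: Hs jL.
- split=> //; first by move=> u v un vn; rewrite /g /= a1.
  by move=> v vn; rewrite /g /= a1.
- case: (pot (n + n)) => // h v vn; exfalso.
  have : 0 < gpot n (g (n + n)); last by lia.
  have [h1 h2] := Wj (n + n) v vn.
  rewrite /gpot (bigD1 (Ordinal h1)) //= -[arr _ 7 _]/(gm (g (n + n)) (gm (g (n + n)) v)) h2.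
  by rewrite -[arr _ 7 _]/(gm (g (n + n)) v) eqxx.
- by move=> j v jL vn; apply: stab7.
- by move=> j v jL vn; apply: stab8.
Qed.

Transparent cexec eval.

(** * Pruning and growing programs *)

(* Arrays: 16 contracted vertices, 17 marks, 18 kept merges, 19 and 20 the grown
   set and its parent map. *)

(** The loop counts up while pruning has to start from the last merge. *)
Definition Ej := (EN +e EN) -e (EVar 5 +e ECst 1).
Definition Pcmp (v : expr) := ERd 7 (Ej *e EN +e v).
Definition Pmeets (a : nat) (w : expr) :=
  Eex 1 BN (Eand (Eeq (Pcmp (EVar 1)) (Pcmp w)) (ERd a (EVar 1))).
Definition Pu := ERd 14 Ej.
Definition Pv := ERd 15 Ej.
Definition Ekeep :=
  Eand (ERd 13 Ej) (Eand (Eor (Pmeets 17 Pu) (Pmeets 17 Pv))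
  (Eand (Eor (Pmeets 17 Pu) (ERd 8 (Ej *e EN +e Pu)))
  (Eand (Eor (Pmeets 17 Pv) (ERd 8 (Ej *e EN +e Pv)))
        (Enot (Eand (Pmeets 16 Pu) (Pmeets 16 Pv)))))).
Definition keep_code := CPut 18 Ej (Ebool Ekeep).
Definition mark_code := CSet 17 (ECst 0) 2 BN
  (Eor (ERd 17 (EVar 2)) (Eand (ERd 18 Ej) (Eor (Eeq (EVar 2) Pu) (Eeq (EVar 2) Pv)))).
Definition prune_code := CFor 5 B2n (CSeq keep_code mark_code).

Definition Gu := ERd 14 (EVar 0).
Definition Gv := ERd 15 (EVar 0).
Definition add_code (u v : expr) := CSeq (CPut 20 v u) (CPut 19 v (ECst 1)).
Definition grow_step :=
  CIf (ERd 18 (EVar 0))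
    (CIf (Eand (ERd 19 Gu) (Enot (ERd 19 Gv))) (add_code Gu Gv)
      (CIf (Eand (ERd 19 Gv) (Enot (ERd 19 Gu))) (add_code Gv Gu) CSkip)) CSkip.
(** A pass over the edges that adds no vertex has reached a closed set, and at most [n] passes can
    add one: hence [n + 1] passes. *)
Definition grow_code :=
  CSeq (CSet 19 (ECst 0) 2 BN (Ebool (ERd 16 (EVar 2))))
    (CFor 5 (BAdd BN (BC 1)) (CFor 0 B2n grow_step)).

Section PruneSem.
Variables (ar : nat -> nat -> nat) (env : nat -> nat) (n j : nat) (gm' : nat -> nat).
Hypothesis hn : ar 0 0 = n.
Hypothesis hj : n + n - (env 5 + 1) = j.
Hypothesis h7 : forall v, v < n -> ar 7 (j * n + v) = gm' v.

Lemma ev_j i : eval ar (upd env 1 i) Ej = j.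
Proof. by rewrite /Ej !evE hn -hj. Qed.
Lemma ev_j2 : eval ar env Ej = j.
Proof. by rewrite /Ej !evE hn -hj. Qed.

Lemma tr_pmeets g a b : b \in [:: 14; 15] -> ar b j < n -> (forall v, v < n -> gm g v = gm' v) ->
  (eval ar env (Pmeets a (ERd b Ej)) != 0) = meets n g (tr (ar a)) (gm g (ar b j)).
Proof.
move=> hb bn hg; rewrite /Pmeets tr_ex bvalN hn; apply: eq_in_has => i.
rewrite mem_iota andTb add0n => iN; cbv beta.
rewrite tr_and tr_eq /Pcmp; congr (_ && _).
by rewrite !ev_rd !ev_add !ev_mul ev_rd !ev_j ev_EN hn ev_var -[upd _ _ _ 1]/(i) !h7 // !hg.
Qed.
End PruneSem.

Lemma prune_step_spec n k env i s : dims n k s -> i < n + n ->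
  let j := n + n - i.+1 in
  let s' := cexec (CSeq keep_code mark_code) (upd env 5 i) s in
  forall g la lb, (forall v, v < n -> arr s 7 (j * n + v) = gm g v) ->
  (forall v, v < n -> (arr s 8 (j * n + v) != 0) = act n la lb g (gm g v)) ->
  (arr s 13 j != 0 -> arr s 14 j < n /\ arr s 15 j < n) ->
  let a := arr s 14 j in let b := arr s 15 j in
  let x := gm g a in let y := gm g b in
  let M := meets n g (tr (arr s 17)) in let K := meets n g (tr (arr s 16)) in
  (tr (arr s' 18) j = (arr s 13 j != 0) && [&& M x || M y, M x || act n la lb g x, M y || act n la lb g y & ~~ (K x && K y)])
  /\ (forall l, l != j -> arr s' 18 l = arr s 18 l)
  /\ (forall v, v < n -> tr (arr s' 17) v = tr (arr s 17) v || (tr (arr s' 18) j && ((v == a) || (v == b)))).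
Proof.
move=> D iL j s' g la lb h7 h8 h13 a b x y M K; have [n0 k0] := D.
have [s1 q1] : exists z, z = cexec keep_code (upd env 5 i) s by eexists.
have es' : s' = cexec mark_code (upd env 5 i) s1 by rewrite /s' cexec_seq -q1.
have a1 c : c != 18 -> arr s1 c = arr s c by move=> h; rewrite q1 cexec_frame // inE.
have a2 c : c != 17 -> arr s' c = arr s1 c by move=> h; rewrite es' cexec_frame // inE.
have hj : n + n - (upd (upd env 5 i) 59 0 5 + 1) = j by rewrite -[upd _ _ _ _]/(i) addn1.
have hj0 : n + n - (upd env 5 i 5 + 1) = j by rewrite -[upd _ _ _ _]/(i) addn1.
have k18 l : arr s1 18 l = if l == j then nat_of_bool (eval (arr s) (upd (upd env 5 i) 59 0) Ekeep != 0) else arr s 18 l.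
  by rewrite q1 /keep_code cput_val (ev_j2 n0 hj0) ev_bool.
have kE : (eval (arr s) (upd (upd env 5 i) 59 0) Ekeep != 0) = (arr s 13 j != 0) && [&& M x || M y, M x || act n la lb g x, M y || act n la lb g y & ~~ (K x && K y)].
  rewrite /Ekeep tr_and ev_rd (ev_j2 n0 hj); case h: (arr s 13 j != 0) => //.
  have [an bn] := h13 h.
  have gE v : v < n -> gm g v = arr s 7 (j * n + v) by move=> vn; rewrite h7.
  rewrite !tr_and !tr_or tr_not tr_and.
  rewrite !(@tr_pmeets _ _ n j (fun v => arr s 7 (j * n + v)) n0 hj _ g) //.
  by rewrite !ev_rd !ev_add !ev_mul !ev_rd !(ev_j2 n0 hj) ?ev_EN ?ev_cst n0 !h8.
split; first by rewrite /tr a2 // k18 eqxx kE eqb0 negbK.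
split; first by move=> l lj; rewrite a2 // k18 (negPf lj).
have k18' : tr (arr s' 18) j = (arr s1 18 j != 0) by rewrite /tr a2.
move=> v vn; rewrite k18' /tr es' /mark_code cset0_val; last by rewrite /bvals /= a1 // n0.
have n1 : arr s1 0 0 = n by rewrite a1.
have hj2 : n + n - (upd (upd env 5 i) 2 v 5 + 1) = j by rewrite -[upd _ _ _ _]/(i) addn1.
rewrite tr_or tr_and tr_or !tr_eq /Pu /Pv !ev_rd !(ev_j2 n1 hj2) ev_var -[upd _ _ _ 2]/(v).
by rewrite [arr s1 17]a1 // [arr s1 14]a1 // [arr s1 15]a1.
Qed.

Definition evt (ar : nat -> nat -> nat) j := if ar 13 j != 0 then Some (ar 14 j, ar 15 j) else None.

Theorem prune_code_spec n k env s la lb (g : nat -> gstate) (eps : nat -> nat) : dims n k s ->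
  (forall j, j < n + n -> gstep n la lb (g j) (g j.+1) (evt (arr s) j) (eps j)) ->
  (forall j v, j <= n + n -> v < n -> arr s 7 (j * n + v) = gm (g j) v) ->
  (forall j v, j < n + n -> v < n -> (arr s 8 (j * n + v) != 0) = act n la lb (g j) (gm (g j) v)) ->
  let s' := cexec prune_code env s in
  exists mk : nat -> pred nat,
  [/\ forall j, j < n + n -> tr (arr s' 18) j = keep_spec n la lb g (evt (arr s)) (tr (arr s 16)) mk j,
      forall j v, j < n + n -> v < n -> mk j v = mark_spec (evt (arr s)) mk (tr (arr s' 18)) j v &
      mk (n + n) = tr (arr s 17)].
Proof.
move=> D Hst H7 H8 s'; rewrite /s' /prune_code cexec_for (dims_bval _ D) -[bval n k B2n]/(n + n).
pose st i := iteri i (fun i s => cexec (CSeq keep_code mark_code) (upd env 5 i) s) s.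
rewrite -/(st (n + n)).
have stS i : st i.+1 = cexec (CSeq keep_code mark_code) (upd env 5 i) (st i) by [].
have fr i a : a \notin [:: 18; 17] -> arr (st i) a = arr s a.
  by move=> h; elim: i => // i IH; rewrite stS cexec_frame.
have Di i : dims n k (st i) by case: D => h1 h2; split; rewrite fr.
have ab j : j < n + n -> arr s 13 j != 0 -> arr s 14 j < n /\ arr s 15 j < n.
  by move=> jL h; have [_ _] := Hst j jL; rewrite /evt h => -[].
have spec i (iL : i < n + n) := fun h1 h2 h3 =>
  @prune_step_spec n k env i (st i) (Di i) iL (g (n + n - i.+1)) la lb h1 h2 h3.
have {}spec i : i < n + n -> _ := fun iL => spec i iL
  (fun v vn => etrans (congr1 (fun f => f _) (fr i 7 isT)) (H7 _ v (leq_subr _ _) vn)).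
have jlt i : i < n + n -> n + n - i.+1 < n + n by move=> h; lia.
(* The marks for step [j] are the contents of array 17 after [2 n - j] iterations, when the steps
   from [j] on have been examined. *)
pose mk j := tr (arr (st (n + n - j)) 17).
have stab m i : i < m -> m <= n + n -> arr (st m) 18 (n + n - i.+1) = arr (st i.+1) 18 (n + n - i.+1).
  elim: m => // m IH; rewrite ltnS leq_eqVlt => /orP[/eqP -> //|im] mL.
  rewrite -IH // ?(ltnW mL) //.
  have [||_ [-> //]] := spec m mL; [| |by apply/eqP; lia].
    by move=> v vn; rewrite fr // H8 // jlt.
  by rewrite !fr //; apply: ab; apply: jlt.
exists mk; split.
- move=> j jL; pose i := n + n - j.+1; have iL : i < n + n by rewrite /i; lia.
  have ej : n + n - i.+1 = j by rewrite /i; lia.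
  have [||sp _] := spec i iL.
    by move=> v vn; rewrite fr // H8 // jlt.
    by rewrite !fr //; apply: ab; apply: jlt.
  have := stab (n + n) i iL (leqnn _); rewrite ej => e18.
  rewrite /tr e18 -/(tr _ _); move: sp; rewrite ej -stS => ->.
  have mE : tr (arr (st i) 17) = mk j.+1 by rewrite /mk.
  rewrite mE !fr // /keep_spec /evt; case: (arr s 13 j != 0) => //.
- move=> j v jL vn; pose i := n + n - j.+1; have iL : i < n + n by rewrite /i; lia.
  have ej : n + n - i.+1 = j by rewrite /i; lia.
  have [||_ [_ sp]] := spec i iL.
    by move=> w wn; rewrite fr // H8 // jlt.
    by rewrite !fr //; apply: ab; apply: jlt.
  have := stab (n + n) i iL (leqnn _); rewrite ej => e18.
  have ei : n + n - j = i.+1 by rewrite /i; lia.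
  have := sp v vn; rewrite ej -stS -ei -/(mk j) => ->.
  have kE : tr (arr (st (n + n)) 18) j = tr (arr (st i.+1) 18) j by rewrite /tr e18.
  have mE : mk j.+1 v = tr (arr (st i) 17) v by [].
  rewrite /mark_spec kE mE ei (fr _ 14) // (fr _ 15) // /evt; congr (_ || _).
  case h: (arr s 13 j != 0) => //.
  have [||sp1 _] := spec i iL.
    by move=> w wn; rewrite fr // H8 // jlt.
    by rewrite !fr //; apply: ab; apply: jlt.
  by move: sp1; rewrite ej -stS /tr => ->; rewrite (fr _ 13) // h.
- by rewrite /mk subnn.
Qed.

Theorem grow_code_spec n k env s c : dims n k s ->
  (forall u v, u < n -> v < n -> c u v = c v u) ->
  (forall i, i < n + n -> tr (arr s 18) i -> arr s 14 i < n /\ arr s 15 i < n) ->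
  let s' := cexec grow_code env s in
  grown n c (tr (arr s 16)) (n + n) (tr (arr s 18)) (arr s 14) (arr s 15) (tr (arr s' 19)) (arr s' 20)
  /\ edges_closed (n + n) (tr (arr s 18)) (arr s 14) (arr s 15) (tr (arr s' 19)).
Proof.
move=> D csym elt s'; rewrite /s' /grow_code cexec_seq.
have [s1 q1] : exists z, z = cexec (CSet 19 (ECst 0) 2 BN (Ebool (ERd 16 (EVar 2)))) env s by eexists.
rewrite -q1.
have a1 a : a != 19 -> arr s1 a = arr s a by move=> h; rewrite q1 cexec_frame // inE.
have D1 : dims n k s1 by case: D => h1 h2; split; rewrite a1.
pose kp := tr (arr s 18); pose ea := arr s 14; pose eb := arr s 15; pose base := tr (arr s 16).
pose gr x := grown n c base (n + n) kp ea eb (tr (arr x 19)) (arr x 20).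
pose frm x := forall a, a \notin [:: 19; 20] -> arr x a = arr s a.
pose I r x := [/\ frm x, gr x & edges_closed (n + n) kp ea eb (tr (arr x 19)) \/ r <= ncount n (tr (arr x 19))].
suff [_ h1 h2] : I n.+1 (cexec (CFor 5 (BAdd BN (BC 1)) (CFor 0 B2n grow_step)) env s1).
  split=> //; case: h2 => // h2.
  by have := leq_trans h2 (ncount_le n _); rewrite ltnn.
have -> : n.+1 = bvals s1 (BAdd BN (BC 1)) by rewrite (dims_bval _ D1) /= addn1.
apply: for_ind.
  split; last by right.
    by move=> a; rewrite !inE negb_or => /andP[h _]; apply: a1.
  apply: grown_init => v vn; rewrite /tr q1 cset0_val; last by rewrite (dims_bval _ D).
  by rewrite tr_bool ev_rd ev_var.
move=> r x _ [fx gx hx]; set G0 := tr (arr x 19) in hx.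
have Dx : dims n k x by case: D => h1 h2; split; rewrite fx.
(* Within a pass either a vertex has been added, or the set is unchanged and closed under the edges
   scanned so far; a set that was closed before is not changed. *)
pose J i y := [/\ frm y, gr y, forall w, w < n -> G0 w -> tr (arr y 19) w,
  (ncount n G0 < ncount n (tr (arr y 19)) \/
   (forall w, w < n -> tr (arr y 19) w = G0 w) /\
   (forall i', i' < i -> kp i' -> G0 (ea i') = G0 (eb i'))) &
  (edges_closed (n + n) kp ea eb G0 -> forall w, w < n -> tr (arr y 19) w = G0 w)].
suff [h1 h2 h3 h4 h5] : J (n + n) (cexec (CFor 0 B2n grow_step) (upd env 5 r) x).
  have tr_closed y : (forall w, w < n -> tr (arr y 19) w = G0 w) -> edges_closed (n + n) kp ea eb G0 ->
      edges_closed (n + n) kp ea eb (tr (arr y 19)).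
    by move=> hy hc i iL ki; have [? ?] := elt i iL ki; rewrite !hy //; apply: hc.
  split=> //; case: hx => hx; first by left; apply: tr_closed => //; apply: h5.
  case: h4 => [h|[h h']]; first by right; apply: leq_ltn_trans h.
  by left; apply: tr_closed.
have -> : n + n = bvals x B2n by rewrite (dims_bval _ Dx).
apply: for_ind; first by split=> //; right.
move=> i y; rewrite (dims_bval _ Dx) -[bval n k B2n]/(n + n) => iL [fy gy h3 h4 h5].
rewrite /grow_step cexec_if ev_rd ev_var -[upd _ _ _ 0]/(i) fy //.
set e := upd _ _ _; set G := tr (arr y 19) in h3 h4 h5.
case ki: (arr s 18 i != 0); last first.
  rewrite cexec_skip; split=> //; case: h4 => h4; [by left|right]; split; first exact: h4.1.
  move=> i'; rewrite ltnS leq_eqVlt => /orP[/eqP ->|]; last exact: h4.2.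
  by rewrite /kp /tr ki.
have [an bn] := elt i iL ki.
have uE z : frm z -> eval (arr z) e Gu = ea i by move=> fz; rewrite /Gu ev_rd ev_var fz.
have vE z : frm z -> eval (arr z) e Gv = eb i by move=> fz; rewrite /Gv ev_rd ev_var fz.
have add_spec U V u v : (forall z, frm z -> eval (arr z) e U = u) -> (forall z, frm z -> eval (arr z) e V = v) ->
    (forall z, frm z -> eval (arr z) (upd e 59 0) U = u) ->
    u < n -> v < n -> G u -> ~~ G v -> (u = ea i /\ v = eb i) \/ (u = eb i /\ v = ea i) ->
    J i.+1 (cexec (add_code U V) e y).
  move=> hU hV hU' un vn Gu0 Gv0 uv; rewrite /add_code cexec_seq.
  have [y1 p1] : exists z, z = cexec (CPut 20 V U) e y by eexists.
  have f1 a : a != 20 -> arr y1 a = arr y a by move=> h; rewrite p1 cexec_frame // inE.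
  have fy1 : frm y1 by move=> a ha; rewrite f1 ?fy //; apply: contra ha => /eqP ->; rewrite !inE eqxx orbT.
  rewrite -p1; have [y2 p2] : exists z, z = cexec (CPut 19 V (ECst 1)) e y1 by eexists.
  have f2 a : a != 19 -> arr y2 a = arr y1 a by move=> h; rewrite p2 cexec_frame // inE.
  have fy2 : frm y2 by move=> a ha; rewrite f2 ?fy1 //; apply: contra ha => /eqP ->; rewrite !inE eqxx.
  rewrite -p2.
  have G2 w : w < n -> tr (arr y2 19) w = G w || (w == v).
    by move=> wn; rewrite /tr p2 cput_val hV // ev_cst; case: (eqVneq w v) => _; [rewrite orbT | rewrite orbF f1].
  have P2 w : w < n -> arr y2 20 w = if w == v then u else arr y 20 w.
    by move=> wn; rewrite f2 // p1 cput_val hV // hU'.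
  have [g1 g2 g3] := grown_add csym elt gy iL ki uv un vn Gu0 Gv0 G2 P2.
  split=> //.
  + by move=> w wn /h3 h; apply: g3 => //; apply: h.
  + left; rewrite g2; case: h4 => [h|[h _]]; first exact: ltnW.
    by rewrite ltnS /ncount; apply: leq_sum => w _; rewrite -/G h.
  + move=> hc; exfalso; have := hc i iL ki.
    have hG := h5 hc; case: uv => -[eu ev]; rewrite -eu -ev -!hG // Gu0 (negPf Gv0) //.
have G19 W : eval (arr y) e (ERd 19 W) = arr y 19 (eval (arr y) e W) by [].
rewrite cexec_if tr_and tr_not (G19 Gu) (G19 Gv) uE // vE //.
case hc: (G (ea i) && ~~ G (eb i)).
  case/andP: hc => hc1 hc2.
  apply: (add_spec Gu Gv (ea i) (eb i)) => //; try by [exact: uE | exact: vE | left].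
rewrite cexec_if tr_and tr_not (G19 Gu) (G19 Gv) uE // vE //.
case hd: (G (eb i) && ~~ G (ea i)).
  case/andP: hd => hd1 hd2.
  apply: (add_spec Gv Gu (eb i) (ea i)) => //; try by [exact: uE | exact: vE | right].
rewrite cexec_skip; split=> //; case: h4 => h4; [by left|right]; split; first exact: h4.1.
move=> i'; rewrite ltnS leq_eqVlt => /orP[/eqP ->|]; last exact: h4.2.
by move=> _; rewrite -!h4.1 //; move: hc hd; rewrite -/G; case: (G _); case: (G _).
Qed.

(** * Value of the pruned forest *)

Definition forest_code := CSeq prune_code grow_code.

(** [kept_connected] is applied to the grown set itself, which therefore contains all marked
    vertices and misses no budget that the potential [lhs] does not count. The last two conclusions
    serve the pair runs and the root run. *)
Theorem forest_code_spec n k env s la lb c0 b0 bL : dims n k s ->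
  hist n la lb c0 b0 bL (arr s 7) (arr s 8) (arr s 13) (arr s 14) (arr s 15) ->
  (forall u v, u < n -> v < n -> c0 u v = c0 v u) ->
  let K := tr (arr s 16) in let M := tr (arr s 17) in
  (forall v, v < n -> K v -> M v) ->
  (forall g v, v < n -> M v -> ~~ meets n g K (gm g v) -> act n la lb g (gm g v)) ->
  (forall g x, meets n g la x -> meets n g lb x -> meets n g K x) ->
  let s' := cexec forest_code env s in
  let G := tr (arr s' 19) in let P := arr s' 20 in
  let val := \sum_(v < n) (G v && ~~ K v) * c0 v (P v) + \sum_(v < n) ~~ G v * b0 v in
  [/\ forall v, v < n -> M v -> G v,
      exists r : nat -> nat, forall v, v < n -> G v -> ~~ K v ->
        [/\ P v < n, G (P v), r (P v) < r v & r v <= n],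
      forall a b p, a < n -> b < n -> (forall v, v < n -> la v = (v == a)) ->
        (forall v, v < n -> lb v = (v == b)) -> (forall v, v < n -> K v = (v == b)) ->
        all (fun v => v < n) p -> last a p = b ->
        val <= path_sum c0 a p + \sum_(v < n) ((v : nat) \notin a :: p) * b0 v &
      (forall v, v < n -> la v = lb v) ->
        2 ^ (n + n) * val + \sum_(v < n) ~~ K v * bL v <= 2 ^ (n + n) * \sum_(v < n) ~~ K v * b0 v].
Proof.
move=> D [g [eps [Hst [i0 i1 i2 i3] Hf H7 H8]]] csym K M HK HM HL s' G P val.
have [s1 q1] : exists x, x = cexec prune_code env s by eexists.
have a1 a : a \notin [:: 18; 17] -> arr s1 a = arr s a by move=> h; rewrite q1 cexec_frame.
have es' : s' = cexec grow_code env s1 by rewrite /s' /forest_code cexec_seq -q1.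
have D1 : dims n k s1 by case: D => h1 h2; split; rewrite a1.
have [mk [Hkeep Hmk mkL]] := prune_code_spec env D Hst H7 H8; rewrite -q1 -/K -/M in Hkeep Hmk mkL.
set keep := tr (arr s1 18) in Hkeep Hmk.
set evs := evt (arr s) in Hst Hkeep Hmk.
have HK' v : v < n -> K v -> mk (n + n) v by rewrite mkL; apply: HK.
have HM' j v : j <= n + n -> v < n -> mk (n + n) v ->
    ~~ meets n (g j) K (gm (g j) v) -> act n la lb (g j) (gm (g j) v).
  by move=> _ vn; rewrite mkL; apply: HM.
have HL' j x : j <= n + n -> meets n (g j) la x -> meets n (g j) lb x -> meets n (g j) K x.
  by move=> _; apply: HL.
have kab i : i < n + n -> keep i -> [/\ ea evs i = arr s 14 i, eb evs i = arr s 15 i, arr s 14 i < n & arr s 15 i < n].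
  move=> iL ki; have [ee an bn _] := keepP Hst Hkeep iL ki.
  move: ee an bn; rewrite /ea /eb /evs /evt; by case: ifP => // _ _ ? ?; split.
have elt i : i < n + n -> tr (arr s1 18) i -> arr s1 14 i < n /\ arr s1 15 i < n.
  by move=> iL ki; rewrite (a1 14) // (a1 15) //; have [] := kab i iL ki.
have [[g1 [r r0 g2] g3] g4] := grow_code_spec env D1 csym elt.
have e14 : arr s1 14 = arr s 14 by apply: a1.
have e15 : arr s1 15 = arr s 15 by apply: a1.
have e16 : arr s1 16 = arr s 16 by apply: a1.
rewrite -es' ?e14 ?e15 ?e16 -/K -/G -/P -/keep in r0 g1 g2 g3 g4.
have conn v : v < n -> mk 0 v -> G v.
  move=> vn mv.
  apply: (@kept_connected n la lb (n + n) g evs eps Hst Hf K mk keep Hkeep Hmk HK' HM' 0 G (leq0n _) _ _ _ v vn).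
  - exact: g1.
  - by move=> u w un wn; rewrite (i0 u un) (i0 w wn) => ->.
  - move=> i iL ki; have iL' : i < n + n by [].
    by have [-> -> _ _] := kab i iL' ki; apply: g4.
  - by apply: meets_self.
have mk0 v : v < n -> mk (n + n) v -> mk 0 v by move=> vn h; apply: (mk_mono Hmk _ vn h); rewrite leq0n leqnn.
have valle : val <= lhs n (n + n) g evs mk keep 0.
  rewrite lhs_init //; apply: leq_add.
    apply: leq_trans g3 _; rewrite !big_nat; apply: leq_sum => i iL.
    case ki: (keep i) => //=; have [e1 e2 an bn] := kab i iL ki.
    by rewrite e1 e2 i1 // mul1n; case: (_ && _); rewrite ?mul1n.
  apply: leq_sum => v _; rewrite i2 // leq_mul2r; apply/orP; right.
  case mv: (mk 0 v); last by rewrite leq_b1.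
  by rewrite conn.
split.
- by move=> v vn Mv; apply: conn => //; apply: mk0 => //; rewrite mkL.
- exists r => v vn Gv Kv; have [p1 p2 p3 p4] := g2 v vn Gv Kv; split=> //.
  apply: leq_trans p4 _; exact: (ncount_le n (fun u => G u && ~~ K u)).
- move=> a b p an bn laE lbE KE pn lp; apply: leq_trans valle _.
  have := pair_bound Hst i0 Hf Hkeep Hmk HK' HM' HL' (leq0n _) an bn laE lbE KE pn lp.
  have -> : \sum_(v < n) ((v : nat) \notin a :: p) * gb (g 0) v = \sum_(v < n) ((v : nat) \notin a :: p) * b0 v.
    by apply: eq_bigr => v _; rewrite i2.
  suff -> : path_sum (gc (g 0)) a p = path_sum c0 a p by [].
  elim: p a an pn {lp laE} => //= y p IH a an /andP[yn pn].
  by rewrite i1 // IH.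
- move=> lab; have := root_upper Hst i0 Hf Hkeep Hmk HK' HM' HL' (leq0n _) lab; rewrite subn0.
  have -> : \sum_(v < n) ~~ K v * gb (g (n + n)) v = \sum_(v < n) ~~ K v * bL v.
    by apply: eq_bigr => v _; rewrite i3.
  have -> : \sum_(v < n) ~~ K v * gb (g 0) v = \sum_(v < n) ~~ K v * b0 v.
    by apply: eq_bigr => v _; rewrite i2.
  by apply: leq_trans; rewrite leq_add2r leq_mul2l valle orbT.
Qed.

Lemma hist_le n la lb c0 b0 bL cm ac mg eu ev : hist n la lb c0 b0 bL cm ac mg eu ev ->
  forall v, v < n -> bL v <= 2 ^ (n + n) * b0 v.
Proof.
move=> [g [eps [Hst [i0 i1 i2 i3] _ _ _]]] v vn; rewrite -i3 // -i2 //.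
suff H j : j <= n + n -> gb (g j) v <= 2 ^ j * gb (g 0) v by apply: H.
elim: j => [|j IH] jL; first by rewrite mul1n.
have [_ /(_ v vn) h _] := Hst j jL.
by have := IH (ltnW jL); rewrite expnS -mulnA; lia.
Qed.

Lemma hist_lower n la lb c0 b0 bL cm ac mg eu ev (ps : seq (nat * seq nat)) (O : pred nat) :
  hist n la lb c0 b0 bL cm ac mg eu ev ->
  (forall q, q \in ps -> [/\ q.1 < n, all (fun v => v < n) q.2, la q.1 && lb q.1 &
     la (last q.1 q.2) && lb (last q.1 q.2)]) ->
  (forall v, O v = has (fun q : nat * seq nat => v \in q.1 :: q.2) ps) ->
  2 ^ (n + n) * \sum_(v < n) O v * b0 v <=
  2 ^ (n + n) * \sum_(q <- ps) path_sum c0 q.1 q.2 + \sum_(v < n) O v * bL v.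
Proof.
move=> [g [eps [Hst [i0 i1 i2 i3] _ _ _]]] Hps HO.
have := root_lower Hst i0 (leq0n _) Hps HO; rewrite subn0.
have -> : \sum_(v < n) O v * gb (g 0) v = \sum_(v < n) O v * b0 v.
  by apply: eq_bigr => v _; rewrite i2.
have -> : \sum_(v < n) O v * gb (g (n + n)) v = \sum_(v < n) O v * bL v.
  by apply: eq_bigr => v _; rewrite i3.
suff -> : \sum_(q <- ps) path_sum (gc (g 0)) q.1 q.2 = \sum_(q <- ps) path_sum c0 q.1 q.2 by [].
rewrite big_seq [RHS]big_seq; apply: eq_bigr => q /Hps[qn pn _ _].
elim: q.2 q.1 qn pn => //= y p IH a an /andP[yn pn].
by rewrite i1 // IH.
Qed.

Lemma hist_ext n la lb c0 c0' b0 b0' bL cm ac mg eu ev cm' ac' mg' eu' ev' :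
  hist n la lb c0 b0 bL cm ac mg eu ev ->
  (forall u v, u < n -> v < n -> c0 u v = c0' u v) -> (forall v, v < n -> b0 v = b0' v) ->
  (forall i, i < (n + n).+1 * n -> cm i = cm' i) -> (forall i, i < (n + n) * n -> ac i = ac' i) ->
  (forall j, j < n + n -> [/\ mg j = mg' j, eu j = eu' j & ev j = ev' j]) ->
  hist n la lb c0' b0' bL cm' ac' mg' eu' ev'.
Proof.
move=> [g [eps [Hst [i0 i1 i2 i3] Hf H7 H8]]] hc hb h1 h2 h3; exists g, eps; split=> //.
- by move=> j jL; have [<- <- <-] := h3 j jL; apply: Hst.
- by split=> //; [move=> u v un vn; rewrite i1 ?hc | move=> v vn; rewrite i2 ?hb].
- by move=> j v jL vn; rewrite -h1 ?H7 // idx_lt.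
- by move=> j v jL vn; rewrite -h2 ?H8 // idx_lt.
Qed.

Ltac seq_step s q f :=
  match goal with |- context [cexec (CSeq ?c1 ?c2) ?e ?s0] =>
    rewrite -> (cexec_seq c1 c2 e s0);
    let E := fresh in
    assert (E : exists z, z = cexec c1 e s0) by (eexists; reflexivity);
    destruct E as [s q]; rewrite <- q;
    assert (f : forall a, a \notin writes c1 -> arr s a = arr s0 a)
      by (intros ? ?; rewrite q; apply cexec_frame; assumption)
  end.

(** Large factors such as [2 ^ (n + n)] or a product of denominators are applied one factor per
    pass, since products need a small right factor. *)
Lemma map_for a y x b bd e env s (F : nat -> nat -> nat -> nat) : a != 0 ->
  (forall s' j i, (forall a', a' != a -> arr s' a' = arr s a') ->
     j < bvals s b -> i < bvals s bd ->
     eval (arr s') (upd (upd env y j) x i) e = F j i (arr s' a i)) ->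
  forall i, i < bvals s bd ->
  arr (cexec (CFor y b (CSet a (ECst 0) x bd e)) env s) a i =
  iteri (bvals s b) (fun j z => F j i z) (arr s a i).
Proof.
move=> a0 H i iB; rewrite cexec_for; set c := CSet _ _ _ _ _.
pose st j := iteri j (fun i s => cexec c (upd env y i) s) s.
have stS j : st j.+1 = cexec c (upd env y j) (st j) by [].
have fr j a' : a' != a -> arr (st j) a' = arr s a'.
  by move=> h; elim: j => // j IH; rewrite stS cexec_frame // inE.
have bE j : bvals (st j) bd = bvals s bd by rewrite /bvals fr // eq_sym.
suff S j : j <= bvals s b -> arr (st j) a i = iteri j (fun j z => F j i z) (arr s a i) by apply: S.
elim: j => // j IH jB.
rewrite stS cset0_val ?bE // H // ?IH //; first exact: ltnW.
exact: fr.
Qed.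

Lemma iteri_prod B (m : nat -> nat) z :
  iteri B (fun j w => m j * w) z = (\prod_(j < B) m j) * z.
Proof. by elim: B => [|B IH] /=; rewrite ?big_ord0 ?mul1n // IH big_ord_recr /= mulnCA mulnA. Qed.

(** Position of the first terminal: two sizes precede it, and the numerators and denominators of
    [n * n] costs and [n] penalties. *)
Definition tbase (n : nat) := 2 + n * n + n * n + n + n.
Definition Etb := ECst 2 +e Esq +e Esq +e EN +e EN.
Definition ES (i : expr) := ERd 0 (Etb +e i +e i).
Definition ET (i : expr) := ERd 0 (Etb +e i +e i +e ECst 1).
Definition Ent (i : expr) := Enot (Eeq (ES i) (ET i)).

Section Inst.
Variables (n k : nat) (inp : nat -> nat).
Definition sI i := inp (tbase n + i + i).
Definition tI i := inp (tbase n + i + i + 1).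
(** Pairs with equal ends are set apart: a path without repetitions from a vertex to itself is that
    vertex alone and can collect nothing. *)
Definition nt i := sI i != tI i.

Definition Base (s : lstate) := dims n k s /\ arr s 0 = inp.

Lemma Base_arr s s' : arr s' 0 = arr s 0 -> Base s -> Base s'.
Proof. by move=> h [[d1 d2] I]; split; [split; rewrite h | rewrite h]. Qed.

Lemma ev_S s env e : Base s -> eval (arr s) env (ES e) = sI (eval (arr s) env e).
Proof. by move=> [[d1 _] I]; rewrite /ES /Etb ev_rd !ev_add !ev_Esq !ev_EN ev_cst d1 I. Qed.

Lemma ev_T s env e : Base s -> eval (arr s) env (ET e) = tI (eval (arr s) env e).
Proof. by move=> [[d1 _] I]; rewrite /ET /Etb ev_rd !ev_add !ev_Esq !ev_EN !ev_cst d1 I. Qed.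

Lemma tr_nt s env e : Base s -> (eval (arr s) env (Ent e) != 0) = nt (eval (arr s) env e).
Proof. by move=> B; rewrite /Ent tr_not tr_eq ev_S // ev_T. Qed.
End Inst.

(** * Preprocessing *)

(* Arrays: 1 scaled costs and penalties, 2 penalties with those of the terminals
   set to 0, 21 charges, 22 and 23 vertex sets and parent maps of the trees of all
   rounds, 25 and 33 weights and values in the selection, 26 selected rounds,
   29 pair owning a forest vertex, 30-32 current path, 36 terminals of the pairs
   with [s <> t], 37 values of the two candidates, 41-45 copy of the history of
   the root run. *)

Definition read_code := CFor 5 (BAdd Bsq (BAdd Bsq (BAdd B2n (BAdd BK BK)))) (CRead (EVar 5)).

Lemma read_code_spec n k x : 1 < size x -> nth 0 x 0 = n -> nth 0 x 1 = k ->
  size x = tbase n + k + k ->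
  let s := cexec read_code (fun=> 0) (start_state x) in
  dims n k s /\ (forall i, i < size x -> arr s 0 i = nth 0 x i) /\ lout s = [::].
Proof.
move=> x1 x0 xk sx s.
have D0 : dims n k (start_state x) by split.
pose I j (z : lstate) := [/\ forall i, arr z 0 i = if i < j.+2 then nth 0 x i else 0,
  linp z = drop j.+2 x & lout z = [::]].
suff [h1 _ h2] : I (n * n + (n * n + (n + n + (k + k)))) s.
  split; first by split; rewrite h1.
  split=> // i ix; rewrite h1 ifT //; move: ix; rewrite sx /tbase; lia.
have -> : n * n + (n * n + (n + n + (k + k))) = bvals (start_state x) (BAdd Bsq (BAdd Bsq (BAdd B2n (BAdd BK BK)))).
  by rewrite (dims_bval _ D0).
apply: for_ind; first by split.
Transparent cexec.
move=> j z jB [h1 h2 h3]; split=> //=.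
- move=> i; rewrite /upd /= h1 h2 -nth0 nth_drop addn0.
  case: eqP => [->|/eqP ne]; first by rewrite ltnS leqnn.
  by rewrite (ltnS i j.+2) (leq_eqVlt i) (negPf ne).
- by rewrite h2 -drop1 drop_drop.
Qed.
Opaque cexec.

(** Each numerator is multiplied by the denominators of all other numbers, which scales everything
    by the product of all denominators. *)
Definition scale_code := CSeq (CSet 1 (ECst 0) 3 Bcand (ERd 0 (ECst 2 +e EVar 3 +e EVar 3)))
  (CFor 5 Bcand (CSet 1 (ECst 0) 3 Bcand (EIf (Eeq (EVar 3) (EVar 5)) (ERd 1 (EVar 3))
     (ERd 1 (EVar 3) *e ERd 0 (ECst 2 +e EVar 5 +e EVar 5 +e ECst 1))))).

Lemma scale_code_spec n k env s : dims n k s ->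
  let s' := cexec scale_code env s in
  forall i, i < n * n + n -> arr s' 1 i =
    (\prod_(j < n * n + n) (if i == j then 1 else arr s 0 (2 + j + j + 1))) * arr s 0 (2 + i + i).
Proof.
move=> D s' i iN; rewrite /s' /scale_code; seq_step s1 q1 f1.
have D1 : dims n k s1 by case: D => h1 h2; split; rewrite f1.
have bE : bvals s1 Bcand = n * n + n by rewrite (dims_bval _ D1).
rewrite (map_for (F := fun j i z => (if i == j then 1 else arr s 0 (2 + j + j + 1)) * z)) ?bE //.
  rewrite iteri_prod q1 cset0_val; last by rewrite (dims_bval _ D).
  by rewrite !evE.
move=> z j l fz jB lB; rewrite ev_if tr_eq !evE -[upd _ _ _ 3]/(l) -[upd _ _ _ 5]/(j).
by rewrite [arr z 0]fz // f1 //; case: ifP => _; rewrite ?mul1n // mulnC.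
Qed.

(** A terminal is on a path of every feasible solution. The budget 0 matters when it belongs only to
    pairs with equal ends: such a vertex is no root, and could be charged although no solution pays
    for it. *)
Definition pi_code := CSet 2 (ECst 0) 2 BN
  (EIf (Eex 1 BK (Eor (Eeq (EVar 2) (ES (EVar 1))) (Eeq (EVar 2) (ET (EVar 1)))))
       (ECst 0) (ERd 1 (Esq +e EVar 2))).

Lemma pi_code_spec n k inp env s : Base n k inp s ->
  let s' := cexec pi_code env s in
  forall v, v < n -> arr s' 2 v =
    if has (fun i => (v == sI n inp i) || (v == tI n inp i)) (iota 0 k) then 0 else arr s 1 (n * n + v).
Proof.
move=> B s' v vn; have [D _] := B; rewrite /s' /pi_code cset0_val; last by rewrite (dims_bval _ D).
rewrite ev_if tr_ex -[bval _ _ BK]/(arr s 0 1) D.2.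
congr (if _ then _ else _); last by rewrite ev_rd ev_add ev_Esq ev_var D.1.
apply: eq_has => i; cbv beta; rewrite tr_or !tr_eq (ev_S _ _ B) (ev_T _ _ B) !ev_var.
by [].
Qed.

Definition k0_code := CSet 36 (ECst 0) 2 BN (Ebool (Eex 1 BK (Eand (Ent (EVar 1))
   (Eor (Eeq (EVar 2) (ES (EVar 1))) (Eeq (EVar 2) (ET (EVar 1))))))).

Lemma k0_code_spec n k inp env s : Base n k inp s ->
  let s' := cexec k0_code env s in
  forall v, v < n -> tr (arr s' 36) v =
    has (fun i => nt n inp i && ((v == sI n inp i) || (v == tI n inp i))) (iota 0 k).
Proof.
move=> B s' v vn; have [D _] := B; rewrite /tr /s' /k0_code cset0_val; last by rewrite (dims_bval _ D).
rewrite tr_bool tr_ex -[bval _ _ BK]/(arr s 0 1) D.2.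
apply: eq_has => i; cbv beta; rewrite tr_and tr_or !tr_eq (tr_nt _ _ B) (ev_S _ _ B) (ev_T _ _ B) !ev_var.
by [].
Qed.

Definition Bh := BMulN (BAdd B2n (BC 1)).
Definition copy (a b : nat) := CSet b (ECst 0) 3 Bh (ERd a (EVar 3)).

(** Costs are doubled because the forest edges will be doubled. Array 21 becomes the loss of budget
    during the run, brought to its final scale [2 ^ (n + n)]. The history is copied since the pair
    runs overwrite the arrays 7 to 15. *)
Definition root_code :=
  CSeq (CSet 3 (ECst 0) 3 Bsq (ERd 1 (EVar 3) +e ERd 1 (EVar 3)))
  (CSeq (CSet 4 (ECst 0) 2 BN (ERd 2 (EVar 2)))
  (CSeq (CSet 5 (ECst 0) 2 BN (ERd 36 (EVar 2)))
  (CSeq (CSet 6 (ECst 0) 2 BN (ERd 36 (EVar 2)))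
  (CSeq moat_code
  (CSeq (CSet 21 (ECst 0) 2 BN (ERd 2 (EVar 2)))
  (CSeq (CFor 5 B2n (CSet 21 (ECst 0) 2 BN (ERd 21 (EVar 2) +e ERd 21 (EVar 2))))
  (CSeq (CSet 21 (ECst 0) 2 BN (ERd 21 (EVar 2) -e ERd 4 (EVar 2)))
  (CSeq (copy 7 41) (CSeq (copy 8 42) (CSeq (copy 13 43) (CSeq (copy 14 44) (copy 15 45)))))))))))).

Lemma hist_lab n (la lb la' lb' : pred nat) c0 b0 bL cm ac mg eu ev :
  (forall v, v < n -> la v = la' v) -> (forall v, v < n -> lb v = lb' v) ->
  hist n la lb c0 b0 bL cm ac mg eu ev -> hist n la' lb' c0 b0 bL cm ac mg eu ev.
Proof.
move=> ha hb.
have mE g (P Q : pred nat) x : (forall v, v < n -> P v = Q v) -> meets n g P x = meets n g Q x.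
  by move=> h; apply: eq_in_has => v; rewrite mem_iota andTb add0n => vn; cbv beta; rewrite h.
have aE g x : act n la lb g x = act n la' lb' g x by rewrite /act (mE g la la') // (mE g lb lb').
have pE g v : pay n la lb g v = pay n la' lb' g v by rewrite /pay (mE g la la') // (mE g lb lb').
have rE g u v : rate n la lb g u v = rate n la' lb' g u v by rewrite /rate !aE.
move=> [g [eps [Hst Hi Hf H7 H8]]]; exists g, eps; split=> //.
- move=> j jL; have [h1 h2 h3] := Hst j jL; split=> //.
    by move=> u v un vn; rewrite -rE; apply: h1.
  by move=> v vn; rewrite -pE; apply: h2.
- by move=> v vn; rewrite -aE; apply: Hf.
- by move=> j v jL vn; rewrite -aE; apply: H8.
Qed.

Lemma root_code_spec n k env s : dims n k s ->
  let s' := cexec root_code env s in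
  exists bL, [/\ forall v, v < n -> arr s' 21 v + bL v = 2 ^ (n + n) * arr s 2 v &
    hist n (tr (arr s 36)) (tr (arr s 36)) (fun u v => 2 * arr s 1 (u * n + v)) (arr s 2) bL
      (arr s' 41) (arr s' 42) (arr s' 43) (arr s' 44) (arr s' 45)].
Proof.
move=> D s'; rewrite /s' /root_code.
seq_step s1 q1 f1; seq_step s2 q2 f2; seq_step s3 q3 f3; seq_step s4 q4 f4; seq_step s5 q5 f5.
seq_step s6 q6 f6; seq_step s7 q7 f7; seq_step s8 q8 f8; seq_step s9 q9 f9; seq_step s10 q10 f10.
seq_step s11 q11 f11; seq_step s12 q12 f12.
have [s13 q13] : exists z, z = cexec (copy 15 45) env s12 by eexists.
rewrite -q13; have f13 a : a \notin [:: 45] -> arr s13 a = arr s12 a by move=> h; rewrite q13 cexec_frame.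
have z1 : arr s1 0 = arr s 0 by apply: f1. have z2 : arr s2 0 = arr s 0 by rewrite f2.
have z3 : arr s3 0 = arr s 0 by rewrite f3. have z4 : arr s4 0 = arr s 0 by rewrite f4.
have z5 : arr s5 0 = arr s 0 by rewrite f5. have z6 : arr s6 0 = arr s 0 by rewrite f6.
have z7 : arr s7 0 = arr s 0 by rewrite f7. have z8 : arr s8 0 = arr s 0 by rewrite f8.
have z9 : arr s9 0 = arr s 0 by rewrite f9. have z10 : arr s10 0 = arr s 0 by rewrite f10.
have z11 : arr s11 0 = arr s 0 by rewrite f11. have z12 : arr s12 0 = arr s 0 by rewrite f12.
have DD z : arr z 0 = arr s 0 -> dims n k z by case: D => d1 d2 h; split; rewrite h.
have bN z : arr z 0 = arr s 0 -> bvals z BN = n by move=> /DD h; rewrite (dims_bval _ h).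
have v3 i : i < n * n -> arr s4 3 i = 2 * arr s 1 i.
  move=> iN; rewrite f4 // f3 // f2 // q1 cset0_val ?(dims_bval _ D) // !evE.
  by rewrite mul2n addnn.
have v4 v : v < n -> arr s4 4 v = arr s 2 v.
  by move=> vn; rewrite f4 // f3 // q2 cset0_val ?bN // !evE f1.
have v5 v : v < n -> arr s4 5 v = arr s 36 v.
  by move=> vn; rewrite f4 // q3 cset0_val ?bN // !evE f2 // f1.
have v6 v : v < n -> arr s4 6 v = arr s 36 v.
  by move=> vn; rewrite q4 cset0_val ?bN // !evE f3 // f2 // f1.
have B4 : balanced n (tr (arr s4 5)) (tr (arr s4 6)).
  by apply: eq_in_has => v; rewrite mem_iota andTb add0n => vn; rewrite /tr v5 // v6.
have H := moat_code_spec env (DD _ z4) B4; rewrite -q5 in H.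
have {}H := hist_lab (la' := tr (arr s 36)) (lb' := tr (arr s 36)) _ _ H.
have {}H := H (fun v vn => congr1 (fun m => m != 0) (v5 v vn)) (fun v vn => congr1 (fun m => m != 0) (v6 v vn)).
have le := hist_le H.
exists (arr s5 4); split.
  move=> v vn; rewrite f13 // f12 // f11 // f10 // f9 // q8 cset0_val ?bN // !evE -[upd _ _ _ 2]/(v).
  rewrite [arr s7 4]f7 // [arr s6 4]f6 //.
  suff -> : arr s7 21 v = 2 ^ (n + n) * arr s 2 v by rewrite subnK //; have := le v vn; rewrite v4.
  have b6 : bvals s6 B2n = n + n by rewrite (dims_bval _ (DD _ z6)).
  rewrite q7 (map_for (F := fun j i z => 2 * z)) ?bN //.
    rewrite b6 iteri_prod prod_nat_const card_ord q6 cset0_val ?bN // !evE -[upd _ _ _ 2]/(v).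
    by rewrite f5 // f4 // f3 // f2 // f1.
  by move=> z j i fz jB iB; rewrite !evE mul2n addnn.
have cp a b (x y : lstate) i : y = cexec (copy a b) env x -> arr x 0 = arr s 0 ->
    i < (n + n).+1 * n -> arr y b i = arr x a i.
  move=> -> hx iN; rewrite /copy cset0_val ?evE //; rewrite (dims_bval _ (DD _ hx)) /=.
  by rewrite addn1.
have le1 : n + n <= (n + n).+1 * n by case: (n) => // m; nia.
apply: (hist_ext H).
- by move=> u v un vn; rewrite v3 // idx_lt.
- by move=> v vn; rewrite v4.
- move=> i iN; rewrite f13 // f12 // f11 // f10 // (cp _ _ _ _ _ q9) //.
  by rewrite f8 // f7 // f6.
- move=> i iN; have iN' : i < (n + n).+1 * n by apply: leq_trans iN _; rewrite leq_mul2r leqnSn orbT.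
  rewrite f13 // f12 // f11 // (cp _ _ _ _ _ q10) //.
  by rewrite f9 // f8 // f7 // f6.
- move=> j jL; have jN : j < (n + n).+1 * n by apply: leq_trans jL le1.
  split.
  + by rewrite f13 // f12 // (cp _ _ _ _ _ q11) // f10 // f9 // f8 // f7 // f6.
  + by rewrite f13 // (cp _ _ _ _ _ q12) // f11 // f10 // f9 // f8 // f7 // f6.
  + by rewrite (cp _ _ _ _ _ q13) // f12 // f11 // f10 // f9 // f8 // f7 // f6.
Qed.

Transparent cexec eval.

(** * The rounds *)

Definition EK := ERd 0 (ECst 1).
Definition Eslot (t i : expr) := (t *e EK +e i) *e EN.
Definition Etg (t i v : expr) := ERd 22 (Eslot t i +e v).
Definition Etp (t i v : expr) := ERd 23 (Eslot t i +e v).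

(** The total factor is [2 * 625 * 4 ^ k.-1 * 2 ^ (n + n)]. Skipping the pair itself in the loop
    over all pairs leaves [k.-1] factors 4, and [25 * 50] is [2 * 625] in constants below 64. *)
Definition cost_setup :=
  CSeq (CSet 3 (ECst 0) 3 Bsq (ERd 1 (EVar 3)))
  (CSeq (CFor 5 B2n (CSet 3 (ECst 0) 3 Bsq (ERd 3 (EVar 3) +e ERd 3 (EVar 3))))
  (CSeq (CFor 5 BK (CSet 3 (ECst 0) 3 Bsq
           (EIf (Eeq (EVar 5) (EVar 6)) (ERd 3 (EVar 3)) (ERd 3 (EVar 3) *e ECst 4))))
        (CSet 3 (ECst 0) 3 Bsq (ERd 3 (EVar 3) *e ECst 25 *e ECst 50)))).
(** The budget [gam t * chi * others] is built factor by factor; multiplication by [avail] is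
    addition over the trees that miss the vertex. *)
Definition lam_setup :=
  CSeq (CSet 4 (ECst 0) 2 BN (ERd 21 (EVar 2)))
  (CSeq (CFor 5 (BC 4) (CSet 4 (ECst 0) 2 BN
           (EIf (Elt (EVar 5) (EVar 7)) (ERd 4 (EVar 2) *e ECst 5) (ERd 4 (EVar 2) *e ECst 4))))
        (CFor 5 BK (CSet 4 (ECst 0) 2 BN (EIf (Eeq (EVar 5) (EVar 6)) (ERd 4 (EVar 2))
           (ESum 3 (BC 4) (EIf (Etg (EVar 3) (EVar 5) (EVar 2)) (ECst 0) (ERd 4 (EVar 2)))))))).
Definition vset (a : nat) (e : expr) := CSet a (ECst 0) 2 BN e.
Definition at_s := Eeq (EVar 2) (ES (EVar 6)).
Definition at_t := Eeq (EVar 2) (ET (EVar 6)).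
Definition pair_code :=
  CSeq cost_setup (CSeq lam_setup (CSeq (vset 5 at_s) (CSeq (vset 6 at_t)
  (CSeq (vset 16 at_t) (CSeq (vset 17 (Eor at_s at_t)) (CSeq moat_code (CSeq forest_code
  (CSeq (CSet 22 (Eslot (EVar 7) (EVar 6)) 2 BN (ERd 19 (EVar 2)))
        (CSet 23 (Eslot (EVar 7) (EVar 6)) 2 BN (ERd 20 (EVar 2))))))))))).
Definition rounds_code := CFor 7 (BC 4) (CFor 6 BK (CIf (Ent (EVar 6)) pair_code CSkip)).

Lemma prod_others k i m : i < k -> \prod_(j < k) (if (j : nat) == i then 1 else m) = m ^ k.-1.
Proof.
move=> ik; rewrite (bigD1 (Ordinal ik)) //= eqxx mul1n.
rewrite (eq_bigr (fun=> m)); last by move=> j; rewrite -val_eqE /= => /negPf ->.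
by rewrite prod_nat_const cardC1 card_ord.
Qed.

Lemma gam_prod t : t < 4 -> \prod_(r < 4) (if r < t then 5 else 4) = gam t.
Proof.
by case: t => [|[|[|[|t]]]] // _; rewrite !big_ord_recr big_ord0.
Qed.

Lemma path_sum_scale S c x p : path_sum (fun u v => S * c u v) x p = S * path_sum c x p.
Proof. by elim: p x => [|y p IH] x /=; rewrite ?muln0 // IH mulnDr. Qed.

Section Pair.
Variables (n k : nat) (inp : nat -> nat).

Definition slot (a : nat -> nat) (t i v : nat) : nat := a ((t * k + i) * n + v).
Definition TT (s : lstate) (t i : nat) : pred nat := fun v => slot (arr s 22) t i v != 0.
Definition PP (s : lstate) (t i v : nat) : nat := slot (arr s 23) t i v.
Definition tcost (c : nat -> nat -> nat) (G : pred nat) (P : nat -> nat) (b : nat) : nat :=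
  \sum_(v < n) (G v && (v != b :> nat)) * c v (P v).

Definition tree_ok (G : pred nat) (P : nat -> nat) (i : nat) : Prop :=
  [/\ exists r, rooted_tree n G P (tI n inp i) n r & G (sI n inp i)].

Definition oracle_ok (c : nat -> nat -> nat) (chi : nat -> nat) (T : nat -> nat -> pred nat) (P : nat -> nat) t i : Prop :=
  forall p, all (fun v => v < n) p -> last (sI n inp i) p = tI n inp i ->
  2 * 625 * 4 ^ k.-1 * 2 ^ (n + n) * tcost c (T t i) P (tI n inp i)
  + \sum_(v < n) ~~ T t i v * (gam t * chi v * others k T t i v) <=
  2 * 625 * 4 ^ k.-1 * 2 ^ (n + n) * path_sum c (sI n inp i) p
  + \sum_(v < n) ((v : nat) \notin sI n inp i :: p) * (gam t * chi v * others k T t i v).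

Lemma slot_neq t i t' i' v w : i < k -> i' < k -> v < n -> w < n -> (t, i) != (t', i') ->
  ((t' * k + i') * n <= (t * k + i) * n + v < (t' * k + i') * n + n) = false.
Proof.
move=> ik ik' vn wn ne; apply: row_disjoint => //; apply: contraNneq ne => h.
have k0 : 0 < k by apply: leq_ltn_trans ik.
have e1 : t = t' by have := congr1 (fun x => x %/ k) h; rewrite !divnMDl // !divn_small // !addn0.
have e2 : i = i' by have := congr1 (fun x => x %% k) h; rewrite !modnMDl !modn_small.
by rewrite e1 e2.
Qed.

Lemma ev_slot s env t i : Base n k inp s ->
  eval (arr s) env (Eslot t i) = (eval (arr s) env t * k + eval (arr s) env i) * n.
Proof. by move=> [[d1 d2] _]; rewrite /Eslot ev_mul ev_add ev_mul ev_EN ev_rd ev_cst d1 d2. Qed.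

Lemma ev_tg s env t i v : Base n k inp s ->
  (eval (arr s) env (Etg t i v) != 0) = TT s (eval (arr s) env t) (eval (arr s) env i) (eval (arr s) env v).
Proof. by move=> B; rewrite /Etg ev_rd ev_add (ev_slot _ _ _ B). Qed.

Lemma pair_code_spec env s t i : Base n k inp s -> i < k -> t < 4 -> nt n inp i ->
  sI n inp i < n -> tI n inp i < n ->
  let c u v := arr s 1 (u * n + v) in
  (forall u v, u < n -> v < n -> c u v = c v u) ->
  (forall t' j v, t' < 4 -> j < k -> v < n -> ~~ done t i t' j -> ~~ TT s t' j v) ->
  let s' := cexec pair_code (upd (upd env 7 t) 6 i) s in
  [/\ forall t' j v, j < k -> v < n -> (t', j) != (t, i) -> TT s' t' j v = TT s t' j v /\ PP s' t' j v = PP s t' j v,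
      tree_ok (TT s' t i) (PP s' t i) i &
      oracle_ok c (arr s 21) (fun t' j => if (t', j) == (t, i) then TT s' t i else TT s t' j) (PP s' t i) t i].
Proof.
move=> B ik t4 nti sn tn c csym und s'; set E := upd (upd env 7 t) 6 i.
rewrite /s' /pair_code.
seq_step s1 q1 f1; seq_step s2 q2 f2; seq_step s3 q3 f3; seq_step s4 q4 f4; seq_step s5 q5 f5.
seq_step s6 q6 f6; seq_step s7 q7 f7; seq_step s8 q8 f8; seq_step s9 q9 f9.
have [s10 q10] : exists z, z = cexec (CSet 23 (Eslot (EVar 7) (EVar 6)) 2 BN (ERd 20 (EVar 2))) E s9 by eexists.
rewrite -/E -q10; have f10 a : a \notin [:: 23] -> arr s10 a = arr s9 a by move=> h; rewrite q10 cexec_frame.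
have B1 : Base n k inp s1 by apply: Base_arr B; apply: f1.
have B2 : Base n k inp s2 by apply: Base_arr B1; apply: f2.
have B3 : Base n k inp s3 by apply: Base_arr B2; apply: f3.
have B4 : Base n k inp s4 by apply: Base_arr B3; apply: f4.
have B5 : Base n k inp s5 by apply: Base_arr B4; apply: f5.
have B6 : Base n k inp s6 by apply: Base_arr B5; apply: f6.
have B7 : Base n k inp s7 by apply: Base_arr B6; apply: f7.
have B8 : Base n k inp s8 by apply: Base_arr B7; apply: f8.
have B9 : Base n k inp s9 by apply: Base_arr B8; apply: f9.
have bE z b : Base n k inp z -> bvals z b = bval n k b by move=> [Dz _]; apply: dims_bval.
pose S := 2 * 625 * 4 ^ k.-1 * 2 ^ (n + n).
have v3 x : x < n * n -> arr s1 3 x = S * arr s 1 x.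
  move=> xN; rewrite q1 /cost_setup.
  seq_step u1 p1 g1; seq_step u2 p2 g2; seq_step u3 p3 g3.
  have C1 : Base n k inp u1 by apply: Base_arr B; apply: g1.
  have C2 : Base n k inp u2 by apply: Base_arr C1; apply: g2.
  have C3 : Base n k inp u3 by apply: Base_arr C2; apply: g3.
  rewrite cset0_val ?bE // !evE -[upd _ _ _ 3]/(x) p3.
  rewrite (map_for (F := fun j i' z => (if j == i then 1 else 4) * z)) ?bE //; last first.
    move=> z j l fz jB lB; rewrite ev_if tr_eq !evE -[upd _ _ _ 3]/(l) -[upd _ _ _ 5]/(j) -[upd _ _ _ 6]/(i).
    by case: eqP => _; rewrite ?mul1n // mulnC.
  rewrite iteri_prod -[bval n k BK]/(k) prod_others // p2.
  rewrite (map_for (F := fun j i' z => 2 * z)) ?bE //; last first.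
    by move=> z j l fz jB lB; rewrite !evE mul2n addnn.
  rewrite iteri_prod -[bval n k B2n]/(n + n) prod_nat_const card_ord p1 cset0_val ?bE // !evE -[upd _ _ _ 3]/(x).
  rewrite /S; move: (4 ^ _) (2 ^ _) (arr s 1 x) => a b d; clear; lia.
pose T0 := TT s.
have v4 v : v < n -> arr s2 4 v = gam t * arr s 21 v * others k T0 t i v.
  move=> vn; rewrite q2 /lam_setup.
  seq_step u1 p1 g1; seq_step u2 p2 g2.
  have C1 : Base n k inp u1 by apply: Base_arr B1; apply: g1.
  have C2 : Base n k inp u2 by apply: Base_arr C1; apply: g2.
  have t22 : arr u2 22 = arr s 22 by rewrite g2 // g1 // f1.
  rewrite (map_for (F := fun j v z => (if j == i then 1 else avail T0 t i j v) * z)) ?bE //; last first.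
    move=> z j l fz jB lB; rewrite ev_if tr_eq !ev_var -[upd _ _ _ 5]/(j) -[upd _ _ _ 6]/(i).
    have Cz : Base n k inp z by apply: Base_arr C2; apply: fz.
    case: eqP => _; first by rewrite !evE mul1n.
    rewrite ev_sum /avail big_distrl; apply: eq_bigr => y _.
    rewrite ev_if (ev_tg _ _ _ _ Cz) !ev_rd !ev_var ev_cst.
    rewrite -[upd _ _ _ 3]/(y : nat) -[upd _ _ _ 5]/(j) -[upd _ _ _ 2]/(l).
    have -> : TT z y j l = T0 y j l by rewrite /TT fz // t22.
    (* Slots still to be filled contain 0, so reading them agrees with the convention that trees not
       found yet are empty. *)
    have d0 : T0 y j l = done t i y j && T0 y j l.
      by case d: (done t i y j) => //=; apply/negbTE/und; rewrite ?d.
    by rewrite [in LHS]d0; case: (_ && _); rewrite /= ?mul0n ?mul1n.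
  rewrite iteri_prod -[bval n k BK]/(k) p2.
  rewrite (map_for (F := fun j v z => (if j < t then 5 else 4) * z)) ?bE //; last first.
    move=> z j l fz jB lB; rewrite ev_if tr_lt !evE -[upd _ _ _ 5]/(j) -[upd _ _ _ 7]/(t).
    by case: ifP => _; rewrite mulnC.
  rewrite iteri_prod -[bval n k (BC 4)]/4 gam_prod // p1 cset0_val ?bE // !evE -[upd _ _ _ 2]/(v) f1 //.
  rewrite mulnC; congr (_ * _); rewrite /others [RHS]big_mkcond /=; apply: eq_bigr => j _.
  by case: eqP.
have i6 : E 6 = i by []. have i7 : E 7 = t by [].
have v5 v : v < n -> tr (arr s6 5) v = (v == sI n inp i).
  by move=> vn; rewrite /tr f6 // f5 // f4 // q3 cset0_val ?bE // tr_eq (ev_S _ _ B2) !ev_var.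
have v6 v : v < n -> tr (arr s6 6) v = (v == tI n inp i).
  by move=> vn; rewrite /tr f6 // f5 // q4 cset0_val ?bE // tr_eq (ev_T _ _ B3) !ev_var.
have v16 v : v < n -> tr (arr s7 16) v = (v == tI n inp i).
  by move=> vn; rewrite /tr f7 // f6 // q5 cset0_val ?bE // tr_eq (ev_T _ _ B4) !ev_var.
have v17 v : v < n -> tr (arr s7 17) v = (v == sI n inp i) || (v == tI n inp i).
  by move=> vn; rewrite /tr f7 // q6 cset0_val ?bE // tr_or !tr_eq (ev_S _ _ B5) (ev_T _ _ B5) !ev_var.
have bal : balanced n (tr (arr s6 5)) (tr (arr s6 6)).
  have h1 : ex n (tr (arr s6 5)) by apply/exP; exists (sI n inp i); rewrite ?v5.
  have h2 : ex n (tr (arr s6 6)) by apply/exP; exists (tI n inp i); rewrite ?v6.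
  by rewrite /balanced h1 h2.
have H := moat_code_spec E B6.1 bal; rewrite -q7 in H.
have c3 : arr s6 3 = arr s1 3 by rewrite f6 // f5 // f4 // f3 // f2.
have c4 : arr s6 4 = arr s2 4 by rewrite f6 // f5 // f4 // f3.
have {}H := hist_ext (c0' := fun u v => S * c u v) (b0' := fun v => gam t * arr s 21 v * others k T0 t i v) H.
have {}H := H (arr s7 7) (arr s7 8) (arr s7 13) (arr s7 14) (arr s7 15).
have {}H := H (fun u v un vn => etrans (congr1 (fun f => f _) c3) (v3 _ (idx_lt un vn))).
have {}H := H (fun v vn => etrans (congr1 (fun f => f _) c4) (v4 v vn)) (fun _ _ => erefl) (fun _ _ => erefl).
have {}H := H (fun _ _ => And3 erefl erefl erefl).
have csym' u v : u < n -> v < n -> S * c u v = S * c v u by move=> un vn; rewrite csym.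
have := forest_code_spec E B7.1 H csym'; rewrite -q8.
case.
- by move=> v vn; rewrite v16 // v17 // => ->; rewrite orbT.
- move=> g v vn; rewrite v17 // => /orP[/eqP vs|/eqP vt] kf; last first.
    by case/negP: kf; apply: meets_self => //; rewrite v16 // vt.
  have ma : meets n g (tr (arr s6 5)) (gm g v) by apply: meets_self; rewrite ?v5 ?vs.
  rewrite /act ma; apply: contra kf => /meetsP[w wn [ew lw]].
  by apply/meetsP; exists w => //; split=> //; rewrite v16 // -v6.
- by move=> g x _ /meetsP[w wn [ew lw]]; apply/meetsP; exists w => //; split=> //; rewrite v16 // -v6.
set G := tr (arr s8 19); set P := arr s8 20 => MG [r Hr] Hpair _.
have off9 : eval (arr s8) E (Eslot (EVar 7) (EVar 6)) = (t * k + i) * n by rewrite (ev_slot _ _ _ B8).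
have off10 : eval (arr s9) E (Eslot (EVar 7) (EVar 6)) = (t * k + i) * n by rewrite (ev_slot _ _ _ B9).
have g22 : arr s8 22 = arr s 22 by rewrite f8 // f7 // f6 // f5 // f4 // f3 // f2 // f1.
have g23 : arr s9 23 = arr s 23 by rewrite f9 // f8 // f7 // f6 // f5 // f4 // f3 // f2 // f1.
have TG v : v < n -> TT s10 t i v = G v.
  move=> vn; rewrite /TT /slot f10 // q9 cset_val off9 bE // leq_addr ltn_add2l vn /= addKn.
  by [].
have TP v : v < n -> PP s10 t i v = P v.
  move=> vn; rewrite /PP /slot q10 cset_val off10 bE // leq_addr ltn_add2l vn /= addKn.
  by rewrite f9.
have Gt : G (tI n inp i) by apply: MG => //; rewrite v17 // eqxx orbT.
have Gs : G (sI n inp i) by apply: MG => //; rewrite v17 // eqxx.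
split.
- move=> t' j v jk vn ne; rewrite /TT /PP /slot f10 // q9 q10 !cset_val off9 off10 !bE //.
  by rewrite !(@slot_neq t' j t i v 0) ?g22 ?g23 //; apply: leq_ltn_trans vn.
- split; last by rewrite TG.
  exists r; split; rewrite ?TG //.
  move=> v vn; rewrite TG // => Gv vt; rewrite TP //.
  have [|h1 h2 h3 h4] := Hr v vn Gv; first by rewrite v16.
  by split=> //; rewrite TG.
- move=> p pn lp; have := Hpair _ _ p sn tn v5 v6 v16 pn lp.
  pose T1 t' j := if (t', j) == (t, i) then TT s10 t i else TT s t' j.
  have oE v : v < n -> others k T1 t i v = others k T0 t i v.
    move=> vn; apply: eq_bigr => j ji; apply: eq_bigr => y _; rewrite /T1.
    by case: eqP => // -[_ /eqP]; rewrite (negPf ji).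
  rewrite eqxx -/T1 path_sum_scale -/S.
  have -> : \sum_(v < n) ~~ TT s10 t i v * (gam t * arr s 21 v * others k T1 t i v) =
            \sum_(v < n) ~~ G v * (gam t * arr s 21 v * others k T0 t i v).
    by apply: eq_bigr => v _; rewrite TG // oE.
  have -> : \sum_(v < n) ((v : nat) \notin sI n inp i :: p) * (gam t * arr s 21 v * others k T1 t i v) =
            \sum_(v < n) ((v : nat) \notin sI n inp i :: p) * (gam t * arr s 21 v * others k T0 t i v).
    by apply: eq_bigr => v _; rewrite oE.
  have -> // : S * tcost c (TT s10 t i) (PP s10 t i) (tI n inp i) =
            \sum_(v < n) (G v && ~~ tr (arr s7 16) v) * (S * c v (P v)).
  by rewrite /tcost big_distrr /=; apply: eq_bigr => v _; rewrite TG // TP // v16 // mulnCA.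
Qed.

Lemma tree_ok_ext G G' P P' i : (forall v, v < n -> G v = G' v) -> (forall v, v < n -> P v = P' v) ->
  sI n inp i < n -> tree_ok G P i -> tree_ok G' P' i.
Proof.
move=> hG hP sn [[r [t1 t2 t3]] gs]; split; last by rewrite -hG.
exists r; split; rewrite -?hG //.
move=> v vn; rewrite -hG // -hP // => Gv vt; have [a b d e] := t3 v vn Gv vt.
by split=> //; rewrite -hG.
Qed.

(** The weights refer only to trees found earlier, so the inequality for a tree survives all later
    steps. *)
Lemma oracle_ok_ext c chi T T' P P' t i :
  (forall t' j v, t' < 4 -> j < k -> v < n -> done t i t' j || ((t', j) == (t, i)) -> T t' j v = T' t' j v) ->
  (forall v, v < n -> P v = P' v) -> t < 4 -> i < k ->
  oracle_ok c chi T P t i -> oracle_ok c chi T' P' t i.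
Proof.
move=> hT hP t4 ik H p pn lp; have := H p pn lp.
have oE v : v < n -> others k T t i v = others k T' t i v.
  move=> vn; apply: eq_bigr => j ji; apply: eq_bigr => y _; case d: (done t i y j) => //=.
  by rewrite (hT y j v) ?d.
have tE v : v < n -> T t i v = T' t i v by move=> vn; rewrite (hT t i v) // eqxx orbT.
have -> : tcost c (T t i) P (tI n inp i) = tcost c (T' t i) P' (tI n inp i).
  by apply: eq_bigr => v _; rewrite tE // hP.
have -> : \sum_(v < n) ~~ T t i v * (gam t * chi v * others k T t i v) =
          \sum_(v < n) ~~ T' t i v * (gam t * chi v * others k T' t i v).
  by apply: eq_bigr => v _; rewrite tE // oE.
have -> // : \sum_(v < n) ((v : nat) \notin sI n inp i :: p) * (gam t * chi v * others k T t i v) =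
          \sum_(v < n) ((v : nat) \notin sI n inp i :: p) * (gam t * chi v * others k T' t i v).
by apply: eq_bigr => v _; rewrite oE.
Qed.

Definition slot_ok (c : nat -> nat -> nat) (chi : nat -> nat) (s : lstate) (t i : nat) : Prop :=
  if nt n inp i then tree_ok (TT s t i) (PP s t i) i /\ oracle_ok c chi (TT s) (PP s t i) t i
  else forall v, v < n -> ~~ TT s t i v.

Lemma doneS t i t' j : done t i.+1 t' j = done t i t' j || ((t', j) == (t, i)).
Proof.
rewrite /done [j < i.+1]ltnS [j <= i]leq_eqVlt -orbA xpair_eqE; congr (_ || _).
by case: (t' == t) => //=; rewrite orbC.
Qed.

Lemma done_irr t i : done t i t i = false.
Proof. by rewrite /done !ltnn andbF. Qed.

Lemma rounds_code_spec env s : Base n k inp s -> (forall x, arr s 22 x = 0) ->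
  (forall i, i < k -> sI n inp i < n /\ tI n inp i < n) ->
  let c u v := arr s 1 (u * n + v) in
  (forall u v, u < n -> v < n -> c u v = c v u) ->
  let s' := cexec rounds_code env s in
  forall t i, t < 4 -> i < k -> slot_ok c (arr s 21) s' t i.
Proof.
move=> B z22 term c csym s'.
pose Inv t i z := [/\ forall a, a \notin writes rounds_code -> arr z a = arr s a,
  forall t' j, t' < 4 -> j < k -> done t i t' j -> slot_ok c (arr s 21) z t' j &
  forall t' j v, t' < 4 -> j < k -> v < n -> ~~ done t i t' j -> ~~ TT z t' j v].
have bE z b : Base n k inp z -> bvals z b = bval n k b by move=> [Dz _]; apply: dims_bval.
have Bi t i z : Inv t i z -> Base n k inp z by move=> [h _ _]; apply: Base_arr B; apply: h.
have stepI t i y : t < 4 -> i < k -> Inv t i y ->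
    Inv t i.+1 (cexec (CIf (Ent (EVar 6)) pair_code CSkip) (upd (upd env 7 t) 6 i) y).
  move=> t4 ik Iy; have By := Bi _ _ _ Iy; case: Iy => Iy1 Iy2 Iy3.
  rewrite cexec_if (tr_nt _ _ By) ev_var -[upd _ _ _ 6]/(i); have [sn tn] := term i ik.
  have e1 : arr y 1 = arr s 1 by apply: Iy1.
  have e21 : arr y 21 = arr s 21 by apply: Iy1.
  case: ifP => nti; last first.
    rewrite cexec_skip; split=> //.
      move=> t' j t4' jk; rewrite doneS => /orP[d|/eqP[-> ->]]; first exact: Iy2.
      by rewrite /slot_ok nti => v vn; apply: Iy3; rewrite ?done_irr.
    by move=> t' j v t4' jk vn; rewrite doneS negb_or => /andP[d ne]; apply: Iy3.
  have csym' u v : u < n -> v < n -> arr y 1 (u * n + v) = arr y 1 (v * n + u).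
    by move=> un vn; rewrite e1; apply: csym.
  have [y' qy] : exists y', y' = cexec pair_code (upd (upd env 7 t) 6 i) y by eexists.
  have [] := pair_code_spec env By ik t4 nti sn tn csym' Iy3.
  rewrite -qy e1 e21 => h1 h2 h3; split.
  - by move=> a ha; rewrite qy cexec_frame ?Iy1.
  - move=> t' j t4' jk; rewrite doneS => /orP[d|/eqP[-> ->]]; last first.
      rewrite /slot_ok nti; split=> //; apply: oracle_ok_ext h3 => // t2 j2 v t24 j2k vn _.
      by case: eqP => [[-> ->]//|/eqP ne]; have [-> _] := h1 t2 j2 v j2k vn ne.
    have ne : (t', j) != (t, i) by apply: contraTneq d => -[-> ->]; rewrite done_irr.
    have := Iy2 t' j t4' jk d; rewrite /slot_ok; case: ifP => _.
      move=> [a b]; split.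
        apply: tree_ok_ext a => [v vn|v vn|]; last by have [] := term j jk.
          by have [-> _] := h1 t' j v jk vn ne.
        by have [_ ->] := h1 t' j v jk vn ne.
      apply: oracle_ok_ext b => // [t2 j2 v t24 j2k vn d2|v vn].
        have ne2 : (t2, j2) != (t, i).
          apply/eqP => -[e2 e3]; move: d2; rewrite e2 e3 [(t, i) == _]eq_sym (negPf ne) orbF => d2.
          move: d d2; rewrite /done; case: (ltngtP t' t) => //= _; case: (ltngtP j i) => //.
        by have [-> _] := h1 t2 j2 v j2k vn ne2.
      by have [_ ->] := h1 t' j v jk vn ne.
    by move=> H v vn; have [-> _] := h1 t' j v jk vn ne; apply: H.
  - move=> t' j v t4' jk vn; rewrite doneS negb_or => /andP[d ne]; have [-> _] := h1 t' j v jk vn ne.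
    exact: Iy3.
have Fin : Inv (bvals s (BC 4)) 0 s'.
  apply: (@for_ind 7 (BC 4) _ env s (fun t z => Inv t 0 z)).
    split=> //; first by move=> t' j _ _; rewrite /done ltn0 andbF.
    by move=> t' j v _ _ _ _; rewrite /TT /slot z22.
  move=> t z t4 Iz; have Bz := Bi _ _ _ Iz.
  have : Inv t (bvals z BK) (cexec (CFor 6 BK (CIf (Ent (EVar 6)) pair_code CSkip)) (upd env 7 t) z).
    apply: (@for_ind 6 BK _ _ z (fun i z => Inv t i z)) => // i y iB Iy.
    by apply: stepI => //; rewrite bE // in iB.
  rewrite bE // -[bval n k BK]/(k).
  have dE t' j : j < k -> done t.+1 0 t' j = done t k t' j.
    by move=> jk; rewrite /done jk andbT ltn0 andbF orbF ltnS leq_eqVlt orbC.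
  move=> [i1 i2 i3]; split=> //.
    by move=> t' j t4' jk; rewrite dE //; apply: i2.
  by move=> t' j v t4' jk vn; rewrite dE //; apply: i3.
case: Fin => _ H _ t i t4 ik; apply: H => //.
by rewrite /done; have -> : t < bvals s (BC 4) by [].
Qed.
End Pair.

(** * Selection *)

Definition Ec (u v : expr) := ERd 1 (u *e EN +e v).
Definition Ecov (i v : expr) := Eex 8 BK (Eand (Elt (EVar 8) i) (Etg (ERd 26 (EVar 8)) (EVar 8) v)).
Definition weight_code :=
  CSeq (CSet 25 (ECst 0) 2 BN (EIf (Ecov (EVar 6) (EVar 2)) (ECst 0) (ERd 21 (EVar 2))))
       (CFor 5 BK (CSet 25 (ECst 0) 2 BN (EIf (Elt (EVar 6) (EVar 5))
          (ESum 3 (BC 4) (EIf (Etg (EVar 3) (EVar 5) (EVar 2)) (ECst 0) (ERd 25 (EVar 2)))) (ERd 25 (EVar 2))))).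
Definition tvalue_code :=
  CSeq (CSet 33 (ECst 0) 3 (BC 4) (ESum 2 BN (EIf (Eand (Etg (EVar 3) (EVar 6) (EVar 2)) (Enot (Eeq (EVar 2) (ET (EVar 6)))))
          (Ec (EVar 2) (Etp (EVar 3) (EVar 6) (EVar 2))) (ECst 0))))
  (CSeq (CFor 5 B2n (CSet 33 (ECst 0) 3 (BC 4) (ERd 33 (EVar 3) +e ERd 33 (EVar 3))))
  (CSeq (CFor 5 BK (CSet 33 (ECst 0) 3 (BC 4) (EIf (Elt (EVar 6) (EVar 5)) (ERd 33 (EVar 3) *e ECst 4) (ERd 33 (EVar 3)))))
        (CSet 33 (ECst 0) 3 (BC 4) (ERd 33 (EVar 3) *e ECst 2 +e
           ESum 2 BN (EIf (Etg (EVar 3) (EVar 6) (EVar 2)) (ECst 0) (ERd 25 (EVar 2))))))).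
Definition argmin_code :=
  CPut 26 (EVar 6) (Efind 3 8 (BC 4) (Enot (Eex 9 (BC 4) (Elt (ERd 33 (EVar 9)) (ERd 33 (EVar 3)))))).
Definition sel_step := CSeq weight_code (CSeq tvalue_code argmin_code).
Definition select_code := CFor 6 BK sel_step.

Lemma prod_after k i m : \prod_(j < k) (if i < j then m else 1) = m ^ (k - i.+1).
Proof.
elim: k => [|k IH]; first by rewrite big_ord0.
rewrite big_ord_recr /= IH subSS; case: ltnP => h; first by rewrite -expnSr -subSn.
by rewrite muln1; congr (_ ^ _); lia.
Qed.

Lemma has_iota_lt k i (Q : pred nat) : i <= k ->
  has (fun j => (j < i) && Q j) (iota 0 k) = has Q (iota 0 i).
Proof.
move=> ik; apply/hasP/hasP => -[j]; rewrite mem_iota /= add0n => h.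
  by move=> /andP[ji Qj]; exists j; rewrite ?mem_iota.
by move=> Qj; exists j; rewrite ?mem_iota /= ?add0n ?h // (leq_trans h).
Qed.

Lemma find_argmin (f : nat -> nat) N : 0 < N ->
  let t := find (fun t => ~~ has (fun y => f y < f t) (iota 0 N)) (iota 0 N) in
  t < N /\ forall y, y < N -> f t <= f y.
Proof.
case: N => // N _ t0; pose P t := ~~ has (fun y => f y < f t) (iota 0 N.+1).
pose t := find P (iota 0 N.+1); rewrite -[t0]/t {t0}.
have hP : has P (iota 0 N.+1).
  have [i _ Hi] := @arg_minnP _ (@ord0 N) xpredT (fun i : 'I_N.+1 => f i) isT.
  apply/hasP; exists (i : nat); first by rewrite mem_iota /=.
  apply/hasPn => y; rewrite mem_iota /= add0n => yN; rewrite -leqNgt.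
  exact: (Hi (Ordinal yN)).
have tN : t < N.+1 by move: hP; rewrite has_find size_iota.
split=> // y yN; have := nth_find 0 hP; rewrite -/t nth_iota // add0n => /hasPn /(_ y).
by rewrite mem_iota /= add0n yN -leqNgt; apply.
Qed.

Section Select.
Variables (n k : nat) (inp : nat -> nat).
Local Notation X := (2 ^ (n + n)).
Definition slot_cost (s : lstate) (t i : nat) : nat :=
  tcost n (fun u v => arr s 1 (u * n + v)) (TT n k s t i) (PP n k s t i) (tI n inp i).
Definition svalue (s : lstate) (sel : nat -> nat) : nat -> nat -> nat :=
  sel_value n k X (arr s 21) (TT n k s) (slot_cost s) sel.

Lemma ev_tp s env t i v : Base n k inp s ->
  eval (arr s) env (Etp t i v) = PP n k s (eval (arr s) env t) (eval (arr s) env i) (eval (arr s) env v).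
Proof. by move=> B; rewrite /Etp ev_rd ev_add (ev_slot _ _ _ B). Qed.

Lemma ev_c s env u v : Base n k inp s ->
  eval (arr s) env (Ec u v) = arr s 1 (eval (arr s) env u * n + eval (arr s) env v).
Proof. by move=> [[d _] _]; rewrite /Ec ev_rd ev_add ev_mul ev_EN d. Qed.

Lemma sum_if_mul N (b : 'I_N -> bool) (F : 'I_N -> nat) :
  \sum_(v < N) (if b v then F v else 0) = \sum_(v < N) b v * F v.
Proof. by apply: eq_bigr => v _; case: (b v); rewrite ?mul1n ?mul0n. Qed.

Lemma sel_step_spec env s i : Base n k inp s -> i < k ->
  let s' := cexec sel_step (upd env 6 i) s in
  [/\ forall j, j != i -> arr s' 26 j = arr s 26 j, arr s' 26 i < 4 &
      forall t, t < 4 -> svalue s (arr s 26) i (arr s' 26 i) <= svalue s (arr s 26) i t].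
Proof.
move=> B ik s'; set E := upd env 6 i; rewrite /s' /sel_step.
seq_step s1 q1 f1; seq_step s2 q2 f2.
have B1 : Base n k inp s1 by apply: Base_arr B; apply: f1.
have B2 : Base n k inp s2 by apply: Base_arr B1; apply: f2.
have bE z b : Base n k inp z -> bvals z b = bval n k b by move=> [Dz _]; apply: dims_bval.
have TE z : arr z 22 = arr s 22 -> TT n k z = TT n k s by move=> h; rewrite /TT h.
have PE z : arr z 23 = arr s 23 -> PP n k z = PP n k s by move=> h; rewrite /PP h.
have Y v : v < n -> arr s1 25 v =
    (~~ covered (TT n k s) (arr s 26) i v) * (arr s 21 v * rest k (TT n k s) i.+1 v).
  move=> vn; rewrite q1 /weight_code; seq_step u1 p1 g1.
  have C1 : Base n k inp u1 by apply: Base_arr B; apply: g1.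
  rewrite (map_for (F := fun j v z => (if i < j then avail (TT n k s) 4 0 j v else 1) * z)) ?bE //; last first.
    move=> z j l fz jB lB; rewrite ev_if tr_lt !ev_var -[upd _ _ _ 5]/(j) -[upd _ _ _ 6]/(i).
    have Cz : Base n k inp z by apply: Base_arr C1; apply: fz.
    case: ifP => _; last by rewrite !evE mul1n.
    rewrite ev_sum /avail big_distrl; apply: eq_bigr => y _.
    rewrite ev_if (ev_tg _ _ _ _ Cz) !ev_rd !ev_var ev_cst.
    rewrite -[upd _ _ _ 3]/(y : nat) -[upd _ _ _ 5]/(j) -[upd _ _ _ 2]/(l).
    rewrite TE; last by rewrite fz // g1.
    rewrite /done ltn_ord /=.
    by case: (TT _ _ _ _ _ _); rewrite /= ?mul0n ?mul1n.
  rewrite iteri_prod -[bval n k BK]/(k) p1 cset0_val ?bE // ev_if.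
  rewrite /Ecov tr_ex -[bval _ _ BK]/(arr s 0 1) B.1.2.
  have -> : has (fun i0 => eval (arr s) (upd (upd (upd env 6 i) 2 v) 8 i0)
      (Eand (Elt (EVar 8) (EVar 6)) (Etg (ERd 26 (EVar 8)) (EVar 8) (EVar 2))) != 0) (iota 0 k) =
      covered (TT n k s) (arr s 26) i v.
    rewrite /covered -(has_iota_lt _ (ltnW ik)); apply: eq_has => j; cbv beta.
    by rewrite tr_and tr_lt (ev_tg _ _ _ _ B) ev_rd !ev_var.
  rewrite ev_cst ev_rd ev_var -[upd _ _ _ 2]/(v) /rest [X in _ = _ * (_ * X)]big_mkcond /=.
  by case: (covered _ _ _ _); rewrite /= ?muln0 ?mul0n ?mul1n // mulnC.
have V t : t < 4 -> arr s2 33 t = svalue s (arr s 26) i t.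
  move=> t4; rewrite q2 /tvalue_code; seq_step u1 p1 g1; seq_step u2 p2 g2; seq_step u3 p3 g3.
  have C1 : Base n k inp u1 by apply: Base_arr B1; apply: g1.
  have C2 : Base n k inp u2 by apply: Base_arr C1; apply: g2.
  have C3 : Base n k inp u3 by apply: Base_arr C2; apply: g3.
  rewrite cset0_val ?bE // ev_add ev_mul ev_cst ev_rd ev_var -[upd _ _ _ 3]/(t) {1}p3.
  rewrite (map_for (F := fun j v z => (if i < j then 4 else 1) * z)) ?bE //; last first.
    move=> z j l fz jB lB; rewrite ev_if tr_lt !evE -[upd _ _ _ 3]/(l) -[upd _ _ _ 5]/(j) -[upd _ _ _ 6]/(i).
    by case: ifP => _; rewrite ?mul1n // mulnC.
  rewrite iteri_prod -[bval n k BK]/(k) prod_after p2.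
  rewrite (map_for (F := fun j i' z => 2 * z)) ?bE //; last first.
    by move=> z j l fz jB lB; rewrite !evE mul2n addnn.
  rewrite iteri_prod -[bval n k B2n]/(n + n) prod_nat_const card_ord p1 cset0_val ?bE //.
  have -> : eval (arr s1) (upd (upd env 6 i) 3 t) (ESum 2 BN (EIf (Eand (Etg (EVar 3) (EVar 6) (EVar 2)) (Enot (Eeq (EVar 2) (ET (EVar 6)))))
          (Ec (EVar 2) (Etp (EVar 3) (EVar 6) (EVar 2))) (ECst 0))) = slot_cost s t i.
    rewrite ev_sum -[bval _ _ BN]/(arr s1 0 0) B1.1.1 /slot_cost /tcost -sum_if_mul; apply: eq_bigr => v _.
    rewrite ev_if tr_and tr_not tr_eq (ev_tg _ _ _ _ B1) (ev_c _ _ _ B1) (ev_tp _ _ _ _ B1) (ev_T _ _ B1) !ev_var ev_cst.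
    by rewrite TE ?PE ?f1.
  rewrite /svalue /sel_value; congr (_ + _); first by clear; lia.
  rewrite ev_sum -[bval _ _ BN]/(arr u3 0 0) C3.1.1; apply: eq_bigr => v _.
  rewrite ev_if (ev_tg _ _ _ _ C3) ev_rd !ev_var ev_cst -[upd _ _ _ 2]/(v : nat) -[upd _ _ _ 3]/(t) -[upd _ _ _ 6]/(i).
  have e22 : arr u3 22 = arr s 22 by rewrite g3 // g2 // g1 // f1.
  have e25 : arr u3 25 = arr s1 25 by rewrite g3 // g2 // g1.
  rewrite TE // e25 Y //.
  by case: (TT _ _ _ _ _ _); rewrite ?andbF ?andbT.
have A j : arr (cexec argmin_code E s2) 26 j =
    if j == i then find (fun t => ~~ has (fun y => arr s2 33 y < arr s2 33 t) (iota 0 4)) (iota 0 4)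
    else arr s 26 j.
  rewrite /argmin_code cput_val ev_var -[E 6]/(i) f2 // f1 //; case: ifP => // _.
  apply: ev_find => // t y t4; rewrite tr_not tr_ex; congr (~~ _).
  by apply: eq_has => w; cbv beta; rewrite tr_lt !ev_rd !ev_var.
split.
- by move=> j ji; rewrite A (negPf ji).
- by rewrite A eqxx; have [] := @find_argmin (arr s2 33) 4 isT.
- move=> t t4; rewrite A eqxx; have [h1 h2] := @find_argmin (arr s2 33) 4 isT.
  by rewrite -!V //; apply: h2.
Qed.

Lemma select_code_spec env s : Base n k inp s ->
  let s' := cexec select_code env s in
  (forall i, i < k -> arr s' 26 i < 4) /\
  forall i t, i < k -> t < 4 -> svalue s (arr s' 26) i (arr s' 26 i) <= svalue s (arr s' 26) i t.
Proof.
move=> B s'.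
pose I i z := (forall a, a \notin writes select_code -> arr z a = arr s a) /\
  forall j, j < i -> arr z 26 j < 4 /\
    forall t, t < 4 -> svalue s (arr z 26) j (arr z 26 j) <= svalue s (arr z 26) j t.
have F : I (bvals s BK) s'.
  apply: for_ind; first by split.
  move=> i z; rewrite (dims_bval _ B.1) -[bval n k BK]/(k) => ik [z1 z2].
  have Bz : Base n k inp z by apply: Base_arr B; apply: z1.
  have [h1 h2 h3] := sel_step_spec env Bz ik.
  have [z' qz] : exists z', z' = cexec sel_step (upd env 6 i) z by eexists.
  rewrite -qz in h1 h2 h3 *.
  (* The values for pair [j] depend only on the selections before [j], so the choice for pair [i]
     leaves the earlier minima intact. *)
  have covE j v : j <= i -> covered (TT n k s) (arr z' 26) j v = covered (TT n k s) (arr z 26) j v.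
    move=> ji; apply: eq_in_has => l; rewrite mem_iota /= add0n => lj.
    by rewrite h1 //; apply: contraTneq (leq_trans lj ji) => ->; rewrite ltnn.
  have svE j t : j <= i -> svalue s (arr z' 26) j t = svalue s (arr z 26) j t.
    by move=> ji; congr (_ + _); apply: eq_bigr => v _; rewrite covE.
  have szE : svalue z = svalue s.
    by rewrite /svalue /slot_cost /TT /PP !z1.
  split; first by move=> a ha; rewrite qz cexec_frame ?z1.
  move=> j; rewrite ltnS leq_eqVlt => /orP[/eqP ->|ji].
    by split=> // t t4; rewrite !svE // -szE; apply: h3.
  have [y1 y2] := z2 j ji; have ne : j != i by apply: contraTneq ji => ->; rewrite ltnn.
  by rewrite h1 //; split=> // t t4; rewrite !svE ?(ltnW ji) //; apply: y2.
case: F => _; rewrite (dims_bval _ B.1) -[bval n k BK]/(k) => F.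
by split=> i; [move=> /F[] | move=> t /F[_ h]; apply: h].
Qed.

(* [u] chooses between the selected trees and the edges [s_i t_i]. *)
Definition tr0 (s : lstate) (u : bool) (i v : nat) : bool :=
  if u then nt n inp i && ((v == sI n inp i) || (v == tI n inp i)) else TT n k s (arr s 26 i) i v.
Definition pa0 (s : lstate) (u : bool) (i v : nat) : nat :=
  if u then tI n inp i else PP n k s (arr s 26 i) i v.
Definition cov0 (s : lstate) (u : bool) (v : nat) : bool := has (fun i => tr0 s u i v) (iota 0 k).
Definition cost0 (s : lstate) (u : bool) (i : nat) : nat :=
  tcost n (fun u v => arr s 1 (u * n + v)) (tr0 s u i) (pa0 s u i) (tI n inp i).
(** The doubled cost of the trees of a candidate and the charge it leaves uncovered, which bounds
    the cost of extending it by the pruned forest. *)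
Definition value0 (s : lstate) (u : bool) : nat :=
  2 * X * (\sum_(i < k) cost0 s u i) + \sum_(v < n) ~~ cov0 s u v * arr s 21 v.
End Select.

Definition Etree0 (u i v : expr) := EIf u (Eand (Ent i) (Eor (Eeq v (ES i)) (Eeq v (ET i)))) (Etg (ERd 26 i) i v).
Definition Epar0 (u i v : expr) := EIf u (ET i) (Etp (ERd 26 i) i v).
Definition choice_code :=
  CSeq (CSet 37 (ECst 0) 3 (BC 2) (ESum 4 BK (ESum 2 BN
     (EIf (Eand (Etree0 (EVar 3) (EVar 4) (EVar 2)) (Enot (Eeq (EVar 2) (ET (EVar 4)))))
          (Ec (EVar 2) (Epar0 (EVar 3) (EVar 4) (EVar 2))) (ECst 0)))))
  (CSeq (CFor 5 B2n (CSet 37 (ECst 0) 3 (BC 2) (ERd 37 (EVar 3) +e ERd 37 (EVar 3))))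
        (CSet 37 (ECst 0) 3 (BC 2) (ERd 37 (EVar 3) *e ECst 2 +e
           ESum 2 BN (EIf (Eex 4 BK (Etree0 (EVar 3) (EVar 4) (EVar 2))) (ECst 0) (ERd 21 (EVar 2)))))).
Definition EU := Elt (ERd 37 (ECst 1)) (ERd 37 (ECst 0)).
Definition useB (s : lstate) : bool := arr s 37 1 < arr s 37 0.

Section Choice.
Variables (n k : nat) (inp : nat -> nat).

Lemma tr_tree0 s env u i v : Base n k inp s -> (eval (arr s) env (Etree0 u i v) != 0) =
  tr0 n k inp s (eval (arr s) env u != 0) (eval (arr s) env i) (eval (arr s) env v).
Proof.
move=> B; rewrite /Etree0 tr_ite /tr0; case: ifP => _; last by rewrite (ev_tg _ _ _ _ B) ev_rd.
by rewrite tr_and tr_or !tr_eq (tr_nt _ _ B) (ev_S _ _ B) (ev_T _ _ B).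
Qed.

Lemma ev_par0 s env u i v : Base n k inp s -> eval (arr s) env (Epar0 u i v) =
  pa0 n k inp s (eval (arr s) env u != 0) (eval (arr s) env i) (eval (arr s) env v).
Proof.
move=> B; rewrite /Epar0 ev_if /pa0; case: ifP => _; last by rewrite (ev_tp _ _ _ _ B) ev_rd.
by rewrite (ev_T _ _ B).
Qed.

Lemma choice_code_spec env s : Base n k inp s ->
  let s' := cexec choice_code env s in
  forall u, value0 n k inp s (useB s') <= value0 n k inp s u.
Proof.
move=> B s'; suff V u : u < 2 -> arr s' 37 u = value0 n k inp s (u != 0).
  have -> : value0 n k inp s (useB s') = arr s' 37 (useB s') by rewrite V; case: (useB s').
  move=> u.
  have -> : value0 n k inp s u = arr s' 37 u by rewrite V; case: u.
  move: (s') => z; rewrite {1}/useB; case: ltnP => h; case: u => //; exact: ltnW.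
move=> u2; rewrite /s' /choice_code; seq_step s1 q1 f1; seq_step s2 q2 f2.
have B1 : Base n k inp s1 by apply: Base_arr B; apply: f1.
have B2 : Base n k inp s2 by apply: Base_arr B1; apply: f2.
have bE z b : Base n k inp z -> bvals z b = bval n k b by move=> [Dz _]; apply: dims_bval.
have TE z a i v : (forall b, b != 37 -> arr z b = arr s b) -> tr0 n k inp z a i v = tr0 n k inp s a i v.
  by move=> h; rewrite /tr0 /TT !h.
rewrite cset0_val ?bE // ev_add ev_mul ev_cst ev_rd ev_var -[upd _ _ _ 3]/(u) {1}q2.
rewrite (map_for (F := fun j i' z => 2 * z)) ?bE //; last first.
  by move=> z j l fz jB lB; rewrite !evE mul2n addnn.
rewrite iteri_prod -[bval n k B2n]/(n + n) prod_nat_const card_ord q1 cset0_val ?bE //.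
rewrite /value0; congr (_ + _).
  rewrite mulnAC [_ * 2]mulnC; congr (_ * _); rewrite ev_sum -[bval _ _ BK]/(arr s 0 1) B.1.2.
  apply: eq_bigr => i _; rewrite ev_sum -[bval _ _ BN]/(arr s 0 0) B.1.1.
  rewrite /cost0 /tcost -sum_if_mul; apply: eq_bigr => v _.
  by rewrite ev_if tr_and tr_not tr_eq (tr_tree0 _ _ _ _ B) (ev_c _ _ _ B) (ev_par0 _ _ _ _ B) (ev_T _ _ B) !ev_var ev_cst.
rewrite ev_sum -[bval _ _ BN]/(arr s2 0 0) B2.1.1; apply: eq_bigr => v _.
rewrite ev_if tr_ex -[bval _ _ BK]/(arr s2 0 1) B2.1.2.
have fs b : b != 37 -> arr s2 b = arr s b by move=> h; rewrite f2 ?f1 // inE.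
have -> : has (fun i => eval (arr s2) (upd (upd (upd env 3 u) 2 v) 4 i) (Etree0 (EVar 3) (EVar 4) (EVar 2)) != 0)
   (iota 0 k) = cov0 n k inp s (u != 0) v.
  by apply: eq_has => i; cbv beta; rewrite (tr_tree0 _ _ _ _ B2) !ev_var TE.
by rewrite ev_cst ev_rd ev_var -[upd _ _ _ 2]/(v : nat) fs //; case: (cov0 _ _ _ _ _ _); rewrite ?mul0n ?mul1n.
Qed.
End Choice.

(** * Combination of the forest and the trees *)

Definition Etree1 (i v : expr) :=
  Eor (Etree0 EU i v) (Eand (ERd 19 v) (Eand (Enot (ERd 16 v)) (Eeq (ERd 29 v) i))).
Definition Epar1 (i v : expr) := EIf (Etree0 EU i v) (Epar0 EU i v) (ERd 20 v).
(** A forest vertex takes over the owner of its parent. Ranks are at most [n], so [n + 1] rounds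
    carry the owners from the covered set to every forest vertex. *)
Definition own_step := CSet 29 (ECst 0) 2 BN (EIf (ERd 16 (EVar 2)) (ERd 29 (EVar 2)) (ERd 29 (ERd 20 (EVar 2)))).
(** The stored root run is restored and pruned with the covered set of the better candidate as both
    the contracted set and the marks. *)
Definition combine_code :=
  CSeq (CSet 16 (ECst 0) 2 BN (Ebool (Eex 4 BK (Etree0 EU (EVar 4) (EVar 2)))))
  (CSeq (CSet 17 (ECst 0) 2 BN (ERd 16 (EVar 2)))
  (CSeq (copy 41 7) (CSeq (copy 42 8) (CSeq (copy 43 13) (CSeq (copy 44 14) (CSeq (copy 45 15)
  (CSeq forest_code
  (CSeq (CSet 29 (ECst 0) 2 BN (Efind 4 8 BK (Etree0 EU (EVar 4) (EVar 2))))
        (CFor 5 (BAdd BN (BC 1)) own_step))))))))).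

Lemma copy_val n k a b env s i : dims n k s -> i < (n + n).+1 * n ->
  arr (cexec (copy a b) env s) b i = arr s a i.
Proof.
move=> D iN; rewrite /copy cset0_val ?evE // (dims_bval _ D).
by rewrite -[bval n k Bh]/((n + n + 1) * n) addn1.
Qed.

Lemma sum_owner k x F : \sum_(i < k) (x == i :> nat) * F <= F.
Proof.
case: (ltnP x k) => xk; last first.
  rewrite big1 // => i _; case: eqP => // e; move: xk; rewrite e leqNgt ltn_ord //.
rewrite (bigD1 (Ordinal xk)) //= eqxx mul1n big1 ?addn0 // => i.
by rewrite -val_eqE /= eq_sym => /negPf ->.
Qed.

Section Combine.
Variables (n k : nat) (inp : nat -> nat).
Local Notation X := (2 ^ (n + n)).

Definition forest (s : lstate) (v : nat) : bool := tr (arr s 19) v && ~~ tr (arr s 16) v.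
Definition tr1 (s : lstate) (i v : nat) : bool :=
  tr0 n k inp s (useB s) i v || (forest s v && (arr s 29 v == i)).
Definition pa1 (s : lstate) (i v : nat) : nat :=
  if tr0 n k inp s (useB s) i v then pa0 n k inp s (useB s) i v else arr s 20 v.

Lemma tr_EU s env : (eval (arr s) env EU != 0) = useB s.
Proof. by rewrite /EU tr_lt !ev_rd !ev_cst. Qed.

Lemma tr_tree1 s env i v : Base n k inp s -> (eval (arr s) env (Etree1 i v) != 0) =
  tr1 s (eval (arr s) env i) (eval (arr s) env v).
Proof.
move=> B; rewrite /Etree1 tr_or (tr_tree0 _ _ _ _ B) tr_EU !tr_and tr_not tr_eq !ev_rd.
by rewrite /tr1 /forest /tr andbA.
Qed.

Lemma ev_par1 s env i v : Base n k inp s -> eval (arr s) env (Epar1 i v) =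
  pa1 s (eval (arr s) env i) (eval (arr s) env v).
Proof. by move=> B; rewrite /Epar1 ev_if (tr_tree0 _ _ _ _ B) (ev_par0 _ _ _ _ B) tr_EU ev_rd. Qed.

Definition base_trees (s : lstate) : Prop := forall i, i < k ->
  if nt n inp i then tree_ok n inp (tr0 n k inp s (useB s) i) (pa0 n k inp s (useB s) i) i
  else forall v, v < n -> ~~ tr0 n k inp s (useB s) i v.

(** A forest vertex joins the tree of the pair that owns the covered vertex above it. It has one
    owner, so over all pairs the forest is paid for at most once. *)
Lemma combine_code_spec env s la c0 b0 bL : Base n k inp s ->
  hist n la la c0 b0 bL (arr s 41) (arr s 42) (arr s 43) (arr s 44) (arr s 45) ->
  (forall u v, u < n -> v < n -> c0 u v = c0 v u) ->
  (forall v, v < n -> la v -> cov0 n k inp s (useB s) v) ->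
  base_trees s ->
  let s' := cexec combine_code env s in
  let G := tr (arr s' 19) in let cov := cov0 n k inp s (useB s) in
  [/\ forall i, i < k -> nt n inp i -> tr1 s' i (sI n inp i) /\
        exists r, rooted_tree n (tr1 s' i) (pa1 s' i) (tI n inp i) (n + n).+1 r,
      forall v, v < n -> G v -> exists i, [/\ i < k, nt n inp i & tr1 s' i v],
      forall c : nat -> nat -> nat, \sum_(i < k) tcost n c (tr1 s' i) (pa1 s' i) (tI n inp i) <=
        \sum_(i < k) tcost n c (tr0 n k inp s (useB s) i) (pa0 n k inp s (useB s) i) (tI n inp i)
        + \sum_(v < n) forest s' v * c v (arr s' 20 v) &
      X * (\sum_(v < n) forest s' v * c0 v (arr s' 20 v) + \sum_(v < n) ~~ G v * b0 v)
        + \sum_(v < n) ~~ cov v * bL v <= X * \sum_(v < n) ~~ cov v * b0 v].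
Proof.
move=> B H csym la_cov Htr s' G cov.
have [s0 q0] : exists z, z = s' by eexists.
have fr a : a \notin writes combine_code -> arr s0 a = arr s a by move=> h; rewrite q0 /s' cexec_frame.
move: q0 fr; rewrite /G -/s' /s' /combine_code => q0 fr {G s'}.
rewrite -q0; move: q0.
seq_step s1 q1 f1; seq_step s2 q2 f2; seq_step s3 q3 f3; seq_step s4 q4 f4; seq_step s5 q5 f5.
seq_step s6 q6 f6; seq_step s7 q7 f7; seq_step s8 q8 f8; seq_step s9 q9 f9 => q10.
have B1 : Base n k inp s1 by apply: Base_arr B; apply: f1.
have B2 : Base n k inp s2 by apply: Base_arr B1; apply: f2.
have B3 : Base n k inp s3 by apply: Base_arr B2; apply: f3.
have B4 : Base n k inp s4 by apply: Base_arr B3; apply: f4.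
have B5 : Base n k inp s5 by apply: Base_arr B4; apply: f5.
have B6 : Base n k inp s6 by apply: Base_arr B5; apply: f6.
have B7 : Base n k inp s7 by apply: Base_arr B6; apply: f7.
have B8 : Base n k inp s8 by apply: Base_arr B7; apply: f8.
have B9 : Base n k inp s9 by apply: Base_arr B8; apply: f9.
have bE z b : Base n k inp z -> bvals z b = bval n k b by move=> [Dz _]; apply: dims_bval.
have tE (z : lstate) : arr z 22 = arr s 22 -> arr z 26 = arr s 26 -> arr z 37 = arr s 37 ->
    tr0 n k inp z (useB z) = tr0 n k inp s (useB s).
  by move=> e1 e2 e3; rewrite /tr0 /useB /TT e1 e2 e3.
have T0 : tr0 n k inp s0 (useB s0) = tr0 n k inp s (useB s) by apply: tE; apply: fr.
have P0 : pa0 n k inp s0 (useB s0) = pa0 n k inp s (useB s) by rewrite /pa0 /useB /PP !fr.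
have K1 v : v < n -> tr (arr s1 16) v = cov v.
  move=> vn; rewrite /tr q1 cset0_val ?bE // tr_bool tr_ex -[bval _ _ BK]/(arr s 0 1) B.1.2.
  by apply: eq_has => i; cbv beta; rewrite (tr_tree0 _ _ _ _ B) tr_EU !ev_var.
have K7 v : v < n -> tr (arr s7 16) v = cov v.
  by move=> vn; rewrite /tr f7 // f6 // f5 // f4 // f3 // f2 //; apply: K1.
have M7 v : v < n -> tr (arr s7 17) v = cov v.
  move=> vn; rewrite /tr f7 // f6 // f5 // f4 // f3 // q2 cset0_val ?bE // ev_rd ev_var.
  exact: K1.
have le1 : n + n <= (n + n).+1 * n by case: (n) => // m; nia.
have H7 : hist n la la c0 b0 bL (arr s7 7) (arr s7 8) (arr s7 13) (arr s7 14) (arr s7 15).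
  apply: (hist_ext H) => //.
  - move=> i iN; rewrite f7 // f6 // f5 // f4 // q3 (copy_val _ _ _ B2.1) //.
    by rewrite f2 // f1.
  - move=> i iN; have iN' : i < (n + n).+1 * n by apply: leq_trans iN _; rewrite leq_mul2r leqnSn orbT.
    rewrite f7 // f6 // f5 // q4 (copy_val _ _ _ B3.1) //.
    by rewrite f3 // f2 // f1.
  - move=> j jL; have jN : j < (n + n).+1 * n by apply: leq_trans jL le1.
    split.
    + by rewrite f7 // f6 // q5 (copy_val _ _ _ B4.1) // f4 // f3 // f2 // f1.
    + by rewrite f7 // q6 (copy_val _ _ _ B5.1) // f5 // f4 // f3 // f2 // f1.
    + by rewrite q7 (copy_val _ _ _ B6.1) // f6 // f5 // f4 // f3 // f2 // f1.
have := forest_code_spec env B7.1 H7 csym; rewrite -q8.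
case.
- by move=> v vn; rewrite K7 // M7.
- move=> g v vn; rewrite M7 // => cv; case/negP; apply: meets_self => //.
  by rewrite K7.
- move=> g x /meetsP[w wn [ew lw]] _; apply/meetsP; exists w => //; split=> //.
  by rewrite K7 //; apply: la_cov.
move=> MG [r Hr] _ Hroot.
set G := tr (arr s8 19) in MG Hr Hroot; set P := arr s8 20 in Hr Hroot.
have g19 : arr s0 19 = arr s8 19 by rewrite q10 cexec_frame // f9.
have g20 : arr s0 20 = P by rewrite q10 cexec_frame // f9.
have g16 : arr s0 16 = arr s7 16 by rewrite q10 cexec_frame // f9 // f8.
have fE v : v < n -> forest s0 v = G v && ~~ cov v by move=> vn; rewrite /forest g19 g16 -/G K7.
have covG v : v < n -> cov v -> G v by move=> vn cv; apply: MG => //; rewrite M7.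
have {}Hr v : v < n -> G v -> ~~ cov v -> [/\ P v < n, G (P v), r (P v) < r v & r v <= n].
  by move=> vn Gv cv; apply: Hr; rewrite ?K7.
pose own0 v := find (fun i => tr0 n k inp s (useB s) i v) (iota 0 k).
have O9 v : v < n -> arr s9 29 v = own0 v.
  move=> vn; rewrite q9 cset0_val ?bE //.
  rewrite (@ev_find _ _ _ _ _ _ (fun i => tr0 n k inp s (useB s) i v)) //.
    by rewrite -[bval _ _ BK]/(arr s8 0 1) B8.1.2.
  move=> i j _; rewrite (tr_tree0 _ _ _ _ B8) tr_EU tE ?ev_var //.
  - by rewrite f8 // f7 // f6 // f5 // f4 // f3 // f2 // f1.
  - by rewrite f8 // f7 // f6 // f5 // f4 // f3 // f2 // f1.
  - by rewrite f8 // f7 // f6 // f5 // f4 // f3 // f2 // f1.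
pose J j (z : lstate) := [/\ forall a, a != 29 -> arr z a = arr s9 a,
  forall v, v < n -> cov v -> arr z 29 v = own0 v &
  forall v, v < n -> G v -> ~~ cov v -> r v < j -> arr z 29 v = arr z 29 (P v)].
have [_ ownK ownF] : J (bvals s9 (BAdd BN (BC 1))) s0.
  rewrite q10; apply: for_ind; first by split=> // v vn _; apply: O9.
  move=> j z _ [j1 j2 j3]; have Bz : Base n k inp z by apply: Base_arr B9; apply: j1.
  have st v : v < n -> arr (cexec own_step (upd env 5 j) z) 29 v = if cov v then arr z 29 v else arr z 29 (P v).
    move=> vn; rewrite /own_step cset0_val ?bE // ev_if !ev_rd ev_var -[upd _ _ _ 2]/(v).
    by rewrite (j1 16) // (j1 20) // f9 // f8 // f9 // -/(tr (arr s7 16) v) K7.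
  split.
  - by move=> a h; rewrite cexec_frame ?j1 // inE.
  - by move=> v vn cv; rewrite st // cv j2.
  - move=> v vn Gv cv rj; have [p1 p2 p3 p4] := Hr v vn Gv cv.
    rewrite !st // (negPf cv); case: ifP => // cp.
    by apply: j3; rewrite ?cp //; apply: leq_trans p3 _.
rewrite bE // -[bval _ _ _]/(n + 1) addn1 in ownF.
have {}ownF v : v < n -> G v -> ~~ cov v -> arr s0 29 v = arr s0 29 (P v).
  by move=> vn Gv cv; apply: ownF => //; have [_ _ _] := Hr v vn Gv cv; rewrite ltnS.
have own_tr v : v < n -> cov v -> own0 v < k /\ tr0 n k inp s (useB s) (own0 v) v.
  move=> vn cv; have lt : own0 v < k by move: cv; rewrite /cov /cov0 has_find size_iota.
  by split=> //; have := nth_find 0 cv; rewrite nth_iota.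
have nt_tr i v : i < k -> v < n -> tr0 n k inp s (useB s) i v -> nt n inp i.
  by move=> ik vn tv; have := Htr i ik; case: ifP => // _ /(_ v vn); rewrite tv.
have own_ok m v : r v < m -> v < n -> G v ->
    [/\ arr s0 29 v < k, nt n inp (arr s0 29 v) & tr1 s0 (arr s0 29 v) v].
  elim: m v => // m IH v rm vn Gv; case cv: (cov v).
    rewrite ownK //; have [o1 o2] := own_tr v vn cv; split=> //; first exact: nt_tr o2.
    by rewrite /tr1 T0 o2.
  have [p1 p2 p3 p4] := Hr v vn Gv (negbT cv).
  have rp : r (P v) < m by apply: leq_trans p3 _.
  have [h1 h2 _] := IH (P v) rp p1 p2.
  have e := ownF v vn Gv (negbT cv); rewrite e; split=> //.
  by rewrite /tr1 fE // Gv cv e eqxx orbT.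
split.
- move=> i ik nti; have := Htr i ik; rewrite nti => -[[ri [t1 t2 t3]] ts].
  split; first by rewrite /tr1 T0 ts.
  set t := tI n inp i in t1 t2 t3 *.
  (* Tree vertices keep their rank, at most [n], and forest vertices are ranked above all of them.
     The root gets 0 because its old rank has no upper bound. *)
  exists (fun v => if v == t then 0 else if tr0 n k inp s (useB s) i v then ri v else n.+1 + r v).
  split=> //; first by rewrite /tr1 T0 t2.
  move=> v vn; rewrite {1}/tr1 /pa1 T0 P0 g20 => + vt; rewrite (negPf vt).
  case tv: (tr0 _ _ _ _ _ i v) => /=.
    move=> _; have [h1 h2 h3 h4] := t3 v vn tv vt; split=> //; first by rewrite /tr1 T0 h2.
      by case: eqP => _; rewrite ?h2 //; apply: leq_ltn_trans h3.
    by apply: leq_trans h4 _; rewrite (leq_trans (leq_addr n n)).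
  rewrite fE // => /andP[/andP[Gv cv] /eqP oi]; have [p1 p2 p3 p4] := Hr v vn Gv cv.
  have eo := ownF v vn Gv cv.
  split=> //; last by rewrite addSn ltnS leq_add2l.
    rewrite /tr1 T0; case cp: (cov (P v)).
      have [_ o2] := own_tr _ p1 cp; rewrite -(ownK _ p1 cp) -eo oi in o2; by rewrite o2.
    by rewrite fE // p2 cp -eo oi eqxx orbT.
  case: eqP => // /eqP pt; case: ifP => tp; last by rewrite ltn_add2l.
  have [_ _ _ h4] := t3 _ p1 tp pt.
  by rewrite addSn ltnS; apply: leq_trans h4 (leq_addr _ _).
- move=> v vn; rewrite g19 -/(tr (arr s8 19) v) => Gv.
  by have [h1 h2 h3] := own_ok (r v).+1 v (leqnn _) vn Gv; exists (arr s0 29 v).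
- move=> c; rewrite g20.
  apply: (@leq_trans (\sum_(i < k) (tcost n c (tr0 n k inp s (useB s) i) (pa0 n k inp s (useB s) i) (tI n inp i)
     + \sum_(v < n) (arr s0 29 v == i) * (forest s0 v * c v (P v))))).
    apply: leq_sum => i _; rewrite /tcost -big_split /=; apply: leq_sum => v _.
    rewrite /tr1 /pa1 T0 P0 g20; case: (tr0 _ _ _ _ _ i v) => /=; first exact: leq_addr.
    rewrite mul0n add0n mulnA leq_mul2r; apply/orP; right.
    by case: (forest s0 v); case: (_ == _); case: (_ != _).
  rewrite big_split /= leq_add2l exchange_big /=; apply: leq_sum => v _; exact: sum_owner.
- have := Hroot (fun _ _ => erefl).
  have -> : \sum_(v < n) (G v && ~~ tr (arr s7 16) v) * c0 v (P v) = \sum_(v < n) forest s0 v * c0 v (arr s0 20 v).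
    by apply: eq_bigr => v _; rewrite fE // K7 // g20.
  have -> : \sum_(v < n) ~~ tr (arr s7 16) v * bL v = \sum_(v < n) ~~ cov v * bL v.
    by apply: eq_bigr => v _; rewrite K7.
  have -> : \sum_(v < n) ~~ tr (arr s7 16) v * b0 v = \sum_(v < n) ~~ cov v * b0 v.
    by apply: eq_bigr => v _; rewrite K7.
  by rewrite /G g19.
Qed.
End Combine.

(** * Path extraction *)

Definition ELEN := ERd 31 (ECst 0).
Definition EPT (j : expr) := ERd 30 j.
Definition Ein (v : expr) := Eex 8 BN (Eand (Elt (EVar 8) ELEN) (Eeq (EPT (EVar 8)) v)).
Definition chain_step :=
  CIf (Eeq (EPT (ELEN -e ECst 1)) (ET (EVar 6))) CSkip
    (CSeq (CPut 30 ELEN (Epar1 (EVar 6) (EPT (ELEN -e ECst 1)))) (CPut 31 (ECst 0) (ELEN +e ECst 1))).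
Definition Epos := Efind 4 8 BN (Eeq (EPT (EVar 4)) (Epar1 (EVar 6) (EVar 3))).
Definition insert_code :=
  CSeq (CPut 32 (ECst 0) (EIf (Eeq Epos (ELEN -e ECst 1)) Epos (Epos +e ECst 1)))
  (CSeq (CSet 30 (ECst 0) 2 BN (EIf (Elt (EVar 2) (ERd 32 (ECst 0))) (EPT (EVar 2))
           (EIf (Eeq (EVar 2) (ERd 32 (ECst 0))) (EVar 3) (EPT (EVar 2 -e ECst 1)))))
        (CPut 31 (ECst 0) (ELEN +e ECst 1))).
Definition insert_step :=
  CIf (Eand (Etree1 (EVar 6) (EVar 3)) (Eand (Enot (Ein (EVar 3))) (Ein (Epar1 (EVar 6) (EVar 3)))))
    insert_code CSkip.
(** Ranks are at most [2 n + 1], so [2 n + 2] passes exhaust them. *)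
Definition BR := BAdd B2n (BC 2).
Definition write_code := CSeq (CWrite ELEN) (CFor 5 BN (CIf (Elt (EVar 5) ELEN) (CWrite (EPT (EVar 5))) CSkip)).
Definition build_code :=
  CSeq (CPut 30 (ECst 0) (ES (EVar 6))) (CSeq (CPut 31 (ECst 0) (ECst 1))
  (CSeq (CFor 5 BR chain_step) (CFor 5 BR (CFor 3 BN insert_step)))).
Definition paths_code :=
  CFor 6 BK (CIf (Ent (EVar 6)) (CSeq build_code write_code) (CSeq (CWrite (ECst 1)) (CWrite (ES (EVar 6))))).

Definition path_is (s : lstate) (q : seq nat) : Prop :=
  arr s 31 0 = size q /\ forall j, j < size q -> arr s 30 j = nth 0 q j.

Lemma find_iota_eq (Q : pred nat) N i : i < N -> Q i -> (forall j, j < i -> ~~ Q j) -> find Q (iota 0 N) = i.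
Proof.
move=> iN Qi Hj; rewrite -(subnKC (ltnW iN)) iotaD find_cat size_iota.
have -> : has Q (iota 0 i) = false.
  by apply/hasP => -[j]; rewrite mem_iota /= add0n => ji; apply/negP/Hj.
by rewrite add0n; move: iN; rewrite -subn_gt0; case: (N - i) => // m _ /=; rewrite Qi addn0.
Qed.

Lemma nth_insert_at m v q j : m <= size q ->
  nth 0 (insert_at m v q) j = if j < m then nth 0 q j else if j == m then v else nth 0 q j.-1.
Proof.
move=> mq; rewrite /insert_at nth_cat size_takel //; case: ltnP => jm; first by rewrite nth_take.
case: eqP => [->|/eqP ne]; first by rewrite subnn.
have mj : m < j by rewrite ltn_neqAle eq_sym ne.
rewrite (_ : j - m = (j.-1 - m).+1) /=; last by lia.
by rewrite nth_drop; congr (nth 0 q _); lia.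
Qed.

Lemma size_insert_at m v q : size (insert_at m v q) = (size q).+1.
Proof. by rewrite size_cat /= addnS -size_cat cat_take_drop. Qed.

Lemma cexec_write e env s : cexec (CWrite e) env s = LState (arr s) (linp s) (rcons (lout s) (eval (arr s) env e)).
Proof. by []. Qed.

Section Paths.
Variables (n k : nat) (inp : nat -> nat).

Lemma tr_in s env e q v : Base n k inp s -> path_is s q -> size q <= n ->
  (forall j, eval (arr s) (upd env 8 j) e = v) -> (eval (arr s) env (Ein e) != 0) = (v \in q).
Proof.
move=> B [h1 h2] qn He; rewrite /Ein tr_ex -[bval _ _ BN]/(arr s 0 0) B.1.1.
transitivity (has (fun j => (j < size q) && (arr s 30 j == v)) (iota 0 n)).
  by apply: eq_has => j; cbv beta; rewrite tr_and tr_lt tr_eq He !ev_rd ev_cst ev_var h1.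
rewrite has_iota_lt //; apply/hasP/idP.
  by move=> [j]; rewrite mem_iota /= add0n => jq /eqP <-; rewrite h2 // mem_nth.
move=> vq; exists (index v q); first by rewrite mem_iota /= add0n index_mem.
by rewrite h2 ?index_mem // nth_index.
Qed.

Lemma chain_step_spec env s i q x : Base n k inp s -> env 6 = i -> path_is s q -> ohead q = Some x ->
  let s' := cexec chain_step env s in
  path_is s' (if last x q == tI n inp i then q else rcons q (pa1 n k inp s i (last x q))).
Proof.
move=> B e6 [h1 h2] oq s'.
have q0 : 0 < size q by case: (q) oq.
have lE : arr s 30 (size q - 1) = last x q.
  by rewrite h2 subn1 ?prednK // nth_last; case: (q) q0.
have eE E : eval (arr s) E (EPT (ELEN -e ECst 1)) = last x q by rewrite /EPT /ELEN !evE h1.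
rewrite /s' /chain_step cexec_if tr_eq eE (ev_T _ _ B) ev_var e6.
case: ifP => _; first by rewrite cexec_skip.
seq_step s1 q1 f1; split.
  by rewrite cput_val ev_cst eqxx ev_add ev_cst /ELEN ev_rd ev_cst f1 // h1 size_rcons addn1.
move=> j; rewrite size_rcons ltnS => jq; rewrite cexec_frame // q1 cput_val /ELEN ev_rd ev_cst h1.
rewrite nth_rcons (ev_par1 _ _ _ B) -/ELEN eE ev_var -[upd _ _ _ 6]/(env 6) e6.
case: eqP => [->|/eqP ne]; first by rewrite ltnn.
by have jq' : j < size q by [rewrite ltn_neqAle ne]; rewrite jq' h2.
Qed.

Lemma insert_step_spec env s i v q : Base n k inp s -> env 6 = i -> env 3 = v -> path_is s q -> uniq q ->
  all (fun w => w < n) q -> v < n ->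
  let s' := cexec insert_step env s in
  let p := pa1 n k inp s i v in
  let m := if index p q == (size q).-1 then index p q else (index p q).+1 in
  path_is s' (if [&& tr1 n k inp s i v, v \notin q & p \in q] then insert_at m v q else q).
Proof.
move=> B e6 e3 Hq uq qn vn s' p m; have sq := uniq_bound uq qn; have [h1 h2] := Hq.
rewrite /s' /insert_step cexec_if !tr_and tr_not (tr_tree1 _ _ _ B) !ev_var e6 e3.
have ev3 j : eval (arr s) (upd env 8 j) (EVar 3) = v by [].
have evp j : eval (arr s) (upd env 8 j) (Epar1 (EVar 6) (EVar 3)) = p.
  by rewrite (ev_par1 _ _ _ B) !ev_var -[upd _ _ _ 6]/(env 6) -[upd _ _ _ 3]/(env 3) e6 e3.
rewrite (tr_in B Hq sq ev3) (tr_in B Hq sq evp).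
case: ifP => C; last by rewrite cexec_skip.
case/and3P: C => Tv vq pq.
have sn : size q < n by have := @uniq_bound n (v :: q); rewrite /= vq uq vn; apply.
have iq : index p q < size q by rewrite index_mem.
have mq : m <= size q by rewrite /m; case: ifP => _ //; apply: ltnW.
have pE E : E 6 = i -> E 3 = v -> eval (arr s) E Epos = index p q.
  move=> E6 E3; rewrite /Epos (@ev_find _ _ _ _ _ _ (fun j => arr s 30 j == p)) //; last first.
    by move=> j j' _; rewrite tr_eq (ev_par1 _ _ _ B) /EPT ev_rd !ev_var -[upd _ _ _ 4]/(j) /upd /= E6 E3.
  rewrite -[bval _ _ BN]/(arr s 0 0) B.1.1; apply: find_iota_eq; first exact: leq_trans iq sq.
    by rewrite h2 // nth_index.
  move=> j ji; rewrite h2; last exact: ltn_trans iq.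
  by have := before_find 0 ji; rewrite /= => ->.
rewrite /insert_code; seq_step s1 q1 f1; seq_step s2 q2 f2.
have B1 : Base n k inp s1 by apply: Base_arr B; apply: f1.
have e32 : arr s1 32 0 = m.
  rewrite q1 cput_val ev_cst eqxx ev_if tr_eq ev_add ev_sub /ELEN ev_rd !ev_cst h1 subn1 !pE //.
  by rewrite addn1.
split.
  by rewrite cput_val ev_cst eqxx ev_add ev_cst /ELEN ev_rd ev_cst f2 // f1 // h1 size_insert_at addn1.
move=> j; rewrite size_insert_at ltnS => jq; rewrite cexec_frame // q2 cset0_val; last first.
  by rewrite (dims_bval _ B1.1); apply: leq_ltn_trans sn.
rewrite ev_if tr_lt ev_if tr_eq /EPT !ev_rd ev_sub !ev_var !ev_cst e32 f1 // -[upd _ _ _ 2]/(j) -[upd _ _ _ 3]/(env 3) e3.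
rewrite nth_insert_at //; case: ltnP => jm; first by rewrite h2 //; apply: leq_trans jm mq.
case: eqP => // /eqP ne; rewrite subn1 h2 //.
have mj : m < j by rewrite ltn_neqAle eq_sym ne.
by rewrite prednK //; apply: leq_ltn_trans mj.
Qed.

Variables (c : nat -> nat -> nat).
Hypothesis c_sym : forall u v, u < n -> v < n -> c u v = c v u.
Hypothesis c_tri : forall u v w, u < n -> v < n -> w < n -> c u w <= c u v + c v w.
Hypothesis c_diag : forall u, u < n -> c u u = 0.

Definition path_ok (s : lstate) (i : nat) (q : seq nat) : Prop :=
  good_path n c (tr1 n k inp s i) (pa1 n k inp s i) (sI n inp i) (tI n inp i) q /\
  forall v, v < n -> tr1 n k inp s i v -> v \in q.

Lemma build_code_spec env s i : Base n k inp s -> i < k -> nt n inp i -> sI n inp i < n ->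
  tr1 n k inp s i (sI n inp i) ->
  (exists r, rooted_tree n (tr1 n k inp s i) (pa1 n k inp s i) (tI n inp i) (n + n).+1 r) ->
  let s' := cexec build_code (upd env 6 i) s in
  exists2 q, path_is s' q & path_ok s i q.
Proof.
move=> B ik nti sn Ts [r HT] s'; rewrite /s' /build_code.
set T := tr1 n k inp s i in HT *; set P := pa1 n k inp s i in HT *.
set a := sI n inp i in sn Ts *; set t := tI n inp i in HT *.
have st : a != t by [].
seq_step s1 q1 f1; seq_step s2 q2 f2; seq_step s3 q3 f3.
have bE z b : Base n k inp z -> bvals z b = bval n k b by move=> [Dz _]; apply: dims_bval.
pose Fr z := forall b, b \notin [:: 30; 31; 32] -> arr z b = arr s b.
have FB z : Fr z -> Base n k inp z by move=> h; apply: Base_arr B; apply: h.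
have FT z : Fr z -> tr1 n k inp z i = T /\ pa1 n k inp z i = P.
  move=> h; rewrite /T /P /tr1 /pa1 /forest /tr0 /pa0 /useB /TT /PP.
  by rewrite !(h 37) // !(h 26) // !(h 22) // !(h 23) // !(h 19) // !(h 16) // !(h 29) // !(h 20).
have Fstep z cc E : all (mem [:: 30; 31; 32]) (writes cc) -> Fr z -> Fr (cexec cc E z).
  by move=> sub h b hb; rewrite cexec_frame ?h //; apply: contra hb; apply: (allP sub).
have F2 : Fr s2.
  by move=> b hb; rewrite f2 ?f1 //; move: hb; rewrite !inE !negb_or => /and3P[h1' h2' h3'] //.
pose R := (n + n).+1.
pose I1 j z := Fr z /\ exists2 q, path_is z q & good_chain n c T P a t R r j q.
have [F3 [q3' Q3 C3]] : I1 (bvals s2 BR) s3.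
  rewrite q3; apply: for_ind.
    split=> //; exists [:: a]; last exact: good_chain_init.
    split=> [|[|//] _].
      by rewrite q2 cput_val !ev_cst eqxx.
    by rewrite f2 // q1 cput_val ev_cst eqxx (ev_S _ _ B) ev_var.
  move=> j z _ [Fz [q Qz Cz]]; have Bz := FB z Fz; have [_ PE] := FT z Fz.
  split; first by apply: Fstep Fz.
  have oq : ohead q = Some a by case: Cz.
  eexists; first exact: (chain_step_spec Bz (erefl : upd (upd env 6 i) 5 j 6 = i) Qz oq).
  rewrite PE; case: eqP => [e|/eqP ne]; first exact: good_chain_stop.
  exact: good_chain_next.
rewrite bE in C3; last exact: FB.
have {C3} C3 : good_chain n c T P a t R r R.+1 q3' by rewrite (_ : R.+1 = bval n k BR) // /R -addn2.
have G3 : good_path n c T P a t q3' by apply: good_chain_path C3.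
(* After [j] passes all tree vertices of rank below [j] are on the path; within a pass those of rank
   [j] follow in the order of their index, as their parents are already there. The root is on the
   path from the start. *)
pose Q j m q := good_path n c T P a t q /\ forall v, v < n -> T v ->
  [|| v == t, r v < j | (r v < j.+1) && (v < m)] -> v \in q.
have tq q : good_path n c T P a t q -> t \in q.
  by move=> [oq <- _ _ _]; case: q oq => // x p /= [->]; apply: mem_last.
pose I2 j m z := Fr z /\ exists2 q, path_is z q & Q j m q.
have stepI j m z : m < n -> I2 j m z -> I2 j m.+1 (cexec insert_step (upd (upd (upd env 6 i) 5 j) 3 m) z).
  move=> mn [Fz [q Qz [gq Hq]]]; have Bz := FB z Fz; have [TE PE] := FT z Fz.
  split; first by apply: Fstep Fz.
  have [oq lq uq aq cq] := gq.
  have qn : all (fun w => w < n) q by apply: sub_all aq => w /andP[].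
  have := @insert_step_spec (upd (upd (upd env 6 i) 5 j) 3 m) z i m q Bz erefl erefl Qz uq qn mn.
  rewrite TE PE => Q'; eexists; first exact: Q'.
  case C: [&& T m, m \notin q & P m \in q].
    have /and3P[Tm mq Pq] := C.
    have mt : m != t by apply: contraNneq mq => ->; apply: tq.
    split; first by eapply good_path_insert; try reflexivity; try eassumption.
    move=> v vn Tv; rewrite mem_insert_at => /or3P[/eqP ->|h|/andP[h]]; last 1 first.
    - rewrite ltnS leq_eqVlt => /orP[/eqP ->|vm]; first by rewrite eqxx.
      by rewrite (Hq v) ?orbT // h vm !orbT.
    - by rewrite tq // orbT.
    - by rewrite (Hq v) ?orbT // h !orbT.
  split=> // v vn Tv /or3P[/eqP ->|h|/andP[h]]; first exact: tq.
    by apply: Hq; rewrite // h orbT.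
  rewrite ltnS leq_eqVlt => /orP[/eqP vm|vm]; last by apply: Hq; rewrite // h vm !orbT.
  case vt: (v == t); first by rewrite (eqP vt) tq.
  move: C; rewrite -vm Tv /=; case vq: (v \in q) => //= /negbT; case/negP.
  have [_ _ HT3] := HT; have [p1 p2 p3 p4] := HT3 v vn Tv (negbT vt).
  by apply: Hq => //; rewrite (leq_trans p3) ?orbT //.
have [F4 [q Q4 [g4 H4]]] : I2 (bvals s3 BR) 0 (cexec (CFor 5 BR (CFor 3 BN insert_step)) (upd env 6 i) s3).
  apply: (@for_ind 5 BR _ _ s3 (fun j z => I2 j 0 z)).
    split=> //; exists q3' => //; split=> // v vn Tv; rewrite !ltn0 andbF !orbF => /eqP ->.
    exact: tq.
  move=> j z _ Iz; have Bz := FB z Iz.1.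
  have : I2 j (bvals z BN) (cexec (CFor 3 BN insert_step) (upd (upd env 6 i) 5 j) z).
    apply: (@for_ind 3 BN _ _ z (fun m z => I2 j m z)) => // m y mB Iy.
    by apply: stepI => //; rewrite bE // in mB.
  rewrite bE // => -[Fy [q Qy [gq Hq]]]; split=> //; exists q => //; split=> // v vn Tv.
  rewrite ltn0 andbF orbF => /orP[h|h]; apply: Hq => //; first by rewrite h.
  by rewrite h vn !orbT.
exists q => //; split=> // v vn Tv; apply: H4 => //.
case vt: (v == t) => //=; have [_ _ HT3] := HT; have [_ _ _ p4] := HT3 v vn Tv (negbT vt).
rewrite bE; last exact: FB.
by rewrite -[bval n k BR]/(n + n + 2) addn2 (leq_ltn_trans p4).
Qed.

Lemma write_code_spec env s q : Base n k inp s -> path_is s q -> size q <= n ->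
  let s' := cexec write_code env s in
  arr s' = arr s /\ lout s' = lout s ++ size q :: q.
Proof.
move=> B [h1 h2] qn s'; rewrite /s' /write_code cexec_seq cexec_write.
set s1 := LState _ _ _.
have a1 : arr s1 = arr s by [].
have B1 : Base n k inp s1 by apply: Base_arr B.
have l1 : lout s1 = rcons (lout s) (size q) by rewrite /s1 /ELEN ev_rd ev_cst h1.
move: s1 a1 B1 l1 => s1 a1 B1 l1.
have [] : arr (cexec (CFor 5 BN (CIf (Elt (EVar 5) ELEN) (CWrite (EPT (EVar 5))) CSkip)) env s1) = arr s /\
    lout (cexec (CFor 5 BN (CIf (Elt (EVar 5) ELEN) (CWrite (EPT (EVar 5))) CSkip)) env s1) =
    lout s ++ size q :: take (bvals s1 BN) q.
  apply: (@for_ind 5 BN _ _ s1 (fun j z => arr z = arr s /\ lout z = lout s ++ size q :: take j q)).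
    by rewrite take0 l1 cats1.
  move=> j z _ [az lz]; rewrite cexec_if tr_lt /ELEN /EPT ev_rd ev_cst ev_var az h1 -[upd _ _ _ 5]/(j).
  case: ltnP => jq; last by rewrite cexec_skip az lz !take_oversize // ltnW.
  rewrite cexec_write ev_rd ev_var; split=> //.
  by rewrite -[upd _ _ _ 5]/(j) /= lz az h2 // (take_nth 0) // rcons_cat rcons_cons.
move=> -> ->; split=> //; rewrite take_oversize // (dims_bval _ B1.1).
exact: qn.
Qed.

Lemma paths_code_spec env s : Base n k inp s -> (forall i, i < k -> sI n inp i < n) ->
  (forall i, i < k -> nt n inp i -> tr1 n k inp s i (sI n inp i) /\
    exists r, rooted_tree n (tr1 n k inp s i) (pa1 n k inp s i) (tI n inp i) (n + n).+1 r) ->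
  exists2 qs : nat -> seq nat,
    lout (cexec paths_code env s) = lout s ++ flatten [seq size (qs i) :: qs i | i <- iota 0 k] &
    forall i, i < k -> if nt n inp i then path_ok s i (qs i) else qs i = [:: sI n inp i].
Proof.
move=> B sn Htr.
pose Fr z := forall b, b \notin [:: 30; 31; 32] -> arr z b = arr s b.
have FT z i : Fr z -> tr1 n k inp z i = tr1 n k inp s i /\ pa1 n k inp z i = pa1 n k inp s i.
  move=> h; rewrite /tr1 /pa1 /forest /tr0 /pa0 /useB /TT /PP.
  by rewrite !(h 37) // !(h 26) // !(h 22) // !(h 23) // !(h 19) // !(h 16) // !(h 29) // !(h 20).
pose I j z := Fr z /\ exists2 qs : nat -> seq nat,
  lout z = lout s ++ flatten [seq size (qs i) :: qs i | i <- iota 0 j] &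
  forall i, i < j -> if nt n inp i then path_ok s i (qs i) else qs i = [:: sI n inp i].
have [_ H] : I (bvals s BK) (cexec paths_code env s).
  apply: for_ind; first by split=> //; exists (fun=> [::]); rewrite ?cats0.
  move=> i z; rewrite (dims_bval _ B.1) -[bval n k BK]/(k) => ik [Fz [qs lz Hqs]].
  have Bz : Base n k inp z by apply: Base_arr B; apply: Fz.
  suff [F' [q lq Hq]] : Fr (cexec (CIf (Ent (EVar 6)) (CSeq build_code write_code) (CSeq (CWrite (ECst 1)) (CWrite (ES (EVar 6))))) (upd env 6 i) z) /\
      exists2 q, lout (cexec (CIf (Ent (EVar 6)) (CSeq build_code write_code) (CSeq (CWrite (ECst 1)) (CWrite (ES (EVar 6))))) (upd env 6 i) z) = lout z ++ size q :: q &
        if nt n inp i then path_ok s i q else q = [:: sI n inp i].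
    split=> //; exists (fun j => if j == i then q else qs j).
      rewrite lq lz -catA; congr (_ ++ _); rewrite -[in RHS]addn1 iotaD map_cat flatten_cat /= eqxx cats0.
      congr (_ ++ _); congr flatten; apply/eq_in_map => j; rewrite mem_iota /= add0n => ji.
      by rewrite ifN //; apply: contraTneq ji => ->; rewrite ltnn.
    move=> j; rewrite ltnS leq_eqVlt => /orP[/eqP ->|ji]; first by rewrite eqxx.
    have -> : (j == i) = false by apply: contraTF ji => /eqP ->; rewrite ltnn.
    exact: Hqs.
  rewrite cexec_if (tr_nt _ _ Bz) ev_var -[upd _ _ _ 6]/(i).
  case: ifP => nti; last first.
    rewrite cexec_seq !cexec_write; split=> //; exists [:: sI n inp i] => //.
    rewrite -[lout _]/(rcons (rcons (lout z) 1) (eval (arr z) (upd env 6 i) (ES (EVar 6)))).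
    by rewrite (ev_S _ _ Bz) ev_var -!cats1 -catA.
  have [t1 t2] := Htr i ik nti; have [TE PE] := FT z i Fz.
  rewrite -TE -PE in t1 t2.
  have [q Qq [gq Hq]] := build_code_spec env Bz ik nti (sn i ik) t1 t2.
  rewrite cexec_seq; have [y qy] : exists y, y = cexec build_code (upd env 6 i) z by eexists.
  rewrite -qy in Qq *.
  have By : Base n k inp y by apply: Base_arr Bz; rewrite qy cexec_frame.
  have [_ _ uq aq _] := gq.
  have qn : size q <= n by apply: uniq_bound uq _; apply: sub_all aq => w /andP[].
  have [w1 w2] := write_code_spec (upd env 6 i) By Qq qn.
  split.
    move=> b hb; rewrite w1 qy cexec_frame; first exact: Fz.
    by apply: contra hb; apply: (allP (isT : all (mem [:: 30; 31; 32]) (writes build_code))).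
  exists q; first by rewrite w2 qy cexec_noio.
  by rewrite /path_ok -TE -PE.
case: H => qs; rewrite (dims_bval _ B.1) => h1 h2; by exists qs.
Qed.
End Paths.

Import Order.TTheory GRing.Theory Num.Theory.

(** * The algorithm *)

Definition main_code :=
  CSeq read_code (CSeq scale_code (CSeq pi_code (CSeq k0_code (CSeq root_code (CSeq rounds_code
  (CSeq select_code (CSeq choice_code (CSeq combine_code paths_code)))))))).

Definition npath (n a b : nat) (q : seq nat) : Prop :=
  [/\ ohead q = Some a, last a q = b, uniq q & all (fun v => v < n) q].

Definition nvalue (n k : nat) (c : nat -> nat -> nat) (p : nat -> nat) (qs : nat -> seq nat) : nat :=
  \sum_(i < k) seq_cost c (qs i) + \sum_(v < n) ~~ has (fun i => (v : nat) \in qs i) (iota 0 k) * p v.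

Lemma big_iota k (Q : pred nat) (F : nat -> nat) :
  \sum_(i <- iota 0 k | Q i) F i = \sum_(i < k | Q i) F i.
Proof. by rewrite -(big_mkord Q F) /index_iota subn0. Qed.

(* The better candidate costs at most the average of the two. *)
Lemma final_arith (a b d X sc D t1 g V A B chi chiO chiM Cp po pen pen' sco : nat) : 0 < X -> a = b + d ->
  sc + D <= 2 * t1 -> 2 * X * t1 + X * g <= V -> V <= A -> V <= B ->
  (4 * a) * A <= (8 * a) * X * Cp + (4 * b) * chi + (4 * d) * chiM ->
  B <= 2 * X * D + chi -> chi = chiO + chiM -> chiO <= 2 * X * Cp -> chiM <= X * po ->
  pen <= g -> Cp <= sco -> po <= pen' ->
  a * (sc + pen) <= (2 * a + b) * (sco + pen').
Proof.
move=> X0 ae h1 h2 h3 h4 h5 h6 h7 h8 h9 h10 h11 h12; subst chi.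
rewrite -(leq_pmul2l X0).
(* The combination behind these products: by [2 * V <= A + B] the term [D] of [B] cancels against
   [h1]. The coefficient of [chiO] becomes [(a + b) / (2 * a)], so [chiO <= 2 * X * Cp] adds
   [1 + b / a] to the coefficient 1 that [Cp] has from [A / 2]. That of [chiM] is 1 because
   [b + d = a]. *)
have g1 := leq_mul (leqnn (a * X)) h1; have g2 := leq_mul (leqnn a) h2.
have g3 := leq_mul (leqnn a) h3; have g4 := leq_mul (leqnn a) h4.
have g6 := leq_mul (leqnn a) h6; have g8 := leq_mul (leqnn a) h8; have g8' := leq_mul (leqnn b) h8.
have g9 := leq_mul (leqnn a) h9; have g10 := leq_mul (leqnn (a * X)) h10.
have g11 := leq_mul (leqnn (a * X)) h11; have g11' := leq_mul (leqnn (b * X)) h11.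
have g12 := leq_mul (leqnn (a * X)) h12.
have z1 := leq0n (a * X * pen'); have z2 := leq0n (b * X * pen').
have ac : a * chiM = b * chiM + d * chiM by rewrite ae mulnDl.
move: h5 g1 g2 g3 g4 g6 g8 g8' g9 g10 g11 g11' g12 z1 z2 ac; clear.
rewrite !mulnDr !mulnDl.
have e1 y : 2 * X * y = X * y + X * y by lia.
lia.
Qed.

Lemma seq_cost_ext n c C q : (forall u v, u < n -> v < n -> c u v = C u v) ->
  all (fun v => v < n) q -> seq_cost c q = seq_cost C q.
Proof.
move=> H; case: q => //= a q; elim: q a => //= b q IH a /and3P[an bn qn].
by rewrite H // IH //= bn.
Qed.

Lemma main_code_spec n k x : 1 < size x -> nth 0 x 0 = n -> nth 0 x 1 = k -> size x = tbase n + k + k ->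
  let S i := nth 0 x (tbase n + i + i) in let T i := nth 0 x (tbase n + i + i + 1) in
  let w e := (\prod_(j < n * n + n) (if e == j :> nat then 1 else nth 0 x (2 + j + j + 1))) * nth 0 x (2 + e + e) in
  let c u v := w (u * n + v) in let p v := w (n * n + v) in
  (forall i, i < k -> S i < n /\ T i < n) ->
  (forall u v, u < n -> v < n -> c u v = c v u) ->
  (forall u v w, u < n -> v < n -> w < n -> c u w <= c u v + c v w) ->
  (forall u, u < n -> c u u = 0) ->
  exists qs : nat -> seq nat, [/\
    lout (cexec main_code (fun=> 0) (start_state x)) = flatten [seq size (qs i) :: qs i | i <- iota 0 k],
    forall i, i < k -> npath n (S i) (T i) (qs i) &
    forall os, (forall i, i < k -> npath n (S i) (T i) (os i)) ->
      625 * nvalue n k c p qs <= (2 * 625 + 256) * nvalue n k c p os].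
Proof.
move=> x1 x0 xk sx S T w c p st csym ctri cdiag; rewrite /main_code.
seq_step s1 q1 f1; seq_step s2 q2 f2; seq_step s3 q3 f3; seq_step s4 q4 f4; seq_step s5 q5 f5.
seq_step s6 q6 f6; seq_step s7 q7 f7; seq_step s8 q8 f8; seq_step s9 q9 f9.
have [D1 [i1 l1]] := read_code_spec x1 x0 xk sx; rewrite -q1 in D1 i1 l1.
pose inp := arr s1 0; have B1 : Base n k inp s1 by split.
have B2 : Base n k inp s2 by apply: Base_arr B1; apply: f2.
have B3 : Base n k inp s3 by apply: Base_arr B2; apply: f3.
have B4 : Base n k inp s4 by apply: Base_arr B3; apply: f4.
have B5 : Base n k inp s5 by apply: Base_arr B4; apply: f5.
have B6 : Base n k inp s6 by apply: Base_arr B5; apply: f6.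
have B7 : Base n k inp s7 by apply: Base_arr B6; apply: f7.
have B8 : Base n k inp s8 by apply: Base_arr B7; apply: f8.
have B9 : Base n k inp s9 by apply: Base_arr B8; apply: f9.
have SE i : i < k -> sI n inp i = S i by move=> ik; rewrite /sI /inp i1 // sx; clear -ik; lia.
have TE i : i < k -> tI n inp i = T i by move=> ik; rewrite /tI /inp i1 // sx; clear -ik; lia.
have stI i : i < k -> sI n inp i < n /\ tI n inp i < n by move=> ik; rewrite SE // TE //; apply: st.
have w2 e : e < n * n + n -> arr s2 1 e = w e.
  move=> eN; rewrite q2 (scale_code_spec _ D1) // /w; congr (_ * _); last first.
    by rewrite i1 // sx /tbase; move: eN; move: (n * n); clear; lia.
  apply: eq_bigr => j _; rewrite i1 // sx /tbase.
  by have := ltn_ord j; move: (nat_of_ord j) => j'; move: (n * n) => m; clear; lia.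
pose C u v := arr s2 1 (u * n + v).
have cC u v : u < n -> v < n -> c u v = C u v.
  by move=> un vn; rewrite /C w2 //; apply: ltn_addr; apply: idx_lt.
have Csym u v : u < n -> v < n -> C u v = C v u by move=> un vn; rewrite -!cC // csym.
have Ctri u v z : u < n -> v < n -> z < n -> C u z <= C u v + C v z.
  by move=> un vn zn; rewrite -!cC // ctri.
have Cdiag u : u < n -> C u u = 0 by move=> un; rewrite -cC // cdiag.
have a41 : arr s4 1 = arr s2 1 by rewrite f4 // f3.
have a51 : arr s5 1 = arr s2 1 by rewrite f5.
have a61 : arr s6 1 = arr s2 1 by rewrite f6.
have a71 : arr s7 1 = arr s2 1 by rewrite f7.
pose term v := has (fun i => (v == sI n inp i) || (v == tI n inp i)) (iota 0 k).
pose b0 := arr s4 2.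
have b0E v : v < n -> b0 v = if term v then 0 else p v.
  move=> vn; rewrite /b0 f4 // q3 (pi_code_spec _ B2) // -/(term v) w2 //.
  by rewrite ltn_add2l.
pose K0 := tr (arr s4 36).
have K0E v : v < n -> K0 v = has (fun i => nt n inp i && ((v == sI n inp i) || (v == tI n inp i))) (iota 0 k).
  by move=> vn; rewrite /K0 q4 (k0_code_spec _ B3).
have [bL [chiE H]] := root_code_spec (fun=> 0) B4.1; rewrite -q5 a41 -/b0 in chiE H.
pose chi := arr s5 21; pose X := 2 ^ (n + n).
have z22 y : arr s5 22 y = 0 by rewrite f5 // f4 // f3 // f2 // f1.
have csym5 u v : u < n -> v < n -> arr s5 1 (u * n + v) = arr s5 1 (v * n + u).
  by move=> un vn; rewrite a51; apply: Csym.
have R := rounds_code_spec (fun=> 0) B5 z22 stI csym5; rewrite -q6 a51 -/C -/chi in R.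
have [sel4 selmin] := select_code_spec (fun=> 0) B6; rewrite -q7 in sel4 selmin.
have V := choice_code_spec (fun=> 0) B7; rewrite -q8 in V.
set U := useB s8 in V.
have t87 u : tr0 n k inp s8 u = tr0 n k inp s7 u by rewrite /tr0 /TT (f8 22) // (f8 26).
have p87 u : pa0 n k inp s8 u = pa0 n k inp s7 u by rewrite /pa0 /PP (f8 23) // (f8 26).
have trees u i : i < k -> if nt n inp i then tree_ok n inp (tr0 n k inp s7 u i) (pa0 n k inp s7 u i) i
    else forall v, v < n -> ~~ tr0 n k inp s7 u i v.
  move=> ik; have [sn tn] := stI i ik; case: u.
    rewrite /tr0 /pa0; case nti: (nt n inp i) => //=; split; last by rewrite eqxx.
    exists (fun v => (v != tI n inp i) : nat); split=> //; first by rewrite eqxx orbT.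
    move=> v vn _ vt; rewrite !eqxx vt orbT; split=> //.
    by apply: leq_ltn_trans vn.
  have := R (arr s7 26 i) i (sel4 i ik) ik; rewrite /slot_ok /tr0 /pa0 /TT /PP (f7 22) // (f7 23) //.
  by case: ifP => // _ [].
have bt : base_trees n k inp s8.
  by move=> i ik; rewrite -/U t87 p87; apply: trees.
have K0cov v : v < n -> K0 v -> cov0 n k inp s8 U v.
  move=> vn; rewrite K0E // => /hasP[i ii /andP[nti vst]]; apply/hasP; exists i => //.
  have ik : i < k by move: ii; rewrite mem_iota.
  rewrite t87; have := trees U i ik; rewrite nti => -[[r [t1 t2 t3]] ts].
  by case/orP: vst => /eqP ->.
have H8 : hist n K0 K0 (fun u v => 2 * arr s2 1 (u * n + v)) b0 bL (arr s8 41) (arr s8 42) (arr s8 43) (arr s8 44) (arr s8 45).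
  by rewrite !f8 // !f7 // !f6.
have Csym2 u v : u < n -> v < n -> 2 * arr s2 1 (u * n + v) = 2 * arr s2 1 (v * n + u).
  by move=> un vn; rewrite -/(C u v) Csym.
have [cb1 cb2 cb3 cb4] := combine_code_spec (fun=> 0) B8 H8 Csym2 K0cov bt.
rewrite -q9 in cb1 cb2 cb3 cb4; rewrite -/U in cb3 cb4.
have snI i : i < k -> sI n inp i < n by move=> /stI[].
have [qs lq Hqs] := paths_code_spec Csym Ctri Cdiag (fun=> 0) B9 snI cb1.
have l9 : lout s9 = [::].
  rewrite q9 cexec_noio // q8 cexec_noio // q7 cexec_noio // q6 cexec_noio // q5 cexec_noio //.
  by rewrite q4 cexec_noio // q3 cexec_noio // q2 cexec_noio.
have Pqs i : i < k -> npath n (S i) (T i) (qs i).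
  move=> ik; have [sn tn] := stI i ik; have := Hqs i ik; case nti: (nt n inp i).
    by move=> [[h1 h2 h3 h4 _] _]; rewrite -SE // -TE //; split=> //; apply: sub_all h4 => v /andP[].
  move=> ->; move/negbFE/eqP: nti => est; rewrite -SE // -TE // -est; split=> //=.
  by rewrite sn.
exists qs; split=> //; first by rewrite lq l9.
move=> os Hos.
have osE i : i < k -> os i = sI n inp i :: behead (os i).
  by move=> ik; have [h _ _ _] := Hos i ik; rewrite SE //; case: (os i) h => // a q [->].
(* Pairs with equal ends are left out of the comparison: they have no tree, and their paths are
   single vertices of cost 0. *)
pose inP i v := nt n inp i && (v \in os i).
pose O v := has (fun i => inP i v) (iota 0 k).
pose cP i := nt n inp i * seq_cost C (os i).
have orc t i : t < 4 -> i < k ->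
    (2 * 625) * 4 ^ k.-1 * X * slot_cost n k inp s6 t i
    + \sum_(v < n) ~~ TT n k s6 t i v * (gam t * chi v * others k (TT n k s6) t i v) <=
    (2 * 625) * 4 ^ k.-1 * X * cP i + \sum_(v < n) ~~ inP i v * (gam t * chi v * others k (TT n k s6) t i v).
  move=> t4 ik; rewrite /slot_cost a61 -/C; have := R t i t4 ik; rewrite /slot_ok /cP /inP.
  case: (nt n inp i).
    move=> [_ /(_ (behead (os i)))]; have [h1 h2 _ h4] := Hos i ik.
    rewrite mul1n (osE i ik) /= in h2 h4 *.
    apply; first by case/andP: h4.
    by rewrite TE.
  move=> nT; rewrite /tcost big1 ?muln0 ?mul0n ?muln0; last first.
    by move=> v _; rewrite (negPf (nT v (ltn_ord v))).
  rewrite leq_add2l; apply: leq_sum => v _; rewrite /= leq_mul2r; apply/orP; right.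
  exact: leq_b1.
have a621 : arr s6 21 = chi by rewrite f6.
rewrite /svalue a621 in selmin.
have Hsel : (4 * 625) * (2 * X * (\sum_(j < k) slot_cost n k inp s6 (arr s7 26 j) j)
      + \sum_(v < n) ~~ covered (TT n k s6) (arr s7 26) k v * chi v) <=
    (8 * 625) * X * (\sum_(i < k) cP i) + (4 * 256) * (\sum_(v < n) chi v) + (4 * 369) * chiM n chi O.
  by eapply selection_bound with (inP := inP); first [exact: orc | exact: sel4 | exact: selmin | by move=> v vn].
have XE (Q : pred nat) : X * (\sum_(v < n) Q v * b0 v) = \sum_(v < n) Q v * chi v + \sum_(v < n) Q v * bL v.
  rewrite big_distrr -big_split /=; apply: eq_bigr => v _.
  by rewrite -mulnDr chiE // mulnCA.
pose D := \sum_(i < k) nt n inp i * C (sI n inp i) (tI n inp i).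
pose Cp := \sum_(i < k) cP i.
have vA : value0 n k inp s7 false = 2 * X * (\sum_(j < k) slot_cost n k inp s6 (arr s7 26 j) j)
    + \sum_(v < n) ~~ covered (TT n k s6) (arr s7 26) k v * chi v.
  rewrite /value0 /cost0 /cov0 /tr0 /pa0 /slot_cost /covered /TT /PP.
  by rewrite (f7 1) // (f7 22) // (f7 23) // (f7 21) // a621.
have vB : value0 n k inp s7 true <= 2 * X * D + \sum_(v < n) chi v.
  apply: leq_add.
    rewrite leq_mul2l; apply/orP; right; apply: leq_sum => i _.
    apply: leq_trans (sum_owner n (sI n inp i) (nt n inp i * C (sI n inp i) (tI n inp i))).
    rewrite /cost0 /tcost a71; apply: leq_sum => v _; rewrite /tr0 /pa0.
    case: (nt n inp i) => //=; case: (eqVneq (v : nat) (sI n inp i)) => [->|_] /=.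
      by rewrite !mul1n; case: (_ != _); rewrite ?mul1n ?mul0n.
    by case: eqP.
  rewrite f7 // a621; apply: leq_sum => v _; case: (cov0 _ _ _ _ _ _) => //.
  by rewrite mul1n.
have chiS : \sum_(v < n) chi v = \sum_(v < n) O v * chi v + chiM n chi O.
  by rewrite -big_split /=; apply: eq_bigr => v _; case: (O v); rewrite ?mul0n ?mul1n ?addn0.
have K0S i : i < k -> nt n inp i -> K0 (sI n inp i) && K0 (tI n inp i).
  move=> ik nti; have [sn tn] := stI i ik; rewrite !K0E //; apply/andP; split; apply/hasP;
  by exists i; rewrite ?mem_iota //= nti eqxx ?orbT.
pose ps := [seq (sI n inp i, behead (os i)) | i <- iota 0 k & nt n inp i].
have hps q : q \in ps -> [/\ q.1 < n, all (fun v => v < n) q.2, K0 q.1 && K0 q.1 & K0 (last q.1 q.2) && K0 (last q.1 q.2)].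
  move=> /mapP[i]; rewrite mem_filter mem_iota /= add0n => /andP[nti ik] -> /=.
  have [sn tn] := stI i ik; have /andP[k1 k2] := K0S i ik nti; have [_ h2 _ h4] := Hos i ik.
  rewrite (osE i ik) /= -TE // in h2 h4; rewrite h2 k1 k2; split=> //.
  by case/andP: h4.
have OE v : O v = has (fun q : nat * seq nat => v \in q.1 :: q.2) ps.
  apply/hasP/hasP => [[i ii /andP[nti vi]]|[q /mapP[i]]].
    have ik : i < k by move: ii; rewrite mem_iota.
    exists (sI n inp i, behead (os i)); last by rewrite /= -osE.
    by apply/mapP; exists i => //; rewrite mem_filter nti.
  rewrite mem_filter => /andP[nti ii] ->; have ik : i < k by move: ii; rewrite mem_iota.
  by rewrite [X in _ \in X]/= -osE // => vi; exists i => //; apply/andP.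
have hO : \sum_(v < n) O v * chi v <= 2 * X * Cp.
  have := hist_lower H hps OE; rewrite -/X XE leq_add2r => h; apply: leq_trans h _.
  rewrite [2 * X]mulnC -mulnA leq_mul2l; apply/orP; right.
  rewrite big_map big_filter big_iota big_mkcond /Cp big_distrr /=; apply: leq_sum => i _.
  rewrite /cP; case: (nt n inp i) => //.
  by rewrite (path_sum_scale 2) mul1n (osE i (ltn_ord i)).
have hM : chiM n chi O <= X * \sum_(v < n) ~~ O v * b0 v.
  by rewrite (XE (fun v => ~~ O v)) leq_addr.
set G := tr (arr s9 19) in cb2 cb4.
pose t1 := \sum_(i < k) tcost n C (tr1 n k inp s9 i) (pa1 n k inp s9 i) (tI n inp i).
have hF : 2 * X * t1 + X * (\sum_(v < n) ~~ G v * b0 v) <= value0 n k inp s7 U.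
  rewrite /value0 -/X f7 // a621 /cost0 a71.
  have := cb3 C; rewrite -/t1 t87 p87.
  have := cb4; rewrite /cov0 t87 -/X (XE (fun v => ~~ has (fun i => tr0 n k inp s7 U i v) (iota 0 k))) leq_add2r.
  have -> : \sum_(v < n) forest s9 v * (2 * arr s2 1 (v * n + arr s9 20 v)) =
            2 * \sum_(v < n) forest s9 v * C v (arr s9 20 v).
    by rewrite big_distrr /=; apply: eq_bigr => v _; rewrite mulnCA.
  rewrite mulnDr => g1 g2; have := leq_mul (leqnn (2 * X)) g2; move: g1.
  rewrite mulnDr mulnA [X * 2]mulnC.
  move=> h1 h2; apply: leq_trans (leq_add h2 (leqnn _)) _; rewrite -addnA; exact: (leq_add (leqnn _) h1).
have hP : \sum_(i < k) seq_cost C (qs i) + D <= 2 * t1.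
  rewrite -big_split big_distrr /=; apply: leq_sum => i _; have := Hqs i (ltn_ord i).
  case: (nt n inp i) => [[gp Hq]|->] //.
  by rewrite mul1n; apply: (good_path_all gp Hq).
have sE (rs : nat -> seq nat) : (forall i, i < k -> npath n (S i) (T i) (rs i)) ->
    \sum_(i < k) seq_cost c (rs i) = \sum_(i < k) seq_cost C (rs i).
  move=> Hrs; apply: eq_bigr => i _; have [_ _ _ h] := Hrs i (ltn_ord i).
  exact: seq_cost_ext cC h.
rewrite /nvalue !sE //.
apply: (@final_arith 625 256 369 X _ D t1 (\sum_(v < n) ~~ G v * b0 v) (value0 n k inp s7 U) _ _ _ _ _ Cp
  (\sum_(v < n) ~~ O v * b0 v) _ _ _ _ erefl hP hF (V false) (V true) _ vB chiS hO hM).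
- by rewrite expn_gt0.
- by rewrite vA; apply: Hsel.
(* A vertex missed by all paths is outside the forest. It is no terminal, so its budget is the true
   scaled penalty. *)
- apply: leq_sum => v _; case hv: (has _ _) => //=; rewrite mul1n.
  have nv i : i < k -> (v : nat) \notin qs i.
    by move=> ik; move/hasPn: hv => /(_ i); rewrite mem_iota; apply.
  have Gv : ~~ G v.
    apply/negP => /(cb2 v (ltn_ord v))[i [ik nti tv]]; have := Hqs i ik; rewrite nti => -[_ /(_ v (ltn_ord v) tv)].
    by rewrite (negPf (nv i ik)).
  rewrite Gv mul1n b0E //; case: ifP => // /hasP[i]; rewrite mem_iota /= add0n => ik.
  have [h1 h2 _ _] := Pqs i ik; rewrite SE // TE // -h2 => vst; have := nv i ik.
  case: (qs i) h1 vst => // a q [->] /= vst; case/negP; case/orP: vst => /eqP ->.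
    exact: mem_head.
  exact: mem_last.
- by apply: leq_sum => i _; rewrite /cP; case: (nt n inp i); rewrite ?mul1n.
(* A vertex outside [O] either is a terminal, with budget 0, or is on no path of the compared
   solution, because a pair with equal ends covers only its terminal. *)
- apply: leq_sum => v _; case Ov: (O v) => //=; rewrite mul1n b0E //; case tv: (term v) => //.
  rewrite (_ : has _ _ = false) ?mul1n //; apply: contraFF tv => /hasP[i ii vi].
  have ik : i < k by move: ii; rewrite mem_iota.
  case nti: (nt n inp i).
    by case/negP: (negbT Ov); apply/hasP; exists i => //; rewrite /inP nti.
  apply/hasP; exists i => //; move: vi; have [_ h2 h3 _] := Hos i ik.
  move/negbFE/eqP: nti => est; rewrite (osE i ik) /= -TE // -est in h2 h3 *.
  case: (behead (os i)) h2 h3 => [|y q] /=; first by rewrite inE => _ _ ->.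
  by move=> h2 /and3P[]; rewrite -{1}h2 mem_last.
Qed.

(** * Instances *)

Lemma nth_flatten2 (A : Type) (f g : A -> nat) (l : seq A) a0 i : i < size l ->
  nth 0 (flatten [seq [:: f a; g a] | a <- l]) (i + i) = f (nth a0 l i) /\
  nth 0 (flatten [seq [:: f a; g a] | a <- l]) (i + i).+1 = g (nth a0 l i).
Proof.
elim: l i => // a l IH [|i] // il; rewrite addSn addnS.
by have [h1 h2] := IH i il; split.
Qed.

Lemma size_flatten2 (A : Type) (f g : A -> nat) (l : seq A) :
  size (flatten [seq [:: f a; g a] | a <- l]) = size l + size l.
Proof. by elim: l => //= a l ->; rewrite addnS. Qed.

Lemma nth_allpairs (A B R : Type) (f : A -> B -> R) s t a0 b0 r0 i j : i < size s -> j < size t ->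
  nth r0 [seq f x y | x <- s, y <- t] (i * size t + j) = f (nth a0 s i) (nth b0 t j).
Proof.
elim: s i => // a s IH [|i] il jl; rewrite /= nth_cat size_map.
  by rewrite mul0n add0n jl (nth_map b0).
by rewrite mulSn -addnA ltnNge leq_addr /= addKn IH.
Qed.

Section Inst.
Variable (I : instance).
Local Notation n := (nV I).
Local Notation k := (nT I).
Local Notation x := (encode_instance I).
Local Notation N := (n * n + n).

(** Costs and penalties in one list, with the numbering of edges and vertices that the programs
    use. *)
Definition rates : seq rat :=
  [seq cost u v | u <- enum 'I_n, v <- enum 'I_n] ++ [seq penalty v | v <- enum 'I_n].

Definition ratN (e : nat) : nat := `|numq (nth 0%R rates e)|%N.
Definition ratD (e : nat) : nat := `|denq (nth 0%R rates e)|%N.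

Lemma size_rates : size rates = N.
Proof. by rewrite size_cat size_allpairs size_map !size_enum_ord. Qed.

Lemma encode_instanceE : x = n :: k :: flatten [seq [:: `|numq q|%N; `|denq q|%N] | q <- rates]
  ++ flatten [seq [:: val (terminal i).1; val (terminal i).2] | i <- enum 'I_k].
Proof. by rewrite /encode_instance /rates map_cat flatten_cat -catA map_allpairs -map_comp. Qed.

Lemma size_x : size x = tbase n + k + k.
Proof.
rewrite encode_instanceE /= size_cat !size_flatten2 size_rates size_enum_ord /tbase.
by move: (n * n) => m; lia.
Qed.

Lemma nth_num e : e < N -> nth 0 x (2 + e + e) = ratN e /\ nth 0 x (2 + e + e + 1) = ratD e.
Proof.
move=> eN; rewrite encode_instanceE (_ : 2 + e + e = (e + e).+2) ?addn1; last by clear; lia.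
rewrite /= !nth_cat !size_flatten2 size_rates.
have -> : e + e < N + N by move: eN; clear; lia.
have -> : (e + e).+1 < N + N by move: eN; clear; lia.
by apply: nth_flatten2; rewrite size_rates.
Qed.

Lemma nth_term (i : 'I_k) : nth 0 x (tbase n + i + i) = (terminal i).1 /\
  nth 0 x (tbase n + i + i + 1) = (terminal i).2.
Proof.
have e1 : tbase n + i + i = (N + N + (i + i)).+2 by rewrite /tbase; move: (n * n) (nat_of_ord i) => m j; clear; lia.
rewrite e1 addn1 encode_instanceE /= !nth_cat !size_flatten2 size_rates.
have -> : (N + N + (i + i) < N + N) = false by rewrite ltnNge leq_addr.
have -> : ((N + N + (i + i)).+1 < N + N) = false by rewrite ltnNge -addnS leq_addr.
rewrite -addnS !addKn.
have [|-> ->] := @nth_flatten2 _ (fun i : 'I_k => val (terminal i).1) (fun i => val (terminal i).2) (enum 'I_k) i i.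
  by rewrite size_enum_ord.
by rewrite nth_ord_enum.
Qed.

Lemma rates_ge0 e : (0 <= nth 0%R rates e)%R.
Proof.
have H : all (fun q : rat => 0 <= q)%R rates.
  rewrite all_cat; apply/andP; split; apply/allP => q.
    by move=> /allpairsP[[u v] [_ _ ->]]; apply: cost_ge0.
  by move=> /mapP[v _ ->]; apply: penalty_ge0.
case: (ltnP e (size rates)) => h; last by rewrite nth_default.
by apply: (allP H); apply: mem_nth.
Qed.

Lemma rates_cost (u v : 'I_n) : nth 0%R rates (u * n + v) = cost u v.
Proof.
rewrite nth_cat size_allpairs !size_enum_ord idx_lt //.
have := @nth_allpairs _ _ _ (fun u v => cost u v) (enum 'I_n) (enum 'I_n) u v 0%R u v.
by rewrite size_enum_ord !nth_ord_enum => -> .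
Qed.

Lemma rates_penalty (v : 'I_n) : nth 0%R rates (n * n + v) = penalty v.
Proof.
rewrite nth_cat size_allpairs !size_enum_ord ltnNge leq_addr /= addKn (nth_map v) ?size_enum_ord //.
by rewrite nth_ord_enum.
Qed.

Definition den : nat := \prod_(j < N) ratD j.
Definition wt (e : nat) : nat :=
  (\prod_(j < N) (if e == j :> nat then 1 else nth 0 x (2 + j + j + 1))) * nth 0 x (2 + e + e).

Lemma den_gt0 : 0 < den.
Proof. by apply: prodn_gt0 => j; rewrite absz_gt0 denq_eq0. Qed.

Lemma wtE e : e < N -> ((wt e)%:R = den%:R * nth 0%R rates e :> rat)%R.
Proof.
move=> eN; rewrite /wt; have [-> _] := nth_num eN.
have -> : \prod_(j < N) (if e == j :> nat then 1 else nth 0 x (2 + j + j + 1)) = \prod_(j < N | (j : nat) != e) ratD j.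
  rewrite [RHS]big_mkcond; apply: eq_bigr => j _; rewrite eq_sym; case: eqP => // _.
  by have [_ e1] := nth_num (ltn_ord j); apply: e1.
have -> : den = ratD e * \prod_(j < N | (j : nat) != e) ratD j.
  by rewrite /den (bigD1 (Ordinal eN)) //=.
rewrite !natrM mulrAC mulrC; congr (_ * _)%R.
rewrite /ratN /ratD !natr_absz ger0_norm ?numq_ge0 ?rates_ge0 // gtr0_norm ?denq_gt0 //.
by rewrite numqE mulrC.
Qed.

Definition cN (u v : nat) : nat := wt (u * n + v).
Definition pN (v : nat) : nat := wt (n * n + v).

Lemma cNE (u v : 'I_n) : ((cN u v)%:R = den%:R * cost u v :> rat)%R.
Proof. by rewrite /cN wtE ?rates_cost //; apply: ltn_addr; apply: idx_lt. Qed.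

Lemma pNE (v : 'I_n) : ((pN v)%:R = den%:R * penalty v :> rat)%R.
Proof. by rewrite /pN wtE ?rates_penalty // ltn_add2l. Qed.

Lemma cN_sym u v : u < n -> v < n -> cN u v = cN v u.
Proof.
move=> un vn; apply/eqP; rewrite -(eqr_nat rat) (cNE (Ordinal un) (Ordinal vn)) (cNE (Ordinal vn) (Ordinal un)).
by rewrite cost_sym.
Qed.

Lemma cN_tri u v w : u < n -> v < n -> w < n -> cN u w <= cN u v + cN v w.
Proof.
move=> un vn wn; rewrite -(ler_nat rat) natrD (cNE (Ordinal un) (Ordinal wn)).
rewrite (cNE (Ordinal un) (Ordinal vn)) (cNE (Ordinal vn) (Ordinal wn)) -mulrDr.
by apply: ler_wpM2l (cost_triangle _ _ _); rewrite ler0n.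
Qed.

Lemma cN_diag u : u < n -> cN u u = 0.
Proof.
move=> un; apply/eqP; rewrite -(eqr_nat rat) (cNE (Ordinal un) (Ordinal un)) cost_diag.
by rewrite mulr0.
Qed.

Lemma path_cost_nat (q : seq 'I_n) :
  (den%:R * path_cost q = (seq_cost cN (map val q))%:R :> rat)%R.
Proof.
case: q => [|a q]; first by rewrite /path_cost big_nil mulr0.
elim: q a => [|b q IH] a; first by rewrite /path_cost big_nil mulr0.
rewrite /path_cost /= big_cons /= mulrDr natrD -cNE; congr (_ + _)%R.
by rewrite -[path_sum _ _ _]/(seq_cost cN (map val (b :: q))) -IH.
Qed.

Lemma value_nat (s : solution I) (qs : nat -> seq nat) :
  (forall i : 'I_k, qs i = map val (s i)) ->
  (den%:R * value s = (nvalue n k cN pN qs)%:R :> rat)%R.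
Proof.
move=> Hq; rewrite /value /nvalue natrD mulrDr !natr_sum !mulr_sumr; congr (_ + _)%R.
  by apply: eq_bigr => i _; rewrite path_cost_nat Hq.
rewrite [LHS]big_mkcond; apply: eq_bigr => v _; rewrite natrM -pNE.
have -> : [forall i, v \notin s i] = ~~ has (fun i => (v : nat) \in qs i) (iota 0 k).
  apply/forallP/hasPn => [h i|h i].
    rewrite mem_iota /= add0n => ik; rewrite (Hq (Ordinal ik)) (mem_map val_inj).
    exact: h.
  by have := h i; rewrite mem_iota /= add0n ltn_ord Hq (mem_map val_inj); apply.
by case: (~~ _); rewrite ?mul1r ?mul0r.
Qed.

(** Every number takes at least one bit. As the input lists at least [n] and [k] numbers, both loop
    bounds are at most its size. *)
Lemma size_le_input : size x <= input_size x.
Proof.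
rewrite /input_size -sum1_size; apply: leq_sum => i _; exact: ltn0Sn.
Qed.

Lemma npath_of (s : solution I) (i : 'I_k) : feasible s ->
  npath n (nth 0 x (tbase n + i + i)) (nth 0 x (tbase n + i + i + 1)) (map val (s i)).
Proof.
move=> /forallP /(_ i) /and3P[/eqP h1 /eqP h2 h3]; have [-> ->] := nth_term i.
split; first by case: (s i) h1 => // a q [->].
- by rewrite last_map h2.
- by rewrite map_inj_uniq //; apply: val_inj.
- by apply/allP => v /mapP[w _ ->]; apply: ltn_ord.
Qed.

Lemma feasible_of (s : solution I) (qs : nat -> seq nat) : (forall i : 'I_k, qs i = map val (s i)) ->
  (forall i, i < k -> npath n (nth 0 x (tbase n + i + i)) (nth 0 x (tbase n + i + i + 1)) (qs i)) ->
  feasible s.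
Proof.
move=> Hq Hn; apply/forallP => i; have [] := Hn i (ltn_ord i); have [-> ->] := nth_term i.
rewrite Hq => h1 h2 h3 _; apply/and3P; split.
- by case: (s i) h1 => // a q /= [] /val_inj ->.
- by move: h2; rewrite last_map => /val_inj ->.
- by move: h3; rewrite map_inj_uniq //; apply: val_inj.
Qed.

Lemma main_code_solution : exists s : solution I,
  [/\ lout (cexec main_code (fun=> 0) (start_state x)) = encode_solution s, feasible s &
      forall s' : solution I, feasible s' -> (value s <= 241%:R / 100%:R * value s')%R].
Proof.
have term_lt i : i < k -> nth 0 x (tbase n + i + i) < n /\ nth 0 x (tbase n + i + i + 1) < n.
  by move=> ik; have [h1 h2] := nth_term (Ordinal ik); split;
  [have := ltn_ord (terminal (Ordinal ik)).1; rewrite -h1 | have := ltn_ord (terminal (Ordinal ik)).2; rewrite -h2].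
have x1 : 1 < size x by rewrite size_x /tbase; clear; lia.
have x0 : nth 0 x 0 = n by rewrite encode_instanceE.
have xk : nth 0 x 1 = k by rewrite encode_instanceE.
have [qs [h1 h2 h3]] := main_code_spec x1 x0 xk size_x term_lt cN_sym cN_tri cN_diag.
pose s : solution I := [ffun i : 'I_k => pmap insub (qs i)].
have sE (i : 'I_k) : qs i = map val (s i).
  have [_ _ _] := h2 i (ltn_ord i); rewrite ffunE.
  by elim: (qs i) => //= v q IH /andP[vn qn]; rewrite insubT /= -IH.
exists s; split.
- rewrite h1 /encode_solution -val_enum_ord -map_comp; congr flatten; apply: eq_map => i /=.
  by rewrite sE size_map.
- exact: feasible_of sE h2.
- move=> s' fs'.
  pose os i := if insub i is Some i' then map val (s' i') else [::].
  have osE (i : 'I_k) : os i = map val (s' i) by rewrite /os valK.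
  have Hos i : i < k -> npath n (nth 0 x (tbase n + i + i)) (nth 0 x (tbase n + i + i + 1)) (os i).
    by move=> ik; have := npath_of (Ordinal ik) fs'; rewrite -osE.
  have := h3 os Hos; rewrite -(ler_nat rat).
  rewrite [X in (X <= _)%R]natrM [X in (_ <= X)%R]natrM -(value_nat sE) -(value_nat osE).
  have -> : ((2 * 625 + 256)%:R = 2%:R * 625%:R + 256%:R :> rat)%R by rewrite natrD natrM.
  have v0 : (0 <= value s')%R.
    apply: addr_ge0; apply: sumr_ge0 => i _; last exact: penalty_ge0.
    by apply: sumr_ge0 => e _; apply: cost_ge0.
  have d0 : (0 < den%:R :> rat)%R by rewrite ltr0n den_gt0.
  rewrite mulrCA [X in (_ <= X)%R]mulrCA (ler_pM2l d0).
  (* Raising [1506 / 625] to [241 / 100] uses that the compared value is nonnegative. *)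
  by move: (value s) (value s') v0 => a b b0 h; lra.
Qed.
End Inst.

Lemma wf_main_code : wf_cmd main_code.
Proof. by vm_compute. Qed.

Local Open Scope ring_scope.

(** The program flips no coins, so the expected value is the average of a constant. *)
Lemma mean_const (m : nat) (a : rat) : (\sum_(r : m.-tuple bool) a) / 2 ^+ m = a.
Proof.
by rewrite sumr_const card_tuple card_bool -(mulr_natr a) natrX mulfK // expf_neq0 // pnatr_eq0.
Qed.

Theorem theorem2 :
  exists P : program, approximation_algorithm (241%:R / 100%:R : rat) P.
Proof.
have [P [p Hp]] := loop_program_poly_time wf_main_code.
exists P, p => I T; have [s [h1 h2 h3]] := main_code_solution I.
have sx := size_le_input I; rewrite size_x /tbase in sx.
have n1 : (nth 0 (encode_instance I) 0 <= input_size (encode_instance I))%N.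
  rewrite [X in (X <= _)%N](_ : _ = nV I); last by rewrite encode_instanceE.
  by apply: leq_trans sx; move: (nV I * nV I)%N; clear; lia.
have k1 : (nth 0 (encode_instance I) 1 <= input_size (encode_instance I))%N.
  rewrite [X in (X <= _)%N](_ : _ = nT I); last by rewrite encode_instanceE.
  by apply: leq_trans sx; move: (nV I * nV I)%N; clear; lia.
exists (fun=> s); split; [|by move=> r|].
- by move=> r; rewrite -h1; apply: (Hp (encode_instance I) r n1 k1).
- move=> opt [[s' fs' <-] _].
  by rewrite (mean_const T (value s)); apply: h3.
Qed.
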